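(* Let $G=(V,E,\sim)$ be a non-oriented connected locally finite graph without loops, let $i_0\in V$ and let $(a_e)_{e\in E}$ be positive reals. Let $(\tilde X_t)_{t\ge 0}$ be a continuous-time ERRW with weights $(a_e)_{e\in E}$ starting at $i_0$. Then there exists a sequence of independent random variables $W_e\sim \mathrm{Gamma}(a_e,1)$, $e\in E$, such that, conditionally on $(W_e)_{e\in E}$, the process $(\tilde X_t)_{t\ge0}$ has the same law as the time modification $(X_t)_{t\ge0}$ of the VRJP with weights $(W_e)_{e\in E}$ starting at $i_0$. In particular, the (discrete-time) ERRW with weights $(a_e)_{e\in E}$ starting at $i_0$ is equal in law to the discrete-time process associated with a VRJP starting at $i_0$ in random independent conductances (weights) $W_e\sim \mathrm{Gamma}(a_e,1)$, $e\in E$.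
   Context: **ERRW.** A $V$-valued process $(X_n)_{n\ge 0}$ is an edge-reinforced random walk (ERRW) with starting point $i_0$ and weights $(a_e)_{e\in E}$ if $X_0=i_0$ and for all $n\ge0$ $$\mathbb P(X_{n+1}=j\mid X_0,\dots,X_n)=\mathbf 1_{\{j\sim X_n\}}\frac{Z_n(\{X_n,j\})}{\sum_{k\sim X_n}Z_n(\{X_n,k\})},\qquad Z_n(e)=a_e+\sum_{k=1}^n\mathbf 1_{\{\{X_{k-1},X_k\}=e\}}.$$ **Continuous-time ERRW.** Let $(\tau^e_k)_{e\in E,k\ge0}$ be independent exponential random variables with parameter $1$ and set $V^e_k=\sum_{l=0}^{k-1}\frac{1}{a_e+l}\tau^e_l$ for $k\ge1$. The process $(\tilde X_t)_{t\ge0}$ starts at $\tilde X_0=i_0$. Let $\tilde T_i(t)=\int_0^t\mathbf 1_{\{\tilde X_u=i\}}du$. Each edge $e=\{i,j\}$ has a clock $\tilde T_e(t)=\tilde T_i(t)+\tilde T_j(t)$, which runs only when $\tilde X$ is at an endpoint of $e$. Whenever the clock of an edge $e$ rings, i.e. $\tilde T_e(t)=V^e_k$ for some $k\ge1$, $\tilde X$ instantaneously crosses $e$; these are the only jumps of $\tilde X$. **VRJP.** The vertex-reinforced jump process with weights $(W_e)_{e\in E}$ starting at $i_0$ is the continuous-time process $(Y_s)_{s\ge0}$ on $V$ with $Y_0=i_0$ such that, conditionally on $(Y_u)_{u\le s}$, if $Y_s=i$ it jumps to a neighbour $j$ of $i$ at rate $W_{\{i,j\}}L_j(s)$, where $L_j(s)=1+\int_0^s\mathbf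 1_{\{Y_u=j\}}du$. The discrete-time process associated with $Y$ is the sequence of its successive positions. **Time modification of the VRJP.** Let $A(s)=\int_0^s\frac{1}{L_{Y_u}(u)}du$ and $X_t=Y_{A^{-1}(t)}$. $\mathrm{Gamma}(a,1)$ is the law with density $\frac{1}{\Gamma(a)}w^{a-1}e^{-w}$ on $(0,\infty)$. *)

(* Defs.v *)
From HB Require Import structures.
From mathcomp Require Import all_boot all_order all_algebra.
From mathcomp Require Import all_classical all_reals all_analysis.
From mathcomp Require Import measurable_realfun.

Set Implicit Arguments.
Unset Strict Implicit.
Unset Printing Implicit Defensive.

Import Order.TTheory GRing.Theory Num.Theory.
Import numFieldNormedType.Exports.

Local Open Scope classical_set_scope.
Local Open Scope ring_scope.

(* A simple graph is given by its adjacency relation; edges are the two-element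
   sets [set i; j] with i ~ j, and edge-indexed families are total functions on
   [set V] of which only the values on [edges adj] matter. *)
Section graph.
Context {V : choiceType}.
Variable adj : rel V.

Definition neighbours (i : V) : set V := [set j | adj i j].

Definition edges : set (set V) :=
  [set e | exists i j, adj i j /\ e = [set i; j]].

Definition locally_finite_graph : Prop :=
  forall i, finite_set (neighbours i).

Definition connected_graph : Prop :=
  forall i j, exists p : seq V, path adj i p /\ last i p = j.

End graph.

Section laws.
Context {d : measure_display} {T : measurableType d} {R : realType}.
Variable P : probability T R.

Definition independent_family {I : choiceType} (D : set I)
    (X : I -> {RV P >-> R}) : Prop :=
  forall (s : seq I) (A : I -> set R), uniq s ->
    (forall i, i \in s -> D i) -> (forall i, measurable (A i)) ->
  (P (\big[setI/setT]_(i <- s) (X i @^-1` A i)) =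
   \prod_(i <- s) P (X i @^-1` A i))%E.

Definition exponential_rv (r : R) (X : {RV P >-> R}) : Prop :=
  forall A : set R, measurable A -> P (X @^-1` A) = exponential_prob r A.

Definition gamma_function (a : R) : R :=
  \int[lebesgue_measure]_(x in `]0, +oo[) (x `^ (a - 1) * expR (- x)).

Definition gamma_rv (a : R) (X : {RV P >-> R}) : Prop :=
  forall A : set R, measurable A ->
  (P (X @^-1` A) =
   \int[lebesgue_measure]_(x in A `&` `]0%R, +oo[%classic)
     ((gamma_function a)^-1 * x `^ (a - 1) * expR (- x))%:E)%E.

End laws.

(* The discrete-time walk.  As V is countable, the conditional law given
   X_0, ..., X_n is stated through the events {X_0 = x_0, ..., X_n = x_n}. *)
Section errw.
Context {R : realType} {V : choiceType}.
Variables (adj : rel V) (a : set V -> R) (i0 : V).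

Definition errw_weight (x : nat -> V) (n : nat) (e : set V) : R :=
  a e + \sum_(1 <= k < n.+1) `[< [set x k.-1; x k] = e >]%:R.

Definition errw_step (x : nat -> V) (n : nat) (j : V) : R :=
  if adj (x n) j then
    errw_weight x n [set x n; j] /
    \sum_(k \in neighbours adj (x n)) errw_weight x n [set x n; k]
  else 0.

Definition is_errw d (T : measurableType d) (P : probability T R)
    (X : T -> nat -> V) : Prop :=
  [/\ forall n v, measurable [set w | X w n = v],
      {ae P, forall w, X w 0%N = i0} &
      forall (n : nat) (x : nat -> V) (j : V),
        (P ([set w | forall k, (k <= n)%N -> X w k = x k] `&`
            [set w | X w n.+1 = j]) =
         P [set w | forall k, (k <= n)%N -> X w k = x k] *
         (errw_step x n j)%:E)%E].

End errw.

(* On an infinite graph with arbitrary weights the continuous-time processes may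
   jump infinitely often in finite time.  Paths therefore take values in
   [option V], where [None] is a cemetery entered exactly at the explosion time;
   for a non-exploding process all values are of the form [Some v].  Only times
   t >= 0 are meaningful. *)
Section paths.
Context {R : realType} {V : choiceType}.
Implicit Types y : R -> option V.

(* Right-continuous for the discrete topology; for t > 0, being alive at time t
   is equivalent to having a left limit in V at t. *)
Definition jump_path (i0 : V) (y : R -> option V) : Prop :=
  [/\ y 0 = Some i0,
      forall t, 0 <= t -> \forall u \near t^'+, y u = y t,
      forall s t, 0 <= s -> s <= t -> y s = None -> y t = None &
      forall t, 0 < t ->
        (y t <> None <-> exists v, \forall u \near t^'-, y u = Some v)].

Definition crosses (y : R -> option V) (t : R) (i j : V) : Prop :=
  (\forall u \near t^'-, y u = Some i) /\ y t = Some j.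

Definition local_time (y : R -> option V) (i : V) (t : R) : R :=
  \int[lebesgue_measure]_(u in `[0, t]) (y u == Some i)%:R.

Definition first_jump (y : R -> option V) (s t : R) : Prop :=
  [/\ s < t, forall u, s <= u -> u < t -> y u = y s & y t <> y s].

Fixpoint jump_time (y : R -> option V) (n : nat) (t : R) : Prop :=
  if n is m.+1 then exists2 s, jump_time y m s & first_jump y s t else t = 0.

(* [None] when y has fewer than n jumps *)
Definition skeleton (y : R -> option V) (n : nat) : option V :=
  xget None [set v | exists2 t, jump_time y n t & v = y t].

(* The laws of processes are laws on the product sigma-algebras below. *)
Definition path_space : Type :=
  g_sigma_algebraType [set B : set (R -> option V) |
    exists t v, 0 <= t /\ B = [set y | y t = v]].

End paths.
Arguments path_space : clear implicits.

Definition sequence_space (V : choiceType) : Type :=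
  g_sigma_algebraType [set B : set (nat -> option V) |
    exists n v, B = [set y | y n = v]].

Definition weight_space (R : realType) (V : choiceType) (adj : rel V) : Type :=
  g_sigma_algebraType [set C : set (set V -> R) |
    exists e (A : set R),
      [/\ edges adj e, measurable A & C = [set w | A (w e)]]].

Section continuous_time.
Context {R : realType} {V : choiceType}.
Variables (adj : rel V) (i0 : V).

Definition positive_weights : set (set V -> R) :=
  [set w | forall e, edges adj e -> 0 < w e].

Definition alarm (a : set V -> R) (tau : set V -> nat -> R) (e : set V)
    (k : nat) : R :=
  \sum_(0 <= l < k) (a e + l%:R)^-1 * tau e l.

Definition edge_clock (x : R -> option V) (i j : V) (t : R) : R :=
  local_time x i t + local_time x j t.

Definition rings (a : set V -> R) (tau : set V -> nat -> R)
    (x : R -> option V) (i j : V) (t : R) : Prop :=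
  exists2 k, (1 <= k)%N & edge_clock x i j t = alarm a tau [set i; j] k.

Definition ct_errw_path (a : set V -> R) (tau : set V -> nat -> R)
    (x : R -> option V) : Prop :=
  [/\ jump_path i0 x,
      forall i j t, adj i j -> 0 < t -> x t <> None ->
        rings a tau x i j t -> crosses x t i j \/ crosses x t j i &
      forall i j t, 0 < t -> i <> j -> crosses x t i j ->
        adj i j /\ rings a tau x i j t].

Definition is_ct_errw (a : set V -> R) d (T : measurableType d)
    (P : probability T R) (tau : set V -> nat -> {RV P >-> R})
    (X : T -> R -> option V) : Prop :=
  [/\ independent_family [set p : set V * nat | edges adj p.1]
        (fun p => tau p.1 p.2),
      forall e k, edges adj e -> exponential_rv 1 (tau e k),
      forall t v, 0 <= t -> measurable [set w | X w t = v] &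
      {ae P, forall w, ct_errw_path a (fun e k => tau e k w) (X w)}].

Definition vrjp_local_time (y : R -> option V) (j : V) (s : R) : R :=
  1 + local_time y j s.

Definition vrjp_rate (W : set V -> R) (y : R -> option V) (s : R) (i j : V)
    : R :=
  if adj i j then W [set i; j] * vrjp_local_time y j s else 0.

Definition vrjp_total_rate (W : set V -> R) (y : R -> option V) (s : R) (i : V)
    : R :=
  \sum_(j \in neighbours adj i) vrjp_rate W y s i j.

Definition past d (T : measurableType d) (Y : T -> R -> option V) (s : R)
    : set (set T) :=
  <<s [set F | exists u v, [/\ 0 <= u, u <= s & F = [set w | Y w u = v]]] >>.

(* Given the past up to time s and Y_s = i, the rates r_j = W_{ij} L_j from i
   stay constant until the next jump, because L_j only grows at j <> i.  Jumping
   at these rates thus means that the next jump after s is before s + h and to j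
   with conditional probability
     int_0^h r_j exp (- r u) du = (r_j / r) (1 - exp (- r h)),  r = sum_j r_j. *)
Definition is_vrjp (W : set V -> R) d (T : measurableType d)
    (P : probability T R) (Y : T -> R -> option V) : Prop :=
  [/\ forall t v, 0 <= t -> measurable [set w | Y w t = v],
      forall w, jump_path i0 (Y w) &
      forall (s h : R) (F : set T) (i j : V), 0 <= s -> 0 <= h ->
        past Y s F ->
        (P ((F `&` [set w | Y w s = Some i]) `&`
            [set w | exists t, [/\ (t <= s + h)%R, first_jump (Y w) s t
                                 & Y w t = Some j]]) =
         \int[P]_(w in F `&` [set w | Y w s = Some i])
           (vrjp_rate W (Y w) s i j / vrjp_total_rate W (Y w) s i *
            (1 - expR (- (vrjp_total_rate W (Y w) s i * h))))%:E)%E].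

Definition vrjp_clock (y : R -> option V) (s : R) : R :=
  \int[lebesgue_measure]_(u in `[0, s])
    (if y u is Some i then (vrjp_local_time y i u)^-1 else 0).

(* y at A^-1(t); the value is [None] for t beyond the range of A, which is
   bounded only if y explodes. *)
Definition time_modification (y : R -> option V) (t : R) : option V :=
  xget None [set v | exists s, [/\ 0 <= s, vrjp_clock y s = t & v = y s]].

End continuous_time.

(* [Q w] is the law attached to the weights w.  The first conjunct makes w |-> Q w
   a measurable kernel, the second is P(X in B | W) = Q_W(B). *)
Definition conditional_law {R : realType} {V : choiceType} (adj : rel V)
    d (T : measurableType d) (P : probability T R)
    d' (S : measurableType d') (W : T -> weight_space R adj) (X : T -> S)
    (Q : weight_space R adj -> set S -> \bar R) : Prop :=
  forall B : set S, measurable B ->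
    measurable_fun (positive_weights adj : set (weight_space R adj))
      (fun w => Q w B) /\
    forall C : set (weight_space R adj), measurable C ->
      (P ((W @^-1` C) `&` (X @^-1` B)) =
       \int[P]_(om in W @^-1` C) Q (W om) B)%E.

(* The law obtained when the weights are themselves random, with the law of W. *)
Definition mixture_law {R : realType} {V : choiceType} (adj : rel V)
    d (T : measurableType d) (P : probability T R) (S : Type)
    (W : T -> weight_space R adj)
    (Q : weight_space R adj -> set S -> \bar R) (B : set S) : \bar R :=
  (\int[P]_om Q (W om) B)%E.

Definition independent_gamma_weights {R : realType} {V : choiceType}
    (adj : rel V) (a : set V -> R) d (T : measurableType d)
    (P : probability T R) (W : set V -> {RV P >-> R}) : Prop :=
  [/\ independent_family (edges adj) W,
      forall e, edges adj e -> gamma_rv (a e) (W e) &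
      forall e om, edges adj e -> 0 < W e om].

(* Main.v *)
Require Import Defs.
From HB Require Import structures.
From mathcomp Require Import all_boot all_order all_algebra.
From mathcomp Require Import all_classical all_reals all_analysis.
From mathcomp Require Import measurable_realfun.
From mathcomp Require Import ring lra.

(** Why the theorem holds.

    The VRJP.  Let [w_e] be the weight of [e = {i, j}] multiplied by the local
    times at [i] and at [j]: this is the rate per unit of the clock of the time
    modification at which the process at [i] crosses [e].  A stay of length [u]
    on this clock multiplies the local time at [i], hence the weights of all
    edges at [i], by [exp u].  So the first jump, after a stay in [du] and
    across [e], has density [w_e e^u exp (- S (e^u - 1))], where [S] is the sum
    of the weights at [i], and the process then starts afresh with the boosted
    weights.  [path_prob] iterates this rule, and [vrjp_follow_law] derives it
    from the definition of the VRJP: in [hold_ray], the jumping rates are used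
    after the first point of a fine grid that follows a jump, and the mesh tends
    to zero.

    Gamma weights.  If the weights are independent with laws Gamma([a_e]), the
    density above is a size-biasing by [w_e] combined with an exponential tilting
    of the weights at [i].  Hence, if [w] is averaged, a step has density
    [a_e exp (- u sum a)], and given this step the boosted weights are again
    independent Gamma variables in which only [a_e] has increased, by one
    ([gamma_conjugate]).  Integrating [u] out gives the jump probabilities of the
    reinforced walk, so that the discrete statement is an induction on the length
    of the path ([mixture_walk]).

    The clocks.  The alarms of an edge are the birth times of a pure birth
    process started from the real number [a_e]; its size at the [k]-th birth,
    multiplied by the exponential of minus the time, is [urn_size], and it
    converges almost surely to a Gamma([a_e]) variable ([urn_limit_law]).  For
    this, [beta_gamma] gives the law of a Gamma variable of index [a_e + n]
    transported back through [n] births, and such a variable is close to its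
    mean when [n] is large.
    At a first ring, the clocks that remain after the crossing have their
    original law ([first_ring_step]), the parameter of the edge has increased by
    one and the limits are the boosted limits.  Comparing with [gamma_conjugate],
    an induction on the number of steps shows that, given the limits [W] of all
    edges, the walk driven by the clocks follows a prescribed sequence of steps
    with probability [path_prob W] ([rings_law]).

    From steps to processes.  A path is determined, up to its explosion time, by
    its trace: the visited vertices with the time spent at each visit.  Almost
    surely the trace of the continuous-time walk is the one given by the clocks
    ([clock_path]), and the trace of the time modification of the VRJP is known
    from [linked_time_modification].  Events of the path spaces are measurable
    events of the traces ([path_event], [sequence_event]), and finite sequences
    of steps form a pi-system, on which the two sides agree by the above; so they
    agree on all events ([mixture_unique]). *)

Set Implicit Arguments.
Unset Strict Implicit.
Unset Printing Implicit Defensive.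

Import Order.TTheory GRing.Theory Num.Theory.
Import numFieldNormedType.Exports.

Local Open Scope classical_set_scope.
Local Open Scope ring_scope.

(** * Laws of families of coordinates *)

Section density.
Context d (T : measurableType d) (R : realType).
Context (m : {measure set T -> \bar R}) (f : T -> \bar R).
Local Open Scope ereal_scope.

(** The measure with density [f] with respect to [m]. *)
Definition mdens (mf : measurable_fun setT f) (f0 : forall x, 0 <= f x)
  (A : set T) : \bar R := \int[m]_(x in A) f x.

Hypotheses (mf : measurable_fun setT f) (f0 : forall x, 0 <= f x).

Let mdens0 : mdens mf f0 set0 = 0.
Proof. by rewrite /mdens integral_set0. Qed.

Let mdens_ge0 A : 0 <= mdens mf f0 A.
Proof. by apply: integral_ge0 => x _; exact: f0. Qed.

Let mdens_sigma_additive : semi_sigma_additive (mdens mf f0).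
Proof.
move=> F mF tF mUF; rewrite /mdens ge0_integral_bigcup//; last first.
  exact: measurable_funTS.
apply/cvg_closeP; split; last by rewrite closeE.
by apply: is_cvg_nneseries => *; exact: integral_ge0.
Qed.

HB.instance Definition _ := isMeasure.Build _ _ _ (mdens mf f0)
  mdens0 mdens_ge0 mdens_sigma_additive.

End density.

Section push.
Context d d' (T1 : measurableType d) (T2 : measurableType d') (R : realType).
Context (m : {measure set T1 -> \bar R}) (f : T1 -> T2).

Definition mpush (mf : measurable_fun [set: T1] f) := pushforward m f.

Hypothesis mf : measurable_fun [set: T1] f.
Let M : {measure set T2 -> \bar R} :=
  measure_function_pushforward__canonical__measure_function_Measure m mf.

HB.instance Definition _ := isMeasure.Build _ _ _ (mpush mf)
  (@measure0 _ _ _ M) (measure_ge0 M) (@measure_semi_sigma_additive _ _ _ M).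

End push.

Section push_proba.
Context d d' (T1 : measurableType d) (T2 : measurableType d') (R : realType).
Context (m : probability T1 R) (f : T1 -> T2).
Hypothesis mf : measurable_fun [set: T1] f.
Let push1 : mpush m mf setT = 1%E.
Proof. by rewrite /mpush /pushforward preimage_setT; exact: probability_setT. Qed.
HB.instance Definition _ := Measure_isProbability.Build _ _ _ (mpush m mf) push1.
End push_proba.

Lemma finite_measure_unique d (R : realType) (T : measurableType d)
    (G : set (set T)) (m1 m2 : {measure set T -> \bar R}) :
  @measurable _ T = <<s G >> -> setI_closed G ->
  (m1 setT < +oo)%E -> m1 setT = m2 setT ->
  (forall A, G A -> m1 A = m2 A) ->
  forall A, measurable A -> m1 A = m2 A.
Proof.
move=> GE GI fin e12 G12 A mA.
apply: (measure_unique (G `|` [set setT]) (fun=> setT)) => //.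
- rewrite GE; apply/seteqP; split; last first.
    apply: smallest_sub; first exact: smallest_sigma_algebra.
    move=> B [GB|->]; first exact: sub_sigma_algebra.
    by rewrite -GE; exact: measurableT.
  apply: smallest_sub; first exact: smallest_sigma_algebra.
  by move=> B GB; apply: sub_sigma_algebra; left.
- move=> B C [GB|->] [GC|->]; rewrite ?setIT ?setTI; [|by left|by left|by right].
  by left; exact: GI.
- by move=> _; right.
- by rewrite bigcup_const//; exists 0%N.
- by move=> B [/G12//|->].
Qed.

Section families.
Context {R : realType} {I : choiceType}.
Implicit Types (D : set I) (s : seq I) (A : I -> set R).

(** Random weights are families over the edges, and exponential clocks are
    families over edges and integers; coordinates outside of [D] are ignored. *)
Definition fam_sets D : set (set (I -> R)) :=
  [set C | exists e (A : set R), [/\ D e, measurable A & C = [set w | A (w e)]]].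

Definition fam_space D : Type := g_sigma_algebraType (fam_sets D).

Lemma measurable_coord D i : D i ->
  measurable_fun [set: fam_space D] (fun w : fam_space D => (w : I -> R) i).
Proof.
move=> Di _ A mA; rewrite setTI; apply: sub_sigma_algebra.
by exists i, A.
Qed.

Lemma measurable_to_fam d (T : measurableType d) D (X : set T) (f : T -> I -> R) :
  (forall i, D i -> measurable_fun X (fun x => f x i)) ->
  measurable_fun X (f : T -> fam_space D).
Proof.
move=> mf mX; move: (mX); apply: measurability; first by [].
by move=> _ [_ [i [A [Di mA ->]]] <-]; exact: (mf i Di mX A mA).
Qed.

Definition cyl s A : set (I -> R) := [set w | forall i, i \in s -> A i (w i)].

Definition fam_cyls D : set (set (I -> R)) :=
  [set C | exists s A, [/\ uniq s, {in s, forall i, D i},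
    (forall i, measurable (A i)) & C = cyl s A]].

Lemma cylE s A : cyl s A = \big[setI/setT]_(i <- s) [set w | A i (w i)].
Proof.
elim: s => [|i s IH]; first by rewrite big_nil; apply/seteqP; split => // w _ i.
rewrite big_cons -IH; apply/seteqP; split => w /=.
  by move=> h; split => [|j js]; apply: h; rewrite inE ?eqxx// js orbT.
by move=> [wi ws] j; rewrite inE => /orP[/eqP->//|]; exact: ws.
Qed.

Lemma measurable_cyl D s A : {in s, forall i, D i} ->
  (forall i, measurable (A i)) -> measurable (cyl s A : set (fam_space D)).
Proof.
move=> sD mA; rewrite cylE big_seq; apply: bigsetI_measurable => i si.
by apply: sub_sigma_algebra; exists i, (A i); split => //; exact: sD.
Qed.

Lemma fam_cyls_generate D : @measurable _ (fam_space D) = <<s fam_cyls D >>.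
Proof.
apply/seteqP; split.
  apply: smallest_sub; first exact: smallest_sigma_algebra.
  move=> _ [i [A [Di mA ->]]]; apply: sub_sigma_algebra; exists [:: i], (fun=> A); split => //; first by move=> j; rewrite inE => /eqP->.
  apply/seteqP; split => w /=; first by move=> ? j; rewrite inE => /eqP->.
  by apply; rewrite inE.
apply: smallest_sub; first exact: sigma_algebra_measurable.
by move=> _ [s [A [us sD mA ->]]]; exact: measurable_cyl.
Qed.

Lemma fam_cyls_setI D : setI_closed (fam_cyls D).
Proof.
move=> _ _ [s [A [us sD mA ->]]] [t [B [ut tD mB ->]]].
exists (undup (s ++ t)), (fun i => (if i \in s then A i else setT) `&`
  (if i \in t then B i else setT)); split; first exact: undup_uniq.
- by move=> i; rewrite mem_undup mem_cat => /orP[/sD|/tD].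
- by move=> i; apply: measurableI; case: ifP.
- apply/seteqP; split => w /=.
    move=> [h1 h2] i _; split.
      by case: ifPn => // /h1.
    by case: ifPn => // /h2.
  move=> h; split => i ii; move: (h i);
    rewrite mem_undup mem_cat ii ?orbT => /(_ isT)[]//.
Qed.

Definition product_law D (mu : I -> {measure set R -> \bar R})
    (m : {measure set (fam_space D) -> \bar R}) : Prop :=
  forall s A, uniq s -> {in s, forall i, D i} -> (forall i, measurable (A i)) ->
  (m (cyl s A) = \prod_(i <- s) mu i (A i))%E.

Lemma fam_measure_unique D (m1 m2 : {measure set (fam_space D) -> \bar R}) :
  (m1 setT < +oo)%E ->
  (forall s A, uniq s -> {in s, forall i, D i} -> (forall i, measurable (A i)) ->
    m1 (cyl s A) = m2 (cyl s A)) ->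
  forall B, measurable B -> m1 B = m2 B.
Proof.
move=> fin h; apply: (finite_measure_unique (fam_cyls_generate D)) => //.
- exact: fam_cyls_setI.
- have -> : setT = cyl [::] (fun=> setT) by apply/seteqP; split.
  exact: h.
- by move=> _ [s [A [us sD mA ->]]]; exact: h.
Qed.

Definition splice D (w' w : I -> R) : I -> R :=
  fun i => if `[< D i >] then w' i else w i.

Lemma measurable_splice D D1 : measurable_fun setT
  ((fun p => splice D1 p.1 p.2) : fam_space D * fam_space D -> fam_space D).
Proof.
apply: measurable_to_fam => i Di; rewrite /splice; case: asboolP => _.
  exact: (measurableT_comp (measurable_coord Di) measurable_fst).
exact: (measurableT_comp (measurable_coord Di) measurable_snd).
Qed.

(** Coordinates of two independent copies can be mixed: this is how
    independence is used everywhere below. *)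
Lemma splice_law D D1 (mu : I -> {measure set R -> \bar R})
    (m : probability (fam_space D) R) : product_law mu m ->
  forall f : fam_space D -> \bar R, measurable_fun setT f ->
  (forall w, 0 <= f w)%E ->
  (\int[m]_w f w = \int[m]_w' \int[m]_w f (splice D1 w' w))%E.
Proof.
move=> pm f mf f0.
have mS := @measurable_splice D D1.
have mfS : measurable_fun setT (f \o
   ((fun p => splice D1 p.1 p.2) : fam_space D * fam_space D -> fam_space D)).
  exact: measurableT_comp.
rewrite -(fubini_tonelli1 (m1 := m) (m2 := m) (f \o
   ((fun p => splice D1 p.1 p.2) : fam_space D * fam_space D -> fam_space D)))//=;
rewrite -(ge0_integral_pushforward mS (m \x m)%E (D := setT))//.
apply: eq_measure_integral => B mB _.
apply: (@fam_measure_unique D m (mpush (m \x m)%E mS)) => //.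
  by rewrite -ge0_fin_numE//; exact: fin_num_measure.
move=> s A us sD mA; rewrite pm// /mpush /pushforward.
pose s1 := [seq i <- s | `[< D1 i >]]; pose s2 := [seq i <- s | ~~ `[< D1 i >]].
rewrite [X in _ = product_measure1 _ _ X](_ : _ = cyl s1 A `*` cyl s2 A); last first.
  apply/seteqP; split => -[w' w] /=.
    move=> h; split => i; rewrite mem_filter => /andP[].
      by move=> Di /h; rewrite /splice Di.
    by move=> /negbTE Di /h; rewrite /splice Di.
  move=> [h1 h2] i si; rewrite /splice; case: ifPn => Di.
    by apply: h1; rewrite mem_filter Di.
  by apply: h2; rewrite mem_filter Di.
rewrite product_measure1E; [|apply: measurable_cyl => // i; rewrite mem_filter => /andP[_ /sD]//..].
rewrite !pm ?filter_uniq//; try by move=> i; rewrite mem_filter => /andP[_ /sD].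
rewrite !big_filter (bigID (fun i => `[< D1 i >])) //=.
Qed.

Definition upd i x (w : I -> R) : I -> R := fun j => if j == i then x else w j.

Lemma measurable_upd D i : measurable_fun setT
  ((fun p => upd i p.1 p.2) : R * fam_space D -> fam_space D).
Proof.
apply: measurable_to_fam => j Dj; rewrite /upd; case: (j == i).
  exact: measurable_fst.
exact: (measurableT_comp (measurable_coord Dj) measurable_snd).
Qed.

Lemma product_law1 D (mu : I -> {measure set R -> \bar R}) (m : probability (fam_space D) R) i (A : set R) :
  product_law mu m -> D i -> measurable A ->
  m [set w | A (w i)] = mu i A.
Proof.
move=> pm Di mA.
have iD : {in [:: i], forall j, D j} by move=> j; rewrite inE => /eqP->.
have := pm [:: i] (fun=> A) isT iD (fun=> mA); rewrite big_seq1 => <-.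
congr (m _); apply/seteqP; split => w /=; first by move=> ? j; rewrite inE => /eqP->.
by apply; rewrite inE.
Qed.

(** Fubini for the coordinate [i] and the remaining ones. *)
Lemma resample_coord D (mu : I -> {measure set R -> \bar R}) (m : probability (fam_space D) R) i
    (f : fam_space D -> \bar R) :
  product_law mu m -> D i -> measurable_fun setT f -> (forall w, 0 <= f w)%E ->
  (\int[m]_w f w = \int[mu i]_x \int[m]_w f (upd i x w))%E.
Proof.
move=> pm Di mf f0; rewrite (splice_law [set i] pm)//.
have mU := @measurable_upd D i.
have mF := measurable_fun_fubini_tonelli_F (m2 := m)
  (f \o ((fun p => upd i p.1 p.2) : R * fam_space D -> fam_space D))
  (measurableT_comp mf mU) (fun=> f0 _).
transitivity (\int[mpush m (measurable_coord Di)]_x \int[m]_w f (upd i x w))%E.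
  rewrite [RHS](ge0_integral_pushforward (measurable_coord Di) m measurableT mF); last first.
    by move=> x _; apply: integral_ge0 => w _; exact: f0.
  apply: eq_integral => w' _; apply: eq_integral => w _; congr f.
  apply/funext => j; rewrite /splice /upd; case: asboolP => [->|].
    by rewrite eqxx.
  by move/eqP/negbTE => ->.
apply: eq_measure_integral => A mA _; rewrite /mpush /pushforward.
exact: product_law1.
Qed.

Lemma expectation_prod D (mu : I -> {measure set R -> \bar R})
    (m : probability (fam_space D) R) s (phi : I -> R -> \bar R) :
  product_law mu m -> uniq s -> {in s, forall i, D i} ->
  (forall i, measurable_fun setT (phi i)) -> (forall i x, 0 <= phi i x)%E ->
  (\int[m]_w \prod_(i <- s) phi i (w i) = \prod_(i <- s) \int[mu i]_x phi i x)%E.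
Proof.
move=> pm + + mphi phi0; elim: s => [|i s IH] /=.
  move=> _ _; rewrite big_nil; under eq_integral do rewrite big_nil.
  by rewrite integral_cst// mul1e; exact: probability_setT.
move=> /andP[is_ us] sD.
have Di : D i by apply: sD; rewrite inE eqxx.
have sD' : {in s, forall i, D i} by move=> j js; apply: sD; rewrite inE js orbT.
have mprod : measurable_fun setT (fun w : fam_space D => \prod_(i <- s) phi i (w i))%E.
  elim: s {IH us is_ sD} sD' => [|j s IH] sD'.
    by rewrite (_ : (fun _ => _) = cst 1%E)//; apply/funext => w; rewrite big_nil.
  rewrite (_ : (fun _ => _) = fun w : fam_space D =>
      phi j (w j) * \prod_(i <- s) phi i (w i))%E; last first.
    by apply/funext => w; rewrite big_cons.
  apply: emeasurable_funM; last first.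
    by apply: IH => k ks; apply: sD'; rewrite inE ks orbT.
  apply: measurableT_comp => //; apply: measurable_coord.
  by apply: sD'; rewrite inE eqxx.
have prod0 w : (0 <= \prod_(i <- s) phi i (w i))%E by exact: prode_ge0.
rewrite (resample_coord pm Di); last 2 first.
- rewrite (_ : (fun _ => _) = fun w : fam_space D =>
      phi i (w i) * \prod_(i <- s) phi i (w i))%E; last first.
    by apply/funext => w; rewrite big_cons.
  apply: emeasurable_funM => //.
  by apply: measurableT_comp => //; exact: measurable_coord.
- by move=> w; exact: prode_ge0.
transitivity (\int[mu i]_x (phi i x * \prod_(i <- s) \int[mu i]_x phi i x))%E.
  apply: eq_integral => x _; rewrite -IH// -ge0_integralZl//.
  apply: eq_integral => w _; rewrite big_cons /upd eqxx; congr (_ * _)%E.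
  apply: eq_big_seq => j js; case: eqP => // ji; by rewrite -ji js in is_.
rewrite big_cons ge0_integralZr//.
by apply: prode_ge0 => j _; apply: integral_ge0.
Qed.

(** The first event depends on the coordinates in [D1] only, the second on the
    other ones, so that splicing two independent copies separates them. *)
Lemma block_indep D D1 (mu : I -> {measure set R -> \bar R}) (m : probability (fam_space D) R)
    (B1 B2 : set (fam_space D)) : product_law mu m ->
  measurable B1 -> measurable B2 ->
  (forall w w', (forall i, D1 i -> w i = w' i) -> B1 w -> B1 w') ->
  (forall w w', (forall i, ~ D1 i -> w i = w' i) -> B2 w -> B2 w') ->
  m (B1 `&` B2) = (m B1 * m B2)%E.
Proof.
move=> pm mB1 mB2 h1 h2.
have mB := measurableI _ _ mB1 mB2.
rewrite -[B1 `&` B2]setIT -integral_indic// (splice_law D1 pm); last 2 first.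
- exact/measurable_EFinP/measurable_indic.
- by move=> w; rewrite lee_fin.
rewrite -[in RHS](setIT B1) -(integral_indic m measurableT mB1).
rewrite -ge0_integralZr//; last exact/measurable_EFinP/measurable_indic.
apply: eq_integral => w' _.
rewrite -[in RHS](setIT B2) -(integral_indic m measurableT mB2).
rewrite -ge0_integralZl//; last exact/measurable_EFinP/measurable_indic.
apply: eq_integral => w _; rewrite -EFinM !indicE -natrM mulnb.
have e : (B1 `&` B2) (splice D1 w' w) = (B1 w' /\ B2 w).
  apply/propext; split => -[b1 b2]; split.
  - by apply: h1 b1 => i Di; rewrite /splice asboolT.
  - by apply: h2 b2 => i Di; rewrite /splice asboolF.
  - by apply: h1 b1 => i Di; rewrite /splice asboolT.
  - by apply: h2 b2 => i Di; rewrite /splice asboolF.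
congr (_ %:R)%:E; congr nat_of_bool.
by apply/idP/andP; rewrite !inE e.
Qed.

End families.

(** * Integration against densities, and Tonelli on subsets *)

Section integral_density.
Context d (T : measurableType d) (R : realType).
Context (m : {measure set T -> \bar R}) (f : T -> \bar R).
Hypotheses (mf : measurable_fun setT f) (f0 : forall x, (0 <= f x)%E).
Local Open Scope ereal_scope.

Import HBNNSimple.

Let integral_mdens_nnsfun (h : {nnsfun T >-> R}) :
  \int[mdens m mf f0]_x (h x)%:E = \int[m]_x ((h x)%:E * f x).
Proof.
under [LHS]eq_integral do rewrite fimfunE -fsumEFin//.
rewrite [LHS]ge0_integral_fsum//; last 2 first.
  - by move=> r; exact/measurable_EFinP/measurableT_comp.
  - by move=> n x _; rewrite EFinM nnfun_muleindic_ge0.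
under [RHS]eq_integral.
  move=> x xD; rewrite fimfunE -fsumEFin// ge0_mule_fsuml; last first.
    by move=> r; rewrite EFinM nnfun_muleindic_ge0.
  over.
rewrite [RHS]ge0_integral_fsum//; last 2 first.
  - move=> r; apply: emeasurable_funM => //.
    by apply/measurable_EFinP; do 2 apply/measurableT_comp => //.
  - by move=> n x _; rewrite mule_ge0// EFinM nnfun_muleindic_ge0.
apply: eq_fsbigr => r _.
rewrite integralZl_indic_nnsfun//= integral_indic// setIT.
have [->|/set0P[x hx]] := eqVneq (h @^-1` [set r]) set0.
  rewrite measure0 mule0 integral0_eq// => x _.
  by rewrite indic0 mulr0 mul0e.
have r0 : (0 <= r)%R by rewrite -hx.
under eq_integral do rewrite EFinM -muleA.
rewrite ge0_integralZl//; last 2 first.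
- apply: emeasurable_funM => //; exact/measurable_EFinP/measurable_indic.
- by move=> y _; rewrite mule_ge0// lee_fin.
congr (_ * _); rewrite [LHS]integral_mkcond; apply: eq_integral => y _.
by rewrite epatch_indic muleC.
Qed.

Lemma ge0_integral_mdens (g : T -> \bar R) :
  measurable_fun setT g -> (forall x, 0 <= g x) ->
  \int[mdens m mf f0]_x g x = \int[m]_x (g x * f x).
Proof.
move=> mg g0; pose g_ := nnsfun_approx measurableT mg.
have cg x : (g_ n x)%:E @[n --> \oo] --> g x by exact: cvg_nnsfun_approx.
have ndg x : {homo (fun n => (g_ n x)%:E) : a b / (a <= b)%N >-> a <= b}.
  by move=> a b ab; rewrite lee_fin//; exact/lefP/nd_nnsfun_approx.
transitivity (limn (fun n => \int[mdens m mf f0]_x (g_ n x)%:E)).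
  rewrite -monotone_convergence//=.
  - by apply: eq_integral => x _; apply/esym/cvg_lim => //=; exact: cg.
  - by move=> n; apply/measurable_EFinP.
  - by move=> n x _; rewrite lee_fin.
under eq_fun do rewrite integral_mdens_nnsfun.
rewrite -monotone_convergence//=.
- apply: eq_integral => x _; apply/cvg_lim => //.
  have [->|fx0] := eqVneq (f x) 0.
    by rewrite mule0; under eq_fun do rewrite mule0; exact: cvg_cst.
  have [gx0|gx0] := eqVneq (g x) 0.
    rewrite gx0 mul0e (_ : (fun _ => _) = cst 0); first exact: cvg_cst.
    apply/funext => n; suff -> : g_ n x = 0%R by rewrite mul0e.
    have : (g_ n x)%:E <= g x.
      have := ereal_nondecreasing_cvgn (ndg x).
      move/(cvg_unique (@ereal_hausdorff R) (cg x)) => ->.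
      by apply: ereal_sup_ubound; exists n.
    by rewrite gx0 lee_fin => h; apply/eqP; rewrite eq_le h fun_ge0.
  by apply: cvgeM; [apply: neq0_mule_def; rewrite mule_eq0 negb_or gx0|exact: cg|exact: cvg_cst].
- by move=> n; apply: emeasurable_funM => //; apply/measurable_EFinP.
- by move=> n x _; rewrite mule_ge0// lee_fin.
- by move=> x _ a b ab; rewrite lee_wpmul2r//; exact: ndg.
Qed.

End integral_density.

Section tonelli_on.
Context d1 d2 (T1 : measurableType d1) (T2 : measurableType d2) (R : realType).
Context (m1 : {sigma_finite_measure set T1 -> \bar R}).
Context (m2 : {sigma_finite_measure set T2 -> \bar R}).
Context (D1 : set T1) (D2 : set T2) (F : T1 * T2 -> \bar R).
Hypotheses (mD1 : measurable D1) (mD2 : measurable D2).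
Hypotheses (mF : measurable_fun setT F) (F0 : forall p, (0 <= F p)%E).
Local Open Scope ereal_scope.

Lemma measurable_fun_integral_on : measurable_fun setT (fun x => \int[m2]_(y in D2) F (x, y)).
Proof.
have mP : measurable_fun setT (F \_ (setT `*` D2)).
  exact: ((measurable_restrictT F (measurableX measurableT mD2)).1 (measurable_funTS mF)).
have P0 p : 0 <= (F \_ (setT `*` D2)) p by rewrite patchE; case: ifP.
have := measurable_fun_fubini_tonelli_F (m2 := m2) _ mP P0.
apply: eq_measurable_fun => x _; rewrite /fubini_F [RHS]integral_mkcond.
apply: eq_integral => y _; rewrite !patchE; congr (if _ then _ else _).
by apply/idP/idP; rewrite !inE /=; [case|].
Qed.

Lemma tonelli_on : \int[m1]_(x in D1) \int[m2]_(y in D2) F (x, y) =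
  \int[m2]_(y in D2) \int[m1]_(x in D1) F (x, y).
Proof.
have mP : measurable_fun setT (F \_ (D1 `*` D2)).
  exact: ((measurable_restrictT F (measurableX mD1 mD2)).1 (measurable_funTS mF)).
have P0 p : 0 <= (F \_ (D1 `*` D2)) p by rewrite patchE; case: ifP.
have eP x y : (x, y) \in D1 `*` D2 = (x \in D1) && (y \in D2).
  by apply/idP/andP; rewrite !inE.
transitivity (\int[m1]_x \int[m2]_y (F \_ (D1 `*` D2)) (x, y)).
  rewrite integral_mkcond; apply: eq_integral => x _.
  rewrite patchE integral_mkcond; case: ifPn => xD.
    by apply: eq_integral => y _; rewrite !patchE eP xD.
  by rewrite integral0_eq// => y _; rewrite !patchE eP (negbTE xD).
rewrite (fubini_tonelli (m1 := m1) (m2 := m2) _ mP P0).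
rewrite [RHS]integral_mkcond; apply: eq_integral => y _.
rewrite patchE; case: ifPn => yD.
  by rewrite [RHS]integral_mkcond; apply: eq_integral => x _; rewrite !patchE eP yD andbT.
by rewrite integral0_eq// => x _; rewrite !patchE eP (negbTE yD) andbF.
Qed.

End tonelli_on.

(** * The density of a holding time *)

Section scaling.
Context {R : realType}.
Local Open Scope ereal_scope.
Notation mu := (@lebesgue_measure R).

Lemma lebesgue_scale (c : R) (mc : measurable_fun [set: measurableTypeR R] ( *%R c : measurableTypeR R -> measurableTypeR R)) (A : set R) : (0 < c)%R -> measurable A ->
  mu A = c%:E * mpush mu mc A.
Proof.
move=> c0 mA.
pose nu := mscale (NngNum (ltW c0)) (mpush mu mc).
have -> : c%:E * mpush mu mc A = nu A by [].
apply: (@lebesgue_measure_unique R nu) => // _ [[a b]] _ <-.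
rewrite /nu /mscale /= /mpush /pushforward.
rewrite [X in _ = _ * mu X](_ : _ = `](a / c)%R, (b / c)%R]%classic); last first.
  apply/seteqP; split => x /=; rewrite !in_itv/=;
  by rewrite ltr_pdivrMr// ler_pdivlMr// ![(x * c)%R]mulrC.
rewrite !lebesgue_measure_itv/= !lte_fin ltr_pM2r ?invr_gt0//.
case: ifP => _; last by rewrite mule0.
by rewrite -EFinB -EFinM -mulrBl mulrCA divff ?mulr1// gt_eqF.
Qed.

Lemma ge0_integral_scale (c : R) (f : R -> \bar R) : (0 < c)%R ->
  measurable_fun setT f -> (forall x, (0 < x)%R -> 0 <= f x) ->
  \int[mu]_(x in `]0%R, +oo[) f x = c%:E * \int[mu]_(x in `]0%R, +oo[) f (c * x)%R.
Proof.
move=> c0 mf f0.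
have mc : measurable_fun [set: measurableTypeR R] ( *%R c : measurableTypeR R -> measurableTypeR R).
  exact: measurable_funM.
have cE A : measurable A -> mu A = mscale (NngNum (ltW c0)) (mpush mu mc) A.
  by move=> mA; rewrite (lebesgue_scale mc c0 mA).
transitivity (\int[mscale (NngNum (ltW c0)) (mpush mu mc)]_(x in `]0%R, +oo[) f x).
  by apply: eq_measure_integral => A mA _; exact: cE.
rewrite ge0_integral_mscale//; last 2 first.
- exact: measurable_funTS.
- by move=> x; rewrite /= in_itv/= andbT; exact: f0.
congr (_ * _).
rewrite [LHS](ge0_integral_pushforward mc) //; last 2 first.
- exact: measurable_funTS.
- by move=> x; rewrite inE/= in_itv/= andbT; exact: f0.
congr (integral _ _ _); apply/seteqP; split => x /=; rewrite !in_itv/= !andbT;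
  by rewrite pmulr_rgt0.
Qed.

(** The holding-time density of the time-changed process: [w] is the weight of
    the edge crossed and [W] the total weight around the current vertex. *)
Definition jump_density (w W u : R) : R :=
  (w * expR u * expR (- (W * (expR u - 1))))%R.

Lemma jump_density_ge0 w W u : (0 <= w)%R -> (0 <= jump_density w W u)%R.
Proof. by move=> w0; rewrite /jump_density !mulr_ge0 ?expR_ge0. Qed.

Lemma measurable_jump_density w W : measurable_fun setT (jump_density w W).
Proof.
apply: measurable_funM; first by apply: measurable_funM.
apply: measurableT_comp => //; apply: measurableT_comp => //.
by apply: measurable_funM => //; exact: measurable_funB.
Qed.

Let F (W u : R) : R := (- expR (- (W * (expR u - 1))))%R.

Let dF (W u : R) : is_derive u 1%R (F W) (W * expR u * expR (- (W * (expR u - 1))))%R.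
Proof.
rewrite /F; apply: is_derive_eq.
rewrite /GRing.scale/=. ring.
Qed.

Let cF (W : R) : continuous (F W).
Proof. by move=> u; apply: differentiable_continuous; apply/derivable1_diffP; exact: ex_derive. Qed.

Let cdens (W : R) : continuous (jump_density W W).
Proof.
move=> u; rewrite /jump_density.
apply: (@continuousM _ R^o (fun u => W * expR u)%R (fun u => expR (- (W * (expR u - 1))))).
  apply: (@continuousM _ R^o (fun=> W) expR); first exact: cvg_cst.
  exact: continuous_expR.
have -> : (fun u => expR (- (W * (expR u - 1))))%R = (fun u => - F W u)%R.
  by apply/funext => v; rewrite /F opprK.
by apply: continuousN; exact: cF.
Qed.

Lemma integral_jump_density_itv (w W c : R) : (0 <= w)%R -> (0 < W)%R -> (0 <= c)%R ->
  \int[mu]_(u in `]0%R, c]) (jump_density w W u)%:E =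
  (w / W * (1 - expR (- (W * (expR c - 1)))))%:E.
Proof.
move=> w0 W0; rewrite le_eqVlt => /predU1P[<-|c0].
  by rewrite set_itvxx integral_set0 expR0 subrr mulr0 oppr0 expR0 subrr mulr0.
have -> : jump_density w W = (fun u => w / W * jump_density W W u)%R.
  by apply/funext => u; rewrite /jump_density !mulrA divfK// gt_eqF.
under eq_integral do rewrite EFinM.
rewrite ge0_integralZl//; last 3 first.
- by apply/measurable_EFinP/measurable_funTS; exact: measurable_jump_density.
- by move=> u _; rewrite lee_fin /jump_density !mulr_ge0 ?expR_ge0// ltW.
- by rewrite lee_fin divr_ge0// ltW.
rewrite [RHS]EFinM; congr (_ * _)%E.
rewrite integral_itv_obnd_cbnd; last first.
  by apply/measurable_EFinP/measurable_funTS; exact: measurable_jump_density.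
rewrite (@continuous_FTC2 _ _ (F W))//.
- by rewrite /F expR0 subrr mulr0 oppr0 expR0 -EFinB opprK addrC.
- by apply: continuous_subspaceT; exact: cdens.
- split.
  + by move=> x _; exact: ex_derive.
  + by apply: cvg_at_right_filter; exact: cF.
  + by apply: cvg_at_left_filter; exact: cF.
- by move=> x _; rewrite derive1E; apply: derive_val.
Qed.

Lemma integral_jump_density (w W : R) : (0 <= w)%R -> (0 < W)%R ->
  \int[mu]_(u in `]0%R, +oo[) (jump_density w W u)%:E = (w / W)%:E.
Proof.
move=> w0 W0.
have -> : jump_density w W = (fun u => w / W * jump_density W W u)%R.
  by apply/funext => u; rewrite /jump_density !mulrA divfK// gt_eqF.
under eq_integral do rewrite EFinM.
rewrite ge0_integralZl//; last 3 first.
- by apply/measurable_EFinP/measurable_funTS; exact: measurable_jump_density.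
- by move=> u _; rewrite lee_fin /jump_density !mulr_ge0 ?expR_ge0// ltW.
- by rewrite lee_fin divr_ge0// ltW.
rewrite -[RHS]mule1; congr (_ * _).
rewrite integral_itv_obnd_cbnd; last first.
  by apply/measurable_EFinP/measurable_funTS; exact: measurable_jump_density.
rewrite (@ge0_continuous_FTC2y _ _ (F W) _ 0)//.
- by rewrite /F expR0 subrr mulr0 oppr0 expR0 EFinN oppeK add0e.
- by move=> u _; rewrite /jump_density !mulr_ge0 ?expR_ge0// ltW.
- by apply: continuous_subspaceT; exact: cdens.
- rewrite /F -oppr0; apply: cvgN.
  have c0 : expR (- (W * u)) @[u --> +oo%R] --> (0 : R)%R.
    apply: (@cvg_comp _ _ _ (fun u => W * u)%R (fun x => expR (- x)) _ (pinfty_nbhs R)); last exact: cvgr_expR.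
    exact: gt0_cvgMry.
  apply: (squeeze_cvgr _ (cvg_cst 0%R) c0); apply: nearW => u.
  rewrite expR_ge0/= ler_expR lerN2 ler_pM2l//.
  by rewrite lerBrDl expR_ge1Dx.
- by apply: cvg_at_right_filter; exact: cF.
- by move=> x _; rewrite derive1E; apply: derive_val.
Qed.

End scaling.

(** * Gamma integrals *)

Section gamma.
Context {R : realType}.
Notation mu := (@lebesgue_measure R).

Definition gamma_kernel (a x : R) : R := x `^ (a - 1) * expR (- x).

Lemma measurable_gamma_kernel a : measurable_fun setT (gamma_kernel a).
Proof.
apply: measurable_funM; first exact: measurable_powR.
by apply: measurableT_comp => //; exact: measurable_funN.
Qed.

Lemma gamma_kernel_ge0 a x : 0 <= gamma_kernel a x.
Proof. by rewrite mulr_ge0 ?powR_ge0 ?expR_ge0. Qed.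

Local Open Scope ereal_scope.

Definition gamma_integral (a : R) (h : R -> \bar R) : \bar R :=
  \int[mu]_(x in `]0%R, +oo[) ((gamma_kernel a x)%:E * h x).

Let mgk a : measurable_fun setT (fun x => (gamma_kernel a x)%:E).
Proof. by apply/measurable_EFinP; exact: measurable_gamma_kernel. Qed.

Lemma gamma_integral_scale (a t : R) (h : R -> \bar R) :
  measurable_fun setT h -> (forall x, (0 < x)%R -> 0 <= h x) ->
  \int[mu]_(x in `]0%R, +oo[)
    ((gamma_kernel a x * expR (- (x * (expR t - 1))))%:E * h (x * expR t)%R) =
  (expR (- (a * t)))%:E * gamma_integral a h.
Proof.
move=> mh h0; rewrite /gamma_integral [X in _ = _ * X](@ge0_integral_scale _ (expR t)); last 3 first.
- exact: expR_gt0.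
- by apply: emeasurable_funM => //; exact: mgk.
- by move=> x x0; rewrite mule_ge0 ?lee_fin ?gamma_kernel_ge0 ?h0.
have mI : measurable_fun (`]0%R, +oo[%classic : set R) (fun x => (gamma_kernel a (expR t * x))%:E * h (expR t * x)%R).
  apply: measurable_funTS; apply: emeasurable_funM; last first.
    by apply: (measurableT_comp mh); exact: measurable_funM.
  by apply: (measurableT_comp (mgk a)); exact: measurable_funM.
have I0 (x : R) : (`]0%R, +oo[%classic : set R) x -> 0 <= (gamma_kernel a (expR t * x))%:E * h (expR t * x)%R.
  rewrite /= in_itv/= andbT => x0.
  by rewrite mule_ge0 ?lee_fin ?gamma_kernel_ge0// h0// mulr_gt0// expR_gt0.
rewrite muleA -EFinM -ge0_integralZl//.
apply: eq_integral => x; rewrite inE/= in_itv/= andbT => x0.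
rewrite muleA -EFinM [(expR t * x)%R]mulrC; congr (_%:E * _).
rewrite /gamma_kernel powRM ?expR_ge0 ?(ltW x0)// -expRM.
set X := (x `^ _)%R.
transitivity (X * (expR (- (a * t)) * expR t * expR (t * (a - 1)) * expR (- (x * expR t))))%R; last by ring.
rewrite -!expRD -mulrA -expRD; congr (_ * expR _)%R; ring.
Qed.

Lemma gamma_integral_size (a : R) (h : R -> \bar R) :
  gamma_integral a (fun x => x%:E * h x) = gamma_integral (a + 1) h.
Proof.
apply: eq_integral => x; rewrite inE/= in_itv/= andbT => x0.
rewrite muleA -EFinM; congr (_%:E * _); rewrite /gamma_kernel addrK mulrAC.
by rewrite -{2}(powRr1 (ltW x0)) -powRD ?subrK// (gt_eqF x0) implybT.
Qed.

Lemma measurable_exp_opp (a : R) : measurable_fun setT (fun y : R => expR (- (a * y))).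
Proof.
apply: (measurableT_comp (@measurable_expR R)).
by apply: measurable_funN; exact: measurable_funM.
Qed.

Lemma integral_exp_density (a : R) : (0 < a)%R ->
  \int[mu]_(y in `]0%R, +oo[) (a * expR (- (a * y)))%:E = 1.
Proof.
move=> a0; rewrite -(integral_exponential_pdf a0).
rewrite integral_itv_obnd_cbnd; last first.
  apply/measurable_EFinP/measurable_funTS; apply: measurable_funM => //.
  by apply: measurableT_comp => //; apply: measurable_funN; exact: measurable_funM.
rewrite integral_mkcond; apply: eq_integral => y _.
by rewrite /exponential_pdf !patchE mulNr; case: ifP.
Qed.

Lemma gamma_integral_succ (a : R) : (0 < a)%R ->
  a%:E * gamma_integral a (cst 1) = gamma_integral (a + 1) (cst 1).
Proof.
move=> a0.
have mJ : measurable_fun setT (fun p : R * R => (jump_density p.1 p.1 p.2)%:E).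
  apply/measurable_EFinP; rewrite /jump_density.
  have m2 : measurable_fun setT (fun p : R * R => expR p.2) by exact: measurableT_comp.
  apply: measurable_funM; first exact: measurable_funM.
  apply: measurableT_comp => //; apply: measurable_funN; apply: measurable_funM => //.
  exact: measurable_funB.
have mG : measurable_fun setT (fun p : R * R =>
    (gamma_kernel a p.1 * (`|jump_density p.1 p.1 p.2|)%R)%:E).
  apply/measurable_EFinP; apply: measurable_funM.
    by apply: measurableT_comp => //; exact: measurable_gamma_kernel.
  by apply: measurableT_comp => //; exact/measurable_EFinP.
have G0 (p : R * R) : 0 <= (gamma_kernel a p.1 * (`|jump_density p.1 p.1 p.2|)%R)%:E.
  by rewrite lee_fin mulr_ge0 ?gamma_kernel_ge0.
have tn := tonelli_on mu mu (D1 := `]0%R, +oo[%classic) (D2 := `]0%R, +oo[%classic)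
  (measurable_itv _) (measurable_itv _) mG G0.
have -> : gamma_integral a (cst 1) = \int[mu]_(x in `]0%R, +oo[) \int[mu]_(y in `]0%R, +oo[)
   (gamma_kernel a x * (`|jump_density x x y|)%R)%:E.
  apply: eq_integral => x; rewrite inE/= in_itv/= andbT => x0.
  under eq_integral do rewrite EFinM.
  rewrite ge0_integralZl; first last.
  - by rewrite lee_fin gamma_kernel_ge0.
  - by move=> y _; rewrite lee_fin.
  - apply/measurable_EFinP/measurable_funTS.
    exact: (measurableT_comp (@normr_measurable R setT) (measurable_jump_density x x)).
  - exact: measurable_itv.
  congr (_ * _); transitivity (x / x)%:E; first by rewrite divff ?gt_eqF.
  rewrite -[LHS](integral_jump_density (ltW x0) x0).
  apply: eq_integral => y _.
  by rewrite (ger0_norm (jump_density_ge0 _ _ (ltW x0))).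
rewrite tn/=.
transitivity (a%:E * \int[mu]_(y in `]0%R, +oo[) ((expR (- (a * y)))%:E * gamma_integral (a + 1) (cst 1))).
  congr (_ * _); apply: eq_integral => y; rewrite inE/= in_itv/= andbT => y0.
  rewrite -gamma_integral_size -gamma_integral_scale; last 2 first.
  - by apply: emeasurable_funM => //; exact/measurable_EFinP.
  - by move=> x x0; rewrite mule1 lee_fin ltW.
  apply: eq_integral => x; rewrite inE/= in_itv/= andbT => x0.
  rewrite mule1 -EFinM (ger0_norm (jump_density_ge0 _ _ (ltW x0))) /jump_density.
  by congr (_%:E); ring.
have mE : measurable_fun (`]0%R, +oo[%classic : set R) (fun y => (expR (- (a * y)))%:E).
  by apply/measurable_EFinP/measurable_funTS; exact: measurable_exp_opp.
have E0 (y : R) : (`]0%R, +oo[%classic : set R) y -> 0 <= (expR (- (a * y)))%:E.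
  by rewrite lee_fin expR_ge0.
have I0 : 0 <= gamma_integral (a + 1) (cst 1).
  by apply: integral_ge0 => x _; rewrite mule1 lee_fin gamma_kernel_ge0.
rewrite ge0_integralZr; [|exact: measurable_itv|exact: mE|exact: E0|exact: I0].
rewrite muleA -[RHS]mul1e; congr (_ * _).
rewrite -[RHS](integral_exp_density a0) -ge0_integralZl; first by [].
- exact: measurable_itv.
- exact: mE.
- exact: E0.
- by rewrite lee_fin ltW.
Qed.

Lemma gamma_integral_mass a : gamma_integral a (cst 1) =
  \int[mu]_(x in `]0%R, +oo[) (gamma_kernel a x)%:E.
Proof. by apply: eq_integral => x _; rewrite mule1. Qed.

Lemma gamma_integral1 : gamma_integral 1 (cst 1) = 1.
Proof.
rewrite -[RHS](integral_exp_density ltr01); apply: eq_integral => x.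
rewrite inE/= in_itv/= andbT => x0.
by rewrite mule1 /gamma_kernel subrr powRr0 !mul1r.
Qed.

Lemma gamma_integral_nat n : gamma_integral n.+1%:R (cst 1) = (n`!)%:R%:E.
Proof.
elim: n => [|n IH]; first by rewrite gamma_integral1.
by rewrite -(natr1 n.+1) -gamma_integral_succ// IH -EFinM -natrM factS.
Qed.

Let p1 (c : R) : (1 `^ c = 1 :> R)%R. Proof. by rewrite powR1. Qed.

Lemma gamma_integral_fin (a : R) : (0 < a)%R -> gamma_integral a (cst 1) \is a fin_num.
Proof.
have ge0 b : 0 <= gamma_integral b (cst 1).
  by apply: integral_ge0 => x _; rewrite mule1 lee_fin gamma_kernel_ge0.
have big b : (1 <= b)%R -> gamma_integral b (cst 1) \is a fin_num.
  move=> b1; pose n := Num.truncn b.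
  have bn : (b - 1 <= n%:R)%R.
    by rewrite lerBlDr natr1 ltW// truncnS_gt// ?num_real.
  rewrite ge0_fin_numE//.
  apply: (@le_lt_trans _ _ (gamma_integral 1 (cst 1) + gamma_integral n.+1%:R (cst 1))); last first.
    by rewrite gamma_integral1 gamma_integral_nat -EFinD ltry.
  have mD b' : measurable_fun (`]0%R, +oo[%classic : set R) (fun x => (gamma_kernel b' x)%:E).
    exact/measurable_funTS.
  have D0 b' (x : R) : (`]0%R, +oo[%classic : set R) x -> 0 <= (gamma_kernel b' x)%:E.
    by rewrite lee_fin gamma_kernel_ge0.
  rewrite !gamma_integral_mass -ge0_integralD; first last.
  - exact: mD.
  - exact: D0.
  - exact: mD.
  - exact: D0.
  - exact: measurable_itv.
  apply: ge0_le_integral.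
  - exact: measurable_itv.
  - exact: D0.
  - exact: mD.
  - by apply: emeasurable_funD; exact: mD.
  - move=> x; rewrite /= in_itv/= andbT => x0.
    rewrite -EFinD lee_fin /gamma_kernel -mulrDl ler_wpM2r ?expR_ge0//.
    rewrite subrr powRr0 -natr1 addrK.
    have [x1|x1] := leP 1%R x.
      rewrite (le_trans (ler_powR x1 bn))// lerDr//.
    apply: (@le_trans _ _ 1%R); last by rewrite lerDl powR_ge0.
    rewrite -[leRHS](p1 (b - 1)%R) ge0_ler_powR// ?nnegrE ?subr_ge0 ?(ltW x0)// ltW//.
move=> a0; have [a1|a1] := leP 1%R a; first exact: big.
have := gamma_integral_succ a0; have : gamma_integral (a + 1) (cst 1) \is a fin_num.
  by apply: big; rewrite lerDr ltW.
move=> + e; rewrite -e; move: (ge0 a); case: (gamma_integral a (cst 1)) => //=.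
by move=> _; rewrite gt0_muley ?lte_fin.
Qed.

Lemma gamma_integral_gt0 (a : R) : (0 < a)%R -> 0 < gamma_integral a (cst 1).
Proof.
move=> a0; pose c := (Num.min 1 (2 `^ (a - 1)) * expR (- 2))%R.
have c0 : (0 < c)%R by rewrite mulr_gt0 ?expR_gt0// lt_min ltr01 powR_gt0.
apply: (@lt_le_trans _ _ (\int[mu]_(x in `[1%R, 2%R]) c%:E)).
  rewrite integral_cst//= lebesgue_measure_itv/= lte_fin ltr1n -EFinB -EFinM lte_fin.
  by rewrite mulr_gt0// subr_gt0 ltr1n.
apply: (@le_trans _ _ (\int[mu]_(x in `[1%R, 2%R]) (gamma_kernel a x)%:E)).
  apply: ge0_le_integral.
  - exact: measurable_itv.
  - by move=> x _; rewrite lee_fin ltW.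
  - exact: measurable_cst.
  - exact: (measurable_funTS (mgk a)).
  - move=> x; rewrite /= in_itv/= => /andP[x1 x2]; rewrite lee_fin.
    have x0 : (0 < x)%R by exact: lt_le_trans x1.
    apply: ler_pM; [by rewrite le_min ler01 powR_ge0|exact: expR_ge0| |by rewrite ler_expR lerN2].
    rewrite ge_min; have [b0|b0] := leP 0%R (a - 1)%R.
      by rewrite -{1}(p1 (a - 1)%R) ge0_ler_powR// nnegrE// ltW.
    apply/orP; right.
    have b0' : (0 <= 1 - a)%R by rewrite subr_ge0 -subr_le0 ltW.
    rewrite -(opprB 1%R a) !powRN lef_pV2 ?posrE ?powR_gt0//.
    by rewrite ge0_ler_powR// nnegrE// ltW.
rewrite gamma_integral_mass.
apply: ge0_subset_integral.
- exact: measurable_itv.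
- exact: measurable_itv.
- exact: (measurable_funTS (mgk a)).
- by move=> x _; rewrite lee_fin gamma_kernel_ge0.
- by move=> x; rewrite /= !in_itv/= andbT => /andP[x1 _]; exact: lt_le_trans x1.
Qed.

Lemma gamma_functionE (a : R) : (0 < a)%R ->
  (gamma_function a)%:E = gamma_integral a (cst 1).
Proof.
move=> a0; rewrite /gamma_function /Rintegral.
rewrite (_ : integral _ _ _ = gamma_integral a (cst 1)); last first.
  by apply: eq_integral => x _; rewrite mule1.
by rewrite fineK// gamma_integral_fin.
Qed.

Lemma gamma_function_ge0 (a : R) : (0 <= gamma_function a)%R.
Proof. by apply: Rintegral_ge0 => x _; rewrite mulr_ge0 ?powR_ge0 ?expR_ge0. Qed.

Lemma gamma_function_gt0 (a : R) : (0 < a)%R -> (0 < gamma_function a)%R.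
Proof. by move=> a0; rewrite -lte_fin gamma_functionE// gamma_integral_gt0. Qed.

Lemma gamma_function_succ (a : R) : (0 < a)%R ->
  gamma_function (a + 1) = (a * gamma_function a)%R.
Proof.
move=> a0; apply: EFin_inj.
by rewrite EFinM !gamma_functionE ?addr_gt0// gamma_integral_succ.
Qed.

End gamma.

(** * Gamma laws under size-biasing and tilting *)

Section gamma_law.
Context {R : realType}.
Notation mu := (@lebesgue_measure R).
Local Open Scope ereal_scope.

Definition gamma_density (a x : R) : \bar R :=
  ((fun x => ((gamma_function a)^-1 * gamma_kernel a x)%:E) \_ `]0%R, +oo[) x.

Lemma measurable_gamma_density a : measurable_fun setT (gamma_density a).
Proof.
apply: (measurable_restrictT _ (measurable_itv _)).1.
apply/measurable_EFinP/measurable_funTS; apply: measurable_funM => //.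
exact: measurable_gamma_kernel.
Qed.

Lemma gamma_density_ge0 a x : 0 <= gamma_density a x.
Proof.
rewrite /gamma_density patchE; case: ifP => // _.
by rewrite lee_fin mulr_ge0 ?invr_ge0 ?gamma_function_ge0 ?gamma_kernel_ge0.
Qed.

Let mid : measurable_fun setT (id : measurableTypeR R -> R).
Proof. exact: measurable_id. Qed.

Definition gamma_law (a : R) : {measure set R -> \bar R} :=
  mpush (mdens mu (measurable_gamma_density a) (gamma_density_ge0 a)) mid.

Lemma gamma_lawE a A : measurable A -> gamma_law a A =
  \int[mu]_(x in A `&` `]0%R, +oo[%classic)
     ((gamma_function a)^-1 * x `^ (a - 1) * expR (- x))%:E.
Proof.
move=> mA; rewrite /gamma_law /= /mpush /pushforward /= /mdens /gamma_density -integral_mkcondr.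
by apply: eq_integral => x _; rewrite /gamma_kernel mulrA.
Qed.

Lemma integral_gamma_law a (h : R -> \bar R) :
  measurable_fun setT h -> (forall x, 0 <= h x) ->
  \int[gamma_law a]_x h x = ((gamma_function a)^-1)%:E * gamma_integral a h.
Proof.
move=> mh h0; rewrite (ge0_integral_pushforward mid)//.
rewrite /comp ge0_integral_mdens// /gamma_integral -ge0_integralZl//; last 3 first.
- apply: measurable_funTS; apply: emeasurable_funM => //.
  by apply/measurable_EFinP; exact: measurable_gamma_kernel.
- by move=> x _; rewrite mule_ge0// lee_fin gamma_kernel_ge0.
- by rewrite lee_fin invr_ge0 gamma_function_ge0.
rewrite [RHS]integral_mkcond; apply: eq_integral => x _.
rewrite /gamma_density !patchE; case: ifP => _; last by rewrite mule0.
by rewrite muleA -EFinM muleC.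
Qed.

Lemma gamma_lawT a : (0 < a)%R -> gamma_law a setT = 1.
Proof.
move=> a0.
have -> : gamma_law a setT = \int[gamma_law a]_x (cst 1 x) by rewrite integral_cst// mul1e.
rewrite integral_gamma_law// -gamma_functionE// -EFinM mulVf// gt_eqF//.
exact: gamma_function_gt0.
Qed.

(** Exponential tilting of a Gamma variable amounts to rescaling it. *)
Lemma gamma_law_scale a t (h : R -> \bar R) :
  measurable_fun setT h -> (forall x, 0 <= h x) ->
  \int[gamma_law a]_x ((expR (- (`|x| * (expR t - 1))))%:E * h (x * expR t)%R) =
  (expR (- (a * t)))%:E * \int[gamma_law a]_x h x.
Proof.
move=> mh h0.
have m1 : measurable_fun setT (fun x : R => (expR (- (`|x| * (expR t - 1))))%:E).
  apply/measurable_EFinP; apply: (measurableT_comp (@measurable_expR R)).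
  apply: measurable_funN; apply: measurable_funM; last exact: measurable_cst.
  exact: (measurableT_comp (@normr_measurable R setT) (@measurable_id _ _ setT)).
have m2 : measurable_fun setT (fun x : R => h (x * expR t)%R).
  by apply: (measurableT_comp mh); exact: measurable_funM.
have m3 := emeasurable_funM m1 m2.
have h3 x : 0 <= (expR (- (`|x| * (expR t - 1))))%:E * h (x * expR t)%R.
  by rewrite mule_ge0// lee_fin expR_ge0.
rewrite (integral_gamma_law a m3 h3) (integral_gamma_law a mh h0).
rewrite [RHS]muleCA -gamma_integral_scale//; congr (_ * _).
apply: eq_integral => x; rewrite inE/= in_itv/= andbT => x0.
by rewrite muleA EFinM gtr0_norm.
Qed.

(** Size-biasing raises the parameter by one: crossing an edge once. *)
Lemma gamma_law_size a (h : R -> \bar R) : (0 < a)%R ->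
  measurable_fun setT h -> (forall x, 0 <= h x) ->
  \int[gamma_law a]_x (`|x|%:E * h x) = a%:E * \int[gamma_law (a + 1)]_x h x.
Proof.
move=> a0 mh h0.
have mH : measurable_fun setT (fun x : R => `|x|%:E * h x).
  apply: emeasurable_funM => //; apply/measurable_EFinP.
  exact: (measurableT_comp (@normr_measurable R setT) (@measurable_id _ _ setT)).
have H0 x : 0 <= `|x|%:E * h x by rewrite mule_ge0 ?lee_fin.
apply: (etrans (integral_gamma_law a mH H0)).
rewrite (integral_gamma_law (a + 1) mh h0).
rewrite (_ : gamma_integral a _ = gamma_integral (a + 1) h); last first.
  rewrite -gamma_integral_size; apply: eq_integral => x.
  by rewrite inE/= in_itv/= andbT => x0; rewrite gtr0_norm.
rewrite muleA -EFinM gamma_function_succ// invfM mulrA divff ?gt_eqF// mul1r//.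
Qed.

Lemma gamma_law_nonpos a : gamma_law a [set x | (x <= 0)%R] = 0.
Proof.
have mA : measurable [set x : R | (x <= 0)%R].
  by rewrite (_ : [set _ | _] = `]-oo, 0%R]%classic)//; apply/seteqP; split => x /=; rewrite in_itv.
rewrite gamma_lawE// (_ : _ `&` _ = set0) ?integral_set0//.
by apply/seteqP; split => x //= []; rewrite in_itv/= andbT leNgt => /negP.
Qed.

(** Crossing an edge after a holding time [t]: size-biasing, then tilting. *)
Lemma gamma_law_size_scale a t (h : R -> \bar R) : (0 < a)%R ->
  measurable_fun setT h -> (forall x, 0 <= h x) ->
  \int[gamma_law a]_x ((`|x| * expR t * expR (- (`|x| * (expR t - 1))))%:E * h (x * expR t)%R) =
  (a * expR (- (a * t)))%:E * \int[gamma_law (a + 1)]_x h x.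
Proof.
move=> a0 mh h0.
have mH : measurable_fun setT (fun x : R => `|x|%:E * h x).
  apply: emeasurable_funM => //; apply/measurable_EFinP.
  exact: (measurableT_comp (@normr_measurable R setT) (@measurable_id _ _ setT)).
have H0 x : 0 <= `|x|%:E * h x by rewrite mule_ge0 ?lee_fin.
rewrite EFinM [_ * _%:E]muleC -muleA -(gamma_law_size a0 mh h0) -(gamma_law_scale a t mH H0).
apply: eq_integral => x _; rewrite muleA -EFinM normrM (gtr0_norm (expR_gt0 t)).
by congr (_%:E * _); ring.
Qed.

(** Moments, needed to compare a Gamma variable of large parameter with its mean. *)
Lemma gamma_law_abs_dev a : (0 < a)%R ->
  \int[gamma_law a]_x (`| `|x| - a |)%:E <= (Num.sqrt a)%:E.
Proof.
move=> a0.
have c1 b : (0 < b)%R -> \int[gamma_law b]_x (cst 1 x) = 1.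
  by move=> b0; rewrite integral_cst// gamma_lawT// mule1.
have mnE : measurable_fun setT (fun x : R => (`|x|)%:E).
  apply/measurable_EFinP.
  exact: (measurableT_comp (@normr_measurable R setT) (@measurable_id _ _ setT)).
have a1 : (0 < a + 1)%R by rewrite addr_gt0.
have E1 : \int[gamma_law a]_x (`|x|)%:E = a%:E.
  transitivity (\int[gamma_law a]_x (`|x|%:E * cst 1 x)).
    by apply: eq_integral => x _; rewrite mule1.
  by rewrite gamma_law_size// c1// mule1.
have E2 : \int[gamma_law a]_x (`|x| * `|x|)%:E = (a * (a + 1))%:E.
  transitivity (\int[gamma_law a]_x (`|x|%:E * (`|x|%:E * cst 1 x))).
    by apply: eq_integral => x _; rewrite mule1 EFinM.
  have mC : measurable_fun setT (fun x : R => `|x|%:E * cst 1 x).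
    by apply: emeasurable_funM => //; exact: measurable_cst.
  have C0 (x : R) : 0 <= `|x|%:E * cst 1 x by rewrite mule1 lee_fin.
  rewrite (gamma_law_size a0 mC C0).
  by rewrite gamma_law_size// c1 ?addr_gt0// mule1.
have iA (c : R) : \int[gamma_law a]_x c%:E = c%:E.
  by rewrite integral_cst// gamma_lawT// mule1.
pose s := Num.sqrt a.
have s0 : (0 < s)%R by rewrite sqrtr_gt0.
have ss : (s * s = a)%R by rewrite -expr2 sqr_sqrtr// ltW.
(* 2 |y - a| <= (y - a)^2 / s + s, rearranged so that all terms are nonnegative *)
have key (x : R) : (`| `|x| - a | + a / s * `|x| <=
    (2 * s)^-1 * (`|x| * `|x|) + (a * a / (2 * s) + s / 2))%R.
  rewrite -subr_ge0; set y := `|x|%R; set z := `|y - a|%R.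
  have zz : (z * z = (y - a) * (y - a))%R by rewrite -!expr2 real_normK// num_real.
  rewrite [leRHS](_ : _ = (z - s) * (z - s) / (2 * s))%R; last first.
    rewrite mulrBl !mulrBr zz; field; exact: lt0r_neq0.
  by apply: divr_ge0; [rewrite -expr2 sqr_ge0|rewrite mulr_ge0// ltW].
have mn : measurable_fun setT (fun x : R => `|x|%R) by exact/measurable_EFinP.
have mL : measurable_fun setT (fun x : R => (`| `|x| - a |)%:E).
  by apply/measurable_EFinP; apply: (measurableT_comp (@normr_measurable R setT)); exact: measurable_funB.
have mxE : measurable_fun setT (fun x : R => (`|x| * `|x|)%:E) by apply/measurable_EFinP; exact: measurable_funM.
have as0 : (0 <= a / s)%R by rewrite divr_ge0 ?ltW.
have s2 : (0 <= (2 * s)^-1)%R by rewrite invr_ge0 mulr_ge0 ?ltW.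
have c0 : (0 <= a * a / (2 * s) + s / 2)%R by rewrite addr_ge0 ?divr_ge0 ?mulr_ge0 ?ltW.
have intL : \int[gamma_law a]_x ((`| `|x| - a |)%:E + (a / s)%:E * (`|x|)%:E) =
    \int[gamma_law a]_x (`| `|x| - a |)%:E + (a / s * a)%:E.
  rewrite ge0_integralD//; last 2 first.
  - by move=> x _; rewrite lee_fin mulr_ge0.
  - by apply: measurable_funeM.
  by rewrite ge0_integralZl// E1.
have intU : \int[gamma_law a]_x (((2 * s)^-1)%:E * (`|x| * `|x|)%:E + (a * a / (2 * s) + s / 2)%:E) =
    ((2 * s)^-1 * (a * (a + 1)) + (a * a / (2 * s) + s / 2))%:E.
  rewrite ge0_integralD//; last 2 first.
  - by move=> x _; rewrite lee_fin mulr_ge0// mulr_ge0.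
  - by apply: measurable_funeM.
  by rewrite ge0_integralZl// ?E2 ?iA// => x _; rewrite lee_fin mulr_ge0.
have : \int[gamma_law a]_x (`| `|x| - a |)%:E + (a / s * a)%:E <=
    ((2 * s)^-1 * (a * (a + 1)) + (a * a / (2 * s) + s / 2))%:E.
  rewrite -intL -intU. apply: ge0_le_integral => //.
  - by move=> x _; rewrite adde_ge0// lee_fin mulr_ge0.
  - by apply: emeasurable_funD => //; apply: measurable_funeM.
  - by apply: emeasurable_funD => //; apply: measurable_funeM.
  - by move=> x _; rewrite -!EFinM -!EFinD lee_fin.
rewrite -leeBrDr// -EFinB => /le_trans; apply; rewrite lee_fin -/s.
clearbody s.
suff -> : ((2 * s)^-1 * (a * (a + 1)) + (a * a / (2 * s) + s / 2) - a / s * a = s)%R by [].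
by rewrite -ss; field; exact: lt0r_neq0.
Qed.

End gamma_law.

(** * Boosted weights and the conjugacy of Gamma weights *)

Section weights.
Context {R : realType} {V : choiceType}.
Variable adj : rel V.
Hypotheses (adj_sym : symmetric adj) (adj_irr : irreflexive adj).
Hypothesis adj_lf : locally_finite_graph adj.
Notation mu := (@lebesgue_measure R).
Notation WS := (fam_space (R := R) (edges adj)).

Definition nbrs (i : V) : seq V := finmap.enum_fset (fset_set (neighbours adj i)).

Lemma mem_nbrs i j : (j \in nbrs i) = adj i j.
Proof.
rewrite /nbrs in_fset_set; last exact: adj_lf.
by apply/idP/idP; rewrite !inE.
Qed.

Lemma uniq_nbrs i : uniq (nbrs i). Proof. exact: finmap.fset_uniq. Qed.

Lemma adj_neq i j : adj i j -> i <> j.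
Proof. by move=> ij e; move: ij; rewrite e adj_irr. Qed.

Lemma edge_inj (i j k : V) : i <> j -> [set i; j] = [set i; k] :> set V -> j = k.
Proof.
move=> ij e; have : [set i; k]%classic j by rewrite -e; right.
by move=> [ji|//]; case: ij.
Qed.

Lemma edge_edges i j : adj i j -> edges adj [set i; j].
Proof. by move=> ij; exists i, j. Qed.

Definition star (i : V) : seq (set V) := [seq [set i; k] | k <- nbrs i].

Lemma uniq_star i : uniq (star i).
Proof.
rewrite map_inj_in_uniq ?uniq_nbrs// => j k; rewrite !mem_nbrs => ij ik.
by apply: edge_inj; exact: adj_neq.
Qed.

Lemma mem_star i j : adj i j -> [set i; j] \in star i.
Proof. by move=> ij; apply/mapP; exists j; rewrite ?mem_nbrs. Qed.

Lemma star_edges i e : e \in star i -> edges adj e.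
Proof. by move=> /mapP[j]; rewrite mem_nbrs => ij ->; exists i, j. Qed.

Lemma star_mem i e : e \in star i -> e i.
Proof. by move=> /mapP[j _ ->]; left. Qed.

Lemma edge_star i e : edges adj e -> e i -> e \in star i.
Proof.
move=> [x [y [xy ->]]] [->|->]; first exact: mem_star.
by rewrite setUC; apply: mem_star; rewrite adj_sym.
Qed.

(** Weights seen after a holding time [u] at [i], in the time scale where the
    walk at [i] crosses the edge [{i, j}] at rate [w {i, j}]. *)
Definition boost (i : V) (u : R) (w : set V -> R) : set V -> R :=
  fun e => if `[< e i >] then w e * expR u else w e.

Lemma measurable_boost i : measurable_fun setT
  ((fun p => boost i p.2 p.1) : WS * R -> WS).
Proof.
apply: measurable_to_fam => e De; rewrite /boost; case: `[< e i >].
  apply: measurable_funM; last by apply: (measurableT_comp (@measurable_expR R)); exact: measurable_snd.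
  exact: (measurableT_comp (measurable_coord De) measurable_fst).
exact: (measurableT_comp (measurable_coord De) measurable_fst).
Qed.

Lemma measurable_boost1 i u : measurable_fun setT (boost i u : WS -> WS).
Proof. exact: (measurableT_comp (@measurable_boost i) (@pair2_measurable _ _ _ _ u)). Qed.

Lemma boostK i u w : boost i (- u) (boost i u w) = w.
Proof.
apply/funext => e; rewrite /boost; case: `[< e i >] => //.
by rewrite -mulrA -expRD addrN expR0 mulr1.
Qed.

(** Weights are only positive on edges and almost surely; absolute values make the
    densities below nonnegative for all families. *)
Definition tot (i : V) (w : set V -> R) : R := \sum_(e <- star i) `|w e|.

Lemma measurable_tot i : measurable_fun setT (tot i : WS -> R).
Proof.
rewrite /tot; have : {in star i, forall e, edges adj e} by move=> e; exact: star_edges.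
elim: (star i) => [|e s IH] sD.
  rewrite (_ : (fun _ => _) = cst 0) => [|//]; last by apply/funext => w; rewrite big_nil.
  exact: measurable_cst.
rewrite (_ : (fun _ => _) = (fun w : WS => `|w e| + \sum_(e <- s) `|w e|)); last first.
  by apply/funext => w; rewrite big_cons.
apply: measurable_funD; last by apply: IH => f fs; apply: sD; rewrite inE fs orbT.
apply: (measurableT_comp (@normr_measurable R setT)).
by apply: measurable_coord; apply: sD; rewrite inE eqxx.
Qed.

Definition leave_density (i j : V) (w : set V -> R) (u : R) : R :=
  jump_density `|w [set i; j]| (tot i w) u.

Lemma leave_density_ge0 i j w u : 0 <= leave_density i j w u.
Proof. exact: jump_density_ge0. Qed.

Lemma measurable_leave_density i j : adj i j -> measurable_fun setT
  (fun p : WS * R => leave_density i j p.1 p.2).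
Proof.
move=> ij.
have me : measurable_fun setT (fun p : WS * R => expR p.2).
  exact: (measurableT_comp (@measurable_expR R) measurable_snd).
apply: measurable_funM; first apply: measurable_funM => //.
  apply: (measurableT_comp (@normr_measurable R setT)).
  exact: (measurableT_comp (measurable_coord (edge_edges ij)) measurable_fst).
apply: (measurableT_comp (@measurable_expR R)); apply: measurable_funN.
apply: measurable_funM; last by apply: measurable_funB => //; exact: measurable_cst.
exact: (measurableT_comp (@measurable_tot i) measurable_fst).
Qed.

(** Probability, for the time-changed process with weights [w] started at [i],
    that the first jumps lead to the prescribed vertices after holding times in
    the prescribed sets.  After a jump the process starts afresh with boosted
    weights. *)
Fixpoint path_prob (i : V) (p : seq (set R * V)) (w : set V -> R) : \bar R :=
  if p is (A, j) :: p' then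
    if adj i j then
      (\int[mu]_(u in `]0%R, +oo[) ((leave_density i j w u * \1_A u)%:E *
         path_prob j p' (boost i u w)))%E
    else 0%E
  else 1%E.

Lemma path_prob_ge0 i p w : (0 <= path_prob i p w)%E.
Proof.
elim: p i w => [|[A j] p IH] i w //=; case: ifP => // _.
apply: integral_ge0 => u _; apply: mule_ge0; last exact: IH.
by rewrite lee_fin mulr_ge0// leave_density_ge0.
Qed.

Definition measurable_steps (p : seq (set R * V)) : Prop :=
  forall q, q \in p -> measurable q.1.

Lemma measurable_step_fun i j (A : set R) (f : WS -> \bar R) : adj i j -> measurable A ->
  measurable_fun setT f -> measurable_fun setT (fun p : WS * R =>
    (leave_density i j p.1 p.2 * \1_A p.2)%:E * f (boost i p.2 p.1))%E.
Proof.
move=> ij mA mf; apply: emeasurable_funM.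
  apply/measurable_EFinP; apply: measurable_funM; first exact: measurable_leave_density.
  exact: (measurableT_comp (measurable_indic mA) measurable_snd).
exact: (measurableT_comp mf (@measurable_boost i)).
Qed.

Lemma measurable_path_prob i p : measurable_steps p ->
  measurable_fun setT (path_prob i p : WS -> \bar R).
Proof.
elim: p i => [|[A j] p IH] i mp /=; first exact: measurable_cst.
case: (boolP (adj i j)) => ij; last exact: measurable_cst.
have mA : measurable A by apply: (mp (A, j)); rewrite inE eqxx.
have mp' : measurable_steps p by move=> q qp; apply: mp; rewrite inE qp orbT.
apply: (@measurable_fun_integral_on _ _ _ _ _ mu `]0%R, +oo[%classic
  (fun p0 : WS * R => (leave_density i j p0.1 p0.2 * \1_A p0.2)%:E * path_prob j p (boost i p0.2 p0.1))%E).
- exact: measurable_itv.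
- exact: measurable_step_fun (IH j mp').
- move=> q; apply: mule_ge0; last exact: path_prob_ge0.
  by rewrite lee_fin mulr_ge0// leave_density_ge0.
Qed.

Lemma star_prod i j (t : R) (s : seq (set V)) (F G : set V -> R) : uniq s ->
  {subset star i <= s} -> adj i j ->
  \prod_(e <- s) (if e \in star i
     then (if e == [set i; j] then F e else 1) * expR (- (G e * t)) else 1) =
  F [set i; j] * expR (- ((\sum_(e <- star i) G e) * t)).
Proof.
move=> us ss ij.
rewrite (bigID (fun e => e \in star i))/= [X in _ * X]big1 ?mulr1; last first.
  by move=> e /negbTE ->.
rewrite -big_filter.
rewrite (perm_big (star i)); last first.
  apply: uniq_perm; rewrite ?filter_uniq ?uniq_star// => e.
  by rewrite mem_filter; case: (boolP (e \in star i)) => // /ss.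
rewrite big_seq (eq_bigr (fun e =>
    (if e == [set i; j] then F e else 1) * expR (- (G e * t)))); last first.
  by move=> e ->.
rewrite -big_seq big_split/=; congr (_ * _).
  rewrite (bigD1_seq [set i; j]) ?uniq_star//=; last exact: mem_star.
  by rewrite eqxx big1 ?mulr1// => e /negbTE ->.
rewrite mulr_suml -sumrN expR_sum.
by [].
Qed.

Definition bump (e0 : set V) (a : set V -> R) : set V -> R :=
  fun e => if e == e0 then a e + 1 else a e.

Definition gamma_weights (a : set V -> R) (m : probability WS R) : Prop :=
  product_law (fun e => gamma_law (a e)) m.

Variables (a : set V -> R) (m m' : probability WS R) (i j : V).
Hypotheses (a_gt0 : forall e, edges adj e -> 0 < a e) (ij : adj i j).
Hypotheses (ma : gamma_weights a m) (ma' : gamma_weights (bump [set i; j] a) m').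
Let e0 := [set i; j].
Let atot := \sum_(e <- star i) a e.

Let me0 : edges adj e0. Proof. exact: edge_edges. Qed.

(** Gamma weights are conjugate: reweighting by the density of a holding time
    [t] at [i] followed by a crossing of [{i, j}] gives boosted weights that are
    again Gamma, with the parameter of [{i, j}] raised by one. *)
Lemma gamma_conjugate (t : R) (h : WS -> \bar R) :
  measurable_fun setT h -> (forall w, 0 <= h w)%E ->
  (\int[m]_w ((leave_density i j w t)%:E * h (boost i t w)) =
   (a e0 * expR (- (t * atot)))%:E * \int[m']_w h w)%E.
Proof.
move=> mh h0.
have mG : measurable_fun setT (fun w : WS => (leave_density i j w t)%:E).
  apply/measurable_EFinP.
  exact: (measurableT_comp (measurable_leave_density ij) (@pair2_measurable _ _ _ _ t)).
have G0 (w : WS) : (0 <= (leave_density i j w t)%:E)%E by rewrite lee_fin leave_density_ge0.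
have mB := @measurable_boost1 i t.
have c0 : 0 <= a e0 * expR (- (t * atot)) by rewrite mulr_ge0 ?expR_ge0// ltW// a_gt0.
have key B : measurable B ->
    mscale (NngNum c0) m' B = mpush (mdens m mG G0) mB B.
  apply: fam_measure_unique.
    rewrite /mscale/= lte_mul_pinfty ?lee_fin//.
    by rewrite -ge0_fin_numE//; exact: fin_num_measure.
  move=> s A us sD mA.
  pose s' := undup (s ++ star i).
  have us' : uniq s' by exact: undup_uniq.
  have sD' : {in s', forall e, edges adj e}.
    by move=> e; rewrite mem_undup mem_cat => /orP[/sD//|/star_edges].
  have ss : {subset star i <= s'} by move=> e es; rewrite mem_undup mem_cat es orbT.
  pose A' e := if e \in s then A e else setT.
  have mA' e : measurable (A' e) by rewrite /A'; case: ifP.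
  have cylE : cyl s A = cyl s' A'.
    apply/seteqP; split => w cw e.
      by move=> _; rewrite /A'; case: ifP => // /cw.
    by move=> es; have := cw e; rewrite mem_undup mem_cat es /A' es; exact.
  pose c e : R := if e \in star i then (if e == e0 then a e else 1) * expR (- (a e * t)) else 1.
  pose g e (x : R) : R := if e \in star i then
    (if e == e0 then `|x| * expR t else 1) * expR (- (`|x| * (expR t - 1))) else 1.
  pose phi e (x : R) : \bar R := ((g e x)%:E * (\1_(A' e) (if e \in star i then (x * expR t)%R else x))%:E)%E.
  have mid : measurable_fun setT (fun x : R => `|x|).
    exact: (measurableT_comp (@normr_measurable R setT) (@measurable_id _ _ setT)).
  have mphi e : measurable_fun setT (phi e).
    rewrite /phi /g; case: (e \in star i); last first.
      apply: emeasurable_funM; first exact: measurable_cst.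
      exact/measurable_EFinP/measurable_indic.
    apply: emeasurable_funM.
      apply/measurable_EFinP; apply: measurable_funM.
        by case: (e == e0); [apply: measurable_funM => //; exact: measurable_cst|exact: measurable_cst].
      apply: (measurableT_comp (@measurable_expR R)); apply: measurable_funN.
      by apply: measurable_funM => //; exact: measurable_cst.
    apply/measurable_EFinP; apply: (measurableT_comp (measurable_indic (mA' e))).
    by apply: measurable_funM => //; exact: measurable_cst.
  have phi0 e x : (0 <= phi e x)%E.
    apply: mule_ge0; rewrite lee_fin// /g; case: ifP => // _.
    by rewrite mulr_ge0 ?expR_ge0//; case: ifP => // _; rewrite mulr_ge0 ?expR_ge0.
  have phiE e : e \in s' ->
      (\int[gamma_law (a e)]_x phi e x = (c e)%:E * gamma_law (bump e0 a e) (A' e))%E.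
    move=> es'; have ae := a_gt0 (sD' _ es').
    have mI : measurable_fun setT (fun x : R => (\1_(A' e) x : R)%:E).
      exact/measurable_EFinP/measurable_indic.
    have I0 (x : R) : (0 <= (\1_(A' e) x : R)%:E)%E by rewrite lee_fin.
    have -> : gamma_law (bump e0 a e) (A' e) =
        (\int[gamma_law (bump e0 a e)]_x (\1_(A' e) x : R)%:E)%E.
      by rewrite (integral_indic _ measurableT (mA' e)) setIT.
    rewrite /phi /g /c /bump; case: (boolP (e \in star i)) => es; last first.
      have -> : (e == e0) = false.
        by apply/negbTE/negP => /eqP ee; move: es; rewrite ee /e0 mem_star.
      by rewrite mul1e; apply: eq_integral => x _; rewrite mul1e.
    case: (e == e0); first exact: gamma_law_size_scale.
    rewrite mul1r -(gamma_law_scale (a e) t mI I0).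
    by apply: eq_integral => x _; rewrite mul1r.
  transitivity ((a e0 * expR (- (t * atot)))%:E *
      \prod_(e <- s') gamma_law (bump e0 a e) (A' e))%E.
    by rewrite cylE -(ma' us' sD' mA').
  rewrite /mpush /pushforward /= /mdens integral_mkcond cylE.
  transitivity (\prod_(e <- s') ((c e)%:E * gamma_law (bump e0 a e) (A' e)))%E.
    rewrite big_split/=; congr (_ * _)%E.
    rewrite prodEFin; congr (_%:E).
    by rewrite (@star_prod i j t s' a a us' ss ij) [t * _]mulrC.
  rewrite big_seq; under eq_bigr do rewrite -phiE//; rewrite -big_seq.
  rewrite -(expectation_prod ma us' sD' mphi phi0).
  apply: eq_integral => w _; rewrite patchE.
  rewrite big_split/= !prodEFin /g.
  rewrite (@star_prod i j (expR t - 1) s' (fun e => `|w e| * expR t) (fun e => `|w e|) us' ss ij) -/(tot i w).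
  have bE : \prod_(e <- s') (\1_(A' e) (if e \in star i then w e * expR t else w e) : R) =
      (w \in boost i t @^-1` cyl s' A')%:R.
    rewrite big_seq (eq_bigr (fun e => (boost i t w e \in A' e)%:R)); last first.
      move=> e es; rewrite indicE /boost.
      have <- // : (e \in star i) = `[< e i >].
      apply/idP/idP => [/star_mem ei|/asboolP]; first exact/asboolP.
      by apply: edge_star; exact: sD'.
    rewrite -big_seq; case: (boolP (w \in _)) => [|].
      rewrite inE/= => cw; rewrite big_seq big1// => e es.
      by rewrite mem_set//; exact: cw.
    rewrite notin_setE/= => cw.
    have [e es ne] : exists2 e, e \in s' & ~ A' e (boost i t w e).
      apply: contrapT => ne; apply: cw => e es; apply: contrapT => nA.
      by apply: ne; exists e.
    rewrite (bigD1_seq e)//= memNset// mul0r//.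
  rewrite bE; case: ifPn => _; last by rewrite mule0.
  by rewrite mule1 /leave_density /jump_density.
have m1E : (\int[mscale (NngNum c0) m']_w h w =
    \int[mpush (mdens m mG G0) mB]_w h w)%E.
  by apply: eq_measure_integral => B mBB _; exact: key.
rewrite -[RHS](ge0_integral_mscale m' measurableT (NngNum c0) mh) => [|w _]; last exact: h0.
rewrite m1E (ge0_integral_pushforward mB _ measurableT mh) => [|w _]; last exact: h0.
have mhB : measurable_fun setT (h \o (boost i t : WS -> WS)) by exact: measurableT_comp.
rewrite (ge0_integral_mdens m mG G0 mhB) => [|w]; last exact: h0.
by apply: eq_integral => w _; rewrite muleC.
Qed.

(** The same with the holding time integrated out. *)
Lemma gamma_conjugate_step (H : WS * R -> \bar R) :
  measurable_fun setT H -> (forall p, 0 <= H p)%E ->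
  (\int[m]_w \int[mu]_(t in `]0%R, +oo[)
     ((leave_density i j w t)%:E * H (boost i t w, t)) =
   \int[mu]_(t in `]0%R, +oo[)
     ((a e0 * expR (- (t * atot)))%:E * \int[m']_w H (w, t)))%E.
Proof.
move=> mH H0.
have mF : measurable_fun setT (fun p : WS * R =>
    (leave_density i j p.1 p.2)%:E * H (boost i p.2 p.1, p.2))%E.
  apply: emeasurable_funM.
    by apply/measurable_EFinP; exact: measurable_leave_density.
  apply: (measurableT_comp mH); apply/measurable_fun_pairP; split.
    exact: measurable_boost.
  exact: measurable_snd.
have F0 (p : WS * R) : (0 <= (leave_density i j p.1 p.2)%:E * H (boost i p.2 p.1, p.2))%E.
  by rewrite mule_ge0// lee_fin leave_density_ge0.
rewrite (tonelli_on m mu (D1 := setT) (D2 := `]0%R, +oo[%classic) measurableT (measurable_itv _) mF F0)/=.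
apply: eq_integral => t _.
apply: (@gamma_conjugate t (fun w => H (w, t))); last by move=> w; exact: H0.
exact: (measurableT_comp mH (@pair2_measurable _ _ _ _ t)).
Qed.

End weights.

(** * Jump times of a path *)

Section jump_paths.
Context {R : realType} {V : choiceType}.
Implicit Types (y : R -> option V) (n : nat) (s t u : R).

(** The date of the [n]-th jump, and 0 if there is none. *)
Definition jump_date y n : R := xget 0 [set t | jump_time y n t].

Lemma first_jump_unique y s t t' : first_jump y s t -> first_jump y s t' -> t = t'.
Proof.
move=> [st c n] [st' c' n']; have [tt'|tt'|//] := ltgtP t t'.
  by case: n; apply: c' => //; exact: ltW.
by case: n'; apply: c => //; exact: ltW.
Qed.

Lemma jump_time_unique y n t t' : jump_time y n t -> jump_time y n t' -> t = t'.
Proof.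
elim: n t t' => [|n IH] t t' /=; first by move=> -> ->.
move=> [s js ft] [s' js' ft']; have ss := IH _ _ js js'; subst s'.
exact: first_jump_unique ft ft'.
Qed.

Lemma jump_dateE y n t : jump_time y n t -> jump_date y n = t.
Proof.
move=> jn; apply: (jump_time_unique (y := y) (n := n)) => //.
exact: (xgetPex 0 (ex_intro _ t jn)).
Qed.

Lemma skeletonE y n t : jump_time y n t -> skeleton y n = y t.
Proof.
move=> jn; rewrite /skeleton.
have [t' jn' ->] := xgetPex None (P := [set v | exists2 t, jump_time y n t & v = y t])
  (ex_intro _ (y t) (ex_intro2 _ _ t jn erefl)).
by rewrite (jump_time_unique jn jn').
Qed.

Lemma skeleton_jump y n v : skeleton y n = Some v ->
  jump_time y n (jump_date y n) /\ y (jump_date y n) = Some v.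
Proof.
move=> sn; have [[t jn]|nj] := pselect (exists t, jump_time y n t).
  by rewrite (jump_dateE jn); split => //; rewrite -sn (skeletonE jn).
move: sn; rewrite /skeleton xgetPN// => u [t jn _]; by apply: nj; exists t.
Qed.

Lemma jump_date0 y : jump_date y 0 = 0. Proof. exact: jump_dateE. Qed.

Lemma skeleton_first_jump y n v : skeleton y n.+1 = Some v ->
  first_jump y (jump_date y n) (jump_date y n.+1).
Proof. by move=> sn; have [[s js fj] _] := skeleton_jump sn; rewrite (jump_dateE js). Qed.

Variables (i0 : V) (y : R -> option V).
Hypothesis yP : jump_path i0 y.

Lemma skeleton0 : skeleton y 0 = Some i0.
Proof. by case: yP => y0 _ _ _; rewrite (@skeletonE y 0 0). Qed.

Lemma jump_time_ge0 n t : jump_time y n t -> 0 <= t.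
Proof.
elim: n t => [|n IH] t /=; first by move=> ->.
by move=> [s /IH s0 [st _ _]]; rewrite ltW// (le_lt_trans s0).
Qed.

Lemma path_near t : 0 <= t ->
  exists2 e, 0 < e & forall u, t <= u -> u < t + e -> y u = y t.
Proof.
move=> t0; case: yP => _ rc _ _; have /= := rc t t0.
rewrite /at_right; move=> -[e /= e0 h]; exists e => // u; rewrite le_eqVlt => /predU1P[->//|tu] ue.
apply: h => //=; rewrite ltr_distlC; rewrite ue andbT.
by rewrite ltrBlDr (lt_trans tu)// ltrDl.
Qed.

Lemma path_left t v : (\forall u \near t^'-, y u = Some v) ->
  exists2 e, 0 < e & forall u, t - e < u -> u < t -> y u = Some v.
Proof.
move=> -[e /= e0 h]; exists e => // u eu ut.
apply: h => //=; rewrite ltr_distlC; apply/andP; split; first by rewrite ltrBlDr -ltrBlDr.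
by rewrite (lt_trans ut)// ltrDl.
Qed.

Lemma left_path t v e : 0 < e -> (forall u, t - e < u -> u < t -> y u = Some v) ->
  \forall u \near t^'-, y u = Some v.
Proof.
move=> e0 h; exists e => //= u ue ut; apply: h => //.
by move: ue; rewrite /= ltr_distlC => /andP[].
Qed.

Lemma jump_alive n t : jump_time y n t -> y t <> None.
Proof.
elim: n t => [|n IH] t /=; first by move=> ->; case: yP => ->.
move=> [s js [st c _]]; have := IH s js; case E : (y s) => [v|//] _.
have s0 := jump_time_ge0 js.
case: yP => _ _ _ ll; have [_] := ll t (le_lt_trans s0 st); apply; exists v.
apply: (@left_path t v (t - s)); first by rewrite subr_gt0.
by move=> u; rewrite opprB addrC subrK -E => su; apply: c; exact: ltW.
Qed.

Lemma jump_skeleton n t : jump_time y n t -> exists v, skeleton y n = Some v.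
Proof.
move=> jn; have := jump_alive jn; rewrite -(skeletonE jn).
by case: (skeleton y n) => // v _; exists v.
Qed.

Lemma skeleton_pred n v : skeleton y n.+1 = Some v ->
  exists w, skeleton y n = Some w.
Proof. by move=> sn; have [[s js _] _] := skeleton_jump sn; exact: jump_skeleton js. Qed.

Lemma jump_date_ge0 n : 0 <= jump_date y n.
Proof.
have [[t jn]|nj] := pselect (exists t, jump_time y n t).
  by rewrite (jump_dateE jn); exact: jump_time_ge0 jn.
by rewrite /jump_date xgetPN// => t jn; apply: nj; exists t.
Qed.

Lemma skeleton_le m n v : (m <= n)%N -> skeleton y n = Some v ->
  exists w, skeleton y m = Some w.
Proof.
move=> /subnK <-; elim: (n - m)%N v => [|k IH] v; first by exists v.
by rewrite addSn => /skeleton_pred[w /IH].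
Qed.

Lemma jump_date_le m n v : (m <= n)%N -> skeleton y n = Some v -> jump_date y m <= jump_date y n.
Proof.
move=> /subnK <-; elim: (n - m)%N v => [|k IH] v //.
rewrite addSn => sk; have [w /IH] := skeleton_pred sk; move/le_trans; apply.
by case: (skeleton_first_jump sk) => /ltW.
Qed.

Lemma jump_date_lt m n v : (m < n)%N -> skeleton y n = Some v -> jump_date y m < jump_date y n.
Proof.
case: n => // n; rewrite ltnS => mn sk; have [w sw] := skeleton_pred sk.
apply: (le_lt_trans (jump_date_le mn sw)); by case: (skeleton_first_jump sk).
Qed.

(** A path that is alive either stays put or has a next jump. *)
Lemma next_jump s : 0 <= s -> (forall u, s <= u -> y u = y s) \/ exists t, first_jump y s t.
Proof.
move=> s0; apply: contrapT => /not_orP[nc nj].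
pose S := [set u | s <= u /\ y u <> y s].
have S0 : S !=set0.
  apply: contrapT => h; apply: nc => u su; apply: contrapT => yu; apply: h.
  by exists u.
have hl : has_inf S by split => //; exists s => u [].
pose tau := inf S.
have before u : s <= u -> u < tau -> y u = y s.
  move=> su ut; apply: contrapT => yu.
  by move: ut; rewrite ltNge => /negP; apply; apply: ge_inf => //; exists s => v [].
have stau : s < tau.
  have [e e0 he] := path_near s0.
  apply: (@lt_le_trans _ _ (s + e)); first by rewrite ltrDl.
  apply: lb_le_inf => // u [su yu]; rewrite leNgt; apply/negP => ue; exact/yu/he.
apply: nj; exists tau; split => // ytau.
have [e e0 he] := path_near (ltW (le_lt_trans s0 stau)).
suff : tau + e <= tau by rewrite leNgt ltrDl e0.
apply: lb_le_inf => // u [su yu]; rewrite leNgt; apply/negP => ue; apply: yu.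
have [ut|tu] := ltP u tau; first exact: before.
by rewrite he.
Qed.

Lemma const_between n v u : skeleton y n = Some v -> jump_date y n <= u ->
  skeleton y n.+1 = None \/ u < jump_date y n.+1 -> y u = Some v.
Proof.
move=> sn nu; have [jn yn] := skeleton_jump sn.
have [c|[t fj]] := next_jump (jump_date_ge0 n); first by rewrite c.
have jn1 : jump_time y n.+1 t by exists (jump_date y n).
have [w sw] := jump_skeleton jn1; rewrite sw (jump_dateE jn1) => -[//|ut].
by case: fj => _ c _; rewrite c.
Qed.

(** The jumps of a path do not accumulate as long as it is alive. *)
Lemma alive_between t v : 0 <= t -> y t = Some v ->
  exists n, [/\ skeleton y n = Some v, jump_date y n <= t &
    skeleton y n.+1 = None \/ t < jump_date y n.+1].
Proof.
move=> t0 yt; apply: contrapT => nex.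
have all n : (exists w, skeleton y n = Some w) /\ jump_date y n <= t.
  elim: n => [|n [[w sn] nt]]; first by rewrite skeleton0 jump_date0; split => //; exists i0.
  apply: contrapT => h.
  have nx : skeleton y n.+1 = None \/ t < jump_date y n.+1.
    case E : (skeleton y n.+1) => [x|]; last by left.
    right; rewrite ltNge; apply/negP => le; apply: h; split => //; by exists x.
  apply: nex; exists n; split => //.
  by rewrite sn -(const_between sn nt nx).
pose S := range (jump_date y).
have hs : has_sup S by split; [exists (jump_date y 0), 0%N|exists t => _ [n _ <-]; case: (all n)].
pose z := sup S.
have nz n : jump_date y n < z.
  have [[w sw] _] := all n.+1; apply: (lt_le_trans (jump_date_lt (ltnSn n) sw)).
  by apply: ub_le_sup; [case: hs|exists n.+1].
have zt : z <= t by apply: ge_sup; [case: hs|move=> _ [n _ <-]; case: (all n)].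
have z0 : 0 < z by rewrite -(jump_date0 y).
have yz : y z <> None.
  by move=> yz; case: yP => _ _ dead _; have := dead z t (ltW z0) zt yz; rewrite yt.
case: yP => _ _ _ ll; have [/(_ yz)[x] /path_left[e e0 he] _] := ll z z0.
have [_ [n _ <-] en] := sup_adherent e0 hs.
have [[w sw] _] := all n.+1; have [_ _] := skeleton_first_jump sw; apply.
by rewrite !he//; apply: (lt_trans en); exact: jump_date_lt sw.
Qed.

Lemma path_someP t v : 0 <= t -> (y t = Some v <->
  exists n, [/\ skeleton y n = Some v, jump_date y n <= t &
    skeleton y n.+1 = None \/ t < jump_date y n.+1]).
Proof.
move=> t0; split; first exact: alive_between.
by move=> [n [sn nt nx]]; exact: const_between nx.
Qed.

End jump_paths.

(** * Local times and the clock of the time modification *)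

Section local_times.
Context {R : realType} {V : choiceType}.
Notation mu := (@lebesgue_measure R).
Variables (i0 : V) (y : R -> option V).
Hypothesis yP : jump_path i0 y.

Let piece n : set R := [set u | [/\ exists v, skeleton y n = Some v, jump_date y n <= u &
  skeleton y n.+1 = None \/ u < jump_date y n.+1]].

Let measurable_piece n : measurable (piece n).
Proof.
rewrite /piece; case: (skeleton y n) => [v|]; last first.
  by rewrite (_ : [set _ | _] = set0)//; apply/seteqP; split => // u [[]].
case: (skeleton y n.+1) => [w|].
  rewrite (_ : [set _ | _] = `[jump_date y n, jump_date y n.+1[%classic)//.
  apply/seteqP; split => u /=; rewrite in_itv/=; first by move=> [_ -> []].
  by move=> /andP[-> ->]; split => //; [exists v|right].
rewrite (_ : [set _ | _] = `[jump_date y n, +oo[%classic)//.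
apply/seteqP; split => u /=; rewrite in_itv/= andbT; first by move=> [_ ->].
by move=> ->; split => //; [exists v|left].
Qed.

Let pieceE n v u : skeleton y n = Some v -> piece n u -> y u = Some v.
Proof. by move=> sn [_ nu nx]; exact: (const_between yP sn nu nx). Qed.

Let piece_ge0 n u : piece n u -> 0 <= u.
Proof. by move=> [_ nu _]; exact: (le_trans (jump_date_ge0 y n) nu). Qed.

Let occ i : set R := [set u | 0 <= u /\ y u = Some i].

Let measurable_occ i : measurable (occ i).
Proof.
rewrite (_ : occ i = \bigcup_n (if skeleton y n == Some i then piece n else set0)).
  by apply: bigcup_measurable => n _; case: ifP.
apply/seteqP; split => u.
  move=> [u0 /(alive_between yP u0)[n [sn nu nx]]]; exists n => //.
  by rewrite sn eqxx; split => //; exists i.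
move=> [n _]; case: ifP => // /eqP sn pu; split; first exact: piece_ge0 pu.
exact: pieceE pu.
Qed.

Let integrable01 (f : R -> R) (t : R) : measurable_fun (`[0, t]%classic : set (measurableTypeR R)) f ->
  (forall u, 0 <= u -> 0 <= f u <= 1) -> mu.-integrable (`[0, t]%classic : set (measurableTypeR R)) (EFin \o f).
Proof.
move=> mf f01; apply: measurable_bounded_integrable => //.
  by rewrite /= lebesgue_measure_itv/=; case: ifP => _; rewrite ?ltry// -EFinB ltry.
exists 1; split; first exact: num_real.
move=> M M1 u /=; rewrite in_itv/= => /andP[u0 _].
by have /andP[f0 f1] := f01 u u0; rewrite ger0_norm// (le_trans f1)// ltW.
Qed.

Let itvD (f : R -> R) (s t : R) : 0 <= s -> s <= t -> mu.-integrable (`[0, t]%classic : set (measurableTypeR R)) (EFin \o f) ->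
  (\int[mu]_(u in `[0%R, t]) f u =
   \int[mu]_(u in `[0%R, s]) f u + \int[mu]_(u in `]s, t]) f u)%R.
Proof.
move=> s0 st fi; rewrite -(@Rintegral_itvB _ f (BLeft 0) (BRight t) s)//.
by rewrite addrC subrK.
Qed.

Let integrable_sub (f : R -> R) (s t : R) : 0 <= s -> mu.-integrable (`[0, t]%classic : set (measurableTypeR R)) (EFin \o f) ->
  mu.-integrable (`]s, t]%classic : set (measurableTypeR R)) (EFin \o f).
Proof.
move=> s0 fi; apply: integrableS fi => //; apply: subset_itvr.
by rewrite bnd_simp.
Qed.

Let indic_int i t : mu.-integrable (`[0, t]%classic : set (measurableTypeR R)) (EFin \o (fun u => (y u == Some i)%:R)).
Proof.
apply: integrable01; last by move=> u _; case: eqP => _; rewrite ?lexx ?ler01.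
apply: (eq_measurable_fun (\1_(occ i) : R -> R)).
  move=> u; rewrite inE/= in_itv/= => /andP[u0 _]; rewrite indicE.
  congr (_ %:R); congr nat_of_bool; apply/idP/eqP; last by move=> yu; rewrite inE.
  by rewrite inE => -[].
by apply: measurable_funTS; exact: measurable_indic.
Qed.

Lemma local_time_ge0 i t : 0 <= local_time y i t.
Proof. by apply: Rintegral_ge0 => u _. Qed.

Lemma local_time0 i : local_time y i 0 = 0.
Proof. by rewrite /local_time set_itv1 Rintegral_set1. Qed.

Lemma local_time_le i s t : 0 <= s -> s <= t -> local_time y i s <= local_time y i t.
Proof.
move=> s0 st; rewrite /local_time (itvD s0 st)// lerDl.
by apply: Rintegral_ge0 => u _.
Qed.

Lemma local_time_const i j s t : 0 <= s -> s <= t ->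
  (forall u, s <= u -> u < t -> y u = Some j) ->
  local_time y i t = local_time y i s + (if j == i then t - s else 0).
Proof.
move=> s0 st c; rewrite /local_time (itvD s0 st)//; congr (_ + _).
move: st; rewrite le_eqVlt => /predU1P[<-|st].
  by rewrite set_itvoc0// Rintegral_set0 subrr; case: ifP.
have fi := integrable_sub s0 (indic_int i t).
rewrite -Rintegral_itv_bndo_bndc; last first.
  by apply: integrableS fi => //; apply: subset_itvl; rewrite bnd_simp.
rewrite (@eq_Rintegral _ _ _ _ _ (cst (j == i)%:R)); last first.
  move=> u; rewrite inE/= in_itv/= => /andP[su ut].
  by rewrite c// ltW.
rewrite Rintegral_cst//= lebesgue_measure_itv/= lte_fin st/=.
by case: eqP => _; rewrite ?mul1r ?mul0r.
Qed.

Let clock_integrand (u : R) : R :=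
  if y u is Some i then (vrjp_local_time y i u)^-1 else 0.

Let local_time_nd i : nondecreasing_fun (local_time y i).
Proof.
move=> s t st; have [s0|s0] := leP 0 s; first exact: local_time_le.
rewrite {1}/local_time set_itv_ge ?Rintegral_set0 ?local_time_ge0//.
by rewrite bnd_simp -ltNge.
Qed.

Let clock_int t : mu.-integrable (`[0, t]%classic : set (measurableTypeR R)) (EFin \o clock_integrand).
Proof.
apply: integrable01; last first.
  move=> u _; rewrite /clock_integrand; case: (y u) => [i|]; last by rewrite lexx ler01.
  have l1 : 1 <= vrjp_local_time y i u by rewrite lerDl local_time_ge0.
  have l0 := lt_le_trans ltr01 l1.
  by rewrite invr_ge0 (ltW l0)/= invf_le1.
pose P := \bigcup_n piece n.
have mP : measurable P by exact: bigcup_measurable.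
rewrite (_ : `[0, t]%classic = (P `&` `[0, t]) `|` (`[0, t] `\` P)); last first.
  by rewrite setIC setUIDK.
apply/measurable_funU.
- exact: measurableI.
- exact: measurableD.
split; last first.
  apply: (eq_measurable_fun (cst 0 : R -> R)); last exact: measurable_cst.
  move=> u; rewrite inE => -[/=]; rewrite in_itv/= => /andP[u0 _] nP.
  rewrite /clock_integrand; case E : (y u) => [i|//]; exfalso; apply: nP.
  have [n [sn nu nx]] := alive_between yP u0 E; exists n => //.
  by split => //; exists i.
rewrite setI_bigcupl; apply/measurable_fun_bigcup => [n|n]; first (by apply: measurableI => //; exact: measurable_piece).
case E : (skeleton y n) => [i|]; last first.
  rewrite (_ : piece n `&` _ = set0); first exact: measurable_fun_set0.
  by apply/seteqP; split => // u [[[v]]]; rewrite E.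
apply: (eq_measurable_fun (fun u => (vrjp_local_time y i u)^-1)).
  by move=> u; rewrite inE => -[pu _]; rewrite /clock_integrand (pieceE E pu).
apply: measurable_funTS.
apply: nonincreasing_measurable => // s u su.
rewrite lef_pV2 ?posrE; first by rewrite lerD2l; exact: local_time_nd.
- by rewrite ltr_wpDr// local_time_ge0.
- by rewrite ltr_wpDr// local_time_ge0.
Qed.

Lemma vrjp_clock0 : vrjp_clock y 0 = 0.
Proof. by rewrite /vrjp_clock set_itv1 Rintegral_set1. Qed.

Lemma vrjp_clock_le s t : 0 <= s -> s <= t -> vrjp_clock y s <= vrjp_clock y t.
Proof.
move=> s0 st; rewrite /vrjp_clock (itvD s0 st (clock_int t)) lerDl.
apply: Rintegral_ge0 => u _; rewrite /clock_integrand; case: (y u) => // i.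
by rewrite invr_ge0 addr_ge0// local_time_ge0.
Qed.

Lemma vrjp_local_time_gt0 i t : 0 < vrjp_local_time y i t.
Proof. by rewrite ltr_wpDr// local_time_ge0. Qed.

Lemma vrjp_clock_const j s t : 0 <= s -> s <= t ->
  (forall u, s <= u -> u < t -> y u = Some j) ->
  vrjp_clock y t = vrjp_clock y s +
    ln (1 + (t - s) / vrjp_local_time y j s).
Proof.
move=> s0 st c; rewrite /vrjp_clock (itvD s0 st (clock_int t)); congr (_ + _).
move: st; rewrite le_eqVlt => /predU1P[<-|st].
  by rewrite set_itvoc0// Rintegral_set0 subrr mul0r addr0 ln1.
have fi := integrable_sub s0 (clock_int t).
pose l := vrjp_local_time y j s; have l0 : 0 < l by exact: vrjp_local_time_gt0.
have fi' : mu.-integrable (`]s, t[%classic : set (measurableTypeR R)) (EFin \o clock_integrand).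
  by apply: integrableS fi => //; apply: subset_itvl; rewrite bnd_simp.
rewrite -Rintegral_itv_bndo_bndc//.
have intE u : u \in `]s, t[ -> clock_integrand u = (l + (u - s))^-1.
  rewrite in_itv/= => /andP[su ut].
  rewrite /clock_integrand c ?(ltW su)// /l /vrjp_local_time.
  rewrite (@local_time_const j j s u s0 (ltW su)) ?eqxx ?addrA// => v sv vu.
  by apply: c => //; exact: lt_trans ut.
transitivity (\int[mu]_(u in `]s, t[) (l + (u - s))^-1)%R.
  by apply: eq_Rintegral => u; rewrite inE/=; exact: intE.
pose F (u : R) := ln (l + (u - s)).
have pos (u : R) : s <= u -> 0 < l + (u - s) by move=> su; rewrite ltr_wpDr// subr_ge0.
have dF (u : R) : s <= u -> is_derive u 1 F (l + (u - s))^-1.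
  move=> su; rewrite /F.
  have h : is_derive u 1 (fun u : R => l + (u - s)) 1.
    by apply: is_derive_eq; rewrite add0r subr0 mul1r.
  have h2 := is_derive1_ln (pos u su).
  have := @is_derive1_comp R (@ln R) (fun u : R => l + (u - s)) u _ _ h2 h.
  by rewrite mulr1 /comp.
have cF (u : R) : s <= u -> F v @[v --> u] --> F u.
  move=> su; apply: differentiable_continuous; apply/derivable1_diffP.
  by have := dF u su => h; exact: ex_derive.
have mG : measurable_fun (`]s, t[%classic : set (measurableTypeR R)) (fun u : R => ((l + (u - s))^-1)%:E).
  have := measurable_int mu fi'; apply: eq_measurable_fun => u; rewrite inE/= in_itv/= => /andP[su ut].
  by rewrite /= intE// in_itv/= su.
rewrite /Rintegral -(@integral_itv_bndoo _ _ _ _ true false)//.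
have -> : (\int[mu]_(u in `[s, t]) ((l + (u - s))^-1)%:E = (F t)%:E - (F s)%:E)%E.
  apply: continuous_FTC2 => //.
  - apply: continuous_in_subspaceT => u; rewrite inE/= in_itv/= => /andP[su _].
    apply: cvgV; first by rewrite gt_eqF// pos.
    by apply: cvgD; [exact: cvg_cst|apply: cvgB; [exact: cvg_id|exact: cvg_cst]].
  - split.
    + move=> u; rewrite in_itv/= => /andP[su _].
      by have h := dF u (ltW su); exact: ex_derive.
    + by apply: cvg_at_right_filter; exact: cF.
    + by apply: cvg_at_left_filter; apply: cF; exact: ltW.
  - move=> u; rewrite in_itv/= => /andP[su _]; rewrite derive1E.
    by have h := dF u (ltW su); exact: derive_val.
rewrite /= /F subrr addr0 -ln_div ?posrE ?pos ?(ltW st)//.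
by rewrite mulrDl divff ?gt_eqF.
Qed.

End local_times.

(** * Measurability of jump times *)

Section exact_jumps.
Context {R : realType} {V : choiceType}.
Implicit Types (x : nat -> V) (n k : nat).

(** These events, and [reached], are expressed below through rational times, which
    makes the jump dates measurable. *)
Definition exact_jumps n x (q : R) (y : R -> option V) : Prop :=
  [/\ forall k, (k <= n)%N -> skeleton y k = Some (x k), jump_date y n <= q &
      skeleton y n.+1 = None \/ q < jump_date y n.+1].

Definition reached n x (q : R) (y : R -> option V) : Prop :=
  (forall k, (k <= n)%N -> skeleton y k = Some (x k)) /\ jump_date y n <= q.

Section one_path.
Variables (i0 : V) (y : R -> option V).
Hypothesis yP : jump_path i0 y.

Lemma dense_right (t q : R) : 0 <= t -> t < q ->
  exists2 s : rat, t < ratr s < q & y (ratr s) = y t.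
Proof.
move=> t0 tq; have [e e0 he] := path_near yP t0.
have te : t < Num.min q (t + e) by rewrite lt_min tq ltrDl.
have [s] := rat_in_itvoo te; rewrite in_itv/= lt_min => /and3P[ts sq se].
by exists s; [rewrite ts|apply: he => //; exact: ltW].
Qed.

Lemma exact_jumps_cur n x q : exact_jumps n x q y -> y q = Some (x n).
Proof. by move=> [sk nq nx]; apply: (const_between yP (sk n (leqnn n))). Qed.

Lemma exact_jumps0 x q : 0 <= q -> (exact_jumps 0 x q y <->
  y q = Some (x 0%N) /\ forall s : rat, 0 <= (ratr s : R) <= q -> y (ratr s) = Some (x 0%N)).
Proof.
move=> q0; split.
  move=> h; split; first exact: exact_jumps_cur h.
  case: h => sk _ nx s /andP[s0 sq]; apply: (const_between yP (sk 0%N isT)).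
    by rewrite jump_date0.
  by case: nx => nx; [left|right; exact: le_lt_trans nx].
move=> [yq ys]; have y0 : y 0 = Some (x 0%N) by rewrite -(ys 0) rmorph0 ?lexx.
have s0 : skeleton y 0 = Some (x 0%N) by rewrite (@skeletonE _ _ y 0 0).
split; [by move=> [|k]|by rewrite jump_date0|].
case E : (skeleton y 1) => [w|]; [right|by left].
have [lt01 _] := skeleton_first_jump E; rewrite jump_date0 y0 => ne.
rewrite ltNge; apply/negP; rewrite le_eqVlt => /predU1P[e|lt1].
  by apply: ne; rewrite e.
have [s /andP[s1 s2] ysE] := dense_right (jump_date_ge0 y 1) lt1.
apply: ne; rewrite -ysE ys// (ltW s2) andbT ltW// (le_lt_trans _ s1)//.
exact: jump_date_ge0.
Qed.

Lemma exact_jumpsS n x q : 0 <= q -> (exact_jumps n.+1 x q y <->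
  x n <> x n.+1 /\ exists r : rat, [/\ 0 <= (ratr r : R) < q, exact_jumps n x (ratr r) y,
   y q = Some (x n.+1),
   forall s : rat, ratr r <= (ratr s : R) <= q -> y (ratr s) = Some (x n) \/ y (ratr s) = Some (x n.+1) &
   forall s t : rat, ratr r <= (ratr s : R) -> (ratr s : R) <= ratr t -> (ratr t : R) <= q ->
     y (ratr t) = Some (x n) -> y (ratr s) = Some (x n)]).
Proof.
move=> q0; split.
  move=> h; have yq := exact_jumps_cur h; case: h => sk nq nx.
  have sn := sk n (leqnSn n); have sn1 := sk n.+1 (leqnn _).
  have [lt c ne] := skeleton_first_jump sn1.
  have [_ yn] := skeleton_jump sn; have [_ yn1] := skeleton_jump sn1.
  have xx : x n <> x n.+1 by move=> xx; apply: ne; rewrite yn yn1 xx.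
  split => //; have [r] := rat_in_itvoo lt; rewrite in_itv/= => /andP[nr rn1].
  have bef (s : rat) : ratr r <= (ratr s : R) -> ratr s < jump_date y n.+1 -> y (ratr s) = Some (x n).
    move=> rs sn1'; apply: (const_between yP sn); last by right.
    by rewrite (le_trans (ltW nr)).
  have aft (s : rat) : jump_date y n.+1 <= ratr s -> (ratr s : R) <= q -> y (ratr s) = Some (x n.+1).
    move=> n1s sq; apply: (const_between yP sn1) => //.
    by case: nx => nx; [left|right; exact: le_lt_trans nx].
  exists r; split => //.
  - by rewrite (lt_le_trans rn1)// andbT (le_trans (jump_date_ge0 y n))// ltW.
  - by split; [move=> k kn; apply: sk; exact: leqW|exact: ltW|right].
  - move=> s /andP[rs sq]; have [sn1'|n1s] := ltP (ratr s) (jump_date y n.+1).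
      by left; exact: bef.
    by right; exact: aft.
  - move=> s t rs st tq yt; apply: bef => //; apply: (le_lt_trans st).
    rewrite ltNge; apply/negP => n1t; move: yt; rewrite aft// => -[/esym].
    exact: xx.
move=> [xx [r [/andP[r0 rq] er yq vals mon]]].
have yr := exact_jumps_cur er; case: er => sk nr nx.
have sn := sk n (leqnn n); have [jn yn] := skeleton_jump sn.
have [c|[J fj]] := next_jump yP (jump_date_ge0 y n).
  by exfalso; apply: xx; move: yq; rewrite c ?yn; [case|exact: le_trans (ltW rq)].
have jn1 : jump_time y n.+1 J by exists (jump_date y n).
have [w sw] := jump_skeleton yP jn1; have JE := jump_dateE jn1.
have [_ yw] := skeleton_jump sw; rewrite JE in yw.
have rJ : ratr r < J by case: nx; rewrite ?sw// JE.
have J0 : 0 <= J by rewrite (le_trans r0)// ltW.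
have Jq : J <= q.
  rewrite leNgt; apply/negP => qJ; apply: xx; case: fj => _ c _.
  by move: yq; rewrite c// ?yn; [case|exact: le_trans (ltW rq)].
have wn : w <> x n by move=> wn; case: fj => _ _; rewrite yw yn wn.
have wE : w = x n.+1.
  move: Jq; rewrite le_eqVlt => /predU1P[Jq|Jq].
    by move: yq; rewrite -Jq yw => -[].
  have [s /andP[Js sq] ys] := dense_right J0 Jq.
  have := vals s; rewrite ys yw (ltW sq) andbT => /(_ (ltW (lt_trans rJ Js))).
  by move=> -[[/wn]|[]].
split; last 2 first.
- by rewrite JE.
- case E : (skeleton y n.+2) => [w'|]; [right|by left].
  have [lt _ ne] := skeleton_first_jump E; rewrite JE in lt ne.
  rewrite yw wE in ne.
  rewrite ltNge; apply/negP; rewrite le_eqVlt => /predU1P[e|lt2].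
    by apply: ne; rewrite e.
  have [t /andP[Jt tq] yt] := dense_right (jump_date_ge0 y n.+2) lt2.
  have [s /andP[Js sJ'] ys] := dense_right J0 lt.
  have rs := ltW (lt_trans rJ Js); have st := ltW (lt_trans sJ' Jt).
  have ytn : y (ratr t) = Some (x n).
    have := vals t; rewrite (ltW tq) andbT => /(_ (le_trans rs st)) -[//|ytn].
    by exfalso; apply: ne; rewrite -yt.
  by have := mon s t rs st (ltW tq) ytn; rewrite ys yw => -[/wn].
- move=> k; rewrite leq_eqVlt => /predU1P[->|]; first by rewrite sw wE.
  exact: sk.
Qed.

Lemma reachedE n x q : 0 <= q -> (reached n x q y <->
  exact_jumps n x q y \/ exists s : rat, 0 <= (ratr s : R) <= q /\ exact_jumps n x (ratr s) y).
Proof.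
move=> q0; split; last first.
  move=> [[sk nq _]|[s [/andP[_ sq] [sk ns _]]]]; split => //.
  exact: le_trans sq.
move=> [sk nq]; case E : (skeleton y n.+1) => [w|]; last by left; split => //; left.
have [lt _ _] := skeleton_first_jump E.
have [n1q|qn1] := leP (jump_date y n.+1) q; last by left; split => //; right.
have [s] := rat_in_itvoo lt; rewrite in_itv/= => /andP[ns sn1].
right; exists s; split; last by split => //; [exact: ltW|right].
by rewrite (le_trans (jump_date_ge0 y n) (ltW ns))/= (le_trans (ltW sn1)).
Qed.

End one_path.

Section measurability.
Context d (T : measurableType d).
Variables (i0 : V) (Y : T -> R -> option V) (r : R).
Hypothesis YP : forall w, jump_path i0 (Y w).
Hypothesis mY : forall u v, 0 <= u -> u <= r -> measurable [set w | Y w u = v].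

Let bigcap_rat (F : rat -> set T) : (forall s, measurable (F s)) ->
  measurable (\bigcap_s F s).
Proof.
move=> mF; rewrite -[X in measurable X]setCK setC_bigcap; apply: measurableC.
by apply: bigcupT_measurable_rat => s; exact: measurableC.
Qed.

Let cond_measurable (P : Prop) (A : set T) : (P -> measurable A) ->
  measurable [set w | P -> A w].
Proof.
move=> mA; have [p|np] := pselect P.
  rewrite (_ : [set _ | _] = A); first exact: mA.
  by apply/seteqP; split => w /=; [apply|].
rewrite (_ : [set _ | _] = setT); first exact: measurableT.
by apply/seteqP; split => w //= _ /np.
Qed.

Lemma measurable_exact_jumps n x q : 0 <= q -> q <= r ->
  measurable [set w | exact_jumps n x q (Y w)].
Proof.
elim: n x q => [|n IH] x q q0 qr.
  rewrite (_ : [set _ | _] = [set w | Y w q = Some (x 0%N)] `&`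
     \bigcap_s [set w | 0 <= (ratr s : R) <= q -> Y w (ratr s) = Some (x 0%N)]); last first.
    apply/seteqP; split => w /=; rewrite (exact_jumps0 (YP w) x q0).
      by move=> [yq h]; split => // s _; exact: h.
    by move=> [yq h]; split => // s; exact: h.
  apply: measurableI; first exact: mY.
  apply: bigcap_rat => s; apply: cond_measurable => /andP[s0 sq].
  by apply: mY => //; exact: le_trans qr.
have [xx|xx] := pselect (x n = x n.+1).
  rewrite (_ : [set _ | _] = set0)//; apply/seteqP; split => // w /=.
  by rewrite (exact_jumpsS (YP w) n x q0) => -[].
rewrite (_ : [set _ | _] = \bigcup_(s : rat)
  (if 0 <= (ratr s : R) < q then [set w | exact_jumps n x (ratr s) (Y w)] `&`
    [set w | Y w q = Some (x n.+1)] `&`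
    \bigcap_(t : rat) [set w | ratr s <= (ratr t : R) <= q ->
       Y w (ratr t) = Some (x n) \/ Y w (ratr t) = Some (x n.+1)] `&`
    \bigcap_(t : rat) \bigcap_(u : rat) [set w |
       [/\ ratr s <= (ratr t : R), (ratr t : R) <= ratr u & (ratr u : R) <= q] ->
       (Y w (ratr u) = Some (x n) -> Y w (ratr t) = Some (x n))]
   else set0)); last first.
  apply/seteqP; split => w /=; rewrite (exact_jumpsS (YP w) n x q0).
    move=> [_ [s [sq ex yq vals mon]]]; exists s => //; rewrite sq.
    split; first split; first split => //.
      by move=> t _; exact: vals.
    by move=> t _ u _ [? ? ?]; exact: mon.
  move=> [s _]; case: ifP => // sq [[[ex yq] vals] mon]; split => //; exists s.
  split => //; first by move=> t; exact: (vals t I).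
  by move=> t u st tu uq; exact: (mon t I u I (And3 st tu uq)).
apply: bigcupT_measurable_rat => s; case: ifP => // /andP[s0 sq].
apply: measurableI; first apply: measurableI; first apply: measurableI.
- by apply: IH => //; rewrite (le_trans (ltW sq)).
- exact: mY.
- apply: bigcap_rat => t; apply: cond_measurable => /andP[st tq].
  by apply: measurableU; apply: mY; rewrite ?(le_trans s0)// (le_trans tq).
- apply: bigcap_rat => t; apply: bigcap_rat => u.
  apply: cond_measurable => -[st tu uq].
  rewrite [X in measurable X](_ : _ = ~` [set w | Y w (ratr u) = Some (x n)] `|`
    [set w | Y w (ratr t) = Some (x n)]); last first.
    apply/seteqP; split => w /=; last by move=> [h /h|].
    by have [yu h|] := pselect (Y w (ratr u) = Some (x n)); [right; exact: h|left].
  have t0 := le_trans s0 st.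
  apply: measurableU; first apply: measurableC.
    by apply: mY; rewrite ?(le_trans t0)// (le_trans uq).
  by apply: mY => //; rewrite (le_trans tu)// (le_trans uq).
Qed.

Lemma measurable_reached n x q : q <= r -> measurable [set w | reached n x q (Y w)].
Proof.
move=> qr; have [q0|q0] := leP 0 q; last first.
  rewrite (_ : [set _ | _] = set0)//; apply/seteqP; split => // w [_].
  by rewrite leNgt (lt_le_trans q0)// jump_date_ge0.
rewrite (_ : [set _ | _] = [set w | exact_jumps n x q (Y w)] `|` \bigcup_(s : rat)
  (if 0 <= (ratr s : R) <= q then [set w | exact_jumps n x (ratr s) (Y w)] else set0)).
  apply: measurableU; first exact: measurable_exact_jumps.
  apply: bigcupT_measurable_rat => s; case: ifP => // /andP[s0 sq].
  by apply: measurable_exact_jumps => //; exact: le_trans qr.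
apply/seteqP; split => w /=; rewrite (reachedE (Y w) n x q0).
  by move=> [?|[s [sq ex]]]; [left|right; exists s => //; rewrite sq].
by move=> [?|[s _]]; [left|case: ifP => // sq ex; right; exists s].
Qed.

Lemma measurable_jump_date n x k : (k <= n)%N ->
  measurable_fun [set w | reached n x r (Y w)] (fun w => jump_date (Y w) k).
Proof.
move=> kn; have mE := @measurable_reached n x r (lexx r).
apply: (measurability (@RGenOInfty.G R)); first exact: RGenOInfty.measurableE.
move=> _ [_ [c ->] <-] /=.
rewrite (_ : _ `&` _ = [set w | reached n x r (Y w)] `\`
   [set w | reached k x (Num.min c r) (Y w)]).
  by apply: measurableD => //; apply: measurable_reached; rewrite ge_min lexx orbT.
apply/seteqP; split => w /= [h]; have [sk nr] := h.
  rewrite in_itv/= andbT => kc; split => // -[_].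
  by rewrite le_min leNgt kc.
move=> nk; split => //; rewrite in_itv/= andbT ltNge; apply/negP => kc; apply: nk.
split; first by move=> l lk; apply: sk; exact: leq_trans kn.
rewrite le_min kc/= (le_trans _ nr)//.
exact: (jump_date_le (YP w) kn (sk n (leqnn n))).
Qed.

End measurability.

End exact_jumps.

(** * Weights seen by the process *)

Section environment.
Context {R : realType} {V : choiceType}.
Variable adj : rel V.
Implicit Types (x : nat -> V) (n k : nat) (w : set V -> R) (y : R -> option V).

(** Holding times of [y] after its time change. *)
Definition hold y n : R := vrjp_clock y (jump_date y n.+1) - vrjp_clock y (jump_date y n).

Definition occ y (v : V) n : R := vrjp_local_time y v (jump_date y n).

(** The weights seen at the [n]-th jump: every stay boosts the edges at the vertex
    that is left. *)
Fixpoint env w x (h : nat -> R) n : set V -> R :=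
  if n is m.+1 then boost (x m) (h m) (env w x h m) else w.

Section one_path.
Variables (i0 : V) (y : R -> option V).
Hypothesis yP : jump_path i0 y.

Lemma occ_gt0 v n : 0 < occ y v n.
Proof. exact: vrjp_local_time_gt0. Qed.

Lemma occ0 v : occ y v 0 = 1.
Proof. by rewrite /occ jump_date0 /vrjp_local_time local_time0 addr0. Qed.

Let const n v u v2 : skeleton y n = Some v -> skeleton y n.+1 = Some v2 ->
  jump_date y n <= u -> u < jump_date y n.+1 -> y u = Some v.
Proof. by move=> sn sn1 nu un; apply: (const_between yP sn nu); right. Qed.

Lemma occS n v v' v2 : skeleton y n = Some v -> skeleton y n.+1 = Some v2 ->
  occ y v' n.+1 = occ y v' n + (if v == v' then jump_date y n.+1 - jump_date y n else 0).
Proof.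
move=> sn sn1; have [lt _ _] := skeleton_first_jump sn1.
have c u : jump_date y n <= u -> u < jump_date y n.+1 -> y u = Some v by exact: const sn sn1.
by rewrite /occ /vrjp_local_time (local_time_const yP v' (jump_date_ge0 y n) (ltW lt) c) addrA.
Qed.

(** During a stay at [v] the local time [l] at [v] grows at unit speed and the
    clock at speed [1 / l]: the clock is a logarithm. *)
Lemma clock_between n v u : skeleton y n = Some v -> jump_date y n <= u ->
  skeleton y n.+1 = None \/ u <= jump_date y n.+1 ->
  vrjp_clock y u = vrjp_clock y (jump_date y n) + ln (1 + (u - jump_date y n) / occ y v n).
Proof.
move=> sn nu nx; apply: (vrjp_clock_const yP (jump_date_ge0 y n)) => // u' nu' u'u.
apply: (const_between yP sn nu'); case: nx => nx; [left|right] => //.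
exact: lt_le_trans nx.
Qed.

Lemma holdE n v v2 : skeleton y n = Some v -> skeleton y n.+1 = Some v2 ->
  hold y n = ln (1 + (jump_date y n.+1 - jump_date y n) / occ y v n).
Proof.
move=> sn sn1; have [lt _ _] := skeleton_first_jump sn1.
rewrite /hold (clock_between sn (ltW lt)); first by rewrite addrC addKr.
by right.
Qed.

Lemma hold_gt0 n v v2 : skeleton y n = Some v -> skeleton y n.+1 = Some v2 -> 0 < hold y n.
Proof.
move=> sn sn1; have [lt _ _] := skeleton_first_jump sn1.
by rewrite (holdE sn sn1) ln_gt0// ltrDl divr_gt0 ?occ_gt0// subr_gt0.
Qed.

Lemma expR_hold n v v2 : skeleton y n = Some v -> skeleton y n.+1 = Some v2 ->
  expR (hold y n) = occ y v n.+1 / occ y v n.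
Proof.
move=> sn sn1; have [lt _ _] := skeleton_first_jump sn1.
have p : 0 < 1 + (jump_date y n.+1 - jump_date y n) / occ y v n.
  by rewrite addr_gt0// divr_gt0 ?occ_gt0// subr_gt0.
rewrite (holdE sn sn1) lnK ?posrE// (occS v sn sn1) eqxx [RHS]mulrDl divff//.
by rewrite gt_eqF// occ_gt0.
Qed.

Lemma hold_le n v v2 c : skeleton y n = Some v -> skeleton y n.+1 = Some v2 ->
  (hold y n <= c) = (jump_date y n.+1 - jump_date y n <= occ y v n * (expR c - 1)).
Proof.
move=> sn sn1; rewrite -ler_expR (expR_hold sn sn1) (occS v sn sn1) eqxx.
have o0 := occ_gt0 v n.
rewrite ler_pdivrMr// mulrBr mulr1 lerBrDl; congr (_ <= _); last exact: mulrC.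
Qed.

(** The product of the boosts at the endpoints of an edge telescopes into the
    product of the two local times. *)
Lemma env_edge w x n i j : (forall k, (k <= n)%N -> skeleton y k = Some (x k)) ->
  i <> j -> env w x (hold y) n [set i; j] = w [set i; j] * occ y i n * occ y j n.
Proof.
move=> + ij; elim: n => [|n IH] sk /=; first by rewrite !occ0 !mulr1.
have sn := sk n (leqnSn n); have sn1 := sk n.+1 (leqnn _).
have hn := IH (fun k kn => sk k (leqW kn)).
have E := expR_hold sn sn1.
have o0 v : occ y v n != 0 by rewrite gt_eqF// occ_gt0.
rewrite /boost hn; case: asboolP => [[/= xi|/= xj]|nx].
- rewrite E xi (occS j sn sn1) xi; have -> : (i == j) = false by apply/eqP.
  by rewrite addr0; field; exact: o0.
- rewrite E xj (occS i sn sn1) xj; have -> : (j == i) = false by apply/eqP => /esym.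
  by rewrite addr0; field; exact: o0.
- rewrite (occS i sn sn1) (occS j sn sn1).
  have -> : (x n == i) = false by apply/eqP => xi; apply: nx; left.
  have -> : (x n == j) = false by apply/eqP => xj; apply: nx; right.
  by rewrite !addr0.
Qed.

End one_path.

Section measurability.
Context d (T : measurableType d).
Variables (i0 : V) (Y : T -> R -> option V) (r : R).
Hypothesis YP : forall om, jump_path i0 (Y om).
Hypothesis mY : forall u v, 0 <= u -> u <= r -> measurable [set om | Y om u = v].
Variables (w : set V -> R) (x : nat -> V) (n : nat).
Let E := [set om | reached n x r (Y om)].

Let mE : measurable E. Proof. exact: measurable_reached YP mY _ _ _ (lexx r). Qed.

Let sk om k : E om -> (k <= n)%N -> skeleton (Y om) k = Some (x k).
Proof. by move=> [sk _]; exact: sk. Qed.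

Lemma measurable_occ v k : (k <= n)%N -> measurable_fun E (fun om => occ (Y om) v k).
Proof.
elim: k => [|k IH] kn.
  apply: (eq_measurable_fun (cst 1 : T -> R)); last exact: measurable_cst.
  by move=> om _; rewrite occ0.
apply: (eq_measurable_fun (fun om => occ (Y om) v k +
    (if x k == v then jump_date (Y om) k.+1 - jump_date (Y om) k else 0))).
  by move=> om; rewrite inE => Eom; rewrite (occS (YP om) v (sk Eom (ltnW kn)) (sk Eom kn)).
apply: measurable_funD; first exact/IH/ltnW.
case: (x k == v); last exact: measurable_cst.
by apply: measurable_funB; apply: (measurable_jump_date YP mY) => //; exact: ltnW.
Qed.

Lemma measurable_hold k : (k < n)%N -> measurable_fun E (fun om => hold (Y om) k).
Proof.
move=> kn; apply: (eq_measurable_fun (fun om =>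
    ln (occ (Y om) (x k) k.+1) - ln (occ (Y om) (x k) k))).
  move=> om; rewrite inE => Eom.
  rewrite -ln_div ?posrE ?occ_gt0//.
  by rewrite -(expR_hold (YP om) (sk Eom (ltnW kn)) (sk Eom kn)) expRK.
apply: measurable_funB; apply: (measurableT_comp (@measurable_ln R));
  [exact: measurable_occ|exact/measurable_occ/ltnW].
Qed.

Lemma measurable_env e : measurable_fun E (fun om => env w x (hold (Y om)) n e).
Proof.
have : (n <= n)%N by []; elim: {1 3}n => [|k IH] kn /=; first exact: measurable_cst.
rewrite /boost; case: `[< e (x k) >]; last exact/IH/ltnW.
apply: measurable_funM; first exact/IH/ltnW.
by apply: (measurableT_comp (@measurable_expR R)); exact: measurable_hold.
Qed.

Lemma measurable_env_fam : measurable_fun E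
  ((fun om => env w x (hold (Y om)) n) : T -> fam_space (R := R) (edges adj)).
Proof. by apply: measurable_to_fam => e _; exact: measurable_env. Qed.

End measurability.

End environment.

(** * Approximation of times by grid points *)

Section grid.
Context {R : realType}.

(** The first point of the grid of mesh [1 / (m + 1)] strictly above [u]. *)
Definition cell (m : nat) (u : R) : nat := Num.truncn (u * m.+1%:R).
Definition grid_pt (m k : nat) : R := k.+1%:R / m.+1%:R.
Definition next_grid (m : nat) (u : R) : R := grid_pt m (cell m u).

Lemma next_grid_gt m u : u < next_grid m u.
Proof. by rewrite /next_grid /grid_pt ltr_pdivlMr// truncnS_gt. Qed.

Lemma next_grid_le m u : 0 <= u -> next_grid m u <= u + m.+1%:R^-1.
Proof.
move=> u0; rewrite /next_grid /grid_pt ler_pdivrMr// mulrDl mulVf// -natr1 lerD2r.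
by rewrite truncn_le mulr_ge0.
Qed.

Lemma cvg_next_grid u : 0 <= u -> next_grid m u @[m --> \oo] --> u.
Proof.
move=> u0; apply: (@squeeze_cvgr _ _ _ _ (fun=> u) (fun m => u + m.+1%:R^-1)).
- apply: nearW => m; rewrite next_grid_le// andbT.
  exact/ltW/next_grid_gt.
- exact: cvg_cst.
- rewrite -[X in _ --> X]addr0; apply: cvgD; first exact: cvg_cst.
  exact: cvg_harmonic.
Qed.

Lemma measurable_cell m : measurable_fun setT (fun u : R => (cell m u)%:R : R).
Proof.
apply: nondecreasing_measurable => // s t st.
by rewrite ler_nat /cell le_truncn// ler_wpM2r.
Qed.

End grid.

Section partition.
Context d (T : measurableType d) (R : realType).

(** An identity between a probability and an integral may be checked on the
    cells of a countable partition. *)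
Lemma measure_partition (P : {measure set T -> \bar R}) (E D : set T) (N : T -> nat)
    (g : T -> \bar R) :
  measurable E -> measurable D -> (forall c, measurable (E `&` [set w | N w = c])) ->
  (forall c, measurable (D `&` [set w | N w = c])) ->
  measurable_fun D g -> (forall w, D w -> 0 <= g w)%E ->
  (forall c, P (E `&` [set w | N w = c]) = \int[P]_(w in D `&` [set w | N w = c]) g w)%E ->
  (P E = \int[P]_(w in D) g w)%E.
Proof.
move=> mE mD mEc mDc mg g0 h.
have cov (A : set T) : A = \bigcup_c (A `&` [set w | N w = c]).
  by apply/seteqP; split => [w Aw|w [c _ []//]]; exists (N w).
have triv (A : set T) : trivIset setT (fun c => A `&` [set w | N w = c]).
  by move=> i j _ _ [w [[_ <-] [_ <-]]].
rewrite [in LHS](cov E) [in RHS](cov D) measure_semi_bigcup//; last first.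
  exact: bigcup_measurable.
rewrite ge0_integral_bigcup//.
- by apply: eq_eseriesr => c _; exact: h.
- by rewrite -cov.
- by move=> w; rewrite -cov; exact: g0.
Qed.

End partition.

(** * The law of the next holding time of the VRJP *)

Section vrjp.
Context {R : realType} {V : choiceType}.
Variable adj : rel V.
Hypotheses (adj_sym : symmetric adj) (adj_irr : irreflexive adj).
Hypothesis adj_lf : locally_finite_graph adj.
Notation mu := (@lebesgue_measure R).
Notation WS := (fam_space (R := R) (edges adj)).
Variables (i0 : V) (w : set V -> R).
Hypothesis w_gt0 : positive_weights adj w.
Context d (T : measurableType d) (P : probability T R) (Y : T -> R -> option V).
Hypothesis YV : is_vrjp adj i0 w P Y.

Let YP om : jump_path i0 (Y om). Proof. by case: YV. Qed.

Let mY t v : 0 <= t -> measurable [set om | Y om t = v].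
Proof. by case: YV => mY _ _; exact: mY. Qed.

Definition visits (x : nat -> V) n : set T :=
  [set om | forall k, (k <= n)%N -> skeleton (Y om) k = Some (x k)].

Let visitsE x n : visits x n = \bigcup_r [set om | reached n x r%:R (Y om)].
Proof.
apply/seteqP; split => om; last by move=> [r _ []].
move=> sk; exists (Num.truncn (jump_date (Y om) n)).+1 => //; split => //.
by rewrite ltW// truncnS_gt.
Qed.

Let mreached x n (r : R) : measurable [set om | reached n x r (Y om)].
Proof. by apply: (measurable_reached YP (r := r)) => // u v u0 _; exact: mY. Qed.

Lemma measurable_visits x n : measurable (visits x n).
Proof. by rewrite visitsE; apply: bigcup_measurable => r _; exact: mreached. Qed.

Let on_visits x n d' (S : measurableType d') (f : T -> S) :
  (forall r : nat, measurable_fun [set om | reached n x r%:R (Y om)] f) ->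
  measurable_fun (visits x n) f.
Proof.
by move=> mf; rewrite visitsE; apply/measurable_fun_bigcup => // r; exact: mreached.
Qed.

Let mjt x n k : (k <= n)%N -> measurable_fun (visits x n) (fun om => jump_date (Y om) k).
Proof.
by move=> kn; apply: on_visits => r; apply: (measurable_jump_date YP (r := r%:R)) => // u v u0 _; exact: mY.
Qed.

Let mocc x n v : measurable_fun (visits x n) (fun om => occ (Y om) v n).
Proof.
by apply: on_visits => r; apply: (measurable_occ YP (r := r%:R)) => // u v' u0 _; exact: mY.
Qed.

Lemma measurable_hold_visits x n k : (k < n)%N ->
  measurable_fun (visits x n) (fun om => hold (Y om) k).
Proof.
by move=> kn; apply: on_visits => r; apply: (measurable_hold YP (r := r%:R)) => // u v' u0 _; exact: mY.
Qed.

Definition env_at x n (om : T) : WS := env w x (hold (Y om)) n.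

Lemma measurable_env_visits x n : measurable_fun (visits x n) (env_at x n).
Proof.
by apply: on_visits => r; apply: (measurable_env_fam YP (r := r%:R)) => // u v' u0 _; exact: mY.
Qed.

Variables (x : nat -> V) (n : nat) (A : nat -> set R) (B : set WS).
Hypotheses (mA : forall k, measurable (A k)) (mB : measurable B).
Hypothesis xadj : adj (x n) (x n.+1).
Let j := x n.+1.
Let i := x n.

Let tev : set T := visits x n `&`
  [set om | (forall k, (k < n)%N -> A k (hold (Y om) k)) /\ B (env_at x n om)].

Variable c : R.
Hypothesis c0 : 0 <= c.

(* the holding time in the original time scale that corresponds to [c] *)
Let theta om : R := occ (Y om) i n * (expR c - 1).

Let theta_ge0 om : 0 <= theta om.
Proof.
apply: mulr_ge0; first exact/ltW/occ_gt0.
by rewrite subr_ge0 -{1}(@expR0 R) ler_expR.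
Qed.

(* generic measurability of the event, in the whole space or in the past *)
Let mtev_gen d' (T' : measurableType d') (Y' : T' -> R -> option V) (r : R) (a b : nat) (m : nat) :
  (forall om, jump_path i0 (Y' om)) ->
  (forall u v, 0 <= u -> u <= r -> measurable [set om | Y' om u = v]) ->
  measurable [set om | [/\ reached n x r (Y' om),
     (forall k, (k < n)%N -> A k (hold (Y' om) k)) /\ B (env w x (hold (Y' om)) n),
     cell m (jump_date (Y' om) n) = a & cell m (occ (Y' om) i n * (expR c - 1)) = b]].
Proof.
move=> YP' mY'; pose E := [set om | reached n x r (Y' om)].
have mE : measurable E by exact: (measurable_reached YP' mY' _ _ (lexx r)).
have pre (f : T' -> R) (C : set R) : measurable_fun E f -> measurable C ->
  measurable (E `&` f @^-1` C) by move=> mf mC; exact: mf.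
have meq (f : T' -> R) (k : nat) : measurable_fun E f ->
    measurable (E `&` [set om | cell m (f om) = k]).
  move=> mf; rewrite (_ : E `&` _ = E `&` (fun om => (cell m (f om))%:R : R) @^-1` [set k%:R]).
    by apply: pre; [exact: (measurableT_comp (measurable_cell m) mf)|exact: measurable_set1].
  apply/seteqP; split => om [Eom] /=; first by move=> ->.
  by move/eqP; rewrite eqr_nat => /eqP.
rewrite (_ : [set _ | _] = (E `&` \bigcap_k (E `&` [set om | (k < n)%N -> A k (hold (Y' om) k)]) `&`
   (E `&` (fun om => env w x (hold (Y' om)) n : WS) @^-1` B)) `&`
   ((E `&` [set om | cell m (jump_date (Y' om) n) = a]) `&`
    (E `&` [set om | cell m (occ (Y' om) i n * (expR c - 1)) = b]))); last first.
  apply/seteqP; split => om /=.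
    by move=> [Eom [hA hB] ha hb]; split; split => //; split => // k _; split => //; exact: hA.
  move=> [[[Eom hA] [_ hB]] [[_ ha] [_ hb]]]; split => //; split => // k.
  by case: (hA k I).
apply: measurableI; first apply: measurableI; first apply: measurableI => //.
- apply: bigcapT_measurable => k; case: (ltnP k n) => kn.
    rewrite (_ : E `&` _ = E `&` (fun om => hold (Y' om) k) @^-1` A k).
      by apply: pre => //; exact: (measurable_hold YP' mY').
    by apply/seteqP; split => om [Eom] h; split => //; exact: h.
  by rewrite (_ : E `&` _ = E)//; apply/seteqP; split => om; [case|].
- exact: (measurable_env_fam YP' mY' w mE mB).
- apply: measurableI; first by apply: meq; exact: (measurable_jump_date YP' mY').
  apply: meq; apply: measurable_funM; last exact: measurable_cst.
  exact: (measurable_occ YP' mY').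
Qed.

Let on_exact m om := exact_jumps n x (next_grid m (jump_date (Y om) n)) (Y om).

Let Z om : R := env_at x n om [set i; j].
Let W om : R := tot adj i (env_at x n om).

Let ij : i <> j. Proof. exact: (adj_neq adj_irr). Qed.

Let env_rate om : visits x n om ->
  Z om = w [set i; j] * occ (Y om) i n * occ (Y om) j n /\
  W om = occ (Y om) i n * \sum_(k <- nbrs adj i) w [set i; k] * occ (Y om) k n.
Proof.
move=> vis; split; first exact: env_edge.
rewrite /W /tot /star big_map big_seq mulr_sumr [RHS]big_seq; apply: eq_bigr => k.
rewrite mem_nbrs// => ik; rewrite /env_at (env_edge (YP om))//; last exact: (adj_neq adj_irr).
rewrite gtr0_norm; first by rewrite mulrCA !mulrA [w _ * _]mulrC.
by rewrite !mulr_gt0 ?occ_gt0// w_gt0//; exact: edge_edges.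
Qed.

Lemma next_edge_gt0 om : visits x n om -> 0 < Z om.
Proof.
move=> /env_rate[-> _]; rewrite !mulr_gt0 ?occ_gt0//.
by apply: w_gt0; exact: edge_edges.
Qed.

Lemma next_tot_gt0 om : visits x n om -> 0 < W om.
Proof.
move=> vis; apply: (lt_le_trans (next_edge_gt0 vis)); rewrite /W /tot.
rewrite (bigD1_seq [set i; j]) ?uniq_star//=; last exact: mem_star.
by rewrite -/(Z om) gtr0_norm ?next_edge_gt0// lerDl sumr_ge0.
Qed.

(* the conditional probability of a jump to [j] within [h] *)
Let gj (h : R) om : R := Z om / W om * (1 - expR (- (W om / occ (Y om) i n * h))).

Let gj01 h om : 0 <= h -> visits x n om -> 0 <= gj h om <= 1.
Proof.
move=> h0 vis; have Z0 := next_edge_gt0 vis; have W0 := next_tot_gt0 vis.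
have o0 := occ_gt0 (Y om) i n.
have e1 : expR (- (W om / occ (Y om) i n * h)) <= 1.
  by rewrite -expR0 ler_expR oppr_le0 mulr_ge0// divr_ge0// ltW.
have ZW : Z om <= W om.
  rewrite /W /tot (bigD1_seq [set i; j]) ?uniq_star//=; last exact: mem_star.
  by rewrite -/(Z om) gtr0_norm// lerDl sumr_ge0.
apply/andP; split.
  by rewrite mulr_ge0 ?divr_ge0 ?subr_ge0// ltW.
apply: mulr_ile1.
- by rewrite divr_ge0// ltW.
- by rewrite subr_ge0.
- by rewrite ler_pdivrMr ?mul1r.
- by rewrite gerBl expR_ge0.
Qed.

Let Dm m := tev `&` [set om | on_exact m om].
Let Em m := Dm m `&` [set om | skeleton (Y om) n.+1 = Some j /\
   jump_date (Y om) n.+1 <= next_grid m (jump_date (Y om) n) + next_grid m (theta om)].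
Let code m om : nat := pickle (cell m (jump_date (Y om) n), cell m (theta om)).

Let cellset m a b := [set om | [/\ exact_jumps n x (grid_pt m a) (Y om),
     (forall k, (k < n)%N -> A k (hold (Y om) k)) /\ B (env_at x n om),
     cell m (jump_date (Y om) n) = a & cell m (theta om) = b]].

Let past_cellset m a b : past Y (grid_pt m a) (cellset m a b).
Proof.
have s0 : 0 <= grid_pt m a :> R by rewrite divr_ge0.
pose G := [set F : set T | exists u v, [/\ 0 <= u, u <= grid_pt m a & F = [set w | Y w u = v]]].
pose T' : measurableType _ := g_sigma_algebraType G.
have mY' u v : 0 <= u -> u <= grid_pt m a -> measurable ([set om | Y om u = v] : set T').
  by move=> u0 us; apply: sub_sigma_algebra; exists u, v.
have h := @mtev_gen _ T' Y (grid_pt m a) a b m YP mY'.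
have h' := @measurable_exact_jumps _ _ _ T' i0 Y (grid_pt m a) YP mY' n x _ s0 (lexx _).
have := measurableI _ _ h h'; rewrite (_ : _ `&` _ = cellset m a b)//.
apply/seteqP; split => om /=; first by move=> [[? ? ? ?] ?].
by move=> [ex ? ? ?]; split => //; split => //; case: ex.
Qed.

Let mcellset m a b : measurable (cellset m a b).
Proof.
have s0 : 0 <= grid_pt m a :> R by rewrite divr_ge0.
have mYs u v : 0 <= u -> u <= grid_pt m a -> measurable [set om | Y om u = v].
  by move=> u0 _; exact: mY.
have := measurableI _ _ (@mtev_gen _ T Y (grid_pt m a) a b m YP mYs)
  (measurable_exact_jumps YP mYs n x s0 (lexx _)).
rewrite (_ : _ `&` _ = cellset m a b)//.
apply/seteqP; split => om /=; first by move=> [[? ? ? ?] ?].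
by move=> [ex ? ? ?]; split => //; split => //; case: ex.
Qed.

Let Dm_code m cd : Dm m `&` [set om | code m om = cd] =
  if unpickle cd is Some (a, b) then if pickle (a, b) == cd then cellset m a b else set0 else set0.
Proof.
apply/seteqP; split => om.
  move=> [[[vis [hA hB]] ex] <-]; rewrite /code pickleK eqxx; split => //.
case E : (unpickle cd) => [[a b]|//]; case: eqP => // <- [ex [hA hB] ha hb].
split; last by rewrite /= /code /theta ha hb.
split; last by rewrite /= /on_exact /next_grid ha.
by split => //; case: ex.
Qed.

Let mDm m : measurable (Dm m).
Proof.
rewrite (_ : Dm m = \bigcup_cd (Dm m `&` [set om | code m om = cd])); last first.
  by apply/seteqP; split => [om Dom|om [cd _ []//]]; exists (code m om).
apply: bigcup_measurable => cd _; rewrite Dm_code.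
by case: (unpickle cd) => [[a b]|//]; case: ifP.
Qed.

Let mEm m : measurable (Em m).
Proof.
have -> : Em m = Dm m `&` (visits x n.+1 `&` (fun om => next_grid m (jump_date (Y om) n) +
   next_grid m (theta om) - jump_date (Y om) n.+1) @^-1` `[0, +oo[).
  apply/seteqP; split => om.
    move=> [Dom [sj le]]; split => //; split.
      by move=> k; rewrite leq_eqVlt => /predU1P[->//|]; case: Dom => -[vis _] _; exact: vis.
    by rewrite /= in_itv/= andbT subr_ge0.
  move=> [Dom [vis]]; rewrite /= in_itv/= andbT subr_ge0 => le; split => //; split => //.
  by rewrite (vis n.+1).
apply: measurableI => //.
have mg (f : T -> R) : measurable_fun (visits x n.+1) f -> measurable_fun (visits x n.+1) (fun om => next_grid m (f om)).
  move=> mf; rewrite /next_grid /grid_pt; apply: measurable_funM; last exact: measurable_cst.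
  under eq_fun do rewrite -natr1.
  apply: measurable_funD; last exact: measurable_cst.
  exact: (measurableT_comp (measurable_cell m) mf).
have mv := measurable_visits x n.+1.
have sub : visits x n.+1 `<=` visits x n by move=> om vis k kn; apply: vis; exact: leqW.
have mth : measurable_fun (visits x n.+1) theta.
  apply: measurable_funM; last exact: measurable_cst.
  by apply: (measurable_funS (measurable_visits x n) sub); exact: mocc.
have h : measurable_fun (visits x n.+1) (fun om => next_grid m (jump_date (Y om) n) +
   next_grid m (theta om) - jump_date (Y om) n.+1).
  apply: measurable_funB; last exact: mjt.
  by apply: measurable_funD; apply: mg => //; exact: mjt.
by apply: h => //; exact: measurable_itv.
Qed.

Let mgj (h : T -> R) : measurable_fun (visits x n) h ->
  measurable_fun (visits x n) (fun om => gj (h om) om).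
Proof.
move=> mh; have me := @measurable_env_visits x n.
have mZ : measurable_fun (visits x n) Z.
  exact: (measurableT_comp (measurable_coord (edge_edges xadj)) me).
have mW : measurable_fun (visits x n) W.
  exact: (measurableT_comp (@measurable_tot _ _ _ adj_lf i) me).
have inv (f : T -> R) : measurable_fun (visits x n) f -> (forall om, visits x n om -> 0 < f om) ->
    measurable_fun (visits x n) (fun om => (f om)^-1).
  move=> mf f0; apply: (eq_measurable_fun (fun om => expR (- ln (f om)))).
    by move=> om; rewrite inE => vis; rewrite expRN lnK// posrE f0.
  apply: (measurableT_comp (@measurable_expR R)); apply: measurable_funN.
  exact: (measurableT_comp (@measurable_ln R) mf).
apply: measurable_funM.
  by apply: measurable_funM => //; apply: inv => // om; exact: next_tot_gt0.
apply: measurable_funB; first exact: measurable_cst.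
apply: (measurableT_comp (@measurable_expR R)); apply: measurable_funN.
apply: measurable_funM => //; apply: measurable_funM => //.
by apply: inv => // om _; exact: occ_gt0.
Qed.

Let rateE om s : visits x n om -> jump_date (Y om) n <= s ->
  skeleton (Y om) n.+1 = None \/ s < jump_date (Y om) n.+1 ->
  vrjp_rate adj w (Y om) s i j = w [set i; j] * occ (Y om) j n /\
  vrjp_total_rate adj w (Y om) s i = W om / occ (Y om) i n.
Proof.
move=> vis ns nx.
have r k : adj i k -> vrjp_rate adj w (Y om) s i k = w [set i; k] * occ (Y om) k n.
  move=> ik; rewrite /vrjp_rate ik /occ /vrjp_local_time.
  rewrite (local_time_const (j := i) (YP om) k (jump_date_ge0 _ n) ns).
    by have /eqP/negbTE -> := adj_neq adj_irr ik; rewrite addr0.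
  move=> u nu us; apply: (const_between (YP om) (vis n (leqnn _)) nu).
  by case: nx => nx; [left|right; exact: lt_trans nx].
split; first exact: r.
rewrite /vrjp_total_rate (fsbig_finite _ _ (adj_lf i))/=.
have [_ ->] := env_rate vis; rewrite mulrAC divff ?mul1r; last by rewrite gt_eqF// occ_gt0.
rewrite -/(nbrs adj i) big_seq [RHS]big_seq; apply: eq_bigr => k.
by rewrite mem_nbrs//; exact: r.
Qed.

Let jump_iff om s : visits x n om -> jump_date (Y om) n <= s ->
  skeleton (Y om) n.+1 = None \/ s < jump_date (Y om) n.+1 ->
  forall t, (first_jump (Y om) s t /\ Y om t = Some j) <->
  (skeleton (Y om) n.+1 = Some j /\ jump_date (Y om) n.+1 = t).
Proof.
move=> vis ns nx t; have sn := vis n (leqnn _); have [jn yn] := skeleton_jump sn.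
have cst u : jump_date (Y om) n <= u -> u <= s -> Y om u = Some i.
  move=> nu us; apply: (const_between (YP om) sn nu).
  by case: nx => nx; [left|right; exact: le_lt_trans nx].
have ys := cst s ns (lexx _); split.
  move=> [[st c' ne] yt].
  have jt1 : jump_time (Y om) n.+1 t.
    exists (jump_date (Y om) n) => //; split; first exact: le_lt_trans st.
      move=> u nu ut; rewrite yn; have [us|us] := leP u s; first exact: cst.
      by rewrite c'// ltW.
    by rewrite yn -ys.
  by rewrite (skeletonE jt1) (jump_dateE jt1).
move=> [sk <-]; have [lt c' ne] := skeleton_first_jump sk; have [_ yj] := skeleton_jump sk.
split => //; split.
- by case: nx => //; rewrite sk.
- by move=> u su un; rewrite ys c'// ?yn// (le_trans ns).
- by rewrite ys -yn.
Qed.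

Let piece m a b : (P (cellset m a b `&` [set om | skeleton (Y om) n.+1 = Some j /\
    (jump_date (Y om) n.+1 <= grid_pt m a + grid_pt m b)%R]) =
  \int[P]_(om in cellset m a b) (gj (grid_pt m b) om)%:E)%E.
Proof.
have g0 k : 0 <= grid_pt m k :> R by rewrite divr_ge0.
have cur : cellset m a b `&` [set om | Y om (grid_pt m a) = Some i] = cellset m a b.
  apply/seteqP; split => [om []//|om cs]; split => //.
  by case: cs => + _ _ _; exact: exact_jumps_cur.
have [_ _ /(_ _ _ _ i j (g0 a) (g0 b) (@past_cellset m a b))] := YV; rewrite cur => E.
transitivity (P (cellset m a b `&` [set om | exists t, [/\ (t <= grid_pt m a + grid_pt m b)%R,
    first_jump (Y om) (grid_pt m a) t & Y om t = Some j]])).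
  congr (P _); apply/seteqP; split => om [cs].
    move=> [sk le]; split => //; exists (jump_date (Y om) n.+1).
    case: (cs) => -[vis ns nx] _ _ _.
    by have [fj yj] := (jump_iff vis ns nx (jump_date (Y om) n.+1)).2 (conj sk erefl).
  move=> [t [le fj yj]]; split => //; case: (cs) => -[vis ns nx] _ _ _.
  by have [sk jtt] := (jump_iff vis ns nx t).1 (conj fj yj); split; rewrite ?jtt.
rewrite E; apply: eq_integral => om; rewrite inE => -[[vis ns nx] _ _ _].
have [-> ->] := rateE vis ns nx; rewrite /gj; congr ((_ * _)%:E).
have [-> _] := env_rate vis; have W0 := next_tot_gt0 vis; have o0 := occ_gt0 (Y om) i n.
by field; rewrite !gt_eqF.
Qed.

Let cell_sum m : (P (Em m) = \int[P]_(om in Dm m) (gj (next_grid m (theta om)) om)%:E)%E.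
Proof.
have sub : Dm m `<=` visits x n by move=> om [[]].
have mth : measurable_fun (visits x n) theta.
  by apply: measurable_funM; [exact: mocc|exact: measurable_cst].
have mng : measurable_fun (visits x n) (fun om => next_grid m (theta om)).
  rewrite /next_grid /grid_pt; apply: measurable_funM; last exact: measurable_cst.
  under eq_fun do rewrite -natr1.
  apply: measurable_funD; last exact: measurable_cst.
  exact: (measurableT_comp (measurable_cell m) mth).
have EDc cd : Em m `&` [set om | code m om = cd] =
    (Dm m `&` [set om | code m om = cd]) `&` Em m.
  by apply/seteqP; split => om; [move=> [[Dom sk] cde]|move=> [[Dom cde] [_ sk]]].
have mDc cd : measurable (Dm m `&` [set om | code m om = cd]).
  rewrite Dm_code; case: (unpickle cd) => [[a b]|//]; by case: ifP.
apply: (measure_partition (N := code m)) => //.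
- by move=> cd; rewrite EDc; exact: measurableI.
- apply/measurable_EFinP; apply: (measurable_funS (measurable_visits x n) sub).
  exact: mgj.
- move=> om /sub vis; rewrite lee_fin.
  have h0 : 0 <= next_grid m (theta om).
    by apply: ltW; apply: le_lt_trans (next_grid_gt m _); exact: theta_ge0.
  by case/andP: (gj01 h0 vis).
move=> cd; rewrite EDc; rewrite Dm_code.
case: (unpickle cd) => [[a b]|]; last by rewrite set0I measure0 integral_set0.
case: (_ == _); last by rewrite set0I measure0 integral_set0.
rewrite (_ : cellset m a b `&` Em m = cellset m a b `&` [set om | skeleton (Y om) n.+1 = Some j /\
    jump_date (Y om) n.+1 <= grid_pt m a + grid_pt m b]); last first.
  apply/seteqP; split => om [cs]; case: (cs) => ex [hA hB] ha hb.
    by move=> [_]; rewrite /= /next_grid ha hb.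
  move=> h; split => //; split; last by rewrite /= /next_grid ha hb.
  split; first by split => //; case: ex.
  by rewrite /= /on_exact /next_grid ha.
apply: (etrans (piece m a b)); apply: eq_integral => om; rewrite inE => -[_ _ _ hb].
by rewrite /next_grid hb.
Qed.

Let on_exact_near om : visits x n om -> \forall m \near \oo, on_exact m om.
Proof.
move=> vis; case E : (skeleton (Y om) n.+1) => [v|]; last first.
  by exists 0%N => // m _; split => //; [exact/ltW/next_grid_gt|left].
have [lt _ _] := skeleton_first_jump E.
have [N _ h] := cvgr_lt _ (cvg_next_grid (jump_date_ge0 (Y om) n)) _ lt.
by exists N => // m /h lm; split => //; [exact/ltW/next_grid_gt|right].
Qed.

Let mtev : measurable tev.
Proof.
have -> : tev = \bigcup_m (Dm m).
  apply/seteqP; split => om; last by move=> [m _ []].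
  move=> tom; have [N _ /(_ N (leqnn N)) h] := on_exact_near tom.1.
  by exists N => //; split.
by apply: bigcup_measurable => m _; exact: mDm.
Qed.

(** The conditional law of the next holding time, on the time scale of the time
    change, and of the next vertex: the event
    that the next jump occurs before [theta] is approximated by grid times, at
    which the defining property of the process applies. *)
Lemma hold_ray :
  (P (tev `&` [set om | skeleton (Y om) n.+1 = Some j /\ (hold (Y om) n <= c)%R]) =
   \int[P]_(om in tev) (Z om / W om * (1 - expR (- (W om * (expR c - 1)))))%:E)%E.
Proof.
pose G : set T := tev `&` [set om | skeleton (Y om) n.+1 = Some j /\ (hold (Y om) n <= c)%R].
have mG : measurable G.
  have -> : G = tev `&` (visits x n.+1 `&` (fun om => hold (Y om) n) @^-1` `]-oo, c]).
    apply/seteqP; split => om; move=> [tom]; rewrite /= in_itv/=.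
      move=> [sk h]; split => //; split => // k; rewrite leq_eqVlt => /predU1P[->//|].
      by case: tom => + _; exact.
    by move=> [vis h]; split => //; split => //; exact: vis.
  apply: measurableI; first exact: mtev.
  by apply: (measurable_hold_visits (ltnSn n)) => //; exact: measurable_visits.
have sub : tev `<=` visits x n by move=> om [].
have mth : measurable_fun (visits x n) theta.
  by apply: measurable_funM; [exact: mocc|exact: measurable_cst].
have ic : P.-integrable tev (cst 1%E : T -> \bar R).
  by apply/integrableP; split => //; rewrite (eq_integral (cst 1%E)) ?integral_cst//=;
    rewrite ?mul1e ?(le_lt_trans (probability_le1 _ mtev)) ?ltry// => om _; rewrite normr1.
have mEin (f : set T) : measurable f -> measurable_fun tev (fun om => (\1_f om : R)%:E).
  by move=> mf; apply/measurable_EFinP; apply: measurable_funTS; exact: measurable_indic.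
have subE m : Em m `<=` tev by move=> om [[]].
have L1 : (fun m => P (Em m)) @ \oo --> P G.
  rewrite (_ : (fun m => P (Em m)) = (fun m => (\int[P]_(om in tev) (\1_(Em m) om : R)%:E)%E)); last first.
    by apply/funext => m; rewrite integral_indic//; congr (P _); rewrite setIidl.
  rewrite (_ : P G = (\int[P]_(om in tev) (\1_G om : R)%:E)%E); last first.
    by rewrite integral_indic//; congr (P _); rewrite setIidl// => om [].
  apply: (@dominated_cvg _ _ _ P tev mtev _ _ (cst 1%E)) => //.
  - by move=> m; apply: mEin; exact: mEm.
  - move=> om tom; have vis := tom.1; apply: cvg_near_cst.
    case: (pselect (skeleton (Y om) n.+1 = Some j)) => sk; last first.
      apply: nearW => m; rewrite !indicE; congr (_%:R%:E); congr nat_of_bool.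
      by apply/idP/idP; rewrite !inE => -[_ []].
    have hl := hold_le (YP om) c (vis n (leqnn n)) sk.
    case: (leP (hold (Y om) n) c) => hc.
      have {}hl : jump_date (Y om) n.+1 - jump_date (Y om) n <= theta om by rewrite -hl.
      have [N _ h] := on_exact_near vis; exists N => // m /h ex; rewrite !indicE !mem_set//.
      split => //; split => //; rewrite -lerBlDl.
      rewrite -(subrK (jump_date (Y om) n) (jump_date (Y om) n.+1)).
      have g1 := next_grid_gt m (jump_date (Y om) n); have g2 := next_grid_gt m (theta om).
      lra.
    have {}hl : theta om < jump_date (Y om) n.+1 - jump_date (Y om) n by rewrite ltNge -hl -ltNge.
    have lim : next_grid m (jump_date (Y om) n) + next_grid m (theta om) @[m --> \oo] -->
        jump_date (Y om) n + theta om.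
      by apply: cvgD; apply: cvg_next_grid; [exact: jump_date_ge0|exact: theta_ge0].
    have lt : jump_date (Y om) n + theta om < jump_date (Y om) n.+1 by lra.
    have [N _ h] := cvgr_lt _ lim _ lt; exists N => // m /h lm; rewrite !indicE.
    rewrite !memNset//; first by move=> [_ []]; rewrite leNgt hc.
    by move=> [_ []]; rewrite leNgt lm.
  - by move=> m om _; rewrite gee0_abs ?lee_fin indicE ?ler0n// lern1 leq_b1.
have L2 : (fun m => P (Em m)) @ \oo --> (\int[P]_(om in tev) (gj (theta om) om)%:E)%E.
  pose f m om : R := \1_(Dm m) om * gj (next_grid m (theta om)) om.
  have mng m : measurable_fun (visits x n) (fun om => next_grid m (theta om)).
    rewrite /next_grid /grid_pt; apply: measurable_funM; last exact: measurable_cst.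
    under eq_fun do rewrite -natr1.
    apply: measurable_funD; last exact: measurable_cst.
    exact: (measurableT_comp (measurable_cell m) mth).
  have mgt m : measurable_fun tev (fun om => gj (next_grid m (theta om)) om).
    by apply: (measurable_funS (@measurable_visits x n) sub); exact: mgj.
  have ng0 m om : 0 <= next_grid m (theta om).
    by apply: ltW; apply: le_lt_trans (next_grid_gt m _); exact: theta_ge0.
  rewrite (_ : (fun m => P (Em m)) = (fun m => (\int[P]_(om in tev) (f m om)%:E)%E)); last first.
    apply/funext => m; rewrite cell_sum.
    rewrite -(setIidr (_ : Dm m `<=` tev)); last by move=> om [].
    rewrite integral_mkcondr; apply: eq_integral => om _; rewrite patchE /f indicE; case: (om \in Dm m); by rewrite ?mul1r ?mul0r.
  apply: (@dominated_cvg _ _ _ P tev mtev _ _ (cst 1%E)) => //.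
  - move=> m; apply/measurable_EFinP; apply: measurable_funM; last exact: mgt.
    by apply: measurable_funTS; apply: measurable_indic; exact: mDm.
  - move=> om tom; have vis := tom.1; apply: cvg_EFin; first by apply: nearW.
    apply: (@cvg_trans _ (gj (next_grid m (theta om)) om @[m --> \oo])).
      apply: near_eq_cvg; have [N _ h] := on_exact_near vis; exists N => // m /h ex.
      by rewrite /= /f indicE mem_set ?mul1r.
    rewrite /gj; apply: cvgMr; apply: cvgB; first exact: cvg_cst.
    apply: (@continuous_cvg _ _ _ _ _ _ expR); first exact: continuous_expR.
    apply: cvgN; apply: cvgMr; apply: cvg_next_grid; exact: theta_ge0.
  - move=> m om tom; have /andP[g0 g1] := gj01 (ng0 m om) tom.1.
    have i0' : 0 <= (\1_(Dm m) om : R) by rewrite indicE ler0n.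
    rewrite gee0_abs ?lee_fin; last exact: mulr_ge0.
    by apply: mulr_ile1 => //; by rewrite indicE lern1 leq_b1.
transitivity (\int[P]_(om in tev) (gj (theta om) om)%:E)%E.
  by rewrite -(cvg_lim (@ereal_hausdorff R) L1) -(cvg_lim (@ereal_hausdorff R) L2).
apply: eq_integral => om _; rewrite /gj /theta mulrA divfK//.
by rewrite gt_eqF// occ_gt0.
Qed.

End vrjp.

(** * From rays to densities *)

Section rays.
Context d (T : measurableType d) d2 (S : measurableType d2) (R : realType).
Notation mu := (@lebesgue_measure R).
Notation RR := (measurableTypeR R).
Variables (P : probability T R) (E E' : set T) (Z : T -> S) (H : T -> R) (dens : S * R -> R).
Hypotheses (mE : measurable E) (mE' : measurable E').
Hypotheses (mZ : measurable_fun setT Z) (mH : measurable_fun setT H).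
Hypotheses (mdn : measurable_fun setT dens) (dn0 : forall p, 0 <= dens p).
Hypothesis H0 : forall om, E' om -> 0 < H om.
Hypothesis ray : forall (B : set S) (c : R), measurable B -> 0 <= c ->
  (P ((E' `&` Z @^-1` B) `&` H @^-1` `]-oo, c]) =
   \int[P]_(om in E `&` Z @^-1` B) \int[mu]_(u in `]0%R, c]) (dens (Z om, u))%:E)%E.

Let g (p : T * RR) : \bar R :=
  ((\1_E p.1 : R) * (\1_(`]0%R, +oo[%classic : set R) p.2 : R) * dens (Z p.1, p.2))%:E.

Let mZ2 : measurable_fun [set: T * RR] (fun p : T * RR => (Z p.1, p.2) : S * R).
Proof.
apply/measurable_fun_pairP; split; last exact: measurable_snd.
exact: (measurableT_comp mZ measurable_fst).
Qed.

Let mg : measurable_fun setT g.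
Proof.
apply/measurable_EFinP; apply: measurable_funM; last exact: (measurableT_comp mdn mZ2).
apply: measurable_funM.
  exact: (measurableT_comp (measurable_indic mE) measurable_fst).
apply: (measurableT_comp (measurable_indic _) measurable_snd).
exact: measurable_itv.
Qed.

Let g0 p : (0 <= g p)%E.
Proof. by rewrite lee_fin !mulr_ge0// indicE ler0n. Qed.

Let m2 : {measure set (S * R) -> \bar R} := mpush (mdens (P \x mu)%E mg g0) mZ2.

Let mI : measurable_fun setT (fun om => (\1_E' om : R)%:E).
Proof. exact/measurable_EFinP/measurable_indic. Qed.
Let I0 om : (0 <= (\1_E' om : R)%:E)%E. Proof. by rewrite lee_fin indicE ler0n. Qed.

Let mZH : measurable_fun setT (fun om => (Z om, H om) : S * R).
Proof. exact/measurable_fun_pairP. Qed.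

Let m1 : {measure set (S * R) -> \bar R} := mpush (mdens P mI I0) mZH.

Let int_m1 (f : S * R -> \bar R) : measurable_fun setT f -> (forall p, 0 <= f p)%E ->
  (\int[m1]_p f p = \int[P]_(om in E') f (Z om, H om))%E.
Proof.
move=> mf f0; rewrite (ge0_integral_pushforward mZH _ measurableT mf) => [|p _]; last exact: f0.
have mfZ : measurable_fun setT (f \o (fun om => (Z om, H om) : S * R)) by exact: measurableT_comp.
rewrite (ge0_integral_mdens P mI I0 mfZ) => [|p]; last exact: f0.
rewrite [RHS]integral_mkcond; apply: eq_integral => om _; rewrite patchE indicE.
by case: (om \in E'); rewrite ?mule1 ?mule0.
Qed.

Let int_m2 (f : S * R -> \bar R) : measurable_fun setT f -> (forall p, 0 <= f p)%E ->
  (\int[m2]_p f p = \int[P]_(om in E) \int[mu]_(u in `]0%R, +oo[)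
     ((dens (Z om, u))%:E * f (Z om, u)))%E.
Proof.
move=> mf f0; rewrite (ge0_integral_pushforward mZ2 _ measurableT mf) => [|p _]; last exact: f0.
have mfZ : measurable_fun setT (f \o (fun p : T * RR => (Z p.1, p.2) : S * R)) by exact: measurableT_comp.
rewrite (ge0_integral_mdens (P \x mu)%E mg g0 mfZ) => [|p]; last exact: f0.
rewrite fubini_tonelli1; first last.
- by move=> p; rewrite mule_ge0//; exact: f0.
- exact: emeasurable_funM.
rewrite [RHS]integral_mkcond; apply: eq_integral => om _; rewrite patchE /fubini_F.
case: (boolP (om \in E)) => omE; last first.
  by rewrite integral0_eq// => u _; rewrite /g indicE/= (negbTE omE) !mul0r mule0.
rewrite [RHS]integral_mkcond; apply: eq_integral => u _; rewrite patchE.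
rewrite /g !indicE/= omE mul1r; case: (u \in _); last by rewrite mul0r mule0.
by rewrite mul1r muleC.
Qed.

Let G : set (set (S * R)) := [set C | exists (B : set S) (c : R),
  measurable B /\ C = B `*` (`]-oo, c]%classic : set R)].

Let GE : @measurable _ (S * R)%type = <<s G >>.
Proof.
have GX (B : set S) c : measurable B -> G (B `*` (`]-oo, c]%classic : set R)).
  by move=> mB; exists B, c.
apply/seteqP; split; last first.
  apply: smallest_sub; first exact: sigma_algebra_measurable.
  by move=> _ [B [c [mB ->]]]; apply: measurableX => //; exact: measurable_itv.
rewrite measurable_prod_measurableType.
apply: smallest_sub; first exact: smallest_sigma_algebra.
move=> _ [B mB [A mA <-]].
pose TG : measurableType _ := g_sigma_algebraType G.
have BT : measurable (B `*` [set: R] : set TG).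
  rewrite (_ : _ `*` _ = \bigcup_n (B `*` (`]-oo, n%:R]%classic : set R))); last first.
    apply/seteqP; split => -[b r] /=; last by move=> [k _ [Bb _]]; split.
    move=> [Bb _]; exists (Num.truncn r).+1 => //; split => //=.
    by rewrite in_itv/= ltW// truncnS_gt.
  by apply: bigcup_measurable => n _; apply: sub_sigma_algebra; exact: GX.
have mS : measurable_fun setT (snd : TG -> R).
  apply: (measurability (@RGenOInfty.G R)); first exact: RGenOInfty.measurableE.
  move=> _ [_ [c ->] <-].
  rewrite (_ : _ `&` _ = ~` ([set: S] `*` (`]-oo, c]%classic : set R))).
    by apply: measurableC; apply: sub_sigma_algebra; exact: GX.
  apply/seteqP; split => -[b r] /=; rewrite !in_itv/= andbT.
    by move=> [_ cr] [_]; rewrite leNgt cr.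
  by move=> nc; split => //; rewrite ltNge; apply/negP => h; exact: nc.
have := measurableI _ _ BT (mS measurableT A mA).
rewrite (_ : _ `&` _ = B `*` A)//; apply/seteqP; split => -[b r] /=.
  by move=> [[Bb _] [_ Ar]].
by move=> [Bb Ar].
Qed.

Let GI : setI_closed G.
Proof.
move=> _ _ [B [c [mB ->]]] [B' [c' [mB' ->]]].
exists (B `&` B'), (Num.min c c'); split; first exact: measurableI.
apply/seteqP; split => -[b r] /=; rewrite !in_itv/= le_min.
  by move=> [[? ->] [? ->]].
by move=> [[? ?] /andP[-> ->]].
Qed.

Let m1G (B : set S) (c : R) : measurable B ->
  m1 (B `*` (`]-oo, c]%classic : set R)) = m2 (B `*` (`]-oo, c]%classic : set R)).
Proof.
move=> mB; have mBc : measurable (B `*` (`]-oo, c]%classic : set R)).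
  by apply: measurableX => //; exact: measurable_itv.
have mf : measurable_fun setT (fun p : S * R => (\1_(B `*` (`]-oo, c]%classic : set R)) p : R)%:E).
  exact/measurable_EFinP/measurable_indic.
have f0 p : (0 <= (\1_(B `*` (`]-oo, c]%classic : set R)) p : R)%:E)%E.
  by rewrite lee_fin indicE ler0n.
have mX (m : {measure set (S * R) -> \bar R}) : m (B `*` (`]-oo, c]%classic : set R)) =
    (\int[m]_p (\1_(B `*` (`]-oo, c]%classic : set R)) p : R)%:E)%E.
  by rewrite integral_indic// setIT.
rewrite !mX.
rewrite int_m1// int_m2//.
have eP b u : ((b, u) \in B `*` (`]-oo, c]%classic : set R)) = (b \in B) && (u <= c).
  apply/idP/andP; first by rewrite !inE /= in_itv/= => -[].
  by move=> [bB uc]; rewrite !inE in bB *; split => //=; rewrite in_itv.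
have mZB : measurable (Z @^-1` B) by rewrite -[X in measurable X]setTI; exact: mZ.
have mHc : measurable (H @^-1` `]-oo, c]).
  by rewrite -[X in measurable X]setTI; apply: mH => //; exact: measurable_itv.
transitivity (P ((E' `&` Z @^-1` B) `&` H @^-1` `]-oo, c])).
  transitivity (\int[P]_(om in E') (\1_(Z @^-1` B `&` H @^-1` `]-oo, c]) om : R)%:E)%E; last first.
    rewrite integral_indic//; last exact: measurableI.
    by rewrite setIC setIA.
  apply: eq_integral => om _; rewrite !indicE eP; congr (_%:R%:E); congr nat_of_bool.
  by apply/andP/idP; rewrite !inE /= in_itv/=.
have [c0|c0] := leP 0 c; last first.
  rewrite (_ : _ `&` _ = set0) ?measure0; last first.
    apply/seteqP; split => // om [[/H0 h _]]; rewrite /= in_itv/= => hc.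
    by move: (lt_le_trans h hc); rewrite ltNge (ltW c0).
  rewrite integral0_eq// => om _; rewrite integral0_eq// => u.
  rewrite /= in_itv/= andbT => u0; rewrite indicE eP leNgt (lt_trans c0 u0) andbF.
  by rewrite mule0.
rewrite (ray mB c0) [LHS]integral_mkcondr; apply: eq_integral => om _.
rewrite patchE (_ : (om \in Z @^-1` B) = (Z om \in B)); last by apply/idP/idP; rewrite !inE.
case: (boolP (Z om \in B)) => ZB; last first.
  by rewrite integral0_eq// => u _; rewrite indicE eP (negbTE ZB) mule0.
rewrite integral_mkcond [RHS]integral_mkcond; apply: eq_integral => u _.
rewrite !patchE indicE eP ZB/=.
have -> : (u \in `]0, c]%classic) = (u \in `]0, +oo[%classic) && (u <= c).
  by apply/idP/andP; rewrite !inE /= !in_itv/= andbT => /andP.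
case: (u \in _) => //=; case: (u <= c); by rewrite ?mule1 ?mule0.
Qed.

(** A density with respect to Lebesgue measure that is known on the rays
    determines the joint law of a state and of the next holding time. *)
Lemma integral_of_rays (f : S * R -> \bar R) : measurable_fun setT f -> (forall p, 0 <= f p)%E ->
  (\int[P]_(om in E') f (Z om, H om) =
   \int[P]_(om in E) \int[mu]_(u in `]0%R, +oo[) ((dens (Z om, u))%:E * f (Z om, u)))%E.
Proof.
move=> mf f0; rewrite -int_m1// -int_m2//.
apply: eq_measure_integral => A mA _.
have mX (c : R) : measurable ([set: S] `*` (`]-oo, c]%classic : set R)).
  by apply: measurableX => //; exact: measurable_itv.
apply: (finite_measure_unique GE GI) => //.
- rewrite /m1 /= /mpush /pushforward preimage_setT /mdens integral_indic// setIT.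
  by rewrite (le_lt_trans (probability_le1 _ mE'))// ltry.
- have cov : [set: S * R] = \bigcup_n ([set: S] `*` (`]-oo, n%:R]%classic : set R)).
    apply/seteqP; split => // -[b r] _; exists (Num.truncn r).+1 => //; split => //=.
    by rewrite ?in_itv/= ltW// truncnS_gt.
  have nd : nondecreasing_seq (fun n => [set: S] `*` (`]-oo, n%:R]%classic : set R)).
    move=> n n' nn'; apply/subsetPset => -[b r] [_] /=; rewrite !in_itv/= => rn; split => //=.
    by rewrite ?in_itv/= (le_trans rn)// ler_nat.
  rewrite cov.
  have l1 := nondecreasing_cvg_mu (mu := m1) (fun n => mX n%:R) (bigcup_measurable (fun n _ => mX n%:R)) nd.
  have l2 := nondecreasing_cvg_mu (mu := m2) (fun n => mX n%:R) (bigcup_measurable (fun n _ => mX n%:R)) nd.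
  rewrite -(cvg_lim (@ereal_hausdorff R) l1) -(cvg_lim (@ereal_hausdorff R) l2).
  by congr (lim (_ @ \oo)); apply/funext => n; exact: m1G.
- by move=> _ [B [c [mB ->]]]; exact: m1G.
Qed.

End rays.

(** * The law of the trace of the VRJP *)

Section trace.
Context {R : realType} {V : choiceType}.

(** From index [n] on, the trace makes the steps of [p]: it leaves after a time
    in the prescribed set and goes to the prescribed vertex. *)
Fixpoint follow (z : nat -> option V * R) (n : nat) (p : seq (set R * V)) : Prop :=
  if p is (A, j) :: p' then
    [/\ (z n.+1).1 = Some j, A (z n).2 & follow z n.+1 p']
  else True.

Lemma eq_follow z z' n p : (forall k, (n <= k)%N -> z k = z' k) ->
  follow z n p -> follow z' n p.
Proof.
elim: p n => [//|[A j] p IH] n zz' /= [h1 h2 h3].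
rewrite -!zz'//; split => //; apply: IH h3 => k nk; apply: zz'; exact: ltnW.
Qed.

(** The visited vertices with the holding times of the time change. *)
Definition vrjp_trace (y : R -> option V) (n : nat) : option V * R := (skeleton y n, hold y n).

End trace.

Section vrjp_law.
Context {R : realType} {V : choiceType}.
Variable adj : rel V.
Hypotheses (adj_sym : symmetric adj) (adj_irr : irreflexive adj).
Hypothesis adj_lf : locally_finite_graph adj.
Notation mu := (@lebesgue_measure R).
Notation WS := (fam_space (R := R) (edges adj)).
Variables (i0 : V) (w : set V -> R).
Hypothesis w_gt0 : positive_weights adj w.
Context d (T : measurableType d) (P : probability T R) (Y : T -> R -> option V).
Hypothesis YV : is_vrjp adj i0 w P Y.

Let YP om : jump_path i0 (Y om). Proof. by case: YV. Qed.

Let mY t v : 0 <= t -> measurable [set om | Y om t = v].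
Proof. by case: YV => mY _ _; exact: mY. Qed.

Let mvisits x n : measurable (visits Y x n).
Proof. exact: measurable_visits YV _ _. Qed.

(* jumps across non-edges have rate zero *)
Let visits_nonadj x n j : ~~ adj (x n) j ->
  P (visits Y x n `&` [set om | skeleton (Y om) n.+1 = Some j]) = 0%E.
Proof.
move=> nadj.
pose Q (r : rat) (k : nat) : set T := [set om | exact_jumps n x (ratr r) (Y om)] `&`
   [set om | exists t, [/\ (t <= ratr r + k%:R)%R, first_jump (Y om) (ratr r) t & Y om t = Some j]].
have sub : visits Y x n `&` [set om | skeleton (Y om) n.+1 = Some j] `<=`
   \bigcup_(r in [set r : rat | 0 <= (ratr r : R)]) \bigcup_k Q r k.
  move=> om [vis sk]; have [lt c ne] := skeleton_first_jump sk.
  have [r /andP[nr r1] _] := dense_right (YP om) (jump_date_ge0 (Y om) n) lt.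
  exists r; first by rewrite /= (le_trans (jump_date_ge0 (Y om) n))// ltW.
  exists (Num.truncn (jump_date (Y om) n.+1)).+1 => //; split; first by split => //; [exact: ltW|right].
  have [_ yj] := skeleton_jump sk; have [_ yn] := skeleton_jump (vis n (leqnn n)).
  have yr : Y om (ratr r) = Y om (jump_date (Y om) n) by rewrite c ?ltW.
  exists (jump_date (Y om) n.+1); split => //.
    rewrite (le_trans (ltW (truncnS_gt _)))// lerDr.
    by rewrite (le_trans (jump_date_ge0 (Y om) n))// ltW.
  split => //; last by rewrite yr.
  by move=> u ru un; rewrite yr c// (le_trans (ltW nr)).
have Q0 r k : 0 <= (ratr r : R) -> P (Q r k) = 0%E.
  move=> r0; have k0 : 0 <= k%:R :> R by [].
  have pst : past Y (ratr r) [set om | exact_jumps n x (ratr r) (Y om)].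
    pose G := [set F : set T | exists u v, [/\ 0 <= u, u <= ratr r & F = [set w | Y w u = v]]].
    pose T' : measurableType _ := g_sigma_algebraType G.
    have mY' u v : 0 <= u -> u <= ratr r -> measurable ([set om | Y om u = v] : set T').
      by move=> u0 us; apply: sub_sigma_algebra; exists u, v.
    exact: (@measurable_exact_jumps _ _ _ T' i0 Y (ratr r) YP mY' n x _ r0 (lexx _)).
  have [_ _ /(_ _ _ _ (x n) j r0 k0 pst)] := YV.
  have cur : [set om | exact_jumps n x (ratr r) (Y om)] `&` [set om | Y om (ratr r) = Some (x n)] =
      [set om | exact_jumps n x (ratr r) (Y om)].
    apply/seteqP; split => [om []//|om ex]; split => //.
    exact: (exact_jumps_cur (YP om) ex).
  rewrite cur => E; apply: (etrans E); rewrite integral0_eq// => om _.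
  by rewrite /vrjp_rate (negbTE nadj) !mul0r.
have mQ r k : 0 <= (ratr r : R) -> measurable (Q r k).
  move=> r0.
  have mE : measurable [set om | exact_jumps n x (ratr r) (Y om)].
    by apply: (measurable_exact_jumps (r := ratr r) YP) => // u v u0 _; exact: mY.
  have -> : Q r k = [set om | exact_jumps n x (ratr r) (Y om)] `&`
      [set om | reached n.+1 (fun m => if m == n.+1 then j else x m) (ratr r + k%:R) (Y om)].
    apply/seteqP; split => om [ex]; have [vis nr nx] := ex; have sn := vis n (leqnn n);
      have [jn yn] := skeleton_jump sn;
      have ye := exact_jumps_cur (YP om) ex.
      move=> [t [tk [rt c ne] yt]]; split => //.
      have jt1 : jump_time (Y om) n.+1 t.
        exists (jump_date (Y om) n) => //; split; first exact: le_lt_trans rt.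
          move=> u nu ut; rewrite yn; have [us|us] := leP u (ratr r).
            apply: (const_between (YP om) sn nu); case: nx => nx; first by left.
            by right; exact: le_lt_trans nx.
          by rewrite c// ltW.
        by rewrite yn -ye.
      split; last by rewrite (jump_dateE jt1).
      move=> m; rewrite leq_eqVlt => /predU1P[->|mn]; first by rewrite eqxx (skeletonE jt1).
      by rewrite ltn_eqF// vis.
    move=> [vis' le]; split => //; have := vis' n.+1 (leqnn _); rewrite eqxx => sk.
    have [lt c ne] := skeleton_first_jump sk; have [_ yj] := skeleton_jump sk.
    exists (jump_date (Y om) n.+1); split => //; split.
    - by case: nx => //; rewrite sk.
    - by move=> u su un; rewrite ye c ?yn// (le_trans nr).
    - by rewrite ye -yn.
  apply: measurableI => //; apply: (measurable_reached (r := ratr r + k%:R) YP) => // u v u0 _.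
  exact: mY.
have mv1 : measurable (visits Y x n `&` [set om | skeleton (Y om) n.+1 = Some j]).
  rewrite (_ : _ `&` _ = visits Y (fun m => if m == n.+1 then j else x m) n.+1)//.
  apply/seteqP; split => om.
    move=> [vis sk] m; rewrite leq_eqVlt => /predU1P[->|mn]; first by rewrite eqxx.
    by rewrite ltn_eqF// vis.
  move=> vis; split; last by have := vis n.+1 (leqnn _); rewrite eqxx.
  by move=> m mn; have := vis m (leqW mn); rewrite ltn_eqF.
pose Q' m := if unpickle m is Some rk then
  (if 0 <= (ratr rk.1 : R) then Q rk.1 rk.2 else set0) else set0.
apply: measure_negligible => //; apply: (negligibleS (A := \bigcup_m Q' m)).
  move=> om /sub[r r0 [k _ Qrk]].
  have Q'E : Q' (pickle (r, k)) = Q r k by rewrite /Q' pickleK ifT.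
  by exists (pickle (r, k)); [exact: I|rewrite Q'E].
apply: negligible_bigcup => m; rewrite /Q'.
case: (unpickle m) => [[r k]/=|]; last exact: negligible_set0.
case: ifP => r0; last exact: negligible_set0.
by apply/negligibleP; [exact: mQ|exact: Q0].
Qed.

Definition visits_in x (A : nat -> set R) n : set T :=
  visits Y x n `&` [set om | forall k, (k < n)%N -> A k (hold (Y om) k)].

Let mvisits_in x A n : (forall k, measurable (A k)) -> measurable (visits_in x A n).
Proof.
move=> mA; rewrite (_ : visits_in x A n = \bigcap_k (visits Y x n `&` 
    [set om | (k < n)%N -> A k (hold (Y om) k)])); last first.
  apply/seteqP; split => om; first by move=> [vis h] k _; split => // kn; exact: h.
  by move=> h; split => [|k kn]; [have [] := h 0%N I|have [_] := h k I; exact].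
apply: bigcapT_measurable => k; case: (ltnP k n) => kn.
  rewrite (_ : _ `&` _ = visits Y x n `&` (fun om => hold (Y om) k) @^-1` A k).
    exact: (measurable_hold_visits YV kn (mvisits x n) (mA k)).
  by apply/seteqP; split => om [vis h]; split => //; exact: h.
by rewrite (_ : _ `&` _ = visits Y x n)//; apply/seteqP; split => om; [case|].
Qed.

Let visits_inS x A n : visits_in x A n.+1 =
  (visits_in x A n `&` [set om | skeleton (Y om) n.+1 = Some (x n.+1)]) `&`
  [set om | A n (hold (Y om) n)].
Proof.
apply/seteqP; split => om.
  move=> [vis h]; split; last exact: h.
  split; last exact: vis.
  by split => [k kn|k kn]; [exact/vis/leqW|exact/h/ltnW].
move=> [[[vis h] sk] An]; split => k; rewrite leq_eqVlt => /predU1P[ek|kn].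
- by rewrite ek.
- exact: vis.
- by case: ek => ->.
- exact: h.
Qed.

Let one_step x A n (phi : WS -> \bar R) : adj (x n) (x n.+1) ->
  (forall k, measurable (A k)) -> measurable_fun setT phi -> (forall z, 0 <= phi z)%E ->
  (\int[P]_(om in visits_in x A n) \int[mu]_(u in `]0%R, +oo[)
     ((leave_density adj (x n) (x n.+1) (env w x (hold (Y om)) n) u * \1_(A n) u)%:E *
      phi (boost (x n) u (env w x (hold (Y om)) n))) =
   \int[P]_(om in visits_in x A n.+1) phi (env w x (hold (Y om)) n.+1))%E.
Proof.
move=> ij mA mphi phi0.
have mE := mvisits_in x n mA.
pose E' := visits_in x A n `&` [set om | skeleton (Y om) n.+1 = Some (x n.+1)].
have E'v : E' `<=` visits Y x n.+1.
  move=> om [[vis _] sk] k; rewrite leq_eqVlt => /predU1P[->//|kn]; exact: vis.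
have mE' : measurable E'.
  rewrite (_ : E' = visits_in x A n `&` visits Y x n.+1); first exact: measurableI.
  apply/seteqP; split => om h; first by split; [case: h|exact: E'v].
  by case: h => h1 h2; split => //; exact: h2.
pose Z om : WS := fun e => ((fun om => env w x (hold (Y om)) n e) \_ (visits Y x n)) om.
pose H om : R := ((fun om => hold (Y om) n) \_ (visits Y x n.+1)) om.
have ZE om : visits Y x n om -> Z om = env w x (hold (Y om)) n.
  by move=> vis; apply/funext => e; rewrite /Z patchE mem_set.
have HE om : visits Y x n.+1 om -> H om = hold (Y om) n.
  by move=> vis; rewrite /H patchE mem_set.
have mZ : measurable_fun setT Z.
  apply: measurable_to_fam => e De.
  apply: (measurable_restrictT _ (mvisits x n)).1.
  have me := measurable_env_visits YV (x := x) (n := n).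
  exact: (measurableT_comp (measurable_coord De) me).
have mH : measurable_fun setT H.
  apply: (measurable_restrictT _ (mvisits x n.+1)).1.
  exact: (measurable_hold_visits YV (ltnSn n)).
have H0 om : E' om -> 0 < H om.
  move=> E'om; have vis := E'v om E'om; rewrite HE//.
  exact: (hold_gt0 (YP om) (vis n (leqnSn n)) (vis n.+1 (leqnn _))).
pose dens (p : WS * R) := leave_density adj (x n) (x n.+1) p.1 p.2.
have mdens : measurable_fun setT dens by exact: measurable_leave_density.
have ray (B : set WS) (c : R) : measurable B -> 0 <= c ->
    (P ((E' `&` Z @^-1` B) `&` H @^-1` `]-oo, c]) =
     \int[P]_(om in visits_in x A n `&` Z @^-1` B) \int[mu]_(u in `]0%R, c]) (dens (Z om, u))%:E)%E.
  move=> mB c0.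
  have EB : visits_in x A n `&` Z @^-1` B = visits Y x n `&`
      [set om | (forall k, (k < n)%N -> A k (hold (Y om) k)) /\ B (env w x (hold (Y om)) n)].
    apply/seteqP; split => om.
      by move=> [[vis h]]; rewrite /preimage/= ZE.
    by move=> [vis [h Bz]]; split; [split|rewrite /preimage/= ZE].
  transitivity (P ((visits_in x A n `&` Z @^-1` B) `&`
      [set om | skeleton (Y om) n.+1 = Some (x n.+1) /\ (hold (Y om) n <= c)%R])).
    congr (P _); apply/seteqP; split => om.
      move=> [[E'om ZB]]; have vis := E'v om E'om; rewrite /= HE// in_itv/= => hc.
      by case: E'om => h1 h2; split; [split|split].
    move=> [[h ZB] [sk hc]]; have E'om : E' om by split.
    by split; [split|rewrite /= HE ?in_itv//=; exact: E'v].
  rewrite EB (hold_ray adj_irr adj_lf w_gt0 YV mA mB ij c0).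
  apply: eq_integral => om; rewrite inE => -[vis _].
  have g1 := next_edge_gt0 adj_irr adj_lf w_gt0 YV ij vis.
  have g2 := next_tot_gt0 adj_irr adj_lf w_gt0 YV ij vis.
  rewrite /dens/= ZE// /leave_density -(integral_jump_density_itv (ltW _) g2 c0)//.
  by rewrite gtr0_norm.
pose f (p : WS * R) : \bar R := ((\1_(A n) p.2 : R)%:E * phi (boost (x n) p.2 p.1))%E.
have mf : measurable_fun setT f.
  apply: emeasurable_funM.
    apply/measurable_EFinP; exact: (measurableT_comp (measurable_indic (mA n)) measurable_snd).
  exact: (measurableT_comp mphi (@measurable_boost _ _ adj (x n))).
have f0 p : (0 <= f p)%E by rewrite mule_ge0// lee_fin indicE ler0n.
have := integral_of_rays mE mE' mZ mH mdens (fun p => leave_density_ge0 _ _ _ _ _) H0 ray mf f0.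
move=> main; transitivity (\int[P]_(om in visits_in x A n)
    (\int[mu]_(u in `]0%R, +oo[) ((dens (Z om, u))%:E * f (Z om, u))))%E.
  apply: eq_integral => om; rewrite inE => -[vis _]; apply: eq_integral => u _.
  by rewrite /dens /f/= ZE// EFinM muleA.
rewrite -main visits_inS -/E' [RHS]integral_mkcondr; apply: eq_integral.
move=> om; rewrite inE => E'om; have vis := E'v om E'om.
rewrite patchE /f/= HE// ZE; last by move=> k kn; exact/vis/leqW.
rewrite indicE (_ : (om \in _) = (hold (Y om) n \in A n)).
  by case: (_ \in A n); rewrite ?mul1e ?mul0e.
by apply/idP/idP; rewrite !inE.
Qed.

Let set_at (S : Type) (f : nat -> S) n v : nat -> S := fun k => if k == n then v else f k.

Let follow_cons x A n B j p :
  visits_in x A n `&` [set om | follow (vrjp_trace (Y om)) n ((B, j) :: p)] =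
  visits_in (set_at x n.+1 j) (set_at A n B) n.+1 `&` [set om | follow (vrjp_trace (Y om)) n.+1 p].
Proof.
have eA k : (k < n)%N -> set_at A n B k = A k by move=> kn; rewrite /set_at ltn_eqF.
have ex k : (k <= n)%N -> set_at x n.+1 j k = x k by move=> kn; rewrite /set_at ltn_eqF.
apply/seteqP; split => om.
  move=> [[vis h] [sk hB fol]]; split => //; split => k; rewrite leq_eqVlt => /predU1P[ek|kn].
  - by rewrite ek /set_at eqxx.
  - by rewrite ex//; exact: vis.
  - by case: ek => ->; rewrite /set_at eqxx.
  - by rewrite eA//; exact: h.
move=> [[vis h] fol]; split; first split => k kn.
- by rewrite (vis k (leqW kn)) ex.
- by have := h k (ltnW kn); rewrite eA.
split => //.
- by rewrite /= (vis n.+1 (leqnn _)) /set_at eqxx.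
- by have := h n (leqnn _); rewrite /set_at eqxx.
Qed.

Let measurable_set_at A n B : (forall k, measurable (A k)) -> measurable B ->
  forall k, measurable ((set_at A n B : nat -> set R) k).
Proof. by move=> mA mB k; rewrite /set_at; case: (k == n). Qed.

Let measurable_follow_from p : measurable_steps p -> forall x A n, (forall k, measurable (A k)) ->
  measurable (visits_in x A n `&` [set om | follow (vrjp_trace (Y om)) n p]).
Proof.
elim: p => [|[B j] p IH] mp x A n mA.
  rewrite (_ : _ `&` _ = visits_in x A n); first exact: mvisits_in.
  by apply/seteqP; split => om; [case|].
rewrite follow_cons; apply: IH; first by move=> q qp; apply: mp; rewrite inE qp orbT.
by apply: measurable_set_at => //; exact: (mp (B, j) (mem_head _ _)).
Qed.

Let law_from p : measurable_steps p -> forall x A n, (forall k, measurable (A k)) ->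
  (P (visits_in x A n `&` [set om | follow (vrjp_trace (Y om)) n p]) =
   \int[P]_(om in visits_in x A n) path_prob adj (x n) p (env w x (hold (Y om)) n))%E.
Proof.
elim: p => [|[B j] p IH] mp x A n mA.
  rewrite /= integral_cst//; last exact: mvisits_in.
  by rewrite mul1e; congr (P _); apply/seteqP; split => om; [case|].
have mB : measurable B by exact: (mp (B, j) (mem_head _ _)).
have mp' : measurable_steps p by move=> q qp; apply: mp; rewrite inE qp orbT.
have [ij|nij] := boolP (adj (x n) j); last first.
  rewrite [RHS](_ : _ = 0%E); last first.
    by rewrite integral0_eq// => om _ /=; rewrite (negbTE nij).
  apply: measure_negligible; first exact: measurable_follow_from.
  have mv1 : measurable (visits Y x n `&` [set om | skeleton (Y om) n.+1 = Some j]).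
    rewrite (_ : _ `&` _ = visits Y (set_at x n.+1 j) n.+1)//.
    apply/seteqP; split => om.
      move=> [vis sk] m; rewrite /set_at leq_eqVlt => /predU1P[->|mn]; first by rewrite eqxx.
      by rewrite ltn_eqF// vis.
    move=> vis; split; last by have := vis n.+1 (leqnn _); rewrite /set_at eqxx.
    by move=> m mn; have := vis m (leqW mn); rewrite /set_at ltn_eqF.
  apply: (negligibleS (A := visits Y x n `&` [set om | skeleton (Y om) n.+1 = Some j])).
    by move=> om [[vis _] [sk _ _]].
  by apply/negligibleP => //; exact: visits_nonadj.
have mA' := measurable_set_at n mA mB.
have ex k : (k <= n)%N -> set_at x n.+1 j k = x k by move=> kn; rewrite /set_at ltn_eqF.
have ee om : env w (set_at x n.+1 j) (hold (Y om)) n = env w x (hold (Y om)) n.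
  suff : forall m, (m <= n)%N ->
    env w (set_at x n.+1 j) (hold (Y om)) m = env w x (hold (Y om)) m by exact.
  by elim=> [//|m IHm] mn /=; rewrite IHm ?(ltnW mn)// ex// ltnW.
have eE : visits_in (set_at x n.+1 j) (set_at A n B) n = visits_in x A n.
  apply/seteqP; split => om [vis h]; split => k kn.
  - by rewrite vis// ex.
  - by have := h k kn; rewrite /set_at ltn_eqF.
  - by rewrite ex//; exact: vis.
  - by rewrite /set_at ltn_eqF//; exact: h.
rewrite follow_cons IH//.
have ij' : adj (set_at x n.+1 j n) (set_at x n.+1 j n.+1).
  by rewrite ex// /set_at eqxx.
rewrite -(one_step ij' mA' _ (path_prob_ge0 _ _ _)); last exact: measurable_path_prob.
rewrite eE; apply: eq_integral => om _; rewrite ee ex// /= ij.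
by apply: eq_integral => u _; rewrite /set_at !eqxx.
Qed.

Lemma measurable_vrjp_follow p : measurable_steps p ->
  measurable [set om | follow (vrjp_trace (Y om)) 0 p].
Proof.
move=> mp; have := measurable_follow_from mp (fun=> i0) 0 (fun=> measurableT).
rewrite (_ : _ `&` _ = [set om | follow (vrjp_trace (Y om)) 0 p])//.
apply/seteqP; split => om; first by case.
by move=> fol; split => //; split => // k; rewrite leqn0 => /eqP ->; exact: skeleton0 (YP om).
Qed.

(** The law of the trace: with the weights boosted by the time spent
    so far, every step is independent of the past. *)
Lemma vrjp_follow_law p : measurable_steps p ->
  P [set om | follow (vrjp_trace (Y om)) 0 p] = path_prob adj i0 p w.
Proof.
move=> mp; have := law_from mp (fun=> i0) 0 (fun=> measurableT).
have -> : visits_in (fun=> i0) (fun=> setT) 0 = setT.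
  apply/seteqP; split => // om _; split => // k; rewrite leqn0 => /eqP ->.
  exact: skeleton0 (YP om).
rewrite setTI => ->; rewrite /= integral_cst//.
have P1 : P [set: T] = 1%E by exact: probability_setT.
by rewrite [X in (_ * X)%E]P1 mule1.
Qed.

End vrjp_law.

(** * Exponential, Beta and Gamma variables *)

Section rays_unique.
Context {R : realType}.

Lemma ray_unique (m1 m2 : {measure set R -> \bar R}) : (m1 setT < +oo)%E -> m1 setT = m2 setT ->
  (forall c, m1 (`]-oo, c]%classic : set R) = m2 (`]-oo, c]%classic : set R)) -> forall A, measurable A -> m1 A = m2 A.
Proof.
move=> fin e12 h; pose G : set (set R) := [set C | exists c : R, C = `]-oo, c]%classic].
apply: (finite_measure_unique (G := G)) => //; last by move=> _ [c ->].
- apply/seteqP; split; last first.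
    apply: smallest_sub; first exact: sigma_algebra_measurable.
    by move=> _ [c ->]; exact: measurable_itv.
  pose TG : measurableType _ := g_sigma_algebraType G.
  have mid : measurable_fun setT (id : TG -> R).
    apply: (measurability (@RGenOInfty.G R)); first exact: RGenOInfty.measurableE.
    move=> _ [_ [c ->] <-]; rewrite setTI preimage_id -setCitvl; apply: measurableC.
    by apply: sub_sigma_algebra; exists c.
  by move=> A mA; have := mid measurableT A mA; rewrite setTI.
- move=> _ _ [c ->] [c' ->]; exists (Num.min c c').
  by apply/seteqP; split => x /=; rewrite !in_itv/= le_min => /andP.
Qed.

End rays_unique.

Section gamma_probability.
Context {R : realType} (a : R).
Hypothesis a0 : 0 < a.

Definition gamma_pr of 0 < a : set R -> \bar R := gamma_law a.

HB.instance Definition _ := isMeasure.Build _ _ _ (gamma_pr a0)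
  (@measure0 _ _ _ (gamma_law a)) (measure_ge0 (gamma_law a))
  (@measure_semi_sigma_additive _ _ _ (gamma_law a)).

HB.instance Definition _ := Measure_isProbability.Build _ _ _ (gamma_pr a0) (gamma_lawT a0).

End gamma_probability.

Section exp_law.
Context {R : realType}.
Notation mu := (@lebesgue_measure R).
Local Open Scope ereal_scope.

Lemma integral_exp_law (h : R -> \bar R) : measurable_fun setT h -> (forall x, 0 <= h x) ->
  \int[gamma_law 1]_x h x = \int[mu]_(x in `]0%R, +oo[) ((expR (- x))%:E * h x).
Proof.
move=> mh h0; rewrite integral_gamma_law//.
have -> : gamma_function 1%R = 1%R :> R.
  by apply: EFin_inj; rewrite gamma_functionE// gamma_integral1.
rewrite invr1 mul1e /gamma_integral; apply: eq_integral => x.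
rewrite inE/= in_itv/= andbT => x0.
by rewrite /gamma_kernel subrr powRr0 mul1r.
Qed.

Lemma integral_gamma_law_abs a (h : R -> \bar R) : measurable_fun setT h -> (forall x, 0 <= h x) ->
  \int[gamma_law a]_x h `|x|%R = \int[gamma_law a]_x h x.
Proof.
move=> mh h0; have mabs : measurable_fun setT (fun x : R => h `|x|%R).
  exact: (measurableT_comp mh (@normr_measurable R setT)).
rewrite (integral_gamma_law _ mabs) => [|x]; last exact: h0.
rewrite (integral_gamma_law _ mh) => [|x]; last exact: h0.
congr (_ * _); rewrite /gamma_integral; apply: eq_integral => x.
by rewrite inE/= in_itv/= andbT => x0; rewrite gtr0_norm.
Qed.

(** An exponential variable rescaled by [b] is a holding time with rate [b];
    multiplying a gamma variable of index [b + 1] by the corresponding beta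
    variable lowers its index by one. *)
Lemma beta_gamma b (phi : R -> \bar R) : (0 < b)%R ->
  measurable_fun setT phi -> (forall x, 0 <= phi x) ->
  \int[gamma_law 1]_x \int[gamma_law (b + 1)%R]_g phi (g * expR (- (x / b)))%R =
  \int[gamma_law b]_g phi g.
Proof.
move=> b0 mphi phi0.
have mF : measurable_fun setT (fun p : R * R => phi (p.2 * expR (- (p.1 / b)))%R).
  apply: (measurableT_comp mphi); apply: measurable_funM; first exact: measurable_snd.
  apply: (measurableT_comp (@measurable_expR R)); apply: measurable_funN.
  by apply: measurable_funM; [exact: measurable_fst|exact: measurable_cst].

have b1 : (0 < b + 1)%R by rewrite addr_gt0.
have mI (x : R) : measurable_fun setT (fun g : R => phi (g * expR (- (x / b)))%R).
  exact: (measurableT_comp mF (@pair1_measurable _ _ _ _ x)).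
have mG : measurable_fun setT (fun x : R => \int[gamma_law (b + 1)%R]_g phi (g * expR (- (x / b)))%R).
  exact: (@measurable_fun_integral_on _ _ _ _ R (gamma_pr b1) setT _ measurableT mF (fun p => phi0 _)).
have G0 x : 0 <= \int[gamma_law (b + 1)%R]_g phi (g * expR (- (x / b)))%R by apply: integral_ge0 => g _; exact: phi0.
rewrite (integral_exp_law mG G0).
rewrite (@ge0_integral_scale R b)//; last 2 first.
- apply: emeasurable_funM => //.
  apply/measurable_EFinP; apply: (measurableT_comp (@measurable_expR R)).
  exact: measurable_funN.
- move=> x _; by rewrite mule_ge0 ?lee_fin ?expR_ge0//.
have mpt (t : R) : measurable_fun setT (fun x : R => phi (x * expR (- t))%R).
  by apply: (measurableT_comp mphi); apply: measurable_funM => //; exact: measurable_cst.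
transitivity (\int[mu]_(t in `]0%R, +oo[)
    \int[gamma_law b]_x ((jump_density `|x| `|x| t)%:E * phi x)).
  rewrite -ge0_integralZl ?lee_fin ?ltW//; last 2 first.
  - apply: measurable_funTS; apply: emeasurable_funM.
      apply/measurable_EFinP; apply: (measurableT_comp (@measurable_expR R)).
      apply: measurable_funN; apply: measurable_funM => //; exact: measurable_cst.
    apply: (measurableT_comp mG); apply: measurable_funM => //; exact: measurable_cst.
  - move=> x _; by rewrite mule_ge0 ?lee_fin ?expR_ge0//.
  apply: eq_integral => t _; rewrite muleA -EFinM.
  have := @gamma_law_size_scale R b t _ b0 (mpt t) (fun x => phi0 _) => h.
  transitivity ((b * expR (- (b * t)))%:E * \int[gamma_law (b + 1)%R]_x phi (x * expR (- t))%R).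
    congr (_ * _); apply: eq_integral => g _; congr (phi (_ * expR (- _)))%R.
    by rewrite mulrAC divff ?mul1r// gt_eqF.
  rewrite -h; apply: eq_integral => x _; congr (_ * phi _).
  by rewrite -mulrA -expRD subrr expR0 mulr1.
have mJ : measurable_fun setT (fun p : R * R => (jump_density `|p.1| `|p.1| p.2)%:E * phi p.1).
  apply: emeasurable_funM; last exact: (measurableT_comp mphi measurable_fst).
  have m1 : measurable_fun setT (fun p : R * R => `|p.1|%R).
    exact: (measurableT_comp (@normr_measurable R setT) measurable_fst).
  have me : measurable_fun setT (fun p : R * R => expR p.2).
    exact: (measurableT_comp (@measurable_expR R) measurable_snd).
  apply/measurable_EFinP; apply: measurable_funM; first exact: measurable_funM.
  apply: (measurableT_comp (@measurable_expR R)); apply: measurable_funN.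
  apply: measurable_funM => //; apply: measurable_funB => //; exact: measurable_cst.
have J0 (p : R * R) : 0 <= (jump_density `|p.1| `|p.1| p.2)%:E * phi p.1.
  by rewrite mule_ge0// lee_fin jump_density_ge0.
have := tonelli_on (gamma_pr b0) mu (D1 := setT) (D2 := `]0%R, +oo[%classic) measurableT (measurable_itv _) mJ J0.
move=> /= <-.
have mphi' : measurable_fun setT (fun x : R => phi `|x|%R).
  exact: (measurableT_comp mphi (@normr_measurable R setT)).
have mJi := @measurable_fun_integral_on _ _ _ _ R mu `]0%R, +oo[%classic _ (measurable_itv _) mJ J0.
rewrite (integral_gamma_law b mJi) => [|x]; last by apply: integral_ge0 => t _; exact: J0.
rewrite (integral_gamma_law b mphi phi0); congr (_ * _); rewrite /gamma_integral.
apply: eq_integral => x; rewrite inE/= in_itv/= andbT => x0; congr (_ * _).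
rewrite gtr0_norm// ge0_integralZr//; last 2 first.
- by apply/measurable_EFinP/measurable_funTS; exact: measurable_jump_density.
- by move=> t _; rewrite lee_fin jump_density_ge0 ?ltW.
by rewrite integral_jump_density ?ltW// divff ?mul1e// gt_eqF.
Qed.

End exp_law.

(** * The limit of an urn *)

Section summable.
Context d (T : measurableType d) (R : realType) (m : {measure set T -> \bar R}).

(** Borel-Cantelli in mean: the expected total variation is finite. *)
Lemma ae_summable (f : nat -> T -> R) (c : R) : 0 <= c ->
  (forall k, measurable_fun setT (f k)) ->
  (forall k, \int[m]_x (`|f k x|)%:E <= (c / (2 ^ k.+1)%:R)%:E)%E ->
  {ae m, forall x, cvgn (series (fun k => f k x))}.
Proof.
move=> c0 mf fc.
have mfa k : measurable_fun setT (fun x => (`|f k x|)%:E).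
  by apply/measurable_EFinP; exact: (measurableT_comp (@normr_measurable R setT)).
have fa0 k x : (0 <= (`|f k x|)%:E)%E by rewrite lee_fin.
pose g x := (\sum_(k <oo) (`|f k x|)%:E)%E.
have g0 x : (0 <= g x)%E by apply: nneseries_ge0.
have mg : measurable_fun setT g.
  by apply: ge0_emeasurable_sum => // k x _ _; exact: fa0.
have gi : m.-integrable setT g.
  apply/integrableP; split => //.
  rewrite (eq_integral g) => [|x _]; last by rewrite gee0_abs.
  rewrite /g integral_nneseries//.
  apply: (@le_lt_trans _ _ c%:E); last exact: ltry.
  apply: le_trans (epsilon_trick0 xpredT c0).
  apply: lee_nneseries => [k _ _|k _]; last exact: fc.
  by apply: integral_ge0 => x _; exact: fa0.
have := integrable_ae measurableT gi; apply: filterS => x /(_ I) gx.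
apply: normed_cvg; apply: nondecreasing_is_cvgn.
  by apply/nondecreasing_seqP => k; rewrite /= seriesSr lerDl.
exists (fine (g x)) => _ [k _ <-]; rewrite -lee_fin fineK//= /series/= -sumEFin.
by apply: nneseries_lim_ge => i _ _; exact: fa0.
Qed.

End summable.

(** The exponential clocks of one family of rings, and the limit that they
    determine. *)
Section urn.
Context {R : realType}.
Implicit Types (b : R) (t : nat -> R).

(** With the [k]-th birth at rate [b + k], the time of the [k]-th birth is the sum of
    the [t l / (b + l)], and [decay b t 0 k] is the exponential of minus this time. *)
Definition decay b t (n k : nat) : R := \prod_(n <= l < k) expR (- (t l / (b + l%:R))).
Definition urn_size b t (k : nat) : R := (b + k%:R) * decay b t 0 k.

(** The limit is taken along powers of 4, where the fluctuations of the sizes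
    are summable; [limn_esup] makes it measurable and total. *)
Definition urn_limit b t : R :=
  fine (limn_esup (fun k => (urn_size b t (4 ^ k))%:E)).

Lemma decay_ge0 b t n k : 0 <= decay b t n k.
Proof. by apply: prodr_ge0 => l _; exact: expR_ge0. Qed.

Lemma decay0 b t n : decay b t n n = 1.
Proof. by rewrite /decay big_geq. Qed.

Lemma decayS b t n k : (n <= k)%N ->
  decay b t n k.+1 = decay b t n k * expR (- (t k / (b + k%:R))).
Proof. by move=> nk; rewrite /decay big_nat_recr. Qed.

Lemma decay_cat b t n k l : (n <= k)%N -> (k <= l)%N ->
  decay b t n l = decay b t n k * decay b t k l.
Proof. by move=> nk kl; rewrite /decay (big_cat_nat nk kl). Qed.

Lemma eq_decay b t t' n k : (forall l, (n <= l < k)%N -> t l = t' l) ->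
  decay b t n k = decay b t' n k.
Proof. by move=> tt'; apply: eq_big_nat => l lk; rewrite tt'. Qed.

Lemma urn_limitE b t l : urn_size b t (4 ^ k) @[k --> \oo] --> l -> urn_limit b t = l.
Proof.
move=> h; rewrite /urn_limit.
have h' : (urn_size b t (4 ^ k))%:E @[k --> \oo] --> l%:E by apply: cvg_EFin => //; exact: nearW.
by rewrite (cvg_limn_einf_sup h').2.
Qed.

End urn.

Section ramp.
Context {R : realType}.

(** A Lipschitz approximation of the indicator function of a ray. *)
Definition ramp (c : R) (j : nat) (x : R) : R := (Num.max 0 (1 - j%:R * Num.max 0 (x - c)))%R.

Lemma ramp01 c j x : (0 <= ramp c j x <= 1)%R.
Proof.
rewrite /ramp le_max lexx/= ge_max ler01/= lerBlDr lerDl mulr_ge0//.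
by rewrite le_max lexx.
Qed.

Lemma ramp_lip c j x y : (ramp c j x <= ramp c j y + j%:R * `|x - y|)%R.
Proof.
have j0 : (0 <= j%:R :> R)%R by [].
have h : (Num.max 0 (y - c) <= Num.max 0 (x - c) + `|x - y|)%R.
  have a1 : (0 <= Num.max 0 (x - c))%R by rewrite le_max lexx.
  have a2 : (x - c <= Num.max 0 (x - c))%R by rewrite le_max lexx orbT.
  have a3 := normr_ge0 (x - y); have a4 := ler_norm (y - x); rewrite distrC in a4.
  by rewrite ge_max; apply/andP; split; lra.
have {}h := ler_wpM2l j0 h; rewrite mulrDr in h.
have b1 : (0 <= ramp c j y)%R by case/andP: (ramp01 c j y).
have b2 : (1 - j%:R * Num.max 0 (y - c) <= ramp c j y)%R by rewrite /ramp le_max lexx orbT.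
have b3 : (0 <= j%:R * `|x - y|)%R by rewrite mulr_ge0.
by rewrite {1}/ramp ge_max; apply/andP; split; lra.
Qed.

Lemma continuous_ramp c j : continuous (ramp c j).
Proof.
move=> x; apply/cvgrPdist_le => /= eps eps0.
have j1 : (0 < j%:R + 1 :> R)%R by rewrite ltr_wpDl.
near=> y.
have h : (`|x - y| <= eps / (j%:R + 1))%R.
  near: y; apply: cvgr_dist_le; last exact: divr_gt0.
  exact: cvg_id.
have l1 := ramp_lip c j x y; have l2 := ramp_lip c j y x; rewrite distrC in l2.
have l3 : (j%:R * `|x - y| <= eps)%R.
  rewrite ler_pdivlMr// in h; apply: le_trans h.
  by rewrite mulrC ler_wpM2l// lerDl.
by rewrite ler_norml; apply/andP; split; lra.
Unshelve. all: by end_near. Qed.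

Lemma measurable_ramp c j : measurable_fun setT (ramp c j).
Proof. exact: (continuous_measurable_fun (@continuous_ramp c j)). Qed.

Lemma cvg_ramp c x : ramp c j x @[j --> \oo] --> ((x <= c)%R%:R : R).
Proof.
case: (leP x c) => xc.
  rewrite (_ : (fun j => _) = cst 1%R); first exact: cvg_cst.
  apply/funext => j; rewrite /ramp.
  have -> : Num.max 0%R (x - c)%R = 0%R :> R by apply/max_idPl; rewrite subr_le0.
  by rewrite mulr0 subr0; apply/max_idPr.
apply: cvg_near_cst; exists (Num.truncn (x - c)^-1).+1 => // j /= hj.
have d0 : (0 < x - c)%R by rewrite subr_gt0.
rewrite /ramp; have -> : Num.max 0%R (x - c)%R = (x - c)%R :> R by apply/max_idPr/ltW.
apply/max_idPl; rewrite subr_le0 -ler_pdivrMr// mul1r.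
by apply: (le_trans (ltW (truncnS_gt _))); rewrite ler_nat.
Qed.

End ramp.

Section kendall.
Context {R : realType} {K : choiceType}.
Variable (D : set K).
Notation DI := ([set p : K * nat | D p.1]).
Notation TT := (fam_space (R := R) DI).
Variable m : probability TT R.
Hypothesis pm : product_law (fun=> gamma_law 1) m.
Local Open Scope ereal_scope.

Definition clocks (tau : K * nat -> R) (e : K) : nat -> R := fun l => tau (e, l).

Section one_edge.
Variables (e : K) (b : R).
Hypotheses (De : D e) (b0 : (0 < b)%R).

Let bn n : (0 < b + n%:R)%R. Proof. by rewrite ltr_wpDr. Qed.

Lemma measurable_decay n k : measurable_fun setT (fun tau : TT => decay b (clocks tau e) n k).
Proof.
rewrite /decay; elim: (index_iota n k) => [|l s IH].
  rewrite (_ : (fun _ => _) = cst 1%R) => [|//]; last by apply/funext => tau; rewrite big_nil.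
  exact: measurable_cst.
rewrite (_ : (fun _ => _) = (fun tau : TT => expR (- (clocks tau e l / (b + l%:R))) *
  \prod_(l <- s) expR (- (clocks tau e l / (b + l%:R))))%R); last first.
  by apply/funext => tau; rewrite big_cons.
apply: measurable_funM => //; apply: (measurableT_comp (@measurable_expR R)).
apply: measurable_funN; apply: measurable_funM; last exact: measurable_cst.
exact: (@measurable_coord R _ DI (e, l) De).
Qed.

Lemma measurable_urn_size k : measurable_fun setT (fun tau : TT => urn_size b (clocks tau e) k).
Proof. by apply: measurable_funM; [exact: measurable_cst|exact: measurable_decay]. Qed.

Lemma measurable_urn_limit : measurable_fun setT (fun tau : TT => urn_limit b (clocks tau e)).
Proof.
apply: (measurableT_comp (@fine_measurable R setT measurableT)).
by apply: measurable_fun_limn_esup => k; apply/measurable_EFinP; exact: measurable_urn_size.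
Qed.

Let one_step n (F : TT * R -> \bar R) : measurable_fun setT F -> (forall p, 0 <= F p) ->
  (forall tau g x, F (upd (e, n) x tau, g) = F (tau, g)) ->
  \int[m]_tau \int[gamma_law (b + n.+1%:R)%R]_g
     F (tau, g * expR (- (clocks tau e n / (b + n%:R))))%R =
  \int[m]_tau \int[gamma_law (b + n%:R)%R]_g F (tau, g).
Proof.
move=> mF F0 Fn.
pose h (p : TT * R) : TT * R := (p.1, p.2 * expR (- (clocks p.1 e n / (b + n%:R))))%R.
have mh : measurable_fun setT h.
  apply/measurable_fun_pairP; split; first exact: measurable_fst.
  apply: measurable_funM; first exact: measurable_snd.
  apply: (measurableT_comp (@measurable_expR R)); apply: measurable_funN.
  apply: measurable_funM; last exact: measurable_cst.
  exact: (measurableT_comp (@measurable_coord R _ DI (e, n) De) measurable_fst).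
have mFh : measurable_fun setT (F \o h) by exact: measurableT_comp.
pose f1 (tau : TT) := \int[gamma_law (b + n.+1%:R)%R]_g F (tau, g * expR (- (clocks tau e n / (b + n%:R))))%R.
have mf1 : measurable_fun setT f1.
  exact: (@measurable_fun_integral_on _ _ _ _ R (gamma_pr (bn n.+1)) setT _ measurableT mFh (fun p => F0 _)).
have f10 tau : 0 <= f1 tau by apply: integral_ge0 => g _; exact: F0.
apply: (etrans (resample_coord (i := (e, n)) (f := f1) pm De mf1 f10)); rewrite /f1.
transitivity (\int[gamma_law 1]_x \int[m]_tau \int[gamma_law (b + n.+1%:R)%R]_g
    F (tau, g * expR (- (x / (b + n%:R))))%R).
  apply: eq_integral => x _; apply: eq_integral => tau _; apply: eq_integral => g _ /=.
  by rewrite /h/= /clocks/= /upd eqxx Fn.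
pose h2 (p : (R * TT) * R) : TT * R := (p.1.2, p.2 * expR (- (p.1.1 / (b + n%:R))))%R.
have mh2 : measurable_fun setT h2.
  apply/measurable_fun_pairP; split.
    exact: (measurableT_comp measurable_snd measurable_fst).
  apply: measurable_funM; first exact: measurable_snd.
  apply: (measurableT_comp (@measurable_expR R)); apply: measurable_funN.
  apply: measurable_funM; last exact: measurable_cst.
  exact: (measurableT_comp measurable_fst measurable_fst).
have mF2 : measurable_fun setT (F \o h2) by exact: measurableT_comp.
pose f2 (p : R * TT) := \int[gamma_law (b + n.+1%:R)%R]_g F (p.2, g * expR (- (p.1 / (b + n%:R))))%R.
have mf2 : measurable_fun setT f2.
  exact: (@measurable_fun_integral_on _ _ _ _ R (gamma_pr (bn n.+1)) setT _ measurableT mF2 (fun p => F0 _)).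
have f20 p : 0 <= f2 p by apply: integral_ge0 => g _; exact: F0.
apply: (etrans (tonelli_on (gamma_pr (@ltr01 R)) m (D1 := setT) (D2 := setT) measurableT measurableT mf2 f20)).
apply: eq_integral => tau _; rewrite /f2/=.
have mp : measurable_fun setT (fun g : R => F (tau, g)).
  exact: (measurableT_comp mF (@pair1_measurable _ _ _ _ tau)).
rewrite (_ : (b + n.+1%:R)%R = (b + n%:R + 1)%R); last by rewrite -addrA natr1.
exact: (beta_gamma (bn n) mp (fun g => F0 _)).
Qed.

(** By [beta_gamma], decaying along one birth turns a Gamma variable of index
    [b + l + 1] into one of index [b + l]; this is iterated from [n] down to [k]. *)
Lemma gamma_backwards k n (F : TT * R -> \bar R) : (k <= n)%N ->
  measurable_fun setT F -> (forall p, 0 <= F p) ->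
  (forall tau tau' g, (forall q, (forall l, (k <= l)%N -> q != (e, l)) -> tau q = tau' q) ->
     F (tau, g) = F (tau', g)) ->
  \int[m]_tau \int[gamma_law (b + n%:R)%R]_g F (tau, g * decay b (clocks tau e) k n)%R =
  \int[m]_tau \int[gamma_law (b + k%:R)%R]_g F (tau, g).
Proof.
move=> kn mF F0 Fk; rewrite -(subnKC kn); elim: (n - k)%N => [|l IH].
  rewrite addn0; apply: eq_integral => tau _; apply: eq_integral => g _.
  by rewrite decay0 mulr1.
apply: (etrans _ IH); rewrite addnS.
pose h (p : TT * R) : TT * R := (p.1, p.2 * decay b (clocks p.1 e) k (k + l))%R.
have mh : measurable_fun setT h.
  apply/measurable_fun_pairP; split; first exact: measurable_fst.
  apply: measurable_funM; first exact: measurable_snd.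
  exact: (measurableT_comp (measurable_decay _ _) measurable_fst).
have mFh : measurable_fun setT (F \o h) by exact: measurableT_comp.
apply: (etrans _ (@one_step (k + l)%N (F \o h) mFh (fun p => F0 _) _)); last first.
  move=> tau g x; rewrite /h/=.
  rewrite (@eq_decay _ _ (clocks (upd (e, (k + l)%N) x tau) e) (clocks tau e)); last first.
    move=> i /andP[_ il]; rewrite /clocks /upd.
    by rewrite xpair_eqE eqxx/= ltn_eqF.
  by apply: Fk => q qe; rewrite /upd (negbTE (qe _ (leq_addr _ _))).
apply: eq_integral => tau _; apply: eq_integral => g _; rewrite /h/=.
congr (F (_, _)); rewrite (decayS b _ (leq_addr l k)).
by rewrite -[RHS]mulrA; congr (_ * _)%R; exact: mulrC.
Qed.

Let gamma_decay n (phi : R -> \bar R) : measurable_fun setT phi -> (forall x, 0 <= phi x) ->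
  \int[m]_tau \int[gamma_law (b + n%:R)%R]_g phi (g * decay b (clocks tau e) 0 n)%R =
  \int[gamma_law b]_x phi x.
Proof.
move=> mphi phi0.
have := @gamma_backwards 0 n (fun p => phi p.2) (leq0n n) (measurableT_comp mphi measurable_snd)
  (fun p => phi0 _) (fun _ _ _ _ => erefl).
move=> /= ->; rewrite addr0 integral_cst//.
by rewrite [X in _ * X](_ : _ = 1) ?mule1//; exact: probability_setT.
Qed.

(* the distance to the limit is at most that of a gamma variable to its mean *)
Let dev n : \bar R := (b / Num.sqrt (b + n%:R))%:E.

Let mean_decay n : \int[m]_tau (decay b (clocks tau e) 0 n)%:E = (b / (b + n%:R))%:E.
Proof.
have mabs : measurable_fun setT (fun x : R => (`|x|)%:E).
  by apply/measurable_EFinP; exact: (@normr_measurable R setT).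
have abs0 (x : R) : 0 <= (`|x|)%:E by rewrite lee_fin.
have size (c : R) : (0 < c)%R -> \int[gamma_law c]_x (`|x : R|)%:E = c%:E.
  move=> c0; have c1 : (0 < c + 1)%R by rewrite addr_gt0.
  transitivity (c%:E * \int[gamma_law (c + 1)%R]_x (cst 1 (x : R))).
    apply: (etrans _ (gamma_law_size c0 (measurable_cst _) (fun _ => lee_tofin ler01))).
    by apply: eq_integral => x _; rewrite mule1.
  rewrite -[RHS]mule1; congr (_ * _); apply: (etrans (integral_cst _ measurableT _)).
  by rewrite mul1e; exact: gamma_lawT.
have h := etrans (gamma_decay n mabs abs0) (size b b0).
have md : measurable_fun setT (fun tau : TT => (decay b (clocks tau e) 0 n)%:E).
  by apply/measurable_EFinP; exact: measurable_decay.
have d0 (tau : TT) : 0 <= (decay b (clocks tau e) 0 n)%:E by rewrite lee_fin decay_ge0.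
have bE : b%:E = (b + n%:R)%:E * \int[m]_tau (decay b (clocks tau e) 0 n)%:E.
  rewrite -h -ge0_integralZl// ?lee_fin ?ltW//; apply: eq_integral => tau _.
  rewrite -(size (b + n%:R)%R (bn n)) muleC -ge0_integralZl//.
  apply: eq_integral => g _; rewrite normrM EFinM muleC; congr (_%:E * _).
  by rewrite ger0_norm ?decay_ge0.
have fin : \int[m]_tau (decay b (clocks tau e) 0 n)%:E \is a fin_num.
  rewrite ge0_fin_numE ?integral_ge0//; move: bE.
  case: (\int[m]_tau _) => [r _|/esym/eqP|/esym/eqP] //; first exact: ltry.
  - by rewrite gt0_muley ?lte_fin.
move: bE; rewrite -(fineK fin) -EFinM => -[bE]; congr (_%:E).
have n0 : (b + n%:R != 0)%R by rewrite gt_eqF.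
by apply: (mulfI n0); rewrite -bE mulrC divfK.
Qed.

Let mdist n (k : nat) : measurable_fun setT
  (fun p : TT * R => (`| `|p.2| * decay b (clocks p.1 e) 0 k - urn_size b (clocks p.1 e) n|)%:E).
Proof.
apply/measurable_EFinP; apply: (measurableT_comp (@normr_measurable R setT)).
apply: measurable_funB; last exact: (measurableT_comp (measurable_urn_size _) measurable_fst).
apply: measurable_funM; last exact: (measurableT_comp (measurable_decay _ _) measurable_fst).
exact: (measurableT_comp (@normr_measurable R setT) measurable_snd).
Qed.

Let dist_limit k n : (k <= n)%N ->
  \int[m]_tau \int[gamma_law (b + n%:R)%R]_g
     (`| `|g| * decay b (clocks tau e) 0 n - urn_size b (clocks tau e) k|)%:E <= dev k.
Proof.
move=> kn; pose F (p : TT * R) := (`| `|p.2| * decay b (clocks p.1 e) 0 k - urn_size b (clocks p.1 e) k|)%:E.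
have F0 p : 0 <= F p by rewrite lee_fin.
have Fk tau tau' g : (forall q, (forall l, (k <= l)%N -> q != (e, l)) -> tau q = tau' q) ->
    F (tau, g) = F (tau', g).
  move=> h; have cl l : (0 <= l < k)%N -> clocks tau e l = clocks tau' e l.
    move=> /andP[_ lk]; apply: h => l' kl'; apply/negP => /eqP[ll'].
    by move: lk; rewrite ll' ltnNge kl'.
  by rewrite /F/= /urn_size (eq_decay b cl).
have := gamma_backwards kn (mdist k k) F0 Fk; rewrite -/F => E.
apply: (@le_trans _ _ (\int[m]_tau \int[gamma_law (b + k%:R)%R]_g F (tau, g))).
  rewrite le_eqVlt; apply/orP; left; apply/eqP; apply: (etrans _ E).
  apply: eq_integral => tau _; apply: eq_integral => g _; rewrite /F/=.
  congr (`|_ - _|%:E); rewrite (decay_cat b _ (leq0n k) kn) normrM.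
  by rewrite (ger0_norm (decay_ge0 _ _ _ _)) -mulrA [(decay _ _ k n * _)%R]mulrC.
apply: (@le_trans _ _ (\int[m]_tau ((decay b (clocks tau e) 0 k)%:E * (Num.sqrt (b + k%:R))%:E))).
  have mle := @measurable_fun_integral_on _ _ _ _ R (gamma_pr (bn k)) setT _ measurableT (mdist k k) F0.
  apply: (ge0_le_integral m measurableT _ mle).
  - by move=> tau _; apply: integral_ge0 => g _; exact: F0.
  - apply: emeasurable_funM; last exact: measurable_cst.
    by apply/measurable_EFinP; exact: measurable_decay.
  move=> tau _; have d0 : 0 <= (decay b (clocks tau e) 0 k)%:E by rewrite lee_fin decay_ge0.
  apply: (le_trans _ (lee_wpmul2l d0 (gamma_law_abs_dev (bn k)))).
  have mabs : measurable_fun setT (fun g : R => (`| `|g| - (b + k%:R)|)%:E).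
    apply/measurable_EFinP; apply: (measurableT_comp (@normr_measurable R setT)).
    by apply: measurable_funB; [exact: (@normr_measurable R setT)|exact: measurable_cst].
  rewrite -(ge0_integralZl (gamma_law (b + k%:R)%R) measurableT mabs (fun _ _ => normr_ge0 _) d0).
  rewrite le_eqVlt; apply/orP; left; apply/eqP; apply: eq_integral => g _.
  rewrite /F/= /urn_size -EFinM -mulrBl normrM mulrC.
  by rewrite (ger0_norm (decay_ge0 _ _ _ _)).
have md : measurable_fun setT (fun tau : TT => (decay b (clocks tau e) 0 k)%:E).
  by apply/measurable_EFinP; exact: measurable_decay.
have d0 (tau : TT) : setT tau -> 0 <= (decay b (clocks tau e) 0 k)%:E by rewrite lee_fin decay_ge0.
rewrite (ge0_integralZr m measurableT md d0); last by rewrite lee_fin sqrtr_ge0.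
rewrite mean_decay -EFinM lee_fin; have sq0 : (0 < Num.sqrt (b + k%:R))%R by rewrite sqrtr_gt0.
have aux (x s : R) : x = (s * s)%R -> s != 0%R -> (b / x * s <= b / s)%R.
  by move=> -> s0; rewrite invfM mulrA divfK.
have sE : (b + k%:R = Num.sqrt (b + k%:R) * Num.sqrt (b + k%:R))%R.
  exact: (esym (sqr_sqrtr (ltW (bn k)))).
exact: (aux _ _ sE (lt0r_neq0 sq0)).
Qed.

Let size_dist k n : (k <= n)%N ->
  \int[m]_tau (`|urn_size b (clocks tau e) n - urn_size b (clocks tau e) k|)%:E <= dev n + dev k.
Proof.
move=> kn; pose F j (p : TT * R) := (`| `|p.2| * decay b (clocks p.1 e) 0 n - urn_size b (clocks p.1 e) j|)%:E.
have F0 j p : 0 <= F j p by rewrite lee_fin.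
have mF j : measurable_fun setT (F j) by exact: mdist.
have mFi j : measurable_fun setT (fun tau : TT => \int[gamma_law (b + n%:R)%R]_g F j (tau, g)).
  exact: (@measurable_fun_integral_on _ _ _ _ R (gamma_pr (bn n)) setT _ measurableT (mF j) (F0 j)).
have Fi0 j tau : setT tau -> 0 <= \int[gamma_law (b + n%:R)%R]_g F j (tau, g).
  by move=> _; apply: integral_ge0 => g _; exact: F0.
apply: (le_trans _ (leeD (dist_limit (leqnn n)) (dist_limit kn))).
rewrite -(ge0_integralD m measurableT (Fi0 n) (mFi n) (Fi0 k) (mFi k)).
apply: (ge0_le_integral m measurableT).
- by move=> tau _; rewrite lee_fin.
- apply/measurable_EFinP; apply: (measurableT_comp (@normr_measurable R setT)).
  by apply: measurable_funB; exact: measurable_urn_size.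
- by apply: emeasurable_funD; exact: mFi.
move=> tau _.
have mFp j : measurable_fun setT (fun g : R => F j (tau, g)).
  exact: (measurableT_comp (mF j) (@pair1_measurable _ _ _ _ tau)).
have Fp0 j (g : R) : setT g -> 0 <= F j (tau, g) by move=> _; exact: F0.
rewrite -(ge0_integralD (gamma_law (b + n%:R)%R) measurableT (Fp0 n) (mFp n) (Fp0 k) (mFp k)).
set c := (`|_ - _|)%:E.
have cE : c = \int[gamma_law (b + n%:R)%R]_g (cst c g).
  apply: esym; apply: (etrans (integral_cst _ measurableT _)).
  by rewrite [X in _ * X](gamma_lawT (bn n)) mule1.
rewrite cE; apply: (ge0_le_integral _ measurableT).
- by move=> g _; rewrite lee_fin.
- exact: measurable_cst.
- by apply: emeasurable_funD; exact: mFp.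
move=> g _; rewrite /F/= -EFinD lee_fin.
by apply: (le_trans (ler_distD (`|g| * decay b (clocks tau e) 0 n)%R _ _)); rewrite [X in (X + _)%R]distrC.
Qed.

Let dev_pow4 j : (dev (4 ^ j) <= (b / 2 ^+ j)%:E).
Proof.
rewrite lee_fin ler_pM2l// lef_pV2 ?posrE ?exprn_gt0 ?sqrtr_gt0//.
rewrite -[leLHS]ger0_norm ?exprn_ge0// -sqrtr_sqr; apply: ler_wsqrtr.
rewrite -exprM mulnC exprM -natrX (_ : (2 ^ 2)%N = 4%N)// natrX.
by rewrite lerDr ltW.
Qed.

Lemma urn_size_cvg : {ae m, forall tau,
  urn_size b (clocks tau e) (4 ^ k) @[k --> \oo] --> urn_limit b (clocks tau e)}.
Proof.
pose u (tau : TT) k := urn_size b (clocks tau e) (4 ^ k).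
have mu k : measurable_fun setT (fun tau => u tau k) by exact: measurable_urn_size.
have mf k : measurable_fun setT (fun tau : TT => telescope (u tau) k) by exact: measurable_funB.
have c0 : (0 <= 4 * b)%R by rewrite mulr_ge0// ltW.
have bd k : \int[m]_tau (`|telescope (u tau) k|)%:E <= (4 * b / (2 ^ k.+1)%:R)%:E.
  apply: (le_trans (size_dist (leq_pexp2l _ (leqnSn k)))) => //.
  apply: (le_trans (leeD (dev_pow4 k.+1) (dev_pow4 k))).
  rewrite -EFinD lee_fin natrX exprS.
  have p0 : (0 < 2 ^+ k :> R)%R by rewrite exprn_gt0.
  have q0 : (0 <= b / 2 ^+ k)%R by rewrite divr_ge0// ltW.
  rewrite invfM !mulrA; have -> : (b / 2 / 2 ^+ k = b / 2 ^+ k / 2)%R by rewrite mulrAC.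
  have -> : (4 * b / 2 / 2 ^+ k = 2 * (b / 2 ^+ k))%R by field; rewrite gt_eqF.
  by lra.
have := ae_summable c0 mf bd; apply: filterS => tau; rewrite telescopeK => /cvg_ex[l /= hl].
have cu : u tau k @[k --> \oo] --> (l + u tau 0%N)%R.
  rewrite (_ : (fun k => u tau k) = (fun k => (u tau k - u tau 0%N) + u tau 0%N)%R); last first.
    by apply/funext => k; rewrite subrK.
  by apply: cvgD => //; exact: cvg_cst.
by rewrite (urn_limitE cu).
Qed.

(** The limit does not change when the urn is observed one step later. *)
Lemma urn_size_shift_cvg : {ae m, forall tau,
  urn_size b (clocks tau e) (4 ^ k).+1 @[k --> \oo] --> urn_limit b (clocks tau e)}.
Proof.
pose f k (tau : TT) := (urn_size b (clocks tau e) (4 ^ k).+1 - urn_size b (clocks tau e) (4 ^ k))%R.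
have mf k : measurable_fun setT (f k) by apply: measurable_funB; exact: measurable_urn_size.
have c0 : (0 <= 4 * b)%R by rewrite mulr_ge0// ltW.
have bd k : \int[m]_tau (`|f k tau|)%:E <= (4 * b / (2 ^ k.+1)%:R)%:E.
  apply: (le_trans (size_dist (leqnSn _))).
  have d1 : dev (4 ^ k).+1 <= dev (4 ^ k).
    rewrite lee_fin ler_pM2l// lef_pV2 ?posrE ?sqrtr_gt0//.
    by apply: ler_wsqrtr; rewrite lerD2l ler_nat.
  apply: (le_trans (leeD (le_trans d1 (dev_pow4 k)) (dev_pow4 k))).
  rewrite -EFinD lee_fin natrX exprS.
  have p0 : (0 < 2 ^+ k :> R)%R by rewrite exprn_gt0.
  have -> : (4 * b / (2 * 2 ^+ k) = b / 2 ^+ k + b / 2 ^+ k)%R by field; rewrite gt_eqF.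
  by [].
apply: filterS2 (ae_summable c0 mf bd) urn_size_cvg => tau /cvg_series_cvg_0 h1 h2.
rewrite -[X in _ --> X]add0r.
rewrite (_ : (fun k => _) = (fun k => f k tau + urn_size b (clocks tau e) (4 ^ k))%R); last first.
  by apply/funext => k; rewrite /f subrK.
exact: cvgD.
Qed.

Let ramp_mean c j n :
  (\int[gamma_law b]_x (ramp c j x)%:E <=
   \int[m]_tau (ramp c j (urn_size b (clocks tau e) n))%:E + j%:R%:E * dev n) /\
  (\int[m]_tau (ramp c j (urn_size b (clocks tau e) n))%:E <=
   \int[gamma_law b]_x (ramp c j x)%:E + j%:R%:E * dev n).
Proof.
have r0 (x : R) : 0 <= (ramp c j x)%:E by rewrite lee_fin; case/andP: (ramp01 c j x).
have mr : measurable_fun setT (fun x : R => (ramp c j x)%:E).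
  by apply/measurable_EFinP; exact: (@measurable_ramp R).
have mra : measurable_fun setT (fun x : R => (ramp c j `|x|)%:E).
  by apply/measurable_EFinP; exact: (measurableT_comp (@measurable_ramp R c j) (@normr_measurable R setT)).
have E1 := etrans (gamma_decay n mra (fun x => r0 _)) (integral_gamma_law_abs b mr r0).
pose A (p : TT * R) := (ramp c j `|p.2 * decay b (clocks p.1 e) 0 n|)%:E.
pose B (p : TT * R) := (ramp c j (urn_size b (clocks p.1 e) n))%:E.
pose F (p : TT * R) := (`| `|p.2| * decay b (clocks p.1 e) 0 n - urn_size b (clocks p.1 e) n|)%:E.
have mF : measurable_fun setT F by exact: mdist.
have mA : measurable_fun setT A.
  apply: (measurableT_comp mra); apply: measurable_funM; first exact: measurable_snd.
  exact: (measurableT_comp (measurable_decay _ _) measurable_fst).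
have mB : measurable_fun setT B.
  by apply: (measurableT_comp mr); exact: (measurableT_comp (measurable_urn_size _) measurable_fst).
have A0 p : 0 <= A p by exact: r0.
have B0 p : 0 <= B p by exact: r0.
have F0 p : 0 <= F p by rewrite lee_fin.
have E2 : \int[m]_tau (ramp c j (urn_size b (clocks tau e) n))%:E =
    \int[m]_tau \int[gamma_law (b + n%:R)%R]_g B (tau, g).
  apply: eq_integral => tau _; apply: esym.
  have E := etrans (integral_cst (gamma_law (b + n%:R)%R) measurableT (B (tau, 0%R)))
    (etrans (congr1 _ (gamma_lawT (bn n))) (mule1 _)).
  by apply: (etrans _ E); apply: eq_integral => g _; reflexivity.
have AB p : A p <= B p + j%:R%:E * F p.
  rewrite /A /B /F -EFinM -EFinD lee_fin normrM (ger0_norm (decay_ge0 _ _ _ _)).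
  exact: ramp_lip.
have BA p : B p <= A p + j%:R%:E * F p.
  rewrite /A /B /F -EFinM -EFinD lee_fin normrM (ger0_norm (decay_ge0 _ _ _ _)) distrC.
  exact: ramp_lip.
have comb (G H : TT * R -> \bar R) : measurable_fun setT G -> measurable_fun setT H ->
    (forall p, 0 <= G p) -> (forall p, 0 <= H p) -> (forall p, G p <= H p + j%:R%:E * F p) ->
    \int[m]_tau \int[gamma_law (b + n%:R)%R]_g G (tau, g) <=
    \int[m]_tau \int[gamma_law (b + n%:R)%R]_g H (tau, g) + j%:R%:E * dev n.
  move=> mG mH G0 H0 GH.
  have j0 : 0 <= j%:R%:E :> \bar R by rewrite lee_fin.
  have mI (G' : TT * R -> \bar R) : measurable_fun setT G' -> (forall p, 0 <= G' p) ->
      measurable_fun setT (fun tau : TT => \int[gamma_law (b + n%:R)%R]_g G' (tau, g)).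
    move=> mG' G'0.
    exact: (@measurable_fun_integral_on _ _ _ _ R (gamma_pr (bn n)) setT _ measurableT mG' G'0).
  have I0 (G' : TT * R -> \bar R) : (forall p, 0 <= G' p) -> forall tau, setT tau ->
      0 <= \int[gamma_law (b + n%:R)%R]_g G' (tau, g).
    by move=> G'0 tau _; apply: integral_ge0 => g _; exact: G'0.
  apply: (le_trans _ (leeD2l _ (lee_wpmul2l j0 (dist_limit (leqnn n))))).
  rewrite -(ge0_integralZl m measurableT (mI F mF F0) (I0 F F0) j0).
  have jI0 (tau : TT) : setT tau -> 0 <= j%:R%:E * \int[gamma_law (b + n%:R)%R]_g F (tau, g).
    by move=> _; apply: mule_ge0 => //; exact: I0.
  have mjI : measurable_fun setT (fun tau : TT => j%:R%:E * \int[gamma_law (b + n%:R)%R]_g F (tau, g)).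
    by apply: emeasurable_funM; [exact: measurable_cst|exact: mI].
  rewrite -(ge0_integralD m measurableT (I0 H H0) (mI H mH H0) jI0 mjI).
  apply: (ge0_le_integral m measurableT (I0 G G0) (mI G mG G0)).
    by apply: emeasurable_funD => //; exact: mI.
  move=> tau _.
  have mp (G' : TT * R -> \bar R) : measurable_fun setT G' -> measurable_fun setT (fun g : R => G' (tau, g)).
    by move=> mG'; exact: (measurableT_comp mG' (@pair1_measurable _ _ _ _ tau)).
  have Fp0 (g : R) : setT g -> 0 <= F (tau, g) by move=> _; exact: F0.
  rewrite -(ge0_integralZl (gamma_law (b + n%:R)%R) measurableT (mp F mF) Fp0 j0).
  have Hp0 (g : R) : setT g -> 0 <= H (tau, g) by move=> _; exact: H0.
  have Gp0 (g : R) : setT g -> 0 <= G (tau, g) by move=> _; exact: G0.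
  have jF0 (g : R) : setT g -> 0 <= j%:R%:E * F (tau, g) by move=> _; exact: mule_ge0.
  have mjF : measurable_fun setT (fun g : R => j%:R%:E * F (tau, g)).
    by apply: emeasurable_funM; [exact: measurable_cst|exact: mp].
  rewrite -(ge0_integralD (gamma_law (b + n%:R)%R) measurableT Hp0 (mp H mH) jF0 mjF).
  apply: (ge0_le_integral _ measurableT Gp0 (mp G mG)).
    by apply: emeasurable_funD => //; exact: mp.
  by move=> g _; exact: GH.
have le_of_eq (x y : \bar R) : x = y -> x <= y by move=> ->.
pose add_dev (z : \bar R) := z + j%:R%:E * dev n.
split.
- apply: (le_trans (le_of_eq _ _ (esym E1))); apply: (le_trans (comb A B mA mB A0 B0 AB)).
  exact: (le_of_eq _ _ (congr1 add_dev (esym E2))).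
- apply: (le_trans (le_of_eq _ _ E2)); apply: (le_trans (comb B A mB mA B0 A0 BA)).
  exact: (le_of_eq _ _ (congr1 add_dev E1)).
Qed.

Let ramp_limit c j :
  \int[gamma_law b]_x (ramp c j x)%:E = \int[m]_tau (ramp c j (urn_limit b (clocks tau e)))%:E.
Proof.
have r0 (x : R) : 0 <= (ramp c j x)%:E by rewrite lee_fin; case/andP: (ramp01 c j x).
have L : \int[m]_tau (ramp c j (urn_size b (clocks tau e) (4 ^ k)))%:E @[k --> \oo] -->
    \int[m]_tau (ramp c j (urn_limit b (clocks tau e)))%:E.
  have mrs (f : TT -> R) : measurable_fun setT f -> measurable_fun setT (fun tau => (ramp c j (f tau))%:E).
    by move=> mf; apply/measurable_EFinP; exact: (measurableT_comp (@measurable_ramp R c j) mf).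
  have i1 : m.-integrable setT (cst 1 : TT -> \bar R).
    apply/integrableP; split; first exact: measurable_cst.
    rewrite (eq_integral (cst 1)) => [|tau _]; last by rewrite gee0_abs.
    rewrite integral_cst// mul1e; apply: (le_lt_trans (probability_le1 _ measurableT)).
    exact: ltry.
  have cv : {ae m, forall tau, setT tau ->
      (ramp c j (urn_size b (clocks tau e) (4 ^ k)))%:E @[k --> \oo] -->
      (ramp c j (urn_limit b (clocks tau e)))%:E}.
    have [N [mN N0 sub]] := urn_size_cvg; exists N; split => // tau nh; apply: sub => h.
    apply: nh => _; apply: cvg_EFin; first exact: nearW.
    by apply: (@continuous_cvg _ _ _ _ _ _ (ramp c j)) => //; exact: continuous_ramp.
  have bd : {ae m, forall (tau : TT) k, setT tau ->
      `|(ramp c j (urn_size b (clocks tau e) (4 ^ k)))%:E| <= cst 1 tau}.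
    apply: aeW => tau k _; rewrite gee0_abs// lee_fin.
    by case/andP: (ramp01 c j (urn_size b (clocks tau e) (4 ^ k))).
  have [_ _] := dominated_convergence measurableT (fun k => mrs _ (measurable_urn_size _))
    (mrs _ measurable_urn_limit) cv i1 bd.
  exact.
have Dv : j%:R%:E * dev (4 ^ k) @[k --> \oo] --> (0 : \bar R).
  apply: (@squeeze_cvge _ _ _ _ (cst 0) _ (fun k => (j%:R * b / 2 ^+ k)%:E)).
  - apply: nearW => k; apply/andP; split.
      by rewrite mule_ge0// lee_fin ?divr_ge0 ?sqrtr_ge0// ltW.
    rewrite -mulrA EFinM lee_wpmul2l ?lee_fin//; exact: dev_pow4.
  - exact: cvg_cst.
  - apply: cvg_EFin; first exact: nearW.
    rewrite (_ : fine \o _ = (fun k => (j%:R * b) * (2^-1) ^+ k)%R); last first.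
      by apply/funext => k; rewrite /= exprVn.
    rewrite -[X in _ --> X](mulr0 (j%:R * b)%R); apply: cvgM; first exact: cvg_cst.
    by apply: cvg_expr; rewrite gtr0_norm ?invf_lt1// ltr1n.
apply/eqP; rewrite eq_le; apply/andP; split.
- have fin0 : ((\int[m]_tau (ramp c j (urn_limit b (clocks tau e)))%:E) +? (0 : \bar R)).
    by rewrite fin_num_adde_defl.
  have h : \int[m]_tau (ramp c j (urn_size b (clocks tau e) (4 ^ k)))%:E +
      j%:R%:E * dev (4 ^ k) @[k --> \oo] --> \int[m]_tau (ramp c j (urn_limit b (clocks tau e)))%:E.
    by rewrite -[X in _ --> X]adde0; apply: cvgeD.
  rewrite -(cvg_lim (@ereal_hausdorff R) h); apply: lime_ge; first by apply/cvg_ex; eexists; exact: h.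
  by apply: nearW => k; case: (ramp_mean c j (4 ^ k)).
- rewrite -(cvg_lim (@ereal_hausdorff R) L).
  have fin0 : ((\int[gamma_law b]_x (ramp c j x)%:E) +? (0 : \bar R)) by rewrite fin_num_adde_defl.
  have h : \int[gamma_law b]_x (ramp c j x)%:E + j%:R%:E * dev (4 ^ k) @[k --> \oo] -->
      \int[gamma_law b]_x (ramp c j x)%:E.
    by rewrite -[X in _ --> X]adde0; apply: cvgeD => //; exact: cvg_cst.
  rewrite -(cvg_lim (@ereal_hausdorff R) h); apply: lee_lim.
  + by apply/cvg_ex; eexists; exact: L.
  + by apply/cvg_ex; eexists; exact: h.
  + by apply: nearW => k; case: (ramp_mean c j (4 ^ k)).
Qed.

(** The limit of the urn is a gamma variable: a gamma variable of large index is
    close to its mean, so that running the urn backwards from it gives almost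
    the size of the urn. *)
Lemma urn_limit_law A : measurable A ->
  m [set tau : TT | A (urn_limit b (clocks tau e))] = gamma_law b A.
Proof.
move=> mA; have -> : m [set tau : TT | A (urn_limit b (clocks tau e))] = mpush m measurable_urn_limit A by [].
apply: ray_unique => //.
- by rewrite /= /mpush /pushforward preimage_setT (le_lt_trans (probability_le1 _ measurableT))// ltry.
- rewrite /= /mpush /pushforward preimage_setT [RHS](gamma_lawT b0); exact: probability_setT.
move=> c; have mc : measurable (`]-oo, c]%classic : set R) by exact: measurable_itv.
have ray_lim d (S : measurableType d) (nu : probability S R) (X : S -> R) (mX : measurable_fun setT X) :
    \int[nu]_s (ramp c j (X s))%:E @[j --> \oo] --> nu (X @^-1` `]-oo, c]).
  have -> : nu (X @^-1` `]-oo, c]) = \int[nu]_s ((X s <= c)%R%:R : R)%:E.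
    rewrite -[X in nu X]setIT -(integral_indic nu measurableT).
      apply: eq_integral => s _; rewrite indicE; congr (_%:R%:E); congr nat_of_bool.
      by apply/idP/idP; rewrite !inE /= in_itv.
    by rewrite -[X in measurable X]setTI; exact: mX.
  have i1 : nu.-integrable setT (cst 1 : S -> \bar R).
    apply/integrableP; split; first exact: measurable_cst.
    rewrite (eq_integral (cst 1)) => [|tau _]; last by rewrite gee0_abs.
    rewrite integral_cst// mul1e; apply: (le_lt_trans (probability_le1 _ measurableT)).
    exact: ltry.
  apply: (@dominated_cvg _ _ _ nu setT measurableT _ _ (cst 1)) => //.
  - move=> j; apply/measurable_EFinP; exact: (measurableT_comp (@measurable_ramp R c j) mX).
  - by move=> s _; apply: cvg_EFin; [exact: nearW|exact: cvg_ramp].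
  - move=> j s _; case/andP: (ramp01 c j (X s)) => r0 r1.
    by rewrite gee0_abs ?lee_fin.
have l1 := ray_lim _ _ m _ measurable_urn_limit.
have l2 := ray_lim _ _ (gamma_pr b0) id (@measurable_id _ _ setT).
have E : (fun j => \int[m]_tau (ramp c j (urn_limit b (clocks tau e)))%:E) =
    (fun j => \int[gamma_law b]_x (ramp c j x)%:E) by apply/funext => j; rewrite ramp_limit.
rewrite E in l1.
exact: (etrans (esym (cvg_lim (@ereal_hausdorff R) l1)) (cvg_lim (@ereal_hausdorff R) l2)).
Qed.

End one_edge.
Definition urn_limits (a : K -> R) (tau : K * nat -> R) : K -> R :=
  fun e => urn_limit (a e) (clocks tau e).

Lemma measurable_urn_limits (a : K -> R) :
  measurable_fun setT (urn_limits a : TT -> fam_space (R := R) D).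
Proof. by apply: measurable_to_fam => e De; exact: measurable_urn_limit. Qed.

Lemma urn_limits_law (a : K -> R) : (forall e, D e -> (0 < a e)%R) ->
  product_law (fun e => gamma_law (a e)) (mpush m (measurable_urn_limits a)).
Proof.
move=> a0 s A us sD mA.
suff : m (urn_limits a @^-1` cyl s A) = \prod_(i <- s) gamma_law (a i) (A i) by [].
elim: s us sD => [|e s IH] us sD.
  rewrite big_nil (_ : urn_limits a @^-1` _ = setT); first exact: probability_setT.
  by apply/seteqP; split.
have /= /andP[es us'] := us.
have sD' : {in s, forall f, D f} by move=> f fs; apply: sD; rewrite inE fs orbT.
have De : D e by apply: sD; rewrite inE eqxx.
rewrite big_cons -(IH us' sD') -(urn_limit_law De (a0 e De) (mA e)).
have -> : urn_limits a @^-1` cyl (e :: s) A =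
    [set tau : TT | A e (urn_limit (a e) (clocks tau e))] `&` urn_limits a @^-1` cyl s A.
  apply/seteqP; split => tau /=.
    by move=> h; split => [|f fs]; apply: h; rewrite inE ?eqxx// fs orbT.
  by move=> [h1 h2] f; rewrite inE => /predU1P[->//|]; exact: h2.
apply: (block_indep (D1 := [set p | p.1 = e]) pm).
- have mu : measurable_fun setT (fun tau : TT => urn_limit (a e) (clocks tau e)).
    exact: measurable_urn_limit.
  have h := mu measurableT _ (mA e).
  by rewrite setTI in h.
- rewrite -[X in measurable X]setTI; apply: (measurable_urn_limits a) => //.
  exact: measurable_cyl.
- move=> tau tau' h; rewrite /= (_ : clocks tau e = clocks tau' e)//.
  by apply/funext => l; exact: h.
- move=> tau tau' h hs f fs; have := hs f fs; rewrite /urn_limits.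
  rewrite (_ : clocks tau f = clocks tau' f)//; apply/funext => l; apply: h => /= fe.
  by move: es; rewrite -fe fs.
Qed.

End kendall.

(** * The exponential law and its lack of memory *)

Section exponential.
Context {R : realType}.
Notation mu := (@lebesgue_measure R).
Local Open Scope ereal_scope.

(** Rays determine a law, so that this identifies Gamma(1) as exponential. *)
Lemma exp_law_ray (c : R) : gamma_law 1 (`]-oo, c]%classic : set R) =
  if (0 <= c)%R then (1 - expR (- c))%:E else 0.
Proof.
have -> : gamma_law 1 (`]-oo, c]%classic : set R) = \int[mu]_(x in `]0%R, c]) (expR (- x))%:E.
  rewrite gamma_lawE; last exact: measurable_itv.
  have -> : gamma_function 1%R = 1%R :> R.
    by apply: EFin_inj; rewrite gamma_functionE// gamma_integral1.
  have -> : (`]-oo, c]%classic : set R) `&` `]0%R, +oo[%classic = `]0%R, c]%classic.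
    by apply/seteqP; split => x /=; rewrite !in_itv/= andbT; [move=> [-> ->]|move=> /andP[-> ->]].
  apply: eq_integral => x; rewrite inE/= in_itv/= => /andP[x0 _].
  by rewrite subrr powRr0 invr1 !mul1r.
case: ifPn => c0; last by rewrite set_itv_ge ?integral_set0// bnd_simp -leNgt ltW// ltNge.
have me : measurable_fun (`]0%R, c]%classic : set (measurableTypeR R)) (fun x : R => (expR (- x))%:E).
  apply: measurable_funTS; apply/measurable_EFinP; apply: (measurableT_comp (@measurable_expR R)).
  exact: measurable_funN.
move: c0; rewrite le_eqVlt => /predU1P[<-|c0].
  by rewrite set_itvxx integral_set0 oppr0 expR0 subrr.
have /= := @exponential_prob_itv0c R 1 c.
rewrite mulN1r -EFinB => <-//.
rewrite /exponential_prob -[RHS]integral_itv_obnd_cbnd//.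
  apply: eq_integral => x; rewrite inE/= in_itv/= => /andP[x0 _].
  by rewrite exponential_pdfE ?ltW// mul1r mulN1r.
by apply: measurable_funTS; apply/measurable_EFinP; exact: measurable_exponential_pdf.
Qed.

Lemma exponential_prob_gamma A : measurable A -> exponential_prob (1 : R) A = gamma_law 1 A.
Proof.
move=> mA; have l01 : (0 < 1 :> R)%R by [].
have mp : measurable_fun [set: measurableTypeR R] (fun x : R => (exponential_pdf (1 : R) x)%:E).
  by apply/measurable_EFinP; exact: measurable_exponential_pdf.
have p0 (x : R) : 0 <= (exponential_pdf (1 : R) x)%:E by rewrite lee_fin exponential_pdf_ge0.
have mid : measurable_fun [set: measurableTypeR R] (id : measurableTypeR R -> R) by exact: measurable_id.
pose m1 : {measure set R -> \bar R} := mpush (mdens mu mp p0) mid.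
rewrite -[LHS]/(m1 A); apply: ray_unique => //.
- by rewrite /m1 /= /mpush /pushforward /mdens preimage_setT integral_exponential_pdf// ltry.
- by rewrite (gamma_lawT l01); exact: integral_exponential_pdf.
move=> c; rewrite exp_law_ray -[LHS]/(\int[mu]_(x in `]-oo, c]%classic) (exponential_pdf (1 : R) x)%:E).
case: ifPn => c0; last first.
  rewrite integral0_eq// => x; rewrite /= in_itv/= => xc.
  by rewrite lt0_exponential_pdf// (le_lt_trans xc)// ltNge.
have E : \int[mu]_(x in `]-oo, c]%classic) (exponential_pdf (1 : R) x)%:E =
    \int[mu]_(x in `[0%R, c]%classic) (exponential_pdf (1 : R) x)%:E.
  transitivity (\int[mu]_(x in `]-oo, c] `&` `[0%R, +oo[%classic) (exponential_pdf (1 : R) x)%:E).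
    rewrite [RHS]integral_mkcondr; apply: eq_integral => x _.
    rewrite patchE; case: ifPn => //; rewrite notin_setE/= in_itv/= andbT => /negP.
    by rewrite -ltNge => x0; rewrite lt0_exponential_pdf.
  congr (integral _ _ _); apply/seteqP; split => x /=; rewrite !in_itv/= ?andbT.
    by move=> [-> ->].
  by move=> /andP[-> ->].
move: c0 E; rewrite le_eqVlt => /predU1P[<-|c0] ->.
  by rewrite set_itv1 integral_set1 oppr0 expR0 subrr.
by have := @exponential_prob_itv0c R 1 c c0; rewrite mulN1r -EFinB => <-.
Qed.

(** Lack of memory. *)
Lemma exp_law_shift (u : R) (B : set R) : (0 <= u)%R -> measurable B ->
  gamma_law 1 [set x | (u < x)%R /\ B (x - u)%R] = (expR (- u))%:E * gamma_law 1 B.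
Proof.
move=> u0 mB.
have mS : measurable (`]u, +oo[%classic : set R) by exact: measurable_itv.
have mI : measurable_fun setT (fun x : R => (\1_(`]u, +oo[%classic : set R) x : R)%:E).
  exact/measurable_EFinP/measurable_indic.
have I0 (x : R) : 0 <= (\1_(`]u, +oo[%classic : set R) x : R)%:E by rewrite lee_fin indicE ler0n.
have ms : measurable_fun setT (fun x : R => x - u)%R by apply: measurable_funB => //; exact: measurable_cst.
pose m1 : {measure set R -> \bar R} := mpush (mdens (gamma_law 1) mI I0) ms.
have e0 : (0 <= expR (- u))%R by exact: expR_ge0.
pose m2 : {measure set R -> \bar R} := mscale (NngNum e0) (gamma_law 1).
have m1E C : measurable C -> m1 C = gamma_law 1 [set x | (u < x)%R /\ C (x - u)%R].
  move=> mC; have mC' : measurable [set x : R | C (x - u)%R].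
    by have := ms measurableT _ mC; rewrite setTI.
  rewrite /m1 /= /mpush /pushforward /mdens integral_indic//.
  by congr (gamma_law 1 _); apply/seteqP; split => x /=; rewrite in_itv/= andbT.
rewrite -m1E// -[RHS]/(m2 B); apply: ray_unique => //.
- rewrite m1E//; apply: (@le_lt_trans _ _ (gamma_law 1 setT)).
    apply: le_measure; rewrite ?inE//.
    by rewrite (_ : [set _ | _] = `]u, +oo[%classic)//; apply/seteqP; split => x /=; rewrite in_itv/= andbT// => -[].
  by rewrite gamma_lawT// ltry.
- rewrite m1E// [RHS](_ : _ = (expR (- u))%:E * gamma_law 1 setT)// gamma_lawT// mule1.
  have -> : [set x : R | (u < x)%R /\ setT (x - u)%R] = ~` `]-oo, u].
    apply/seteqP; split => x /=; rewrite in_itv/=; first by move=> [ux _]; apply/negP; rewrite -ltNge.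
    by move=> /negP; rewrite -ltNge.
  have h : gamma_law 1 (`]-oo, u]%classic : set R) + gamma_law 1 (~` `]-oo, u]%classic : set R) = 1.
    rewrite -measureU//; last by rewrite setICr.
      by rewrite setUv; exact: gamma_lawT.
    by apply: measurableC; exact: measurable_itv.
  move: h; rewrite exp_law_ray u0.
  case: (gamma_law 1 _) => [r| |] //; rewrite -EFinD => -[h]; congr (_%:E); lra.
move=> c; rewrite m1E; last exact: measurable_itv.
rewrite [RHS](_ : _ = (expR (- u))%:E * gamma_law 1 (`]-oo, c]%classic : set R))// exp_law_ray.
have -> : [set x : R | (u < x)%R /\ `]-oo, c]%classic (x - u)%R] = `]-oo, (c + u)%R] `\` `]-oo, u].
  apply/seteqP; split => x /=; rewrite !in_itv/= lerBlDr.
    by move=> [ux ->]; split => //; apply/negP; rewrite -ltNge.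
  by move=> [-> /negP]; rewrite -ltNge.
have [c0|c0] := leP 0%R c; last first.
  rewrite mule0 (_ : _ `\` _ = set0) ?measure0//; apply/seteqP; split => // x /=.
  by rewrite !in_itv/= => -[xc /negP]; rewrite -ltNge => ux; lra.
have fin1 : gamma_law 1 (`]-oo, (c + u)%R]%classic : set R) < +oo by rewrite exp_law_ray addr_ge0// ltry.
have E : gamma_law 1 ((`]-oo, (c + u)%R]%classic : set R) `\` `]-oo, u]) =
    gamma_law 1 (`]-oo, (c + u)%R]%classic : set R) - gamma_law 1 ((`]-oo, (c + u)%R]%classic : set R) `&` `]-oo, u]).
  by apply: measureD => //; exact: measurable_itv.
rewrite E setIidr; last by move=> x /=; rewrite !in_itv/= => /le_trans; apply; rewrite lerDr.
rewrite !exp_law_ray u0 addr_ge0// -EFinB -EFinM; congr (_%:E).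
by rewrite opprD expRD; ring.
Qed.

End exponential.

(** * First rings *)

Section clocks.
Context {R : realType} {V : choiceType}.
Variable adj : rel V.
Hypotheses (adj_sym : symmetric adj) (adj_irr : irreflexive adj).
Hypothesis adj_lf : locally_finite_graph adj.
Notation mu := (@lebesgue_measure R).
Notation WS := (fam_space (R := R) (edges adj)).
Notation DI := ([set p : set V * nat | edges adj p.1]).
Notation TT := (fam_space (R := R) DI).
Implicit Types (a : set V -> R) (tau : set V * nat -> R) (i j : V) (e : set V).

(** Time left before the next ring of an edge with current weight [a e]. *)
Definition next_ring a tau e : R := tau (e, 0%N) / a e.

Definition first_ring a tau i j : Prop :=
  adj i j /\ forall e, e \in star adj i -> e != [set i; j] ->
    next_ring a tau [set i; j] < next_ring a tau e.

(** The clocks that remain after the walk has spent the time [t] at [i] and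
    crossed the edge to [j]. *)
Definition elapse a i j (t : R) tau : set V * nat -> R := fun p =>
  if p.1 == [set i; j] then tau (p.1, p.2.+1)
  else if (p.1 \in star adj i) && (p.2 == 0%N) then tau p - a p.1 * t else tau p.

Definition next_vertex a tau i : option V :=
  xget None [set o | exists2 j, o = Some j & first_ring a tau i j].

(** The walk driven by the clocks: vertices and holding times. *)
Fixpoint clock_trace (n : nat) a i tau : option V * R :=
  match n, next_vertex a tau i with
  | 0%N, Some j => (Some i, next_ring a tau [set i; j])
  | 0%N, None => (Some i, 0)
  | n'.+1, Some j => clock_trace n' (bump [set i; j] a) j
                       (elapse a i j (next_ring a tau [set i; j]) tau)
  | _.+1, None => (None, 0)
  end.

Fixpoint rings_along (p : seq (set R * V)) a i tau : Prop :=
  if p is (A, j) :: p' then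
    [/\ first_ring a tau i j, A (next_ring a tau [set i; j]) &
      rings_along p' (bump [set i; j] a) j (elapse a i j (next_ring a tau [set i; j]) tau)]
  else True.

Lemma first_ring_unique a tau i j j' : first_ring a tau i j -> first_ring a tau i j' -> j = j'.
Proof.
move=> [ij h] [ij' h']; apply: contrapT => jj'.
have ne : [set i; j] != [set i; j'] :> set V.
  apply/eqP => /(edge_inj (adj_neq adj_irr ij)); exact: jj'.
have := h _ (mem_star adj_lf ij'); rewrite eq_sym ne => /(_ isT) h1.
have := h' _ (mem_star adj_lf ij) ne; by rewrite ltNge (ltW h1).
Qed.

Lemma next_vertexP a tau i j : next_vertex a tau i = Some j <-> first_ring a tau i j.
Proof.
rewrite /next_vertex; set S := [set o | _].
have S1 o : S o -> exists2 j, xget None S = Some j & first_ring a tau i j.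
  by move=> So; apply: (xgetPex None (P := S)); exists o.
split.
  case: (pselect (exists o, S o)) => [ex|none].
    by have [ov /S1 [j' -> fr]] := ex; case=> <-.
  by rewrite xgetPN// => o So; apply: none; exists o.
move=> fr; have [|j' -> fr'] := S1 (Some j); first by exists j.
by rewrite (first_ring_unique fr fr').
Qed.

Let follow_shift (z : nat -> option V * R) n p :
  follow (fun k => z k.+1) n p <-> follow z n.+1 p.
Proof.
elim: p n => [//|[A j] p IH] n /=; split => -[h1 h2 h3]; split => //; exact/IH.
Qed.

Lemma rings_alongP p a i tau : rings_along p a i tau <->
  follow (fun n => clock_trace n a i tau) 0 p.
Proof.
elim: p a i tau => [//|[A j] p IH] a i tau.
pose z n := clock_trace n a i tau.
suff : rings_along ((A, j) :: p) a i tau <->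
    [/\ (z 1%N).1 = Some j, A (z 0%N).2 & follow z 1 p] by [].
split.
  move=> [fr At /IH h]; have nx := (next_vertexP a tau i j).2 fr; split.
  - by rewrite /z /= nx; case: next_vertex.
  - by rewrite /z /= nx.
  - by apply: (iffLR (@follow_shift z 0 p)); apply: eq_follow h => k _; rewrite /z /= nx.
move=> [h1 At /(@follow_shift z 0 p) h]; case E : (next_vertex a tau i) => [j'|]; last first.
  by move: h1; rewrite /z /= E.
have jj' : j' = j by move: h1; rewrite /z /= E; case: (next_vertex _ _ j') => [?|] -[].
subst j'; split.
- exact/next_vertexP.
- by move: At; rewrite /z /= E.
- by apply/IH; apply: eq_follow h => k _; rewrite /z /= E.
Qed.

Lemma measurable_next_ring a e : edges adj e ->
  measurable_fun setT (fun tau : TT => next_ring a tau e).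
Proof.
move=> De; apply: measurable_funM; last exact: measurable_cst.
exact: (@measurable_coord R _ DI (e, 0%N) De).
Qed.

Lemma measurable_first_ring a i j : measurable [set tau : TT | first_ring a tau i j].
Proof.
have [ij|nij] := boolP (adj i j); last first.
  have -> : [set tau : TT | first_ring a tau i j] = set0.
    by apply/seteqP; split => // tau -[]; rewrite (negbTE nij).
  exact: measurable0.
have -> : [set tau : TT | first_ring a tau i j] = [set tau : TT | forall e, e \in star adj i ->
    e != [set i; j] -> next_ring a tau [set i; j] < next_ring a tau e].
  by apply/seteqP; split => tau; [case|].
have : {subset star adj i <= star adj i} by [].
elim: {1 3}(star adj i) => [|e s IH] ss.
  have -> : [set tau : TT | forall e, e \in [::] -> e != [set i; j] ->
    next_ring a tau [set i; j] < next_ring a tau e] = setT by apply/seteqP; split.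
  exact: measurableT.
have De : edges adj e by apply: (star_edges adj_lf (i := i)); apply: ss; rewrite inE eqxx.
have -> : [set tau : TT | forall f, f \in e :: s -> f != [set i; j] ->
    next_ring a tau [set i; j] < next_ring a tau f] = (if e == [set i; j] then setT else
    (fun tau : TT => next_ring a tau e - next_ring a tau [set i; j]) @^-1` `]0, +oo[%classic) `&`
    [set tau : TT | forall e, e \in s -> e != [set i; j] ->
       next_ring a tau [set i; j] < next_ring a tau e].
  apply/seteqP; split => tau.
    move=> h; split; last by move=> f fs; apply: h; rewrite inE fs orbT.
    case: ifPn => // ne; rewrite /= in_itv/= andbT subr_gt0.
    by apply: h => //; rewrite inE eqxx.
  move=> [h1 h2] f; rewrite inE => /predU1P[->|]; last exact: h2.
  by move: h1; case: ifPn => //; rewrite /= in_itv/= andbT subr_gt0.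
apply: measurableI; last by apply: IH => f fs; apply: ss; rewrite inE fs orbT.
case: ifP => // _; rewrite -[X in measurable X]setTI.
apply: measurable_funB; [exact: measurable_next_ring| |by []|exact: measurable_itv].
by apply: measurable_next_ring; exact: edge_edges.
Qed.

Lemma measurable_elapse a i j : edges adj [set i; j] -> measurable_fun setT
  ((fun p => elapse a i j p.1 p.2) : R * TT -> TT).
Proof.
move=> De; apply: measurable_to_fam => -[e l] /= Del; rewrite /elapse/=.
have mc k : measurable_fun setT (fun p : R * TT => (p.2 : set V * nat -> R) (e, k)).
  exact: (measurableT_comp (@measurable_coord R _ DI (e, k) Del) measurable_snd).
case: (e == _); first exact: mc.
case: (_ && _); last exact: mc.
apply: measurable_funB; first exact: mc.
by apply: measurable_funM; [exact: measurable_cst|exact: measurable_fst].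
Qed.

Lemma measurable_elapse_ring a i j : edges adj [set i; j] -> measurable_fun setT
  ((fun tau => elapse a i j (next_ring a tau [set i; j]) tau) : TT -> TT).
Proof.
move=> De.
have mp : measurable_fun setT (fun tau : TT => (next_ring a tau [set i; j], tau)).
  by apply/measurable_fun_pairP; split; [exact: measurable_next_ring|exact: measurable_id].
exact: (measurableT_comp (measurable_elapse a De) mp).
Qed.

Lemma measurable_rings_along p a i : measurable_steps p ->
  measurable [set tau : TT | rings_along p a i tau].
Proof.
elim: p a i => [|[A j] p IH] a i mp; first exact: measurableT.
have [ij|nij] := boolP (adj i j); last first.
  have -> : [set tau : TT | rings_along ((A, j) :: p) a i tau] = set0.
    by apply/seteqP; split => // tau -[[]]; rewrite (negbTE nij).
  exact: measurable0.
have De := edge_edges ij.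
have -> : [set tau : TT | rings_along ((A, j) :: p) a i tau] = ([set tau : TT | first_ring a tau i j] `&`
    (setT `&` (fun tau : TT => next_ring a tau [set i; j]) @^-1` A)) `&`
    (setT `&` (fun tau => elapse a i j (next_ring a tau [set i; j]) tau) @^-1`
       [set tau : TT | rings_along p (bump [set i; j] a) j tau]).
  by apply/seteqP; split => tau /=; [move=> [? ? ?]|move=> [[? [_ ?]] [_ ?]]].
apply: measurableI; first apply: measurableI.
- exact: measurable_first_ring.
- by apply: (measurable_next_ring a De) => //; exact: (mp (A, j) (mem_head _ _)).
- apply: (measurable_elapse_ring a De) => //; apply: IH => q qp.
  by apply: mp; rewrite inE qp orbT.
Qed.

Variable m : probability TT R.
Hypothesis pm : product_law (fun=> gamma_law 1) m.

Let big_sub (S : eqType) (s s' : seq S) (f : S -> \bar R) : uniq s -> uniq s' -> {subset s <= s'} ->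
  (\prod_(q <- s') (if q \in s then f q else 1) = \prod_(q <- s) f q)%E.
Proof.
move=> us us' ss; rewrite -big_mkcond -big_filter; apply: perm_big.
apply: uniq_perm => //; first exact: filter_uniq.
by move=> q; rewrite mem_filter; apply: andb_idr; exact: ss.
Qed.

Let measurable_later a i e0 (t : R) : (forall e, edges adj e -> 0 < a e) ->
  measurable [set tau : TT | forall e, e \in star adj i -> e != e0 -> t < next_ring a tau e].
Proof.
move=> a0; pose s0 := [seq (e, 0%N) | e <- star adj i & e != e0].
have s0D : {in s0, forall q, DI q}.
  by move=> _ /mapP[e + ->]; rewrite mem_filter => /andP[_ es]; exact: (star_edges adj_lf es).
have := measurable_cyl (D := DI) (s := s0) (A := fun q => `]a q.1 * t, +oo[%classic) s0D (fun q => measurable_itv _).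
have iff e tau : e \in star adj i -> (`]a e * t, +oo[%classic (tau (e, 0%N)) <-> t < next_ring a tau e).
  move=> es; rewrite /= in_itv/= andbT /next_ring ltr_pdivlMr 1?mulrC// a0//.
  exact: (star_edges adj_lf es).
rewrite (_ : cyl s0 _ = [set tau : TT | forall e, e \in star adj i -> e != e0 -> t < next_ring a tau e])//.
apply/seteqP; split => tau.
  move=> h e es ne; apply/iff => //; apply: (h (e, 0%N)).
  by apply/mapP; exists e => //; rewrite mem_filter ne.
move=> St _ /mapP[e + ->]; rewrite mem_filter => /andP[ne es].
by apply/iff => //; exact: St.
Qed.

(* given that no edge rings before [t], the remaining clocks have the original law *)
Let elapse_law a i j (t : R) (B : set TT) : adj i j -> 0 <= t ->
  (forall e, edges adj e -> 0 < a e) -> measurable B ->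
  m ([set tau : TT | forall e, e \in star adj i -> e != [set i; j] -> t < next_ring a tau e] `&`
     [set tau : TT | B (elapse a i j t tau)]) =
  ((expR (- (t * \sum_(e <- star adj i | e != [set i; j]) a e)))%:E * m B)%E.
Proof.
move=> ij t0 a0 mB; set e0 := [set i; j].
set S : set TT := [set tau | forall e, _ -> _ -> _].
pose s0 := [seq (e, 0%N) | e <- star adj i & e != e0].
have us0 : uniq s0.
  rewrite map_inj_uniq; last by move=> e f [].
  by apply: filter_uniq; exact: (uniq_star adj_irr adj_lf).
have s0P e l : ((e, l) \in s0) = [&& e \in star adj i, e != e0 & l == 0%N].
  apply/mapP/and3P; first by move=> [f]; rewrite mem_filter => /andP[fe fs] [-> ->].
  by move=> [es ee /eqP ->]; exists e => //; rewrite mem_filter ee.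
have s0D : {in s0, forall q, DI q}.
  by move=> [e l]; rewrite s0P => /and3P[es _ _]; exact: (star_edges adj_lf es).
pose sig (q : set V * nat) := if q.1 == e0 then (q.1, q.2.+1) else q.
have sig_inj (s : seq (set V * nat)) : {in s &, injective sig}.
  move=> [e l] [f k] _ _; rewrite /sig/=; case: eqP => [->|ne]; case: eqP => [->|nf] //.
  - by move=> [->].
  - by move=> [ef]; case: nf.
  - by move=> [ef]; case: ne.
have mel : measurable_fun setT (elapse a i j t : TT -> TT).
  exact: (measurableT_comp (measurable_elapse a (edge_edges ij)) (@pair1_measurable _ _ _ _ t)).
have c0 : 0 <= expR (- (t * \sum_(e <- star adj i | e != e0) a e)) by exact: expR_ge0.
(* the event that a cylinder is met after the time [t] is a cylinder *)
have key s A : uniq s -> {in s, forall q, DI q} -> (forall q, measurable (A q)) ->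
    m (S `&` [set tau : TT | cyl s A (elapse a i j t tau)]) =
    ((expR (- (t * \sum_(e <- star adj i | e != e0) a e)))%:E * m (cyl s A))%E.
  move=> us sD mA.
  pose s' := undup (s ++ s0).
  have us' : uniq s' by exact: undup_uniq.
  have sD' : {in s', forall q, DI q}.
    by move=> q; rewrite mem_undup mem_cat => /orP[/sD|/s0D].
  pose A' q := if q \in s then A q else setT.
  have mA' q : measurable (A' q) by rewrite /A'; case: ifP.
  have cylE : cyl s A = cyl s' A'.
    apply/seteqP; split => tau h q.
      by move=> _; rewrite /A'; case: ifP => // /h.
    by move=> qs; have := h q; rewrite mem_undup mem_cat qs /A' qs; exact.
  pose A2 (r : set V * nat) : set R := if r.1 == e0 then A' (r.1, r.2.-1)
    else if r \in s0 then [set x | (a r.1 * t < x)%R /\ A' r (x - a r.1 * t)%R] else A' r.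
  have mA2 r : measurable (A2 r).
    rewrite /A2; case: ifP => // _; case: ifP => // _.
    rewrite (_ : [set x | _ /\ _] = `]a r.1 * t, +oo[%classic `&` (setT `&` (fun x => x - a r.1 * t) @^-1` A' r)).
      apply: measurableI; first exact: measurable_itv.
      by apply: measurable_funB => //; exact: measurable_cst.
    by apply/seteqP; split => x /=; rewrite in_itv/= andbT; [move=> [? ?]|move=> [? [_ ?]]].
  have usig : uniq (map sig s') by rewrite map_inj_in_uniq//; exact: sig_inj.
  have sigD : {in map sig s', forall q, DI q}.
    by move=> _ /mapP[q /sD' Dq ->]; rewrite /sig; case: ifP.
  have SE : S `&` [set tau : TT | cyl s A (elapse a i j t tau)] = cyl (map sig s') A2.
    rewrite cylE; apply/seteqP; split => tau.
      move=> [St ct] _ /mapP[[e l] qs ->]; have := ct _ qs.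
      rewrite /elapse /sig /A2/=; case: (eqVneq e e0) => [->|ne]/=; first by rewrite eqxx.
      rewrite (negbTE ne) s0P ne/=; case: (boolP (_ && _)) => // /andP[es /eqP l0].
      move=> h; split => //; have := St e es ne.
      by rewrite /next_ring ltr_pdivlMr ?l0 1?mulrC// a0//; exact: (star_edges adj_lf es).
    move=> ct; split.
      move=> e es ne; have qs : (e, 0%N) \in map sig s'.
        apply/mapP; exists (e, 0%N); last by rewrite /sig/= (negbTE ne).
        by rewrite mem_undup mem_cat s0P es ne orbT.
      have := ct _ qs; rewrite /A2/= (negbTE ne) s0P es ne/= => -[h _].
      by rewrite /next_ring ltr_pdivlMr 1?mulrC// a0//; exact: (star_edges adj_lf es).
    move=> [e l] qs; have := ct _ (map_f sig qs).
    rewrite /elapse /sig /A2/=; case: (eqVneq e e0) => [->|ne]/=; first by rewrite eqxx.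
    by rewrite (negbTE ne) s0P ne/=; case: (boolP (_ && _)) => // _ [].
  rewrite SE (pm usig sigD mA2) cylE (pm us' sD' mA') big_map.
  transitivity (\prod_(q <- s') ((if q \in s0 then (expR (- (a q.1 * t)))%:E else 1) *
      gamma_law 1 (A' q)))%E.
    apply: eq_big_seq => -[e l] qs; rewrite /sig /A2/= s0P.
    case: (eqVneq e e0) => [->|ne]/=; first by rewrite eqxx andbF mul1e.
    rewrite (negbTE ne) s0P ne/=; case: (boolP (_ && _)) => [/andP[es _]|_]; last by rewrite mul1e.
    by apply: exp_law_shift => //; rewrite mulr_ge0// ltW// a0//; exact: (star_edges adj_lf es).
  rewrite big_split/= big_sub//; last by move=> q qs; rewrite mem_undup mem_cat qs orbT.
  congr (_ * _)%E; rewrite /s0 big_map big_filter prodEFin; congr (_%:E).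
  rewrite mulr_sumr -sumrN expR_sum; apply: eq_bigr => e _; by rewrite mulrC.
have mS : measurable S by exact: measurable_later.
have mI : measurable_fun setT (fun tau : TT => (\1_S tau : R)%:E).
  exact/measurable_EFinP/measurable_indic.
have I0 (tau : TT) : (0 <= (\1_S tau : R)%:E)%E by rewrite lee_fin indicE ler0n.
pose m1 : {measure set TT -> \bar R} := mpush (mdens m mI I0) mel.
pose m2 : {measure set TT -> \bar R} := mscale (NngNum c0) m.
have m1E C : measurable C -> m1 C = m (S `&` [set tau : TT | C (elapse a i j t tau)]).
  move=> mC; have mC' : measurable (elapse a i j t @^-1` C : set TT).
    by have := mel measurableT _ mC; rewrite setTI.
  by rewrite /m1 /= /mpush /pushforward /mdens integral_indic.
rewrite -m1E// -[RHS]/(m2 B); apply: fam_measure_unique => //.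
- rewrite m1E//; apply: (le_lt_trans (probability_le1 _ _)); last exact: ltry.
  by apply: measurableI => //; rewrite (_ : [set tau : TT | _] = setT)//; apply/seteqP; split.
- move=> s A us sD mA; rewrite m1E; first exact: key.
  exact: measurable_cyl.
Qed.

(** The first ring at a vertex: it occurs at the time [t] on the given edge with
    density [a e0 exp (- t sum a e)], and then leaves behind clocks with the
    original law. *)
Lemma first_ring_step a i j (F : R * TT -> \bar R) : adj i j ->
  (forall e, edges adj e -> 0 < a e) -> measurable_fun setT F -> (forall p, 0 <= F p)%E ->
  (\int[m]_(tau in [set tau : TT | first_ring a tau i j])
     F (next_ring a tau [set i; j], elapse a i j (next_ring a tau [set i; j]) tau) =
   \int[mu]_(t in `]0%R, +oo[)
     ((a [set i; j] * expR (- (t * \sum_(e <- star adj i) a e)))%:E * \int[m]_tau F (t, tau)))%E.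
Proof.
move=> ij a0 mF F0; set e0 := [set i; j]; have De : edges adj e0 by exact: edge_edges.
have ae0 : 0 < a e0 by exact: a0.
pose S (t : R) : set TT := [set tau | forall e, e \in star adj i -> e != e0 -> t < next_ring a tau e].
pose f1 (tau : TT) := ((\1_[set tau : TT | first_ring a tau i j] tau : R)%:E *
   F (next_ring a tau e0, elapse a i j (next_ring a tau e0) tau))%E.
have mp : measurable_fun setT (fun tau : TT => (next_ring a tau e0, elapse a i j (next_ring a tau e0) tau) : R * TT).
  apply/measurable_fun_pairP; split; first exact: measurable_next_ring.
  exact: measurable_elapse_ring.
have mf1 : measurable_fun setT f1.
  apply: emeasurable_funM; last exact: (measurableT_comp mF mp).
  by apply/measurable_EFinP; apply: measurable_indic; exact: measurable_first_ring.
have f10 tau : (0 <= f1 tau)%E by rewrite mule_ge0// lee_fin indicE ler0n.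
transitivity (\int[m]_tau f1 tau)%E.
  rewrite [LHS]integral_mkcond; apply: eq_integral => tau _; rewrite patchE /f1 indicE.
  by case: (_ \in _); rewrite ?mul1e ?mul0e.
apply: (etrans (resample_coord (i := (e0, 0%N)) (f := f1) pm De mf1 f10)).
pose G (t : R) : \bar R := (\int[m]_tau F (t, tau))%E.
have mG : measurable_fun setT G by exact: (@measurable_fun_integral_on _ _ _ _ R m setT _ measurableT mF F0).
have G0 t : (0 <= G t)%E by apply: integral_ge0 => tau _; exact: F0.
pose c (t : R) : R := expR (- (t * \sum_(e <- star adj i | e != e0) a e)).
have inner (x : R) : 0 < x -> (\int[m]_tau f1 (upd (e0, 0%N) x tau) = (c (x / a e0))%:E * G (x / a e0)%R)%E.
  move=> x0; have t0 : 0 <= x / a e0 by rewrite divr_ge0// ltW.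
  set t := x / a e0.
  have el (tau : TT) : elapse a i j t (upd (e0, 0%N) x tau) = elapse a i j t tau.
    apply/funext => -[e l]; rewrite /elapse /upd/= -/e0 !xpair_eqE.
    by case: (eqVneq e e0) => [->|ne]//=; rewrite (negbTE ne).
  have mel : measurable_fun setT (elapse a i j t : TT -> TT).
    exact: (measurableT_comp (measurable_elapse a De) (@pair1_measurable _ _ _ _ t)).
  have fE (tau : TT) : f1 (upd (e0, 0%N) x tau) = ((\1_(S t) tau : R)%:E * F (t, elapse a i j t tau))%E.
    rewrite /f1 /next_ring {2 3}/upd eqxx -/t el; congr (_%:E * _)%E.
    rewrite !indicE; congr (_%:R); congr nat_of_bool; apply/idP/idP; rewrite !inE.
      move=> [_ h] e es ne; have := h e es ne; rewrite /next_ring -/e0 /upd !xpair_eqE eqxx/=.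
      by rewrite (negbTE ne).
    move=> h; split => // e es ne; have := h e es ne; rewrite /next_ring -/e0 /upd !xpair_eqE eqxx/=.
    by rewrite (negbTE ne).
  rewrite (eq_integral (fun tau : TT => (\1_(S t) tau : R)%:E * F (t, elapse a i j t tau))%E) => [|tau _]; last exact: fE.
  have mS : measurable (S t) by exact: measurable_later.
  have mI : measurable_fun setT (fun tau : TT => (\1_(S t) tau : R)%:E).
    exact/measurable_EFinP/measurable_indic.
  have I0 (tau : TT) : (0 <= (\1_(S t) tau : R)%:E)%E by rewrite lee_fin indicE ler0n.
  pose m1 : {measure set TT -> \bar R} := mpush (mdens m mI I0) mel.
  pose m2 : {measure set TT -> \bar R} := mscale (NngNum (expR_ge0 (- (t * \sum_(e <- star adj i | e != e0) a e)))) m.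
  have mFt : measurable_fun setT (fun tau : TT => F (t, tau)).
    exact: (measurableT_comp mF (@pair1_measurable _ _ _ _ t)).
  have E : (\int[m1]_tau F (t, tau) = \int[m2]_tau F (t, tau))%E.
    apply: eq_measure_integral => B mB _.
    have mB' : measurable (elapse a i j t @^-1` B : set TT).
      by have := mel measurableT _ mB; rewrite setTI.
    rewrite /m1 /= /mpush /pushforward /mdens integral_indic//.
    exact: (elapse_law ij t0 a0 mB).
  rewrite (ge0_integral_mscale m measurableT _ mFt) in E; last by move=> tau _; exact: F0.
  rewrite -[RHS]E (ge0_integral_pushforward mel _ measurableT mFt) => [|tau _]; last exact: F0.
  have mFe : measurable_fun setT ((fun tau : TT => F (t, tau)) \o (elapse a i j t : TT -> TT)).
    exact: measurableT_comp.
  rewrite (ge0_integral_mdens m mI I0 mFe) => [|tau]; last exact: F0.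
  by apply: eq_integral => tau _; rewrite muleC.
pose g1 (x : R) : \bar R := (\int[m]_tau f1 (upd (e0, 0%N) x tau))%E.
have mg1 : measurable_fun setT g1.
  apply: (@measurable_fun_integral_on _ _ _ _ R m setT (fun p : R * TT => f1 (upd (e0, 0%N) p.1 p.2)) measurableT).
    exact: (measurableT_comp mf1 (measurable_upd _)).
  by move=> p; exact: f10.
have g10 x : (0 <= g1 x)%E by apply: integral_ge0 => tau _; exact: f10.
rewrite (integral_exp_law mg1 g10) (ge0_integral_scale ae0); last 2 first.
- apply: emeasurable_funM => //; apply/measurable_EFinP.
  by apply: (measurableT_comp (@measurable_expR R)); exact: measurable_funN.
- by move=> x _; rewrite mule_ge0// lee_fin expR_ge0.
have mc : measurable_fun setT (fun x : R => (expR (- (a e0 * x)))%:E * g1 (a e0 * x)%R)%E.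
  have ma : measurable_fun setT (fun x : R => a e0 * x) by apply: measurable_funM => //; exact: measurable_cst.
  apply: emeasurable_funM; last exact: (measurableT_comp mg1 ma).
  apply/measurable_EFinP; apply: (measurableT_comp (@measurable_expR R)).
  exact: measurable_funN.
rewrite -(ge0_integralZl mu (measurable_itv _) (measurable_funTS mc)) ?lee_fin ?(ltW ae0)//; last first.
  by move=> x _; rewrite mule_ge0// lee_fin expR_ge0.
apply: eq_integral => t; rewrite inE/= in_itv/= andbT => t0.
rewrite /g1 inner ?mulr_gt0// mulrAC divff ?mul1r ?gt_eqF// !muleA -!EFinM; congr (_%:E * _)%E.
rewrite -mulrA -expRD; congr (_ * expR _).
rewrite (bigD1_seq e0) ?uniq_star//=; last exact: mem_star.
by rewrite mulrDr opprD [a e0 * t]mulrC.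
Qed.

End clocks.

(** * The law of the walk driven by the clocks *)

Section local.
Context {R : realType} {I : choiceType} (D : set I).

(** Measurable events only depend on the coordinates in [D]. *)
Lemma measurable_fam_local (C : set (fam_space (R := R) D)) : measurable C ->
  forall w w', (forall i, D i -> w i = w' i) -> C w -> C w'.
Proof.
pose L : set (set (I -> R)) := [set C | forall w w', (forall i, D i -> w i = w' i) -> C w -> C w'].
suff : @measurable _ (fam_space (R := R) D) `<=` L by move=> h mC; exact: h.
apply: smallest_sub.
  split.
  - by [].
  - move=> B LB w w' ww' [_ nB]; split => // Bw'; apply: nB; apply: LB Bw' => i Di.
    by rewrite ww'.
  - by move=> F LF w w' ww' [n _ Fn]; exists n => //; exact: LF Fn.
by move=> _ [e [A [De mA ->]]] w w' ww' /=; rewrite ww'.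
Qed.

End local.

Lemma ae_mp2 d (T : measurableType d) (R : realType) (m : {measure set T -> \bar R}) (A B C : T -> Prop) :
  {ae m, forall x, A x} -> {ae m, forall x, B x} -> (forall x, A x -> B x -> C x) ->
  {ae m, forall x, C x}.
Proof. by move=> h1 h2 h; apply: filterS2 h1 h2. Qed.

Section clock_law.
Context {R : realType} {V : choiceType}.
Variable adj : rel V.
Hypotheses (adj_sym : symmetric adj) (adj_irr : irreflexive adj).
Hypothesis adj_lf : locally_finite_graph adj.
Notation mu := (@lebesgue_measure R).
Notation WS := (fam_space (R := R) (edges adj)).
Notation DI := ([set p : set V * nat | edges adj p.1]).
Notation TT := (fam_space (R := R) DI).
Implicit Types (a : set V -> R) (tau : set V * nat -> R) (i j : V) (e : set V).
Variable m : probability TT R.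
Hypothesis pm : product_law (fun=> gamma_law 1) m.

Let decay1 b (t : nat -> R) k : decay b t 0 k.+1 = expR (- (t 0%N / b)) * decay (b + 1) (fun l => t l.+1) 0 k.
Proof.
rewrite /decay big_nat_recl// addr0; congr (_ * _); apply: eq_bigr => l _.
by rewrite -addrA nat1r.
Qed.

(* the limits after the first ring are the boosted limits *)
Let urn_limits_elapse a i j : adj i j -> (forall e, edges adj e -> 0 < a e) ->
  {ae m, forall tau : TT, forall e, edges adj e ->
     urn_limits (bump [set i; j] a) (elapse adj a i j (next_ring a tau [set i; j]) tau) e =
     boost i (next_ring a tau [set i; j]) (urn_limits a tau) e}.
Proof.
move=> ij a0; set e0 := [set i; j]; have De0 : edges adj e0 by exact: edge_edges.
have all_cvg (s : seq (set V)) : {subset s <= star adj i} -> {ae m, forall tau : TT, forall e, e \in s ->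
    urn_size (a e) (clocks tau e) (4 ^ k) @[k --> \oo] --> urn_limit (a e) (clocks tau e)}.
  elim: s => [|e s IH] ss; first exact: aeW.
  have De : edges adj e by apply: (star_edges adj_lf (i := i)); apply: ss; rewrite inE eqxx.
  have h1 := urn_size_cvg pm De (a0 e De).
  have ss' : {subset s <= star adj i} by move=> f fs; apply: ss; rewrite inE fs orbT.
  have h2 := IH ss'.
  apply: (ae_mp2 h1 h2) => tau {}h1 {}h2 f; rewrite inE => /predU1P[->//|]; exact: h2.
have h1 := all_cvg _ (fun e es => es).
have h2 := urn_size_shift_cvg pm De0 (a0 e0 De0).
apply: (ae_mp2 h1 h2) => tau {}h1 {}h2 e De; set t := next_ring a tau e0.
have ae0 := a0 e0 De0.
rewrite /boost; case: asboolP => ei; last first.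
  have nes : e \notin star adj i by apply/negP => /(star_mem); exact: ei.
  have ne : e != e0 by apply: contraNneq nes => ->; exact: mem_star.
  rewrite /urn_limits /bump (negbTE ne); congr (urn_limit _ _); apply/funext => l.
  by rewrite /clocks /elapse/= -/e0 (negbTE ne) (negbTE nes).
have es : e \in star adj i by exact: edge_star.
have [ee|ne] := eqVneq e e0.
  rewrite ee /urn_limits; apply: urn_limitE; rewrite /bump eqxx.
  rewrite (_ : (fun k => _) = (fun k => urn_size (a e0) (clocks tau e0) (4 ^ k).+1 * expR t)).
    by apply: cvgM => //; exact: cvg_cst.
  apply/funext => k; rewrite /urn_size decay1.
  have -> : clocks (elapse adj a i j t tau) e0 = (fun l => clocks tau e0 l.+1).
    by apply/funext => l; rewrite /clocks /elapse/= -/e0 eqxx.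
  rewrite (_ : expR (- (clocks tau e0 0 / a e0)) = expR (- t))//.
  have -> : a e0 + 1 + (4 ^ k)%:R = a e0 + (4 ^ k).+1%:R by rewrite -natr1 -addrA [1 + _]addrC.
  by rewrite [expR _ * decay _ _ _ _]mulrC mulrA -[RHS]mulrA -expRD addNr expR0 mulr1.
rewrite /urn_limits; apply: urn_limitE; rewrite /bump (negbTE ne).
rewrite (_ : (fun k => _) = (fun k => urn_size (a e) (clocks tau e) (4 ^ k) * expR t)).
  by apply: cvgM; [exact: h1|exact: cvg_cst].
apply/funext => k; rewrite /urn_size -mulrA; congr (_ * _).
have : (0 < 4 ^ k)%N by rewrite expn_gt0.
case: (4 ^ k)%N => // n _; rewrite !decay1 mulrAC; congr (_ * _); last first.
  congr (decay _ _ _ _); apply/funext => l.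
  by rewrite /clocks /elapse/= -/e0 (negbTE ne) andbF.
rewrite -expRD; congr expR.
have ae := a0 e De.
rewrite /clocks /elapse/= -/e0 (negbTE ne) es/= mulrBl [a e * t]mulrC mulfK ?gt_eqF//.
by rewrite opprB addrC.
Qed.

Let law_of_limits a (a0 : forall e, edges adj e -> 0 < a e) :
  gamma_weights a (mpush m (measurable_urn_limits (D := edges adj) a)).
Proof. exact: (urn_limits_law pm). Qed.

Lemma bump_gt0 e0 a : (forall e, edges adj e -> 0 < a e) ->
  forall e, edges adj e -> 0 < bump e0 a e.
Proof. by move=> a0 e De; rewrite /bump; case: ifP => _; rewrite ?addr_gt0// a0. Qed.

(** Conditionally on the limits of the urns, the walk driven by the clocks has
    the law of the time-changed process with these weights. *)
Lemma rings_law p : measurable_steps p -> forall a i (C : set WS),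
  (forall e, edges adj e -> 0 < a e) -> measurable C ->
  (m ((urn_limits a @^-1` C : set TT) `&` [set tau : TT | rings_along adj p a i tau]) =
   \int[m]_(tau in (urn_limits a @^-1` C : set TT)) path_prob adj i p (urn_limits a tau))%E.
Proof.
elim: p => [|[A j] p IH] mp a i C a0 mC.
  have mC' : measurable (urn_limits a @^-1` C : set TT).
    by have := measurable_urn_limits (D := edges adj) a measurableT mC; rewrite setTI.
  rewrite (_ : [set tau : TT | _] = setT) ?setIT; last by apply/seteqP; split.
  by rewrite /= integral_cst// mul1e.
have mA : measurable A by exact: (mp (A, j) (mem_head _ _)).
have mp' : measurable_steps p by move=> q qp; apply: mp; rewrite inE qp orbT.
have mC' : measurable (urn_limits a @^-1` C : set TT).
  by have := measurable_urn_limits (D := edges adj) a measurableT mC; rewrite setTI.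
have [ij|nij] := boolP (adj i j); last first.
  rewrite [RHS]integral0_eq; last by move=> tau _ /=; rewrite (negbTE nij).
  rewrite (_ : _ `&` _ = set0) ?measure0//; apply/seteqP; split => // tau [_ [[]]].
  by rewrite (negbTE nij).
set e0 := [set i; j]; pose a' := bump e0 a.
have a'0 : forall e, edges adj e -> 0 < a' e by exact: bump_gt0.
pose t_ tau := next_ring a tau e0; pose el tau := elapse adj a i j (t_ tau) tau.
pose F (q : R * TT) : \bar R := ((\1_A q.1 : R)%:E * ((\1_C (boost i (- q.1) (urn_limits a' q.2)) : R)%:E *
  (\1_[set tau : TT | rings_along adj p a' j tau] q.2 : R)%:E))%E.
have mR : measurable [set tau : TT | rings_along adj p a' j tau].
  exact: measurable_rings_along.
have mbk : measurable_fun setT (fun q : R * TT => boost i (- q.1) (urn_limits a' q.2) : WS).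
  have mq : measurable_fun setT (fun q : R * TT => ((urn_limits a' q.2 : WS), - q.1)).
    apply/measurable_fun_pairP; split.
      exact: (measurableT_comp (measurable_urn_limits a') measurable_snd).
    by apply: measurable_funN; exact: measurable_fst.
  exact: (measurableT_comp (@measurable_boost R V adj i) mq).
have mF : measurable_fun setT F.
  apply: emeasurable_funM.
    by apply/measurable_EFinP; exact: (measurableT_comp (measurable_indic mA) measurable_fst).
  apply: emeasurable_funM.
    by apply/measurable_EFinP; exact: (measurableT_comp (measurable_indic mC) mbk).
  by apply/measurable_EFinP; exact: (measurableT_comp (measurable_indic mR) measurable_snd).
have F0 q : (0 <= F q)%E by rewrite !mule_ge0// lee_fin indicE ler0n.
have mFR : measurable [set tau : TT | first_ring adj a tau i j] by exact: measurable_first_ring.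
pose E := (urn_limits a @^-1` C : set TT) `&` [set tau : TT | rings_along adj ((A, j) :: p) a i tau].
have mE : measurable E by apply: measurableI => //; exact: measurable_rings_along.
have LHS1 : (m E = \int[m]_(tau in [set tau : TT | first_ring adj a tau i j]) F (t_ tau, el tau))%E.
  have EFR : E `<=` [set tau : TT | first_ring adj a tau i j] by move=> tau [_ []].
  have -> : (m E = \int[m]_(tau in [set tau : TT | first_ring adj a tau i j]) (\1_E tau : R)%:E)%E.
    by rewrite integral_indic// setIidl.
  have mel : measurable_fun setT (fun tau : TT => (t_ tau, el tau) : R * TT).
    apply/measurable_fun_pairP; split; first exact: (measurable_next_ring _ (edge_edges ij)).
    exact: (measurable_elapse_ring _ (edge_edges ij)).
  apply: (@ae_eq_integral _ _ _ m) => //.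
  - by apply/measurable_EFinP; apply: measurable_funTS; exact: measurable_indic.
  - by apply: measurable_funTS; exact: (measurableT_comp mF mel).
  have [N [mN N0 sub]] := urn_limits_elapse ij a0; exists N; split => // tau nh; apply: sub => h.
  apply: nh => fr; rewrite /F/= -!EFinM !indicE -!natrM !mulnb; congr (_%:R%:E); congr nat_of_bool.
  have Ceq : (boost i (- t_ tau) (urn_limits a' (el tau)) \in C) = (tau \in (urn_limits a @^-1` C : set TT)).
    have ag e : edges adj e -> boost i (- t_ tau) (urn_limits a' (el tau)) e = urn_limits a tau e.
      move=> De; rewrite -[in RHS](boostK i (t_ tau) (urn_limits a tau)).
      have he : urn_limits a' (el tau) e = boost i (t_ tau) (urn_limits a tau) e by exact: (h e De).
      by rewrite {1}/boost he.
    apply/idP/idP; rewrite !inE => hC; apply: (measurable_fam_local mC) hC => e De; first exact: ag.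
    by rewrite ag.
  rewrite Ceq; apply/idP/and3P.
    by move=> /set_mem[hC [_ hA hR]]; split; exact: mem_set.
  move=> [/set_mem hA /set_mem hC /set_mem hR]; apply: mem_set; split; first exact: hC.
  by split.
pose H (q : WS * R) : \bar R := ((\1_A q.2 : R)%:E * ((\1_C (boost i (- q.2) q.1) : R)%:E * path_prob adj j p q.1))%E.
have mbk2 : measurable_fun setT (fun q : WS * R => boost i (- q.2) q.1 : WS).
  have mq : measurable_fun setT (fun q : WS * R => (q.1, - q.2) : WS * R).
    apply/measurable_fun_pairP; split; first exact: measurable_fst.
    by apply: measurable_funN; exact: measurable_snd.
  exact: (measurableT_comp (@measurable_boost R V adj i) mq).
have mH : measurable_fun setT H.
  apply: emeasurable_funM.
    by apply/measurable_EFinP; exact: (measurableT_comp (measurable_indic mA) measurable_snd).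
  apply: emeasurable_funM.
    by apply/measurable_EFinP; exact: (measurableT_comp (measurable_indic mC) mbk2).
  exact: (measurableT_comp (measurable_path_prob adj_lf j mp') measurable_fst).
have H0 q : (0 <= H q)%E by rewrite !mule_ge0 ?path_prob_ge0// lee_fin indicE ler0n.
have FH t : (\int[m]_tau F (t, tau) =
    \int[mpush m (measurable_urn_limits (D := edges adj) a')]_w H (w, t))%E.
  have mHt : measurable_fun setT (fun w : WS => H (w, t)).
    exact: (measurableT_comp mH (@pair2_measurable _ _ _ _ t)).
  rewrite [RHS](ge0_integral_pushforward (measurable_urn_limits a') _ measurableT mHt) => [|w _]; last exact: H0.
  rewrite preimage_setT /F /H/=.
  pose Ct : set WS := [set w | C (boost i (- t) w)].
  have mCt : measurable Ct by have := @measurable_boost1 R V adj i (- t) measurableT _ mC; rewrite setTI.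
  have IHt := IH mp' a' j Ct a'0 mCt.
  have mCt' : measurable (urn_limits a' @^-1` Ct : set TT).
    by have := measurable_urn_limits (D := edges adj) a' measurableT mCt; rewrite setTI.
  transitivity ((\1_A t : R)%:E * m ((urn_limits a' @^-1` Ct : set TT) `&` [set tau : TT | rings_along adj p a' j tau]))%E.
    have mI : measurable ((urn_limits a' @^-1` Ct : set TT) `&` [set tau : TT | rings_along adj p a' j tau]).
      exact: measurableI.
    have -> : (m ((urn_limits a' @^-1` Ct : set TT) `&` [set tau : TT | rings_along adj p a' j tau]) =
       \int[m]_tau (\1_((urn_limits a' @^-1` Ct : set TT) `&` [set tau : TT | rings_along adj p a' j tau]) tau : R)%:E)%E.
      by rewrite integral_indic// setIT.
    have mI1 : measurable_fun setT (fun tau : TT => (\1_((urn_limits a' @^-1` Ct : set TT) `&`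
        [set tau : TT | rings_along adj p a' j tau]) tau : R)%:E).
      by apply/measurable_EFinP; exact: measurable_indic.
    have I01 (tau : TT) : setT tau -> (0 <= (\1_((urn_limits a' @^-1` Ct : set TT) `&`
        [set tau : TT | rings_along adj p a' j tau]) tau : R)%:E)%E by rewrite lee_fin indicE ler0n.
    have At0 : (0 <= (\1_A t : R)%:E)%E by rewrite lee_fin indicE ler0n.
    rewrite -(ge0_integralZl m measurableT mI1 I01 At0).
    apply: eq_integral => tau _; congr (_ * _)%E; rewrite -EFinM !indicE -natrM mulnb.
    congr (_%:R%:E); congr nat_of_bool; apply/andP/idP; rewrite !inE; by [].
  have mpp : measurable_fun setT (fun tau : TT => path_prob adj j p (urn_limits a' tau)).
    exact: (measurableT_comp (measurable_path_prob adj_lf j mp') (measurable_urn_limits a')).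
  have mpr : measurable_fun setT ((fun tau : TT => path_prob adj j p (urn_limits a' tau)) \_ (urn_limits a' @^-1` Ct : set TT)).
    by apply: (measurable_restrictT _ mCt').1; exact: measurable_funTS.
  have pr0 (tau : TT) : setT tau -> (0 <= ((fun tau : TT => path_prob adj j p (urn_limits a' tau)) \_ (urn_limits a' @^-1` Ct : set TT)) tau)%E.
    by move=> _; rewrite patchE; case: ifP => // _; exact: path_prob_ge0.
  have At0 : (0 <= (\1_A t : R)%:E)%E by rewrite lee_fin indicE ler0n.
  rewrite IHt integral_mkcond -(ge0_integralZl m measurableT mpr pr0 At0).
  apply: eq_integral => tau _ /=; congr (_ * _)%E; rewrite patchE indicE.
  rewrite (_ : (tau \in _) = (boost i (- t) (urn_limits a' tau) \in C)); last by apply/idP/idP; rewrite !inE.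
  by case: (_ \in C); rewrite ?mul1e ?mul0e.
rewrite -/E LHS1 (first_ring_step adj_irr adj_lf pm ij a0 mF F0).
have GC := gamma_conjugate_step adj_sym adj_irr adj_lf a0 ij (law_of_limits a0) (law_of_limits a'0) mH H0.
transitivity (\int[mu]_(t in `]0%R, +oo[)
   ((a e0 * expR (- (t * (\sum_(e <- star adj i) a e))))%:E *
    \int[mpush m (measurable_urn_limits (D := edges adj) a')]_w H (w, t)))%E.
  by apply: eq_integral => t _; rewrite FH.
apply: (etrans (esym GC)).
have mK : measurable_fun setT (path_prob adj i ((A, j) :: p) : WS -> \bar R) by exact: measurable_path_prob.
have mK1 : measurable_fun setT (fun w : WS => ((\1_C w : R)%:E * path_prob adj i ((A, j) :: p) w)%E).
  by apply: emeasurable_funM => //; by apply/measurable_EFinP; exact: measurable_indic.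
transitivity (\int[mpush m (measurable_urn_limits (D := edges adj) a)]_w
    ((\1_C w : R)%:E * path_prob adj i ((A, j) :: p) w))%E.
  apply: eq_integral => w _ /=; rewrite ij.
  have ms : measurable_fun (`]0%R, +oo[%classic : set (measurableTypeR R)) (fun u : R =>
      (leave_density adj i j w u * \1_A u)%:E * path_prob adj j p (boost i u w))%E.
    apply: measurable_funTS.
    exact: (measurableT_comp (measurable_step_fun adj_lf ij mA (measurable_path_prob adj_lf j mp'))
      (@pair1_measurable _ _ _ _ w)).
  have s0 (u : measurableTypeR R) : (`]0%R, +oo[%classic : set R) u ->
      (0 <= (leave_density adj i j w u * \1_A u)%:E * path_prob adj j p (boost i u w))%E.
    move=> _; apply: mule_ge0; last exact: path_prob_ge0.
    by rewrite lee_fin mulr_ge0 ?leave_density_ge0// indicE ler0n.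
  have C0 : (0 <= (\1_C w : R)%:E)%E by rewrite lee_fin indicE ler0n.
  rewrite -(ge0_integralZl mu (measurable_itv _) ms s0 C0).
  apply: eq_integral => u _; rewrite /H/= boostK EFinM.
  by rewrite !muleA; congr (_ * _)%E; rewrite muleC !muleA.
rewrite (ge0_integral_pushforward (measurable_urn_limits a) _ measurableT mK1) => [|w _]; last first.
  by rewrite mule_ge0 ?path_prob_ge0// lee_fin indicE ler0n.
rewrite preimage_setT [RHS]integral_mkcond; apply: eq_integral => tau _.
rewrite patchE (_ : (tau \in _) = (urn_limits a tau \in C)); last by apply/idP/idP; rewrite !inE.
rewrite -[LHS]/(((\1_C (urn_limits a tau) : R)%:E * path_prob adj i ((A, j) :: p) (urn_limits a tau))%E) indicE.
by case: (_ \in C); rewrite ?mul1e ?mul0e.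
Qed.

End clock_law.

(** * Almost sure existence of first rings *)

Section alive.
Context {R : realType} {V : choiceType}.
Variable adj : rel V.
Hypotheses (adj_irr : irreflexive adj).
Hypothesis adj_lf : locally_finite_graph adj.
Notation mu := (@lebesgue_measure R).
Notation DI := ([set p : set V * nat | edges adj p.1]).
Notation TT := (fam_space (R := R) DI).
Variable m : probability TT R.
Hypothesis pm : product_law (fun=> gamma_law 1) m.
Hypothesis has_nbr : forall i, exists j, adj i j.

Let measurable_ring a i j : measurable [set tau : TT | first_ring adj a tau i j].
Proof. exact: measurable_first_ring. Qed.

Let first_ring_prob a i j : adj i j -> (forall e, edges adj e -> 0 < a e) ->
  m [set tau : TT | first_ring adj a tau i j] =
  (a [set i; j] / \sum_(e <- star adj i) a e)%:E.
Proof.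
move=> ij a0.
have s0 : 0 < \sum_(e <- star adj i) a e.
  rewrite (bigD1_seq [set i; j]) ?uniq_star//=; last exact: mem_star.
  rewrite ltr_pwDl ?a0//; first exact: edge_edges.
  by rewrite big_seq_cond sumr_ge0// => e /andP[es _]; rewrite ltW// a0//; exact: (star_edges adj_lf es).
have m1 : measurable_fun setT (cst 1%E : R * TT -> \bar R) by exact: measurable_cst.
have := first_ring_step adj_irr adj_lf pm ij a0 m1 (fun _ => lee_tofin ler01).
rewrite integral_cst// mul1e => ->.
set s := \sum_(e <- _) _.
have c0 : (0 <= (a [set i; j] / s)%:E)%E.
  by rewrite lee_fin divr_ge0 ?ltW// a0//; exact: edge_edges.
rewrite -[RHS]mule1 -[in RHS](integral_exp_density s0).
have md : measurable_fun (`]0%R, +oo[%classic : set (measurableTypeR R)) (fun y : R => (s * expR (- (s * y)))%:E).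
  apply: measurable_funTS; apply/measurable_EFinP; apply: measurable_funM; first exact: measurable_cst.
  apply: (measurableT_comp (@measurable_expR R)); apply: measurable_funN.
  by apply: measurable_funM => //; exact: measurable_cst.
have d0 (y : measurableTypeR R) : (`]0%R, +oo[%classic : set R) y -> (0 <= (s * expR (- (s * y)))%:E)%E.
  by move=> _; rewrite lee_fin mulr_ge0 ?expR_ge0// ltW.
rewrite -(ge0_integralZl mu (measurable_itv _) md d0 c0); apply: eq_integral => t _.
have E1 : (\int[m]_tau (cst 1%E : R * TT -> \bar R) (t, tau) = 1)%E.
  transitivity (1%E * m setT)%E; first exact: (integral_cst m measurableT 1%E).
  by rewrite mul1e; exact: probability_setT.
apply: (etrans (congr1 (mule _) E1)).
rewrite mule1 -EFinM; congr (_%:E); rewrite mulrA divfK ?gt_eqF//.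
by rewrite [t * s]mulrC.
Qed.

Let measurable_ringU a i (s : seq V) :
  measurable (\big[setU/set0]_(j <- s) [set tau : TT | first_ring adj a tau i j]).
Proof. by apply: bigsetU_measurable => j _; exact: measurable_ring. Qed.

Let ring_memU a i (s : seq V) tau :
  (\big[setU/set0]_(j <- s) [set tau : TT | first_ring adj a tau i j]) tau ->
  exists2 j, j \in s & first_ring adj a tau i j.
Proof.
elim: s => [|j s IH]; first by rewrite big_nil.
rewrite big_cons => -[h|/IH[k ks h]]; first by exists j => //; rewrite inE eqxx.
by exists k => //; rewrite inE ks orbT.
Qed.

Let next_vertex_noneE a i : [set tau : TT | next_vertex adj a tau i = None] =
  ~` (\big[setU/set0]_(j <- nbrs adj i) [set tau : TT | first_ring adj a tau i j]).
Proof.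
apply/seteqP; split => tau /=.
  by move=> nx /ring_memU[j _ /(next_vertexP adj_irr adj_lf a tau i j).2]; rewrite nx.
move=> h; case E : (next_vertex adj a tau i) => [j|//]; exfalso; apply: h.
have fr := (next_vertexP adj_irr adj_lf a tau i j).1 E.
have : j \in nbrs adj i by rewrite mem_nbrs//; case: fr.
elim: (nbrs adj i) => [//|k s IH]; rewrite inE big_cons => /predU1P[<-|/IH]; [by left|by right].
Qed.

Let next_vertex_none a i : (forall e, edges adj e -> 0 < a e) ->
  m [set tau : TT | next_vertex adj a tau i = None] = 0%E.
Proof.
move=> a0; pose FR j := [set tau : TT | first_ring adj a tau i j].
have sum (s : seq V) : uniq s -> {subset s <= nbrs adj i} ->
    (m (\big[setU/set0]_(j <- s) FR j) = \sum_(j <- s) (a [set i; j] / \sum_(e <- star adj i) a e)%:E)%E.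
  elim: s => [|j s IH] us ss; first by rewrite !big_nil measure0.
  have /= /andP[js us'] := us.
  have ij : adj i j by rewrite -(mem_nbrs adj_lf); apply: ss; rewrite inE eqxx.
  have disj : FR j `&` \big[setU/set0]_(j <- s) FR j = set0.
    apply/seteqP; split => // tau [h /ring_memU[k ks h']].
    by move: js; rewrite (first_ring_unique adj_irr adj_lf h h') ks.
  rewrite !big_cons (measureU m (measurable_ring a i j) (measurable_ringU a i s) disj).
  congr (_ + _)%E; first exact: first_ring_prob.
  by apply: IH => // k ks; apply: ss; rewrite inE ks orbT.
have tot1 : (m (\big[setU/set0]_(j <- nbrs adj i) FR j) = 1)%E.
  rewrite sum ?uniq_nbrs// sumEFin -mulr_suml; congr (_%:E).
  rewrite /star big_map divff// gt_eqF//.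
  have [j ij] := has_nbr i.
  rewrite (bigD1_seq j) ?uniq_nbrs ?mem_nbrs//=.
  rewrite ltr_pwDl ?a0//; first exact: edge_edges.
  rewrite big_seq_cond sumr_ge0// => k /andP[kn _]; rewrite ltW// a0//; apply: edge_edges.
  by rewrite -(mem_nbrs adj_lf).
rewrite next_vertex_noneE (probability_setC m (measurable_ringU a i _)).
by rewrite [X in (_ - X)%E]tot1 subee.
Qed.

(** Almost surely, a strictly first ring occurs at every step. *)
Lemma clock_trace_alive n a i : (forall e, edges adj e -> 0 < a e) ->
  {ae m, forall tau : TT, (clock_trace adj n a i tau).1 <> None}.
Proof.
elim: n a i => [|n IH] a i a0.
  by apply: aeW => tau /=; case: (next_vertex _ _ _ _).
pose G j : set TT := [set tau | first_ring adj a tau i j ->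
  (clock_trace adj n (bump [set i; j] a) j (elapse adj a i j (next_ring a tau [set i; j]) tau)).1 <> None].
have aeG j : {ae m, forall tau : TT, G j tau}.
  have [ij|nij] := boolP (adj i j); last first.
    by apply: aeW => tau [ij _]; move: nij; rewrite ij.
  have [N [mN N0 sub]] := IH (bump [set i; j] a) j (@bump_gt0 R V adj [set i; j] a a0).
  pose F (q : R * TT) : \bar R := (\1_N q.2 : R)%:E.
  have mF : measurable_fun setT F.
    by apply/measurable_EFinP; exact: (measurableT_comp (measurable_indic mN) measurable_snd).
  have F0 q : (0 <= F q)%E by rewrite lee_fin indicE ler0n.
  have := first_ring_step adj_irr adj_lf pm ij a0 mF F0.
  rewrite [RHS]integral0_eq; last first.
    move=> t _; rewrite /F/= (_ : (\int[m]_tau (\1_N tau : R)%:E)%E = 0%E) ?mule0//.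
    by rewrite integral_indic// setIT.
  have mel := measurable_elapse_ring a (edge_edges ij).
  have mB : measurable ((fun tau : TT => elapse adj a i j (next_ring a tau [set i; j]) tau : TT) @^-1` N).
    by have := mel measurableT _ mN; rewrite setTI.
  have -> : (\int[m]_(tau in [set tau : TT | first_ring adj a tau i j])
       F (next_ring a tau [set i; j], elapse adj a i j (next_ring a tau [set i; j]) tau) =
     m (((fun tau : TT => elapse adj a i j (next_ring a tau [set i; j]) tau : TT) @^-1` N) `&`
        [set tau : TT | first_ring adj a tau i j]))%E.
    by rewrite -(integral_indic m (measurable_ring a i j) mB).
  move=> E; exists (((fun tau : TT => elapse adj a i j (next_ring a tau [set i; j]) tau : TT) @^-1` N) `&`
        [set tau : TT | first_ring adj a tau i j]); split => //.
    by apply: measurableI => //; exact: measurable_ring.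
  move=> tau /= nG; have [fr dead] : first_ring adj a tau i j /\ ~ ~ ((clock_trace adj n (bump [set i; j] a) j
      (elapse adj a i j (next_ring a tau [set i; j]) tau)).1 = None).
    split; first by apply: contrapT => nfr; apply: nG.
    by move=> nd; apply: nG.
  by split => //; apply: sub => /= nd; exact: dead.
have all_G (s : seq V) : {ae m, forall tau : TT, forall j, j \in s -> G j tau}.
  elim: s => [|j s IHs]; first exact: aeW.
  apply: (ae_mp2 (aeG j) IHs) => tau h1 h2 k; rewrite inE => /predU1P[->//|]; exact: h2.
have some : {ae m, forall tau : TT, next_vertex adj a tau i <> None}.
  exists [set tau : TT | next_vertex adj a tau i = None]; split.
  - by rewrite next_vertex_noneE; apply: measurableC; exact: measurable_ringU.
  - exact: next_vertex_none.
  - by move=> tau /= h; apply: contrapT => h'; exact: h.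
apply: (ae_mp2 (all_G (nbrs adj i)) some) => tau hG hs /=.
case E : (next_vertex adj a tau i) hs => [j|//] _.
have fr := (next_vertexP adj_irr adj_lf a tau i j).1 E.
by apply: (hG j) => //; rewrite mem_nbrs//; case: fr.
Qed.

End alive.

(** * The continuous-time walk follows its clocks *)

Section clock_path.
Context {R : realType} {V : choiceType}.
Variable adj : rel V.
Hypotheses (adj_sym : symmetric adj) (adj_irr : irreflexive adj).
Hypothesis adj_lf : locally_finite_graph adj.
Variables (i0 : V) (a : set V -> R) (tau : set V * nat -> R) (x : R -> option V).
Hypothesis a_gt0 : forall e, edges adj e -> 0 < a e.
Hypothesis tau_gt0 : forall e k, edges adj e -> 0 < tau (e, k).
Hypothesis xP : ct_errw_path adj i0 a (fun e k => tau (e, k)) x.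

Let jP : jump_path i0 x. Proof. by case: xP. Qed.

(* the remaining alarms of the weights [b] and the clocks [th] are those of the
   path after the time [s], of which [N e] have already rung *)
Let synchronous (b : set V -> R) (th : set V * nat -> R) (s : R) : Prop :=
  [/\ forall e, edges adj e -> 0 < b e,
      forall e k, edges adj e -> 0 < th (e, k) &
      exists N : set V -> nat, forall u v, adj u v ->
       (forall k, alarm a (fun e k => tau (e, k)) [set u; v] (k.+1 + N [set u; v]) =
          edge_clock x u v s + alarm b (fun e k => th (e, k)) [set u; v] k.+1) /\
       (forall k, (k <= N [set u; v])%N ->
          alarm a (fun e k => tau (e, k)) [set u; v] k <= edge_clock x u v s)].

Let alarm1 (b : set V -> R) (th : set V * nat -> R) e :
  alarm b (fun e k => th (e, k)) e 1 = next_ring b th e.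
Proof. by rewrite /alarm big_nat1 addr0 mulrC. Qed.

Let alarm_ge (b : set V -> R) (th : set V * nat -> R) e k : 0 < b e -> (forall k, 0 < th (e, k)) ->
  next_ring b th e <= alarm b (fun e k => th (e, k)) e k.+1.
Proof.
move=> b0 t0; rewrite -alarm1 /alarm big_nat1 [leRHS]big_nat_recl// lerDl.
by apply: sumr_ge0 => l _; rewrite mulr_ge0 ?invr_ge0 ?ltW// addr_gt0 ?ltr_wpDr.
Qed.

(* only the edges at [i] have running clocks while the path stays at [i] *)
Let edge_clock_const u v i s t : adj u v -> 0 <= s -> s <= t ->
  (forall r, s <= r -> r < t -> x r = Some i) ->
  edge_clock x u v t = edge_clock x u v s + (if [set u; v] \in star adj i then t - s else 0).
Proof.
move=> uv s0 st c; rewrite /edge_clock !(local_time_const jP _ s0 st c).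
have uv' := adj_neq adj_irr uv.
have -> : ([set u; v] \in star adj i) = (i == u) || (i == v).
  apply/idP/orP; first by move=> /star_mem[->|->]; rewrite eqxx; [left|right].
  by case=> /eqP ->; apply: edge_star => //; [exact: edge_edges|left|exact: edge_edges|right].
case: (eqVneq i u) => [iu|_]; case: (eqVneq i v) => [iv|_] //=.
- by case: uv'; rewrite -iu -iv.
- by rewrite addr0 addrAC.
- by rewrite addr0 addrA.
- by rewrite !addr0.
Qed.

(* an edge at [i] rings after [s] while the path is at [i] only at its
   remaining alarms *)
Let rings_at b th s t i j : synchronous b th s -> adj i j -> 0 <= s -> s < t ->
  (forall r, s <= r -> r < t -> x r = Some i) ->
  rings a (fun e k => tau (e, k)) x i j t ->
  exists k, t - s = alarm b (fun e k => th (e, k)) [set i; j] k.+1.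
Proof.
move=> [_ _ [N h]] ij s0 st c [k k1]; have [h1 h2] := h i j ij.
rewrite (edge_clock_const ij s0 (ltW st) c) mem_star// => E.
have [kN|Nk] := leqP k (N [set i; j]).
  have := h2 k kN; rewrite -E gerDl subr_le0 leNgt st; done.
exists (k - N [set i; j]).-1.
have := h1 (k - N [set i; j]).-1.
by rewrite prednK ?subn_gt0// subnK ?(ltnW Nk)// -E => /addrI.
Qed.

Let step b th n s i j : jump_time x n s -> x s = Some i -> synchronous b th s ->
  first_ring adj b th i j ->
  let t := next_ring b th [set i; j] in
  [/\ jump_time x n.+1 (s + t), x (s + t) = Some j &
      synchronous (bump [set i; j] b) (elapse adj b i j t th) (s + t)].
Proof.
move=> js xs sync [ij fr] t; have s0 := jump_time_ge0 js.
have [b0 th0 [N h]] := sync; have De : edges adj [set i; j] by exact: edge_edges.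
have t0 : 0 < t by rewrite divr_gt0 ?b0 ?th0.
have st : s < s + t by rewrite ltrDl.
have ijn := adj_neq adj_irr ij.
have left_at t' : s < t' -> (forall r, s <= r -> r < t' -> x r = Some i) ->
    \forall u \near t'^'-, x u = Some i.
  move=> st' c; apply: (left_path (e := t' - s)); first by rewrite subr_gt0.
  by move=> u; rewrite opprB addrC subrK => su ut; apply: c => //; exact: ltW.
have alive_at t' : s < t' -> (forall r, s <= r -> r < t' -> x r = Some i) -> x t' <> None.
  move=> st' c; have t'0 := le_lt_trans s0 st'.
  case: jP => _ _ _ lim; apply/(lim t' t'0); exists i; exact: left_at.
have left_unique t' v v' : (\forall u \near t'^'-, x u = Some v) -> (\forall u \near t'^'-, x u = Some v') -> v = v'.
  move=> /path_left[e e0 h1] /path_left[e' e'0 h2].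
  pose u := t' - Num.min e e' / 2.
  have m0 : 0 < Num.min e e' by rewrite lt_min e0.
  have m1 : Num.min e e' <= e by rewrite ge_min lexx.
  have m2 : Num.min e e' <= e' by rewrite ge_min lexx orbT.
  have u1 : t' - e < u by rewrite /u; lra.
  have u2 : t' - e' < u by rewrite /u; lra.
  have u3 : u < t' by rewrite /u; lra.
  by have := h1 u u1 u3; rewrite (h2 u u2 u3) => -[].
(* the ring times of the edges at [i] are at least [t], with equality only for the first ring *)
have late t' v : s < t' -> (forall r, s <= r -> r < t' -> x r = Some i) -> adj i v ->
    rings a (fun e k => tau (e, k)) x i v t' -> t <= t' - s /\ (v <> j -> t < t' - s).
  move=> st' c iv rg; have [k Ek] := rings_at sync iv s0 st' c rg.
  have ge := @alarm_ge b th [set i; v] k (b0 _ (edge_edges iv)) (fun k => th0 _ k (edge_edges iv)).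
  rewrite Ek; case: (eqVneq [set i; v] [set i; j]) => [e|ne].
    by rewrite e in ge *; split => // vj; case: vj; exact: (edge_inj (adj_neq adj_irr iv) e).
  have lt := fr _ (mem_star adj_lf iv) ne.
  by split => [|_]; [exact: le_trans (ltW lt) ge|exact: lt_le_trans lt ge].
have jump_target t' : first_jump x s t' -> exists v, [/\ x t' = Some v, adj i v &
    rings a (fun e k => tau (e, k)) x i v t'].
  move=> [st' c ne]; have c' r : s <= r -> r < t' -> x r = Some i by move=> sr rt; rewrite c.
  case E : (x t') => [v|]; last by case: (alive_at t' st' c').
  have iv : i <> v by move=> iv; apply: ne; rewrite E xs iv.
  case: xP => _ _ cr; have [] := cr i v t' (le_lt_trans s0 st') iv; first by split => //; exact: left_at.
  by move=> adjv rg; exists v.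
(* the first jump after [s] is at [s + t] *)
have fj : first_jump x s (s + t).
  have [t' fj] : exists t', first_jump x s t' /\ t' <= s + t.
    apply: contrapT => none.
    have c r : s <= r -> r <= s + t -> x r = Some i.
      move=> sr rt; have [const|[t' fj]] := next_jump jP s0; first by rewrite const.
      have [//|tt'] := leP t' (s + t); first by move=> le; case: none; exists t'.
      by case: fj => _ c _; rewrite c// (le_lt_trans rt).
    have c' r : s <= r -> r < s + t -> x r = Some i by move=> sr rt; apply: c => //; exact: ltW.
    have rg : rings a (fun e k => tau (e, k)) x i j (s + t).
      exists (1 + N [set i; j])%N => //; have [h1 _] := h i j ij.
      rewrite (h1 0%N) alarm1 (edge_clock_const ij s0 (ltW st) c') mem_star//.
      by rewrite [s + t]addrC addrK.
    have xt : x (s + t) = Some i by apply: c => //; exact: ltW.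
    have st0 := le_lt_trans s0 st.
    case: xP => _ /(_ i j (s + t) ij st0) ringcross _.
    have [|[_]|[lf _]] := ringcross _ rg; first by rewrite xt.
    - by rewrite xt => -[].
    - by apply: ijn; apply: left_unique lf; exact: left_at.
  case: fj => fj le; have [v [xv iv rg]] := jump_target t' fj.
  have [st' c ne] := fj; have c' r : s <= r -> r < t' -> x r = Some i by move=> sr rt; rewrite c.
  have [ge _] := late t' v st' c' iv rg.
  by have -> : s + t = t' by apply/eqP; rewrite eq_le le andbT -lerBrDl.
have [v [xv iv rg]] := jump_target _ fj.
have [_ c ne] := fj; have c' r : s <= r -> r < s + t -> x r = Some i by move=> sr rt; rewrite c.
have vj : v = j.
  apply: contrapT => vj; have [_ /(_ vj)] := late _ v st c' iv rg.
  by rewrite [s + t]addrC addrK ltxx.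
split.
- by exists s.
- by rewrite xv vj.
have el0 e k : edges adj e -> 0 < elapse adj b i j t th (e, k).
  move=> Ee; rewrite /elapse/=; case: eqVneq => [_|ne']; first exact: th0.
  case: (boolP (_ && _)) => [/andP[es /eqP ->]|_]; last exact: th0.
  by have := fr e es ne'; rewrite subr_gt0 mulrC -/t ltr_pdivlMr// b0.
split.
- exact: bump_gt0.
- exact: el0.
exists (fun e => (N e + (e == [set i; j]))%N) => u v' uv; have [h1 h2] := h u v' uv.
rewrite (edge_clock_const uv s0 (ltW st) c') [s + t]addrC addrK.
set e := [set u; v']; have De' : edges adj e by exact: edge_edges.
have [ee|ne'] := eqVneq e [set i; j].
  have es : e \in star adj i by rewrite ee; exact: mem_star.
  rewrite es; have shift k : alarm (bump [set i; j] b) (fun e0 k0 => elapse adj b i j t th (e0, k0)) e k.+1 =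
      alarm b (fun e k => th (e, k)) e k.+2 - t.
    rewrite /alarm [in RHS]big_nat_recl// addr0 -/(next_ring b th e).
    rewrite (_ : (b e)^-1 * th (e, 0%N) = t); last by rewrite /t ee mulrC.
    rewrite [RHS]addrAC subrr add0r; apply: eq_bigr => l _.
    by rewrite /bump /elapse/= ee eqxx -natr1 -addrA [1 + _]addrC.
  split => [k|k].
    rewrite shift addn1 addnS -addSn h1 -/e; lra.
  rewrite addn1 leq_eqVlt => /predU1P[->|].
    have := h1 0%N; rewrite add1n alarm1 -/e => ->.
    by rewrite ee /t.
  by rewrite ltnS => /h2 le; apply: (le_trans le); rewrite lerDl ltW.
rewrite addn0; have [es|nes] := boolP (e \in star adj i).
  have shift k : alarm (bump [set i; j] b) (fun e0 k0 => elapse adj b i j t th (e0, k0)) e k.+1 =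
      alarm b (fun e k => th (e, k)) e k.+1 - t.
    rewrite /alarm [in RHS]big_nat_recl// [in LHS]big_nat_recl// /bump /elapse/= (negbTE ne') es/=.
    rewrite !addr0 mulrBr mulrA mulVf ?mul1r ?gt_eqF ?b0//.
    rewrite [RHS]addrAC; congr (_ + _); apply: eq_bigr => l _; by rewrite andbF.
  split => k; first by rewrite shift h1 -/e; lra.
  by move=> /h2 le; apply: (le_trans le); rewrite lerDl ltW.
have shift k : alarm (bump [set i; j] b) (fun e0 k0 => elapse adj b i j t th (e0, k0)) e k =
    alarm b (fun e k => th (e, k)) e k.
  by apply: eq_bigr => l _; rewrite /bump /elapse/= (negbTE ne') (negbTE nes).
by rewrite addr0; split => k; [rewrite shift h1|exact: h2].
Qed.

(* the path follows the trace of the clocks as long as the latter is alive *)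
Let follow_clocks n : forall b th k s i, jump_time x k s -> x s = Some i -> synchronous b th s ->
  (forall l, (l <= n)%N -> (clock_trace adj l b i th).1 <> None) ->
  exists s', [/\ jump_time x (k + n) s', x s' = (clock_trace adj n b i th).1 &
    forall l, (l < n)%N -> jump_date x (k + l).+1 - jump_date x (k + l) = (clock_trace adj l b i th).2].
Proof.
elim: n => [|n IH] b th k s i js xs sync al.
  exists s; rewrite addn0 xs; split => //=; by case: next_vertex.
have := al 1%N isT; rewrite /=; case E : (next_vertex adj b th i) => [j|//] _.
have fr := (next_vertexP adj_irr adj_lf b th i j).1 E.
have [js' xs' sync'] := step js xs sync fr.
have al' l : (l <= n)%N -> (clock_trace adj l (bump [set i; j] b) j
    (elapse adj b i j (next_ring b th [set i; j]) th)).1 <> None.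
  by move=> ln; have := al l.+1 ln; rewrite /= E.
have [s' [js2 xs2 gaps]] := IH _ _ _ _ _ js' xs' sync' al'.
exists s'; split; rewrite ?addnS -?addSn//=.
case=> [|l] ln; last by have := gaps l ln; rewrite /= E !addnS ?addSn.
by rewrite /= E addn0 /= (jump_dateE js) (jump_dateE js') addrAC subrr add0r.
Qed.

(** A path of the reinforced walk visits the vertices given by the clocks, with
    the holding times given by the clocks. *)
Lemma clock_path n : (forall l, (l <= n)%N -> (clock_trace adj l a i0 tau).1 <> None) ->
  skeleton x n = (clock_trace adj n a i0 tau).1 /\
  forall l, (l < n)%N -> jump_date x l.+1 - jump_date x l = (clock_trace adj l a i0 tau).2.
Proof.
move=> al; have x0 : x 0 = Some i0 by case: jP.
have sync0 : synchronous a tau 0.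
  split => //; exists (fun=> 0%N) => u v uv.
  rewrite /edge_clock !local_time0 addr0; split => k; first by rewrite addn0 add0r.
  by rewrite leqn0 => /eqP ->; rewrite /alarm big_geq.
have [s' [js xs gaps]] := @follow_clocks n a tau 0%N 0 i0 erefl x0 sync0 al.
by split; [rewrite (skeletonE js)|move=> l ln; exact: gaps].
Qed.

(** On an isolated vertex the path never jumps. *)
Lemma isolated_path : (forall j, ~~ adj i0 j) -> skeleton x 1 = None.
Proof.
move=> iso; case E : (skeleton x 1) => [v|//]; exfalso.
have [lt c ne] := skeleton_first_jump E; have [_ xv] := skeleton_jump E.
rewrite jump_date0 in lt c ne; have x0 : x 0 = Some i0 by case: jP.
have iv : i0 <> v by move=> iv; apply: ne; rewrite xv x0 iv.
case: xP => _ _ /(_ i0 v (jump_date x 1) lt iv)[|ad _]; last by move: (iso v); rewrite ad.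
split => //; apply: (left_path (e := jump_date x 1)) => // u; rewrite subrr => u0 ut.
by rewrite c// ltW.
Qed.

End clock_path.

(** * Events of traces *)

Section countable_union.
Context d (T : measurableType d).

Lemma measurable_bigcup_inj (I : Type) (g : I -> nat) (F : I -> set T) : injective g ->
  (forall i, measurable (F i)) -> measurable (\bigcup_i F i).
Proof.
move=> gi mF; rewrite (_ : \bigcup_i F i = \bigcup_c (\bigcup_(i in [set i | g i = c]) F i)).
  apply: bigcup_measurable => c _.
  have [[i gic]|none] := pselect (exists i, g i = c).
    rewrite (_ : \bigcup_(i in _) F i = F i)//; apply/seteqP; split => x.
      by move=> [k gk Fk]; rewrite (gi i k)// gic.
    by move=> Fx; exists i.
  rewrite (_ : \bigcup_(i in _) F i = set0)//; apply/seteqP; split => // x [k gk _].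
  by apply: none; exists k.
apply/seteqP; split => x; first by move=> [i _ Fx]; exists (g i) => //; exists i.
by move=> [c _ [i _ Fx]]; exists i.
Qed.

End countable_union.

Section trace_space.
Context {R : realType} {V : choiceType}.
Implicit Types (p q : seq (set R * V)) (z : nat -> option V * R).

(** The steps that satisfy both constraints; none if the vertices disagree. *)
Fixpoint meet_steps p q : option (seq (set R * V)) :=
  match p, q with
  | [::], _ => Some q
  | _, [::] => Some p
  | (A, j) :: p', (B, k) :: q' =>
      if j == k then omap (cons (A `&` B, j)) (meet_steps p' q') else None
  end.

Lemma meet_stepsP p q n z : follow z n p /\ follow z n q <->
  if meet_steps p q is Some r then follow z n r else False.
Proof.
elim: p q n => [|[A j] p IH] [|[B k] q] n /=; try by split; [case|].
case: eqVneq => [<-|jk]; last first.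
  by split => // -[[h1 _ _] [h2 _ _]]; move: jk; rewrite h1 in h2; case: h2 => ->; rewrite eqxx.
have := IH q n.+1; case: (meet_steps p q) => [r|] /= h; split.
- move=> [[h1 h2 h3] [h4 h5 h6]]; split => //; exact/h.
- by move=> [h1 [h2 h5] /h[h3 h6]].
- by move=> [[_ _ h3] [_ _ h6]]; apply/h.
- by [].
Qed.

Definition steps_in (K : set (set R)) p : Prop := forall s : set R * V, s \in p -> K s.1.

Lemma meet_steps_in K p q r : setI_closed K -> steps_in K p -> steps_in K q ->
  meet_steps p q = Some r -> steps_in K r.
Proof.
move=> KI; elim: p q r => [|[A j] p IH] [|[B k] q] r Kp Kq /=; try by move=> [<-].
case: eqVneq => // jk; case E : (meet_steps p q) => [r'|//] [<-] s.
have Kp' : steps_in K p by move=> t tp; apply: Kp; rewrite inE tp orbT.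
have Kq' : steps_in K q by move=> t tq; apply: Kq; rewrite inE tq orbT.
rewrite inE => /predU1P[->|]; last exact: (IH q r' Kp' Kq' E).
apply: KI; first exact: (Kp (A, j) (mem_head _ _)).
exact: (Kq (B, k) (mem_head _ _)).
Qed.

Definition trace_cyls (K : set (set R)) : set (set (nat -> option V * R)) :=
  [set B | B = set0 \/ exists2 p, steps_in K p & B = [set z | follow z 0 p]].

(** Traces of holding times and vertices; the class [K] restricts the events on
    the holding times. *)
Definition trace_space (K : set (set R)) : Type := g_sigma_algebraType (trace_cyls K).

Lemma trace_cyls_setI K : setI_closed K -> setI_closed (trace_cyls K).
Proof.
move=> KI _ B [->|[p Kp ->]]; first by left; rewrite set0I.
move=> [->|[q Kq ->]]; first by left; rewrite setI0.
case E : (meet_steps p q) => [r|]; last first.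
  left; apply/seteqP; split => // z h.
  by have := (meet_stepsP p q 0 z).1 h; rewrite E.
right; exists r; first exact: meet_steps_in E.
by apply/seteqP; split => z h; have := meet_stepsP p q 0 z; rewrite E => -[h1 h2]; [exact: h1|exact: h2].
Qed.

Lemma measurable_follow K p : steps_in K p -> measurable ([set z | follow z 0 p] : set (trace_space K)).
Proof. by move=> Kp; apply: sub_sigma_algebra; right; exists p. Qed.

Variable i0 : V.
Variable (f : V -> nat).
Hypothesis f_inj : injective f.

(** The conditions that all traces of paths satisfy: dead traces stay dead. *)
Definition proper z : Prop := (z 0%N).1 = Some i0 /\ forall n, (z n).1 = None -> (z n.+1).1 = None.

Definition along (x : seq V) : seq (set R * V) := [seq (setT, v) | v <- x].

Let visit (x : seq V) : set (nat -> option V * R) := [set z | follow z 0 (along x)].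

Let visitP x n z : follow z n (along x) <->
  forall k, (k < size x)%N -> (z (n + k).+1).1 = Some (nth i0 x k).
Proof.
elim: x n => [|v x IH] n /=; first by split.
split.
  by move=> [h1 _ /IH h] [|k] kx; [rewrite addn0|rewrite addnS -addSn; exact: h].
move=> h; split => //; first by have := h 0%N isT; rewrite addn0.
by apply/IH => k kx; have := h k.+1 kx; rewrite addnS -addSn.
Qed.

(* the sequences of vertices are countable *)
Let code (x : seq V) : nat := pickle (map f x).
Let code_inj : injective code.
Proof. by move=> x y /(pcan_inj pickleK)/(inj_map f_inj). Qed.

Let proper_alive z n : proper z -> (z n).1 <> None -> forall k, (k <= n)%N -> (z k).1 <> None.
Proof.
move=> [_ zd]; elim: n => [|n IH] zn k; first by rewrite leqn0 => /eqP ->.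
rewrite leq_eqVlt => /predU1P[->//|kn]; apply: IH => // zn'; apply: zn; exact: zd.
Qed.

Let proper_visit z n : proper z -> (z n).1 <> None -> exists2 x, size x = n & visit x z.
Proof.
move=> pz al; exists [seq odflt i0 (z k.+1).1 | k <- iota 0 n]; first by rewrite size_map size_iota.
apply/(visitP _ 0) => k; rewrite size_map size_iota => kn.
rewrite (nth_map 0%N) ?size_iota// nth_iota// add0n.
have := proper_alive pz al kn; by case: ((z k.+1).1).
Qed.

Section vertices.
Variable K : set (set R).
Hypothesis KT : K setT.

Let mvisit x : measurable (visit x : set (trace_space K)).
Proof. by apply: measurable_follow => _ /mapP[v _ ->]. Qed.

Definition at_vertex n (u : V) : set (trace_space K) :=
  if n is 0 then (if u == i0 then setT else set0)
  else \bigcup_(x in [set x | size x = n /\ last i0 x = u]) visit x.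

Lemma measurable_visits_in (A : set (seq V)) : measurable (\bigcup_(x in A) visit x : set (trace_space K)).
Proof.
rewrite (_ : \bigcup_(x in A) visit x = \bigcup_x (if `[< A x >] then visit x else set0)).
  by apply: (measurable_bigcup_inj code_inj) => x; case: asboolP => // _; exact: mvisit.
apply/seteqP; split => z; first by move=> [x Ax vx]; exists x => //; rewrite asboolT.
by move=> [x _]; case: asboolP => // Ax vx; exists x.
Qed.

Lemma measurable_at_vertex n u : measurable (at_vertex n u).
Proof. by case: n => [|n]; [rewrite /at_vertex; case: ifP|exact: measurable_visits_in]. Qed.

Lemma at_vertexP n u z : proper z -> at_vertex n u z <-> (z n).1 = Some u.
Proof.
move=> pz; have [z0 _] := pz; case: n => [|n].
  by rewrite /at_vertex z0; case: eqVneq => [->|ne]; split => // -[e]; move: ne; rewrite e eqxx.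
split.
  move=> [x [sx lx] /(visitP x 0)/(_ n)]; rewrite sx add0n => /(_ (ltnSn n)) ->.
  by rewrite -lx (last_nth i0) sx.
move=> zn; have [|x sx vx] := proper_visit (n := n.+1) pz; first by rewrite zn.
exists x => //; split => //; have := (visitP x 0 z).1 vx n; rewrite sx add0n => /(_ (ltnSn n)).
by rewrite zn (last_nth i0) sx => -[->].
Qed.

(** On proper traces, the position at step [n] is decided by countably many
    sequences of vertices. *)
Lemma sequence_event (B : set (sequence_space V)) : measurable B ->
  exists2 B' : set (trace_space K), measurable B' & forall z, proper z -> (B (fun n => (z n).1) <-> B' z).
Proof.
pose L : set (set (nat -> option V)) := [set B | exists2 B' : set (trace_space K), measurable B' &
  forall z, proper z -> (B (fun n => (z n).1) <-> B' z)].
suff : @measurable _ (sequence_space V) `<=` L by move=> h /h.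
apply: smallest_sub.
  split.
  - by exists set0.
  - move=> A [A' mA h]; exists (~` A'); first exact: measurableC.
    move=> z pz; split; first by move=> [_ nA] /(h z pz).
    by move=> nA; split => // /(h z pz).
  - move=> F LF; have [F' hF] := choice (fun n => let: ex_intro2 A m h := LF n in
      ex_intro (fun A : set (trace_space K) => measurable A /\ forall z, proper z -> (F n (fun n => (z n).1) <-> A z)) A (conj m h)).
    exists (\bigcup_n F' n); first by apply: bigcup_measurable => n _; case: (hF n).
    move=> z pz; split => -[n _ h]; exists n => //; have [_ hn] := hF n; exact/(hn z pz).
move=> _ [n [[u|] ->]].
  exists (at_vertex n u); first exact: measurable_at_vertex.
  by move=> z pz; split => [?|?]; apply/at_vertexP.
exists (~` (\bigcup_u at_vertex n u)).
  by apply: measurableC; apply: (measurable_bigcup_inj f_inj) => u; exact: measurable_at_vertex.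
move=> z pz /=; split; first by move=> zn [u _ /(at_vertexP n u pz)]; rewrite zn.
move=> h; case E : ((z n).1) => [u|//]; exfalso; apply: h; exists u => //.
exact/at_vertexP.
Qed.

End vertices.

Section times.
Notation TS := (trace_space measurable).

Let mvisit x : measurable (visit x : set TS).
Proof. by apply: measurable_follow => _ /mapP[v _ ->]; exact: measurableT. Qed.

Definition jump_sum z n : R := \sum_(0 <= k < n) (z k).2.

(** [y] is the path that makes the jumps of the trace [z]. *)
Definition linked (y : R -> option V) z : Prop := forall t v, 0 <= t ->
  (y t = Some v <-> exists n, [/\ (z n).1 = Some v, jump_sum z n <= t &
    (z n.+1).1 = None \/ t < jump_sum z n.+1]).

Let set_step (A : set R) k (x : seq V) : seq (set R * V) :=
  [seq (if l == k then A else setT, nth i0 x l) | l <- iota 0 (size x)].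

Let follow_map (h : nat -> set R * V) m n s z :
  follow z n [seq h l | l <- iota s m] <->
  forall l, (l < m)%N -> (z (n + l).+1).1 = Some (h (s + l)%N).2 /\ (h (s + l)%N).1 (z (n + l)%N).2.
Proof.
elim: m n s => [|m IH] n s /=; first by split.
case E : (h s) => [A j]; split.
  move=> [h1 h2 /IH h3] [|l] lm; first by rewrite !addn0 E.
  by have := h3 l lm; rewrite !addSn !addnS.
move=> h1; have := h1 0%N isT; rewrite !addn0 E => -[? ?]; split => //.
by apply/IH => l lm; have := h1 l.+1 lm; rewrite !addSn !addnS.
Qed.

Let measurable_time k x : (k < size x)%N -> measurable_fun (visit x : set TS) (fun z : TS => (z k).2).
Proof.
move=> kx _ A mA.
rewrite (_ : _ `&` _ = [set z | follow z 0 (set_step A k x)]).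
  apply: measurable_follow => _ /mapP[l _ ->] /=; by case: ifP.
apply/seteqP; split => z.
  move=> [/(visitP x 0) vx Az]; apply/(follow_map _ _ 0 0) => l lx; rewrite !add0n/=.
  split; first by have := vx l lx; rewrite add0n.
  by case: eqVneq => // ->.
move=> /(follow_map _ _ 0 0) h; split.
  by apply/(visitP x 0) => l lx; case: (h l lx).
by have [_] := h k kx; rewrite !add0n/= eqxx.
Qed.

Let measurable_jump_sum n x : (n <= size x)%N ->
  measurable_fun (visit x : set TS) (fun z : TS => jump_sum z n).
Proof.
elim: n => [|n IH] nx.
  rewrite (_ : (fun z : TS => _) = cst 0); first exact: measurable_cst.
  by apply/funext => z; rewrite /jump_sum big_geq.
rewrite (_ : (fun z : TS => _) = (fun z : TS => jump_sum z n + (z n).2)).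
  by apply: measurable_funD; [apply: IH; exact: ltnW|exact: measurable_time].
by apply/funext => z; rewrite /jump_sum big_nat_recr.
Qed.

(* being at [u] at time [t], after [n] jumps *)
Let now (n : nat) (u : V) (t : R) : set TS :=
  \bigcup_x (if (size x == n) && (last i0 x == u) then
     visit x `&` [set z | jump_sum z n <= t] `&`
     (~` (\bigcup_v visit (rcons x v)) `|`
      \bigcup_v (visit (rcons x v) `&` [set z | t < jump_sum z n.+1])) else set0).

Let measurable_now n u t : measurable (now n u t).
Proof.
apply: (measurable_bigcup_inj code_inj) => x; case: ifP => // /andP[/eqP sx _].
have mle : measurable ((visit x : set TS) `&` [set z : TS | jump_sum z n <= t]).
  rewrite (_ : [set z : TS | _] = (fun z : TS => jump_sum z n) @^-1` `]-oo, t]); last first.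
    by apply/seteqP; split => z /=; rewrite in_itv.
  by apply: measurable_jump_sum; rewrite ?sx.
apply: measurableI => //; apply: measurableU.
  by apply: measurableC; apply: (measurable_bigcup_inj f_inj) => v; exact: mvisit.
apply: (measurable_bigcup_inj f_inj) => v.
rewrite (_ : [set z : TS | _] = (fun z : TS => jump_sum z n.+1) @^-1` `]t, +oo[); last first.
  by apply/seteqP; split => z /=; rewrite in_itv/= andbT.
by apply: measurable_jump_sum; rewrite ?size_rcons ?sx.
Qed.

Let nowP n u t z : proper z -> now n u t z <->
  [/\ (z n).1 = Some u, jump_sum z n <= t & (z n.+1).1 = None \/ t < jump_sum z n.+1].
Proof.
move=> pz; have [z0 zd] := pz.
have last_visit x : visit x z -> (z (size x)).1 = Some (last i0 x).
  move=> /(visitP x 0); case: (lastP x) => [_|x' w]; first by rewrite z0.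
  by move=> /(_ (size x')); rewrite size_rcons last_rcons add0n nth_rcons ltnn eqxx => /(_ (ltnSn _)).
have visit_rcons x v : visit x z -> visit (rcons x v) z <-> (z (size x).+1).1 = Some v.
  move=> vx; split; first by move=> /last_visit; rewrite size_rcons last_rcons.
  move=> zv; apply/(visitP _ 0) => k; rewrite size_rcons ltnS add0n leq_eqVlt => /predU1P[->|kx].
    by rewrite nth_rcons ltnn eqxx.
  by rewrite nth_rcons kx; have := (visitP x 0 z).1 vx k kx; rewrite add0n.
split.
  move=> [x _]; case: ifP => // /andP[/eqP sx /eqP lx] [[vx le] h].
  split => //; first by rewrite -sx (last_visit x) ?lx.
  case: h => [nv|[v _ [_ lt]]]; last by right.
  left; case E : ((z n.+1).1) => [v|//]; exfalso; apply: nv; exists v => //.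
  by apply/visit_rcons => //; rewrite sx.
move=> [zn le h]; have [|x sx vx] := proper_visit (n := n) pz; first by rewrite zn.
exists x => //; have lx : last i0 x = u by have := last_visit x vx; rewrite sx zn => -[].
rewrite sx lx !eqxx/=; split; first by split.
case E : ((z n.+1).1) h => [v|] h; last first.
  by left => -[v _ /(visit_rcons x v vx)]; rewrite sx E.
right; exists v => //; split; first by apply/visit_rcons => //; rewrite sx.
by case: h.
Qed.

(** Given the sequence of vertices, being at a vertex at time [t] is a condition on
    finitely many holding times; the sequences of vertices are countable. *)
Lemma path_event (B : set (path_space R V)) : measurable B ->
  exists2 B' : set TS, measurable B' & forall y z, proper z -> linked y z -> (B y <-> B' z).
Proof.
pose L : set (set (R -> option V)) := [set B | exists2 B' : set TS, measurable B' &
  forall y z, proper z -> linked y z -> (B y <-> B' z)].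
suff : @measurable _ (path_space R V) `<=` L by move=> h /h.
apply: smallest_sub.
  split.
  - by exists set0.
  - move=> A [A' mA h]; exists (~` A'); first exact: measurableC.
    move=> y z pz yz; split; first by move=> [_ nA] /(h y z pz yz).
    by move=> nA; split => // /(h y z pz yz).
  - move=> F LF; have [F' hF] := choice (fun n => let: ex_intro2 A m h := LF n in
      ex_intro (fun A : set TS => measurable A /\ forall y z, proper z -> linked y z -> (F n y <-> A z)) A (conj m h)).
    exists (\bigcup_n F' n); first by apply: bigcup_measurable => n _; case: (hF n).
    move=> y z pz yz; split => -[n _ h]; exists n => //; have [_ hn] := hF n; exact/(hn y z pz yz).
have mnow u t : measurable (\bigcup_n now n u t) by apply: bigcup_measurable => n _; exact: measurable_now.
have nowE y z u t : 0 <= t -> proper z -> linked y z -> (y t = Some u <-> (\bigcup_n now n u t) z).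
  move=> t0 pz yz; split.
    by move=> /(yz t u t0)[n h]; exists n => //; apply/nowP.
  by move=> [n _ /(nowP n u t pz) h]; apply/(yz t u t0); exists n.
move=> _ [t [[u|] [t0 ->]]].
  by exists (\bigcup_n now n u t) => // y z pz yz; exact: nowE.
exists (~` (\bigcup_u \bigcup_n now n u t)).
  by apply: measurableC; apply: (measurable_bigcup_inj f_inj).
move=> y z pz yz /=; split; first by move=> yt [u _ /(nowE y z u t t0 pz yz)]; rewrite yt.
move=> h; case E : (y t) => [u|//]; exfalso; apply: h; exists u => //.
exact/(nowE y z u t t0 pz yz).
Qed.

End times.

End trace_space.

(** * Traces of the walk and of the time modification *)

Section countable_graph.
Context {V : choiceType}.
Variable adj : rel V.
Hypothesis adj_lf : locally_finite_graph adj.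
Hypothesis adj_conn : connected_graph adj.

(** Every vertex is determined by the neighbours chosen along a path from a
    fixed vertex. *)
Lemma graph_countable (i0 : V) : exists f : V -> nat, injective f.
Proof.
pose walk (c : seq nat) : V := foldl (fun v k => nth v (nbrs adj v) k) i0 c.
have surj v : exists c, walk c = v.
  have [p [pp <-]] := adj_conn i0 v; rewrite /walk; clear v walk.
  elim: p i0 pp => [|w p IH] u /=; first by exists [::].
  move=> /andP[uw /IH[c hc]]; exists (index w (nbrs adj u) :: c) => /=.
  by rewrite nth_index ?mem_nbrs.
have [g hg] := choice surj.
exists (fun v => pickle (g v)) => u v /(pcan_inj pickleK) guv.
by rewrite -(hg u) -(hg v) guv.
Qed.

End countable_graph.

Section linking.
Context {R : realType} {V : choiceType}.
Variables (i0 : V) (y : R -> option V).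
Hypothesis yP : jump_path i0 y.

Let skeleton_dead n : skeleton y n = None -> skeleton y n.+1 = None.
Proof.
move=> sn; case E : (skeleton y n.+1) => [v|//].
by have [w] := skeleton_pred yP E; rewrite sn.
Qed.

(** A path is constant between its jumps, so it is linked to any trace with its
    vertices and the gaps between its jumps. *)
Lemma linked_skeleton (z : nat -> option V * R) :
  (forall n, (z n).1 = skeleton y n) ->
  (forall n v, skeleton y n.+1 = Some v -> (z n).2 = jump_date y n.+1 - jump_date y n) ->
  proper i0 z /\ linked y z.
Proof.
move=> z1 z2; split.
  split; first by rewrite z1; exact: skeleton0 yP.
  by move=> n; rewrite !z1; exact: skeleton_dead.
have sumE n v : skeleton y n = Some v -> jump_sum z n = jump_date y n.
  elim: n v => [|n IH] v sn; first by rewrite /jump_sum big_geq// jump_date0.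
  have [w sw] := skeleton_pred yP sn.
  by rewrite /jump_sum big_nat_recr//= -/(jump_sum z n) (IH w sw) (z2 n v sn) addrC subrK.
move=> t v t0; rewrite (path_someP yP v t0); split=> -[n [sn nt nx]]; exists n; split.
- by rewrite z1.
- by rewrite (sumE n v).
- case: nx => nx; first by left; rewrite z1.
  rewrite z1; case E : (skeleton y n.+1) => [w|]; last by left.
  by right; rewrite (sumE _ w).
- by rewrite -z1.
- by rewrite -(sumE n v)// -z1.
- case: nx => nx; first by left; rewrite -z1.
  case E : (skeleton y n.+1) => [w|]; last by left.
  by right; rewrite -(sumE _ w).
Qed.

Let clock_jt_le n m v : (n <= m)%N -> skeleton y m = Some v ->
  vrjp_clock y (jump_date y n) <= vrjp_clock y (jump_date y m).
Proof. by move=> nm sm; apply: (vrjp_clock_le yP); [exact: jump_date_ge0|exact: (jump_date_le yP nm sm)]. Qed.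

Let clock_ln_lt n v u u' : jump_date y n <= u -> jump_date y n <= u' ->
  (ln (1 + (u - jump_date y n) / occ y v n) < ln (1 + (u' - jump_date y n) / occ y v n)) = (u < u').
Proof.
have o0 := occ_gt0 y v n => h h'.
have pos s : jump_date y n <= s -> 0 < 1 + (s - jump_date y n) / occ y v n.
  by move=> ns; apply: ltr_pwDl => //; apply: divr_ge0; rewrite ?subr_ge0// ltW.
by rewrite ltr_ln ?posrE ?pos// ltrD2l ltr_pM2r ?invr_gt0// ltrD2r.
Qed.

(* the clock is continuous and strictly increasing while the path is alive *)
Let clock_lt n v u : skeleton y n = Some v -> jump_date y n <= u -> u < jump_date y n.+1 ->
  forall v', skeleton y n.+1 = Some v' -> vrjp_clock y u < vrjp_clock y (jump_date y n.+1).
Proof.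
move=> sn nu un v' sn1; have lt := le_lt_trans nu un.
rewrite (clock_between yP sn nu (or_intror (ltW un))).
rewrite (clock_between yP sn (ltW lt) (or_intror (lexx _))) ltrD2l.
have o0 := occ_gt0 y v n.
by rewrite clock_ln_lt// ltW.
Qed.

(** The time change keeps the visited vertices and turns the time spent into
    the increments of the clock. *)
Lemma linked_time_modification :
  proper i0 (vrjp_trace y) /\ linked (time_modification y) (vrjp_trace y).
Proof.
split.
  split; first exact: skeleton0 yP.
  by move=> n; exact: skeleton_dead.
have sumE n : jump_sum (vrjp_trace y) n = vrjp_clock y (jump_date y n).
  elim: n => [|n IH]; first by rewrite /jump_sum big_geq// jump_date0 vrjp_clock0.
  by rewrite /jump_sum big_nat_recr//= -/(jump_sum (vrjp_trace y) n) IH /hold addrC subrK.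
move=> t v t0; rewrite /time_modification; set S := [set v | _]; split.
  move=> xv; have [s [s0 cs ys]] : S (Some v).
    rewrite -xv; have [[w Sw]|none] := pselect (exists w, S w); first exact: (xgetPex None (ex_intro _ w Sw)).
    by move: xv; rewrite xgetPN// => w Sw; apply: none; exists w.
  have [n [sn ns nx]] := (path_someP yP v s0).1 (esym ys).
  exists n; split; rewrite ?sumE//.
    by rewrite -cs; apply: (vrjp_clock_le yP); first exact: jump_date_ge0.
  case: nx => nx; first by left.
  case E : (skeleton y n.+1) => [w|]; last by left; rewrite /= E.
  by right; rewrite -cs; exact: (clock_lt sn ns nx E).
move=> [n [/= sn nt nx]]; rewrite sumE in nt; rewrite sumE in nx.
have o0 := occ_gt0 y v n.
(* the time at which the clock reaches [t] *)
pose u := jump_date y n + occ y v n * (expR (t - vrjp_clock y (jump_date y n)) - 1).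
have e1 : 1 <= expR (t - vrjp_clock y (jump_date y n)) by rewrite -[leLHS](@expR0 R) ler_expR subr_ge0.
have nu : jump_date y n <= u by rewrite lerDl mulr_ge0 ?(ltW o0)// subr_ge0.
have lnE : ln (1 + (u - jump_date y n) / occ y v n) = t - vrjp_clock y (jump_date y n).
  by rewrite /u addrAC subrr add0r mulrAC divff ?gt_eqF// mul1r addrC subrK expRK.
have u_lt v' : skeleton y n.+1 = Some v' -> u < jump_date y n.+1.
  move=> sn1; have [lt _ _] := skeleton_first_jump sn1.
  case: nx => [|nx]; first by rewrite sn1.
  rewrite (clock_between yP sn (ltW lt) (or_intror (lexx _))) -ltrBlDl -lnE in nx.
  by move: nx; rewrite clock_ln_lt// ltW.
have un : skeleton y n.+1 = None \/ u < jump_date y n.+1.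
  by case E : (skeleton y n.+1) => [v'|]; [right; exact: u_lt E|left].
have un' : skeleton y n.+1 = None \/ u <= jump_date y n.+1 by case: un => h; [left|right; exact: ltW].
have u0 : 0 <= u by apply: le_trans nu; exact: jump_date_ge0.
have cu : vrjp_clock y u = t by rewrite (clock_between yP sn nu un') lnE addrC subrK.
have Sv : S (Some v).
  by exists u; split => //; rewrite (const_between yP sn nu un).
have uniq w : S w -> w = Some v.
  move=> [s [s0 cs ->]].
  have ns : jump_date y n <= s.
    rewrite leNgt; apply/negP => sn'.
    have ys : exists v', y s = Some v'.
      case E : (y s) => [v'|]; first by exists v'.
      case: yP => _ _ dead _; have := dead s (jump_date y n) s0 (ltW sn') E.
      by have [_ ->] := skeleton_jump sn.
    case: ys => v' /(path_someP yP v' s0)[m [sm ms mx]].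
    have mn : (m < n)%N.
      rewrite ltnNge; apply/negP => nm; have := jump_date_le yP nm sm.
      by rewrite leNgt (le_lt_trans ms).
    have [w' sw'] := skeleton_le yP mn sn.
    have sm1 : s < jump_date y m.+1 by case: mx => //; rewrite sw'.
    have := clock_lt sm ms sm1 sw'; rewrite cs.
    by rewrite ltNge (le_trans (clock_jt_le mn sn)).
  case E : (skeleton y n.+1) => [v'|]; last by rewrite (const_between yP sn ns)//; left.
  case: nx => [|nx]; first by rewrite E.
  apply: (const_between yP sn ns); right; rewrite ltNge; apply/negP => le.
  have := vrjp_clock_le yP (jump_date_ge0 y n.+1) le; rewrite cs leNgt.
  by rewrite nx.
by apply: uniq; apply: (xgetPex None); exists (Some v).
Qed.

End linking.

(** * Mixtures are determined by finite sequences of steps *)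

Section mixture.
Context {R : realType} {V : choiceType}.
Variable adj : rel V.
Hypotheses (adj_irr : irreflexive adj).
Hypothesis adj_lf : locally_finite_graph adj.
Notation WS := (fam_space (R := R) (edges adj)).
Variables (i0 : V) (f : V -> nat).
Hypothesis f_inj : injective f.
Context (d' : measure_display) (T' : (set V -> R) -> measurableType d')
  (P' : forall w, probability (T' w) R) (Y : forall w, T' w -> R -> option V).
Hypothesis YV : forall w, positive_weights adj w -> is_vrjp adj i0 w (P' w) (@Y w).
Variable K : set (set R).
Hypotheses (KI : setI_closed K) (Km : K `<=` measurable) (KT : K setT).
Notation TS := (trace_space (R := R) (V := V) K).

(** The quenched side of the mixture. *)
Definition trace_kernel (w : set V -> R) (B : set (nat -> option V * R)) : \bar R :=
  P' w [set om | B (vrjp_trace (Y om))].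

Lemma measurable_positive : measurable (positive_weights adj : set WS).
Proof.
pose g (q : V * V) := pickle (f q.1, f q.2).
have gi : injective g by move=> [u v] [u' v'] /(pcan_inj pickleK)[/f_inj -> /f_inj ->].
rewrite (_ : positive_weights adj = ~` (\bigcup_q (if adj q.1 q.2 then
    [set w : WS | ~ 0 < w [set q.1; q.2]] else set0))).
  apply: measurableC; apply: (measurable_bigcup_inj gi) => -[u v]/=; case: ifP => // uv.
  rewrite (_ : [set w : WS | _] = (fun w : WS => w [set u; v]) @^-1` `]-oo, 0]).
    rewrite -[X in measurable X]setTI.
    by apply: (measurable_coord (edge_edges uv)) => //; exact: measurable_itv.
  by apply/seteqP; split => w; rewrite /= in_itv/= leNgt => /negP.
apply/seteqP; split => w.
  by move=> h [[u v] _ /=]; case: ifP => // uv; apply; apply: h; exact: edge_edges.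
move=> h _ [u [v [uv ->]]]; apply: contrapT => nw; apply: h; exists (u, v) => //=.
by rewrite uv.
Qed.

Let mtrace w : positive_weights adj w -> measurable_fun setT (fun om : T' w => vrjp_trace (Y om) : TS).
Proof.
move=> w0.
apply: measurability; first by [].
move=> _ [_ [->|[p Kp ->]] <-]; first by rewrite preimage_set0 setI0.
have mp : measurable_steps p by move=> q qp; apply: Km; exact: Kp.
by rewrite setTI; exact: (measurable_vrjp_follow (YV w0) mp).
Qed.

Let mtrace_set w B : positive_weights adj w -> measurable (B : set TS) ->
  measurable [set om : T' w | B (vrjp_trace (Y om))].
Proof. by move=> w0 mB; have := mtrace w0 measurableT mB; rewrite setTI. Qed.

Let kernel_follow w p : positive_weights adj w -> steps_in K p ->
  trace_kernel w [set z | follow z 0 p] = path_prob adj i0 p w.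
Proof.
move=> w0 Kp; apply: (vrjp_follow_law adj_irr adj_lf w0 (YV w0)).
by move=> q qp; apply: Km; exact: Kp.
Qed.

Context d1 (T1 : measurableType d1) (P1 : probability T1 R) (W : T1 -> WS).
Hypotheses (mW : measurable_fun setT W) (W0 : forall om, positive_weights adj (W om)).
Variables (C : set T1) (nu : {measure set TS -> \bar R}).
Hypothesis mC : measurable C.
Hypothesis nuE : forall p, steps_in K p ->
  (nu [set z | follow z 0 p] = \int[P1]_(om in C) path_prob adj i0 p (W om))%E.

Let good (B : set TS) : Prop := [/\ measurable B,
  measurable_fun (positive_weights adj : set WS) (fun w => trace_kernel w B) &
  (nu B = \int[P1]_(om in C) trace_kernel (W om) B)%E].

Let kernel_le1 w B : positive_weights adj w -> measurable (B : set TS) -> (trace_kernel w B <= 1)%E.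
Proof. by move=> w0 mB; apply: probability_le1; exact: mtrace_set. Qed.

Let mkernelW B : measurable_fun (positive_weights adj : set WS) (fun w => trace_kernel w B) ->
  measurable_fun C (fun om => trace_kernel (W om) B).
Proof.
move=> mk; apply: (measurable_comp measurable_positive _ mk (measurable_funTS mW)).
by move=> _ [om _ <-].
Qed.

Let good_follow p : steps_in K p -> good [set z | follow z 0 p].
Proof.
move=> Kp; split; first exact: measurable_follow.
- apply: (eq_measurable_fun (path_prob adj i0 p : WS -> \bar R)).
    by move=> w; rewrite inE => w0; rewrite kernel_follow.
  apply: measurable_funTS; apply: measurable_path_prob => // q qp.
  by apply: Km; exact: Kp.
- by rewrite nuE//; apply: eq_integral => om _; rewrite kernel_follow.
Qed.

Let goodT : good setT.
Proof.
have -> : [set: TS] = [set z | follow z 0 [::]] by apply/seteqP; split.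
exact: good_follow.
Qed.

Let nu_fin B : good B -> nu B \is a fin_num.
Proof.
move=> [mB _ _]; have [_ _ nT] := goodT.
rewrite ge0_fin_numE//; apply: (@le_lt_trans _ _ (nu setT)); first by apply: le_measure; rewrite ?inE.
rewrite nT; apply: (@le_lt_trans _ _ (\int[P1]_(om in C) (cst 1%E om))%E).
  have k0 om : C om -> (0 <= trace_kernel (W om) setT)%E by move=> _; exact: measure_ge0.
  have mk : measurable_fun C (fun om => trace_kernel (W om) setT).
    by apply: mkernelW; case: goodT.
  have k1 om : C om -> (trace_kernel (W om) setT <= cst 1%E om)%E.
    by move=> _; exact: kernel_le1.
  have m1 : measurable_fun C (cst 1%E : T1 -> \bar R) by exact: measurable_cst.
  have c0 om : C om -> (0 <= (cst 1%E : T1 -> \bar R) om)%E by move=> _; exact: lee01.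
  exact: (ge0_le_integral P1 mC k0 mk m1 k1).
by rewrite integral_cst// mul1e (le_lt_trans (probability_le1 _ mC))// ltry.
Qed.

Let goodD A B : good A -> good B -> B `<=` A -> good (A `\` B).
Proof.
move=> gA gB BA; have [mA kA nA] := gA; have [mB kB nB] := gB.
have mD : measurable (A `\` B) by exact: measurableD.
have kD w : positive_weights adj w ->
    (trace_kernel w (A `\` B) = trace_kernel w A - trace_kernel w B)%E.
  move=> w0; rewrite /trace_kernel.
  have mA' := mtrace_set w0 mA; have mB' := mtrace_set w0 mB.
  have fA : (P' w [set om | A (vrjp_trace (Y om))] < +oo)%E.
    by rewrite (le_lt_trans (probability_le1 _ mA'))// ltry.
  rewrite -[in RHS](setIidr (_ : [set om : T' w | B (vrjp_trace (Y om))] `<=` [set om | A (vrjp_trace (Y om))])).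
    by rewrite -(measureD mA' mB' fA).
  by move=> om; exact: BA.
have mkD : measurable_fun (positive_weights adj : set WS) (fun w => trace_kernel w (A `\` B)).
  apply: (eq_measurable_fun ((fun w => trace_kernel w A - trace_kernel w B)%E : WS -> \bar R)).
    by move=> w; rewrite inE => w0; rewrite kD.
  exact: emeasurable_funB.
split => //.
have sumk om : (trace_kernel (W om) A = trace_kernel (W om) (A `\` B) + trace_kernel (W om) B)%E.
  rewrite kD// subeK// ge0_fin_numE ?measure_ge0//.
  by rewrite (le_lt_trans (kernel_le1 (W0 om) mB))// ltry.
have nD : (nu A = nu (A `\` B) + nu B)%E.
  rewrite -measureU//; first by rewrite setDKU.
  by apply/seteqP; split => // z [[]].
have : (nu (A `\` B) + nu B = \int[P1]_(om in C) trace_kernel (W om) (A `\` B) + nu B)%E.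
  have k0 B' om : C om -> (0 <= trace_kernel (W om) B')%E by move=> _; exact: measure_ge0.
  have E := ge0_integralD P1 mC (k0 _) (mkernelW mkD) (k0 _) (mkernelW kB).
  by rewrite -nD nA nB -E; apply: eq_integral => om _; rewrite sumk.
by move=> /(congr1 (fun x => x - nu B)%E); rewrite !addeK// nu_fin.
Qed.

Let good_lim (F : (set TS)^nat) : nondecreasing_seq F -> (forall n, good (F n)) -> good (\bigcup_n F n).
Proof.
move=> nd gF; have mF n : measurable (F n) by case: (gF n).
have mU : measurable (\bigcup_n F n) by exact: bigcup_measurable.
have kU w : positive_weights adj w -> trace_kernel w (F n) @[n --> \oo] --> trace_kernel w (\bigcup_n F n).
  move=> w0; rewrite /trace_kernel.
  rewrite (_ : [set om : T' w | _] = \bigcup_n [set om : T' w | F n (vrjp_trace (Y om))]); last first.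
    by apply/seteqP; split => om [n _ h]; exists n.
  apply: (nondecreasing_cvg_mu (mu := P' w)).
  - by move=> n; exact: mtrace_set.
  - by apply: bigcup_measurable => n _; exact: mtrace_set.
  - by move=> n n' nn'; apply/subsetPset => om; exact: (subsetPset _ _ (nd n n' nn')).
have mkF n : measurable_fun (positive_weights adj : set WS) (fun w => trace_kernel w (F n)) by case: (gF n).
have mkU : measurable_fun (positive_weights adj : set WS) (fun w => trace_kernel w (\bigcup_n F n)).
  by exact: (@emeasurable_fun_cvg _ WS R _ (fun n w => trace_kernel w (F n))
    (fun w => trace_kernel w (\bigcup_n F n)) mkF kU).
split => //.
have l1 : nu (F n) @[n --> \oo] --> nu (\bigcup_n F n) by apply: (nondecreasing_cvg_mu (mu := nu)).
have l2 : (\int[P1]_(om in C) trace_kernel (W om) (F n))%E @[n --> \oo] -->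
    (\int[P1]_(om in C) trace_kernel (W om) (\bigcup_n F n))%E.
  have := @cvg_monotone_convergence _ _ _ P1 C mC (fun n om => trace_kernel (W om) (F n))
    (fun n => mkernelW (mkF n)) (fun n om _ => measure_ge0 _ _).
  rewrite (eq_integral (fun om => trace_kernel (W om) (\bigcup_n F n))) => [|om _]; last first.
    exact/cvg_lim/kU.
  apply => om _ n n' nn'; apply: le_measure; rewrite ?inE; [exact: mtrace_set|exact: mtrace_set|].
  by move=> om'; exact: (subsetPset _ _ (nd n n' nn')).
have E : (fun n => nu (F n)) = (fun n => \int[P1]_(om in C) trace_kernel (W om) (F n))%E.
  by apply/funext => n; case: (gF n).
rewrite E in l1; exact: (etrans (esym (cvg_lim (@ereal_hausdorff R) l1)) (cvg_lim (@ereal_hausdorff R) l2)).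
Qed.

(** A measure on traces that agrees with the mixture of the laws of the
    time-changed processes on finite sequences of steps is this mixture. *)
Lemma mixture_unique (B : set TS) : measurable B ->
  measurable_fun (positive_weights adj : set WS) (fun w => trace_kernel w B) /\
  (nu B = \int[P1]_(om in C) trace_kernel (W om) B)%E.
Proof.
suff h : <<s trace_cyls K >> `<=` [set B | good B] by move=> /h[].
apply: lambda_system_subset => //.
- exact: trace_cyls_setI.
- split.
  + by [].
  + exact: goodT.
  + by move=> A B' BA gA gB; exact: goodD.
  + by move=> F nd gF; exact: good_lim.
- move=> _ [->|[p Kp ->]]; last exact: good_follow.
  have := goodD goodT goodT (@subset_refl _ setT); rewrite setDv; exact.
Qed.

End mixture.

(** * The continuous-time walk as a mixture *)

Section almost_everywhere.
Context d (T : measurableType d) (R : realType) (m : {measure set T -> \bar R}).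

Lemma ae_mp (A B : T -> Prop) : {ae m, forall x, A x} -> (forall x, A x -> B x) -> {ae m, forall x, B x}.
Proof. by move=> h AB; apply: filterS h. Qed.

Lemma ae_countable (I : Type) (g : I -> nat) (A : I -> T -> Prop) : injective g ->
  (forall i, {ae m, forall x, A i x}) -> {ae m, forall x, forall i, A i x}.
Proof.
move=> gi h; have : {ae m, forall x, forall n i, g i = n -> A i x}.
  apply: ae_foralln => n.
  have [[i gin]|none] := pselect (exists i, g i = n).
    by apply: filterS (h i) => x Ax j gj; rewrite (gi j i)// gj gin.
  by apply: aeW => x i gin; exfalso; apply: none; exists i.
by apply: filterS => x hx i; exact: (hx (g i)).
Qed.

(** Used to replace limits and traces by almost surely equal versions. *)
Lemma ae_same_measure (A B : set T) : measurable A -> measurable B ->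
  {ae m, forall x, A x <-> B x} -> m A = m B.
Proof.
move=> mA mB [N [mN N0 sub]].
have key x : N x \/ (A x <-> B x).
  by have [h|h] := pselect (A x <-> B x); [right|left; exact: sub].
have le X Y : measurable X -> measurable Y -> X `<=` Y `|` N -> (m X <= m Y)%E.
  move=> mX mY XY; apply: (@le_trans _ _ (m (Y `|` N))).
    by apply: le_measure; rewrite ?inE//; exact: measurableU.
  have N0' : m N = 0%E := N0.
  have U : (m (Y `|` N) <= m Y + m N)%E by exact: measureU2.
  by rewrite N0' adde0 in U.
apply/eqP; rewrite eq_le; apply/andP; split; apply: le => // x Xx.
  by case: (key x) => [|h]; [right|left; exact/h].
by case: (key x) => [|h]; [right|left; exact/h].
Qed.

Lemma ae_same_integral (A B : set T) (f g : T -> \bar R) : measurable A -> measurable B ->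
  measurable_fun setT f -> measurable_fun setT g ->
  {ae m, forall x, A x <-> B x} -> {ae m, forall x, f x = g x} ->
  (\int[m]_(x in A) f x = \int[m]_(x in B) g x)%E.
Proof.
move=> mA mB mf mg AB fg; rewrite integral_mkcond [RHS]integral_mkcond.
apply: (ae_eq_integral (g \_ B)%E (f \_ A)%E measurableT).
- by apply/(measurable_restrictT _ mA); exact: measurable_funTS.
- by apply/(measurable_restrictT _ mB); exact: measurable_funTS.
- apply: (ae_mp2 AB fg) => x h e _; rewrite /patch e.
  by case: ifPn; case: ifPn => //; rewrite ?inE ?notin_setE => h1 h2; exfalso; tauto.
Qed.

End almost_everywhere.

Lemma independent_product_law {R : realType} {I : choiceType} (D : set I)
    d (T : measurableType d) (P : probability T R) (X : I -> {RV P >-> R})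
    (mu : I -> {measure set R -> \bar R})
    (mX : measurable_fun setT ((fun om i => X i om) : T -> fam_space D)) :
  independent_family D X -> (forall i A, D i -> measurable A -> P (X i @^-1` A) = mu i A) ->
  product_law mu (mpush P mX).
Proof.
move=> ind law s A us sD mA.
suff : P ((fun om i => X i om) @^-1` cyl s A) = (\prod_(i <- s) mu i (A i))%E by [].
have -> : (fun om i => X i om) @^-1` cyl s A = \big[setI/setT]_(i <- s) (X i @^-1` A i).
  by rewrite cylE; elim: s {us sD} => [|i s IH]; rewrite ?big_nil ?big_cons// -IH.
by rewrite ind// !big_seq; apply: eq_bigr => i /sD Di; exact: law.
Qed.

Section continuous_walk.
Context {R : realType} {V : choiceType}.
Variable adj : rel V.
Hypotheses (adj_sym : symmetric adj) (adj_irr : irreflexive adj).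
Hypotheses (adj_lf : locally_finite_graph adj) (adj_conn : connected_graph adj).
Notation WS := (fam_space (R := R) (edges adj)).
Notation DI := ([set p : set V * nat | edges adj p.1]).
Notation TT := (fam_space (R := R) DI).
Variables (i0 : V) (a : set V -> R).
Hypothesis a_gt0 : forall e, edges adj e -> 0 < a e.

(** So the walk can only stop if the graph is a single vertex. *)
Lemma connected_neighbour j0 : adj i0 j0 -> forall i, exists j, adj i j.
Proof.
move=> ij i; have [[|w p] /= [pp e]] := adj_conn i i0; first by exists j0; rewrite e.
by exists w; case/andP: pp.
Qed.

Lemma ae_edges d (T : measurableType d) (m : {measure set T -> \bar R}) (A : set V -> T -> Prop) :
  (forall e, edges adj e -> {ae m, forall x, A e x}) ->
  {ae m, forall x, forall e, edges adj e -> A e x}.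
Proof.
move=> h; have [f f_inj] := graph_countable adj_lf adj_conn i0.
pose g (q : V * V) := pickle (f q.1, f q.2).
have gi : injective g by move=> [u v] [u' v'] /(pcan_inj pickleK)[/f_inj -> /f_inj ->].
have : {ae m, forall x, forall q : V * V, adj q.1 q.2 -> A [set q.1; q.2] x}.
  apply: (ae_countable gi) => -[u v] /=; have [uv|nuv] := boolP (adj u v); last exact: aeW.
  by apply: (ae_mp (h _ (edge_edges uv))) => x Ax _.
by move=> H; apply: (ae_mp H) => x hx e [u [v [uv ->]]]; exact: (hx (u, v) uv).
Qed.

Context d (T : measurableType d) (P : probability T R)
  (tau : set V -> nat -> {RV P >-> R}) (X : T -> R -> option V).
Hypothesis XP : is_ct_errw adj i0 a tau X.

Let cl : T -> TT := fun om p => tau p.1 p.2 om.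

Let mcl : measurable_fun setT cl.
Proof. by apply: measurable_to_fam => p _; exact: (measurable_funP (tau p.1 p.2)). Qed.

Let m : probability TT R := mpush P mcl.

Let pm : product_law (fun=> gamma_law 1) m.
Proof.
apply: (independent_product_law (X := fun p => tau p.1 p.2) (mu := fun=> gamma_law 1) mcl); first by case: XP.
move=> p A Dp mA; case: XP => _ h _ _.
exact: (etrans (h _ _ Dp A mA) (exponential_prob_gamma mA)).
Qed.

Let urn : T -> WS := fun om => urn_limits a (cl om).

Let murn : measurable_fun setT urn.
Proof. exact: (measurableT_comp (measurable_urn_limits (D := edges adj) a) mcl). Qed.

Let urn_law s (A : set V -> set R) : uniq s -> {in s, forall e, edges adj e} -> (forall e, measurable (A e)) ->
  P (urn @^-1` cyl s A) = (\prod_(e <- s) gamma_law (a e) (A e))%E.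
Proof. by move=> us sD mA; exact: (urn_limits_law pm a_gt0 us sD mA). Qed.

Let urn_gt0 : {ae P, forall om, forall e, edges adj e -> 0 < urn om e}.
Proof.
apply: ae_edges => e De; have mN : measurable `]-oo, 0 : R] by exact: measurable_itv.
have E : urn @^-1` cyl [:: e] (fun=> `]-oo, 0 : R]%classic) = [set om | ~ 0 < urn om e].
  apply/seteqP; split => om /=.
    by move=> /(_ e); rewrite inE eqxx => /(_ isT); rewrite /= in_itv/= leNgt => /negP.
  by move=> h e'; rewrite inE => /eqP->; rewrite /= in_itv/= leNgt; exact/negP.
exists [set om | ~ 0 < urn om e]; split => //.
  rewrite -E -[X in measurable X]setTI; apply: murn => //; apply: measurable_cyl => //.
  by move=> e'; rewrite inE => /eqP->.
suff z : P [set om | ~ 0 < urn om e] = 0%E by exact: z.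
rewrite -E urn_law ?big_seq1//; last by move=> e'; rewrite inE => /eqP->.
rewrite -(gamma_law_nonpos (a e)); congr (gamma_law _ _); by rewrite set_itvE.
Qed.

Let clocks_gt0 : {ae P, forall om, forall e k, edges adj e -> 0 < cl om (e, k)}.
Proof.
suff : {ae P, forall om, forall k e, edges adj e -> 0 < cl om (e, k)}.
  by move=> h; apply: (ae_mp h) => om H e k; exact: H.
apply: (ae_countable (g := id)) => // k; apply: ae_edges => e De.
have mN : measurable [set x : R | x <= 0].
  have -> : [set x : R | x <= 0] = `]-oo, 0 : R]%classic by rewrite set_itvE.
  exact: measurable_itv.
have E : tau e k @^-1` [set x : R | x <= 0] = [set om | ~ 0 < cl om (e, k)].
  by apply/seteqP; split => om; rewrite /= leNgt => /negP.
exists [set om | ~ 0 < cl om (e, k)]; split => //.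
  by rewrite -E -[X in measurable X]setTI; exact: (measurable_funP (tau e k)).
rewrite -E; case: XP => _ h _ _.
apply: (etrans (h e k De _ mN)); apply: (etrans (exponential_prob_gamma mN)).
exact: gamma_law_nonpos.
Qed.

(* Positive versions of the limits, defined everywhere. *)
Let limit_weight (om : T) (e : set V) : R :=
  if (0 < urn om e) && `[< edges adj e >] then urn om e else 1.

Let limit_weight_gt0 om e : 0 < limit_weight om e.
Proof. by rewrite /limit_weight; case: ifP => // /andP[]. Qed.

Let mlimit_weight e : measurable_fun setT (limit_weight^~ e).
Proof.
rewrite /limit_weight; case: asboolP => De; last first.
  rewrite (_ : (fun _ => _) = cst 1); first exact: measurable_cst.
  by apply/funext => om; rewrite andbF.
have me : measurable_fun setT (fun om => urn om e) by exact: (measurableT_comp (measurable_coord De) murn).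
rewrite (_ : (fun _ => _) = (fun om => if 0 < urn om e then urn om e else 1)); last first.
  by apply/funext => om; rewrite andbT.
apply: measurable_fun_ifT => //; apply: measurable_fun_ltr => //.
Qed.

Let lw : T -> WS := limit_weight.

Let mlw : measurable_fun setT lw.
Proof. by apply: measurable_to_fam => e _; exact: mlimit_weight. Qed.

Let lw_urn : {ae P, forall om, forall e, edges adj e -> lw om e = urn om e}.
Proof.
apply: (ae_mp urn_gt0) => om h e De; rewrite /lw /limit_weight h//=.
by case: asboolP.
Qed.

Let lw_urn_set (C : set WS) : measurable C -> {ae P, forall om, (lw @^-1` C) om <-> (urn @^-1` C) om}.
Proof.
move=> mC; apply: (ae_mp lw_urn) => om h; split; apply: (measurable_fam_local mC) => e De.
  by rewrite h.
by rewrite h.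
Qed.

Let lw_urnE (C : set WS) : measurable C -> P (lw @^-1` C) = P (urn @^-1` C).
Proof.
move=> mC; apply: ae_same_measure; last exact: lw_urn_set.
  by rewrite -[X in measurable X]setTI; exact: mlw.
by rewrite -[X in measurable X]setTI; exact: murn.
Qed.

Let path_prob_local p (w w' : set V -> R) : measurable_steps p -> (forall e, edges adj e -> w e = w' e) ->
  path_prob adj i0 p w = path_prob adj i0 p w'.
Proof.
move=> mp ww'.
have mS : measurable ((path_prob adj i0 p : WS -> \bar R) @^-1` [set path_prob adj i0 p w]).
  rewrite -[X in measurable X]setTI; apply: (measurable_path_prob adj_lf i0 mp measurableT).
  exact: emeasurable_set1.
by symmetry; exact: (measurable_fam_local mS ww' erefl).
Qed.

Let Z : T -> trace_space (R := R) (V := V) measurable := fun om n => clock_trace adj n a i0 (cl om).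

Let Z_follow p : Z @^-1` [set z | follow z 0 p] = cl @^-1` [set t | rings_along adj p a i0 t].
Proof. by apply/seteqP; split => om h; [exact: (rings_alongP adj_irr adj_lf p a i0 (cl om)).2 h|exact: (rings_alongP adj_irr adj_lf p a i0 (cl om)).1 h]. Qed.

Let mfollow p : measurable_steps p -> measurable (Z @^-1` [set z | follow z 0 p]).
Proof.
move=> mp; rewrite Z_follow -[X in measurable X]setTI; apply: mcl => //.
exact: measurable_rings_along.
Qed.

Let mZ : measurable_fun setT Z.
Proof.
apply: measurability; first by [].
move=> _ [_ [->|[p Kp ->]] <-]; first by rewrite preimage_set0 setI0.
by rewrite setTI; exact: mfollow.
Qed.

Let trace_law p (C : set WS) : steps_in measurable p -> measurable C ->
  (P ((Z @^-1` [set z | follow z 0 p]) `&` (lw @^-1` C)) = \int[P]_(om in lw @^-1` C) path_prob adj i0 p (lw om))%E.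
Proof.
move=> mp mC.
have mlC : measurable (lw @^-1` C) by rewrite -[X in measurable X]setTI; exact: mlw.
have muC : measurable (urn @^-1` C) by rewrite -[X in measurable X]setTI; exact: murn.
have mpp : measurable_fun setT (path_prob adj i0 p : WS -> \bar R) by exact: measurable_path_prob.
have E1 : P ((Z @^-1` [set z | follow z 0 p]) `&` (lw @^-1` C)) =
    P ((urn @^-1` C) `&` (cl @^-1` [set t | rings_along adj p a i0 t])).
  rewrite Z_follow; apply: ae_same_measure.
  - by apply: measurableI => //; rewrite -Z_follow; exact: mfollow.
  - by apply: measurableI => //; rewrite -Z_follow; exact: mfollow.
  - by apply: (ae_mp (lw_urn_set mC)) => om h; split=> -[h1 h2]; split=> //; exact/h.
have E2 : (\int[P]_(om in lw @^-1` C) path_prob adj i0 p (lw om) =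
    \int[P]_(om in urn @^-1` C) path_prob adj i0 p (urn om))%E.
  apply: ae_same_integral => //.
  - exact: (measurableT_comp mpp mlw).
  - exact: (measurableT_comp mpp murn).
  - exact: lw_urn_set.
  - by apply: (ae_mp lw_urn) => om h; exact: path_prob_local.
rewrite E1 E2; have /= L := rings_law adj_sym adj_irr adj_lf pm mp i0 a_gt0 mC.
apply: (etrans L).
have mU : measurable (urn_limits a @^-1` C : set TT).
  by have := measurable_urn_limits (D := edges adj) a measurableT mC; rewrite setTI.
apply: (ge0_integral_pushforward mcl P mU).
  by apply: measurable_funTS; exact: (measurableT_comp mpp (measurable_urn_limits (D := edges adj) a)).
by move=> t _; exact: path_prob_ge0.
Qed.

Let linked_trace : {ae P, forall om, proper i0 (Z om) /\ linked (X om) (Z om)}.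
Proof.
have [] := XP => _ _ _ xP.
have [[j0 ij0]|iso] := pselect (exists j, adj i0 j); last first.
  apply: (ae_mp xP) => om cP; have jP : jump_path i0 (X om) by case: cP.
  have iso' j : ~~ adj i0 j by apply/negP => ij; apply: iso; exists j.
  have s1 := isolated_path (tau := cl om) cP iso'.
  have sS n : skeleton (X om) n.+1 = None.
    elim: n => [//|n IH]; case E : (skeleton (X om) n.+2) => [v|//].
    by have [w] := skeleton_pred jP E; rewrite IH.
  apply: (linked_skeleton jP) => [[|n]|n v]; last by rewrite sS.
    by rewrite (skeleton0 jP) /Z /=; case: next_vertex.
  rewrite sS /Z /= (_ : next_vertex adj a (cl om) i0 = None)//.
  by rewrite /next_vertex xgetPN// => v [j _ [ij _]]; move: (iso' j); rewrite ij.
have has_nbr := connected_neighbour ij0.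
have alive : {ae P, forall om, forall n, (clock_trace adj n a i0 (cl om)).1 <> None}.
  apply: (ae_countable (g := id)) => // n.
  have [N [mN N0 sub]] := clock_trace_alive adj_irr adj_lf pm has_nbr n i0 a_gt0.
  exists (cl @^-1` N); split => //.
    by rewrite -[X in measurable X]setTI; exact: mcl.
  by move=> om h; exact: sub.
apply: (ae_mp2 alive (ae_mp2 xP clocks_gt0 (fun om h1 h2 => conj h1 h2))) => om al [cP t0].
have jP : jump_path i0 (X om) by case: cP.
have E n := clock_path adj_sym adj_irr adj_lf (tau := cl om) a_gt0 t0 cP (n := n) (fun l _ => al l).
apply: (linked_skeleton jP) => [n|n v _]; first by have [-> _] := E n.
by have [_ ->] := E n.+1.
Qed.

Let mX : measurable_fun setT (X : T -> path_space R V).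
Proof.
apply: measurability; first by [].
move=> _ [_ [t [v [t0 ->]]] <-]; rewrite setTI.
by case: XP => _ _ h _; exact: h.
Qed.

(** The rescaled limits of the clocks are the random conductances; given them,
    the walk has the law of the time-changed process. *)
Theorem continuous_walk_mixture : exists W : set V -> {RV P >-> R},
  independent_gamma_weights adj a W /\
  forall (d' : measure_display) (T' : (set V -> R) -> measurableType d')
    (P' : forall w, probability (T' w) R) (Y : forall w, T' w -> R -> option V),
  (forall w, positive_weights adj w -> is_vrjp adj i0 w (P' w) (@Y w)) ->
  conditional_law P ((fun om e => W e om) : T -> weight_space R adj)
    (X : T -> path_space R V)
    (fun w B => P' w [set om | B (time_modification (@Y w om))]).
Proof.
have rv e : exists Z : {RV P >-> R}, forall om, Z om = limit_weight om e.
  pose Zm := isMeasurableFun.Build _ _ _ _ (limit_weight^~ e) (mlimit_weight e).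
  pose Zf : {mfun T >-> R} := HB.pack (limit_weight^~ e) Zm.
  by exists Zf.
have [W WE] := choice rv; exists W; split.
  have We e A : edges adj e -> measurable A -> P (W e @^-1` A) = gamma_law (a e) A.
    move=> De mA; have sD : {in [:: e], forall e, edges adj e} by move=> e'; rewrite inE => /eqP->.
    have := urn_law (s := [:: e]) (A := fun=> A) isT sD (fun=> mA); rewrite big_seq1 => <-.
    rewrite -lw_urnE; last exact: measurable_cyl.
    congr (P _); apply/seteqP; split => om /=; rewrite WE.
      by move=> h e'; rewrite inE => /eqP->.
    by apply; rewrite inE.
  split.
  - move=> s A us sD mA.
    have sD' : {in s, forall e, edges adj e} by move=> e; exact: sD.
    transitivity (P (lw @^-1` cyl s A)).
      congr (P _); rewrite cylE; elim: s {us sD sD'} => [|i s IH]; rewrite ?big_nil ?big_cons// IH.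
      by apply/seteqP; split => om /=; rewrite WE.
    rewrite lw_urnE; last exact: measurable_cyl.
    rewrite urn_law// !big_seq; apply: eq_bigr => e es; rewrite We//; exact: sD.
  - by move=> e De A mA; rewrite We// gamma_lawE.
  - by move=> e om De; rewrite WE.
move=> d' T' P' Y YV B mB.
have -> : (fun om e => W e om) = lw by apply/funext => om; apply/funext => e; rewrite WE.
have [f f_inj] := graph_countable adj_lf adj_conn i0.
have [B' mB' BB'] := path_event i0 f_inj mB.
have kE w : positive_weights adj w ->
    P' w [set om | B (time_modification (Y w om))] = trace_kernel P' Y w B'.
  move=> w0; have [_ yP _] := YV w w0; congr (P' w _); apply/seteqP; split => om /=.
    by have [pr li] := linked_time_modification (yP om); move/(BB' _ _ pr li).
  by have [pr li] := linked_time_modification (yP om); move/(BB' _ _ pr li).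
have lw0 om : positive_weights adj (lw om) by move=> e _; exact: limit_weight_gt0.
have mix (C : set WS) (mC : measurable C) :
    measurable_fun (positive_weights adj : set WS) (fun w => trace_kernel P' Y w B') /\
    P (Z @^-1` B' `&` lw @^-1` C) = (\int[P]_(om in lw @^-1` C) trace_kernel P' Y (lw om) B')%E.
  have mlC : measurable (lw @^-1` C) by rewrite -[X in measurable X]setTI; exact: mlw.
  pose nu : {measure set trace_space (R := R) (V := V) measurable -> \bar R} := mpush (mrestr P mlC) mZ.
  have nuE p : steps_in measurable p -> nu [set z | follow z 0 p] =
      (\int[P]_(om in lw @^-1` C) path_prob adj i0 p (lw om))%E.
    by move=> mp; exact: trace_law.
  exact: (mixture_unique adj_irr adj_lf f_inj YV (@measurableI _ _) (@subset_refl _ _)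
    mlw lw0 mlC nuE mB').
split.
  have [mk _] := mix setT measurableT.
  apply: (eq_measurable_fun ((fun w => trace_kernel P' Y w B') : WS -> \bar R)) => //.
  by move=> w; rewrite inE => w0; rewrite kE.
move=> C mC; have mlC : measurable (lw @^-1` C) by rewrite -[X in measurable X]setTI; exact: mlw.
have [_ E] := mix C mC.
transitivity (P (Z @^-1` B' `&` lw @^-1` C)).
  apply: ae_same_measure.
  - by apply: measurableI => //; rewrite -[X in measurable X]setTI; exact: mX.
  - by apply: measurableI => //; rewrite -[X in measurable X]setTI; exact: mZ.
  - apply: (ae_mp linked_trace) => om [pr li]; split=> -[h1 h2]; split => //; exact/(BB' _ _ pr li).
apply: (etrans E); apply: eq_integral => om _. 
have -> : (fun e => W e om) = lw om by apply/funext => e; rewrite WE.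
exact: (esym (kE (lw om) (lw0 om))).
Qed.

End continuous_walk.

(** * The discrete walk as a mixture *)

Section unit_mass.
Context d (T : measurableType d) (R : realType).
Context (m : {measure set T -> \bar R}).

(** A copy of [m] that carries the structure of a probability. *)
Definition unit_mass (m1 : m setT = 1%E) : set T -> \bar R := m.

Hypothesis m1 : m setT = 1%E.

HB.instance Definition _ := isMeasure.Build _ _ _ (unit_mass m1)
  (measure0 m) (measure_ge0 m) (@measure_semi_sigma_additive _ _ _ m).

HB.instance Definition _ := Measure_isProbability.Build _ _ _ (unit_mass m1) m1.

End unit_mass.

Section discrete_walk.
Context {R : realType} {V : choiceType}.
Variable adj : rel V.
Hypotheses (adj_sym : symmetric adj) (adj_irr : irreflexive adj).
Hypothesis adj_lf : locally_finite_graph adj.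
Notation mu := (@lebesgue_measure R).
Notation WS := (fam_space (R := R) (edges adj)).
Implicit Types (b : set V -> R) (i j : V) (x : seq V).

(** The coordinates stay independent under size-biasing by one of them; only the
    law of this one changes, and [gamma_law_size] identifies the new one. *)
Lemma size_bias_law b (m : probability WS R) e0 : (forall e, edges adj e -> 0 < b e) ->
  edges adj e0 -> gamma_weights b m ->
  exists m' : probability WS R, gamma_weights (bump e0 b) m'.
Proof.
move=> b0 De0 mb; have be0 := b0 _ De0.
pose g (w : WS) : \bar R := (`|w e0| / b e0)%:E.
have mg : measurable_fun setT g.
  apply/measurable_EFinP; apply: measurable_funM; last exact: measurable_cst.
  exact: (measurableT_comp (@normr_measurable R setT) (measurable_coord De0)).
have g0 w : (0 <= g w)%E by rewrite lee_fin divr_ge0// ltW.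
have key s A : uniq s -> {in s, forall e, edges adj e} -> (forall e, measurable (A e)) ->
    mdens m mg g0 (cyl s A) = (\prod_(e <- s) gamma_law (bump e0 b e) (A e))%E.
  move=> us sD mA.
  pose s' := if e0 \in s then s else e0 :: s.
  have us' : uniq s' by rewrite /s'; case: ifPn => //= ->.
  have sD' : {in s', forall e, edges adj e}.
    by move=> e; rewrite /s'; case: ifPn => _; [exact: sD|rewrite inE => /orP[/eqP->//|/sD]].
  have e0s' : e0 \in s' by rewrite /s'; case: ifPn => //; rewrite inE eqxx.
  have ss e : e \in s -> e \in s' by rewrite /s'; case: ifPn => // _; rewrite inE => ->; rewrite orbT.
  pose A' e := if e \in s then A e else setT.
  have mA' e : measurable (A' e) by rewrite /A'; case: ifP.
  have cE : cyl s A = cyl s' A'.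
    apply/seteqP; split => w cw e.
      by move=> _; rewrite /A'; case: ifP => // /cw.
    by move=> es; have := cw e (ss e es); rewrite /A' es.
  pose phi e (x : R) : \bar R := ((if e == e0 then `|x| / b e0 else 1)%:E * (\1_(A' e) x : R)%:E)%E.
  have mI e : measurable_fun setT (fun x : R => (\1_(A' e) x : R)%:E).
    by apply/measurable_EFinP; exact: measurable_indic.
  have mabs : measurable_fun setT (fun x : R => `|x|).
    exact: (measurableT_comp (@normr_measurable R setT) (@measurable_id _ _ setT)).
  have mphi e : measurable_fun setT (phi e).
    apply: emeasurable_funM; last exact: mI.
    case: (e == e0); last exact: measurable_cst.
    by apply/measurable_EFinP; apply: measurable_funM; [exact: mabs|exact: measurable_cst].
  have phi0 e (x : R) : (0 <= phi e x)%E.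
    by apply: mule_ge0; rewrite lee_fin//; case: ifP => // _; rewrite divr_ge0// ltW.
  have I0 e (x : R) : (0 <= (\1_(A' e) x : R)%:E)%E by rewrite lee_fin.
  have gI e c : gamma_law c (A' e) = (\int[gamma_law c]_x (\1_(A' e) x : R)%:E)%E.
    by rewrite (integral_indic _ measurableT (mA' e)) setIT.
  have phiE e : (\int[gamma_law (b e)]_x phi e x = gamma_law (bump e0 b e) (A' e))%E.
    rewrite /phi /bump gI; case: eqP => [->|_]; last first.
      by apply: eq_integral => x _; rewrite mul1e.
    have c0 : (0 <= ((b e0)^-1)%:E)%E by rewrite lee_fin invr_ge0 ltW.
    have mh : measurable_fun setT (fun x : R => ((b e0)^-1)%:E * (\1_(A' e0) x : R)%:E)%E.
      by apply: emeasurable_funM; [exact: measurable_cst|exact: mI].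
    have h0 (x : R) : (0 <= ((b e0)^-1)%:E * (\1_(A' e0) x : R)%:E)%E by exact: mule_ge0.
    have E := gamma_law_size be0 mh h0.
    have E2 := ge0_integralZl (gamma_law (b e0 + 1)) measurableT (mI e0) (fun (x : R) _ => I0 e0 x) c0.
    apply: (etrans _ (etrans E _)); first by apply: eq_integral => x _; rewrite muleA -EFinM.
    apply: (etrans (congr1 _ E2)); rewrite muleA -EFinM divff ?gt_eqF//.
    by rewrite mul1e.
  transitivity (\prod_(e <- s') gamma_law (bump e0 b e) (A' e))%E; last first.
    have Es : (\prod_(e <- s) gamma_law (bump e0 b e) (A' e) =
        \prod_(e <- s) gamma_law (bump e0 b e) (A e))%E.
      by apply: eq_big_seq => e es; rewrite /A' es.
    rewrite /s'; case: ifPn => e0s //.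
    rewrite big_cons Es /A' (negbTE e0s) gamma_lawT ?mul1e//.
    by rewrite /bump eqxx addr_gt0.
  rewrite /mdens integral_mkcond cE.
  have -> : (\prod_(e <- s') gamma_law (bump e0 b e) (A' e) =
      \prod_(e <- s') \int[gamma_law (b e)]_x phi e x)%E.
    by apply: eq_bigr => e _; rewrite phiE.
  rewrite -(expectation_prod mb us' sD' mphi phi0).
  apply: eq_integral => w _; rewrite patchE /phi big_split/=.
  have -> : (\prod_(e <- s') (if e == e0 then `|w e| / b e0 else 1)%:E = g w)%E.
    by rewrite (bigD1_seq e0)//= eqxx big1 ?mule1// => e /negbTE ->.
  case: ifPn.
    rewrite inE => cw; rewrite big_seq big1 ?mule1// => e es.
    by rewrite indicE mem_set//; exact: cw.
  rewrite notin_setE/= => cw.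
  have [e es ne] : exists2 e, e \in s' & ~ A' e (w e).
    apply: contrapT => ne; apply: cw => e es; apply: contrapT => nA.
    by apply: ne; exists e.
  by rewrite [X in (_ * X)%E](bigD1_seq e)//= indicE memNset// mul0e mule0.
have tot1 : mdens m mg g0 setT = 1%E.
  have -> : [set: WS] = cyl [::] (fun=> setT) by apply/seteqP; split.
  by rewrite key ?big_nil.
by exists (unit_mass tot1) => s A us sD mA; exact: key.
Qed.

Definition walk_step b i j : R :=
  if adj i j then b [set i; j] / \sum_(e <- star adj i) b e else 0.

Fixpoint walk_prob b i x : R :=
  if x is j :: x' then walk_step b i j * walk_prob (bump [set i; j] b) j x' else 1.

Lemma star_sum_gt0 b i j : (forall e, edges adj e -> 0 < b e) -> adj i j ->
  0 < \sum_(e <- star adj i) b e.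
Proof.
move=> b0 ij; have es := mem_star adj_lf ij.
rewrite (big_rem _ es)/= ltr_pwDl//; first exact: b0 (edge_edges ij).
rewrite big_seq sumr_ge0// => e /mem_rem er; apply: ltW; apply: b0.
have De : edges adj e := star_edges adj_lf er.
exact: De.
Qed.

(** Averaging over Gamma weights turns the time-changed process, forgetting the
    times, into the reinforced walk: by conjugacy a step taken by the process
    has the probability of the step of the walk, and leaves Gamma weights with
    the parameters of the reinforced walk. *)
Lemma mixture_walk p : steps_in [set setT] p -> forall b i (m : probability WS R),
  (forall e, edges adj e -> 0 < b e) -> gamma_weights b m ->
  (\int[m]_w path_prob adj i p w = (walk_prob b i (map snd p))%:E)%E.
Proof.
elim: p => [|[A j] p IH] Kp b i m b0 mb.
  apply: (etrans (integral_cst m measurableT 1%E)); rewrite mul1e.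
  exact: probability_setT.
have AT : A = setT := Kp (A, j) (mem_head _ _).
have Kp' : steps_in [set setT] p by move=> q qp; apply: Kp; rewrite inE qp orbT.
have mp : measurable_steps p by move=> q qp; rewrite (Kp' q qp).
rewrite [map _ _]/= [walk_prob _ _ _]/= /walk_step.
have [ij|nij] := boolP (adj i j); last first.
  rewrite mul0r (_ : (fun w => path_prob adj i ((A, j) :: p) w) = cst 0%E).
    by apply: (etrans (integral_cst m measurableT 0%E)); rewrite mul0e.
  by apply/funext => w /=; rewrite (negbTE nij).
have [m' mb'] := size_bias_law b0 (edge_edges ij) mb.
have b0' e : edges adj e -> 0 < bump [set i; j] b e by exact: bump_gt0.
pose H (q : WS * R) := path_prob adj j p q.1.
have mH : measurable_fun setT H.
  exact: (measurableT_comp (measurable_path_prob adj_lf j mp) measurable_fst).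
have H0 q : (0 <= H q)%E by exact: path_prob_ge0.
have step := gamma_conjugate_step adj_sym adj_irr adj_lf b0 ij mb mb' mH H0.
have S0 := star_sum_gt0 b0 ij; set S := \sum_(e <- _) b e in S0 step *.
have wE := IH Kp' (bump [set i; j] b) j m' b0' mb'.
set wp := walk_prob _ _ _ in wE *.
have wp0 : 0 <= wp.
  by rewrite -lee_fin -wE; apply: integral_ge0 => w _; exact: path_prob_ge0.
apply: (etrans _ (etrans step _)).
  apply: eq_integral => w _ /=; rewrite ij AT; apply: eq_integral => u _.
  by rewrite indicE in_setT mulr1.
have be0 := b0 _ (edge_edges ij).
have k0 : (0 <= (b [set i; j] / S * wp)%:E)%E.
  by rewrite lee_fin mulr_ge0// divr_ge0// ltW.
have mE : measurable_fun (`]0%R, +oo[%classic : set R) (fun t : R => (S * expR (- (S * t)))%:E).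
  apply/measurable_EFinP/measurable_funTS; apply: measurable_funM => //.
  by apply: measurableT_comp => //; apply: measurable_funN; exact: measurable_funM.
have E0 (t : R) : `]0%R, +oo[%classic t -> (0 <= (S * expR (- (S * t)))%:E)%E.
  by move=> _; rewrite lee_fin mulr_ge0 ?expR_ge0// ltW.
have mD : measurable (`]0%R, +oo[%classic : set R) by exact: measurable_itv.
have Z := ge0_integralZl mu mD mE E0 k0.
apply: (etrans _ (etrans Z _)); last by rewrite (integral_exp_density S0) mule1.
apply: eq_integral => t _; rewrite /H /= wE -!EFinM; congr (_%:E).
have Sn : S != 0 by rewrite gt_eqF.
by rewrite (mulrC t S); move: (expR _) => E; field.
Qed.

Fixpoint crossed b i x : set V -> R :=
  if x is j :: x' then crossed (bump [set i; j] b) j x' else b.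

Lemma walk_prob_rcons b i x j :
  walk_prob b i (rcons x j) = walk_prob b i x * walk_step (crossed b i x) (last i x) j.
Proof.
elim: x b i => [|k x IH] b i /=; first by rewrite mulr1 mul1r.
by rewrite IH mulrA.
Qed.

(** Reinforcing step by step gives the edge counts along the path. *)
Lemma crossedE v0 b i x e : crossed b i x e = errw_weight b (nth v0 (i :: x)) (size x) e.
Proof.
elim: x b i => [|k x IH] b i; first by rewrite /errw_weight big_geq// addr0.
rewrite [LHS]/= IH /errw_weight [in RHS]big_ltn// big_add1 /= addrA; congr (_ + _).
  by rewrite /bump; case: eqP => [->|ne]; case: asboolP => // h; rewrite ?addr0//; case: ne.
by apply: eq_big_nat => -[|l].
Qed.

Lemma errw_stepE v0 b i x j :
  errw_step adj b (nth v0 (i :: x)) (size x) j = walk_step (crossed b i x) (last i x) j.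
Proof.
have L : nth v0 (i :: x) (size x) = last i x by exact: (nth_last v0 (i :: x)).
rewrite /errw_step /walk_step L; case: ifP => // _; rewrite (crossedE v0); congr (_ / _).
rewrite (fsbig_finite _ _ (adj_lf _))/= /star /nbrs big_map.
by apply: eq_bigr => k _; rewrite (crossedE v0).
Qed.

Variables (i0 : V) (a : set V -> R).
Hypothesis adj_conn : connected_graph adj.
Hypothesis a_gt0 : forall e, edges adj e -> 0 < a e.
Context d (T : measurableType d) (P : probability T R) (X : T -> nat -> V).
Hypothesis XP : is_errw adj a i0 P X.

Let measurable_coords n (h : nat -> nat) (y : nat -> V) :
  measurable [set om | forall k, (k < n)%N -> X om (h k) = y k].
Proof.
rewrite (_ : [set om | _] = \bigcap_k (if (k < n)%N then [set om | X om (h k) = y k] else setT)).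
  by apply: bigcapT_measurable => k; case: ifP => // _; case: XP.
apply/seteqP; split => om.
  by move=> H k _; case: ifP => // kn; exact: H.
by move=> H k kn; have := H k I; rewrite kn.
Qed.

(** The chain rule; [crossed] carries the weights along the path. *)
Lemma errw_path_prob x :
  P [set om | forall k, (k < (size x).+1)%N -> X om k = nth i0 (i0 :: x) k] = (walk_prob a i0 x)%:E.
Proof.
elim/last_ind: x => [|x j IH].
  have mA := measurable_coords 1 id (nth i0 [:: i0]).
  apply: (etrans _ (probability_setT P)); apply: (ae_same_measure mA measurableT).
  by case: XP => _ X0 _; apply: (ae_mp X0) => om h; split => // _ [|k].
have [_ _ step] := XP.
rewrite walk_prob_rcons EFinM -(errw_stepE i0) -IH.
rewrite -step; congr (P _); apply/seteqP; split => om.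
  move=> h; split => [k kn|] /=.
    have -> : nth i0 (i0 :: x) k = nth i0 (i0 :: rcons x j) k.
      by rewrite -rcons_cons nth_rcons /= ltnS kn.
    by apply: h; rewrite size_rcons ltnS ltnW.
  have -> : j = nth i0 (i0 :: rcons x j) (size x).+1.
    by rewrite /= nth_rcons ltnn eqxx.
  by apply: h; rewrite size_rcons.
move=> [h1 h2] k; rewrite size_rcons ltnS leq_eqVlt => /orP[/eqP ->|kn].
  by rewrite /= nth_rcons ltnn eqxx.
by rewrite -rcons_cons nth_rcons /= kn; exact: h1.
Qed.

Let Z : T -> trace_space (R := R) (V := V) [set setT] := fun om n => (Some (X om n), 0).

Let followP (x : nat -> V) p n : steps_in [set setT] p ->
  follow (fun k => (Some (x k), 0 : R)) n p <->
  forall k, (k < size p)%N -> x (n + k).+1 = nth i0 (map snd p) k.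
Proof.
elim: p n => [|[A j] p IH] n Kp; first by split.
have AT : A = setT := Kp (A, j) (mem_head _ _).
have Kp' : steps_in [set setT] p by move=> q qp; apply: Kp; rewrite inE qp orbT.
split.
  move=> [[xj] _ fo] [|k]; first by rewrite addn0.
  by rewrite ltnS addnS -addSn; exact: ((IH n.+1 Kp').1 fo k).
move=> h; split; first by have /= := h 0%N isT; rewrite addn0 => ->.
  by rewrite AT.
by apply/(IH n.+1 Kp') => k kp; have := h k.+1 kp; rewrite addnS addSn.
Qed.

Let mfollow p : steps_in [set setT] p -> measurable (Z @^-1` [set z | follow z 0 p]).
Proof.
move=> Kp; rewrite (_ : _ @^-1` _ =
  [set om | forall k, (k < size p)%N -> X om k.+1 = nth i0 (map snd p) k]).
  exact: (measurable_coords (size p) S).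
by apply/seteqP; split => om h; apply/(followP _ 0 Kp).
Qed.

Let mZ : measurable_fun setT Z.
Proof.
apply: measurability; first by [].
move=> _ [_ [->|[p Kp ->]] <-]; first by rewrite preimage_set0 setI0.
by rewrite setTI; exact: mfollow.
Qed.

Let trace_law p : steps_in [set setT] p ->
  P (Z @^-1` [set z | follow z 0 p]) = (walk_prob a i0 (map snd p))%:E.
Proof.
move=> Kp; rewrite -errw_path_prob; apply: ae_same_measure; first exact: mfollow.
  exact: (measurable_coords _ id).
case: XP => _ X0 _; apply: (ae_mp X0) => om h0; rewrite size_map; split.
  by move=> /(followP _ 0 Kp) h [|k] kn; [exact: h0|exact: h].
by move=> h; apply/(followP _ 0 Kp) => k kn; exact: (h k.+1 kn).
Qed.

Let mX : measurable_fun setT ((fun om n => Some (X om n)) : T -> sequence_space V).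
Proof.
apply: measurability; first by [].
move=> _ [_ [n [v ->]] <-]; rewrite setTI; case: v => [v|]; last first.
  by rewrite (_ : _ @^-1` _ = set0)//; apply/seteqP; split.
rewrite (_ : _ @^-1` _ = [set om | X om n = v]); first by case: XP.
by apply/seteqP; split => om /=; [case|move=> ->].
Qed.

Theorem discrete_walk_mixture d1 (T1 : measurableType d1) (P1 : probability T1 R)
    (W : set V -> {RV P1 >-> R}) : independent_gamma_weights adj a W ->
  forall (d' : measure_display) (T' : (set V -> R) -> measurableType d')
    (P' : forall w, probability (T' w) R) (Y : forall w, T' w -> R -> option V),
  (forall w, positive_weights adj w -> is_vrjp adj i0 w (P' w) (@Y w)) ->
  forall B : set (sequence_space V), measurable B ->
  measurable_fun (positive_weights adj : set (weight_space R adj))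
    (fun w => P' w [set om | B (skeleton (@Y w om))]) /\
  P [set om | B (fun n => Some (X om n))] =
  mixture_law P1 ((fun om e => W e om) : T1 -> weight_space R adj)
    (fun w B => P' w [set om | B (skeleton (@Y w om))]) B.
Proof.
move=> [indW gammaW W_gt0] d' T' P' Y YV B mB.
pose Wf : T1 -> WS := fun om e => W e om.
have mW : measurable_fun setT Wf.
  by apply: measurable_to_fam => e _; exact: (measurable_funP (W e)).
have W0 om : positive_weights adj (Wf om) by move=> e De; exact: W_gt0.
pose m1 : probability WS R := mpush P1 mW.
have mb : gamma_weights a m1.
  apply: (independent_product_law (X := W) (mu := fun e => gamma_law (a e)) mW indW).
  by move=> e A De mA; rewrite gammaW// gamma_lawE.
have KI : setI_closed [set [set: R]] by move=> _ _ -> ->; rewrite setIT.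
have Km : [set [set: R]] `<=` measurable by move=> _ ->; exact: measurableT.
have [f f_inj] := graph_countable adj_lf adj_conn i0.
have [B' mB' BB'] := sequence_event i0 f_inj (K := [set [set: R]]) erefl mB.
have kE w : positive_weights adj w ->
    P' w [set om | B (skeleton (Y w om))] = trace_kernel P' Y w B'.
  move=> w0; have [_ yP _] := YV w w0; congr (P' w _); apply/seteqP; split => om /=.
    by have [pr _] := linked_time_modification (yP om); move/(BB' _ pr).
  by have [pr _] := linked_time_modification (yP om); move/(BB' _ pr).
pose nu : {measure set trace_space (R := R) (V := V) [set setT] -> \bar R} := mpush P mZ.
have nuE p : steps_in [set setT] p -> nu [set z | follow z 0 p] =
    (\int[P1]_(om in setT) path_prob adj i0 p (Wf om))%E.
  move=> Kp; apply: (etrans (trace_law Kp)).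
  have mp : measurable_steps p by move=> q qp; rewrite (Kp q qp).
  apply: (etrans (esym (mixture_walk Kp i0 a_gt0 mb))).
  apply: (ge0_integral_pushforward mW P1 measurableT); first exact: measurable_path_prob.
  by move=> w _; exact: path_prob_ge0.
have [mk nB] := mixture_unique adj_irr adj_lf f_inj YV KI Km mW W0 measurableT nuE mB'.
split.
  apply: (eq_measurable_fun ((fun w => trace_kernel P' Y w B') : WS -> \bar R)) => //.
  by move=> w; rewrite inE => w0; rewrite kE.
transitivity (P (Z @^-1` B')).
  apply: ae_same_measure.
  - by have := mX measurableT mB; rewrite setTI.
  - by have := mZ measurableT mB'; rewrite setTI.
  - case: XP => _ X0 _; apply: (ae_mp X0) => om h0.
    have pr : proper i0 (Z om) by split; rewrite /Z/= ?h0.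
    by split => h; apply/(BB' _ pr).
apply: (etrans nB); rewrite /mixture_law; apply: eq_integral => om _.
exact: (esym (kE (Wf om) (W0 om))).
Qed.

End discrete_walk.

Theorem theorem1 (R : realType) (V : choiceType) (adj : rel V)
    (adj_sym : symmetric adj) (adj_irr : irreflexive adj)
    (adj_lf : locally_finite_graph adj) (adj_conn : connected_graph adj)
    (i0 : V) (a : set V -> R) (a_gt0 : forall e, edges adj e -> 0 < a e) :
  (* continuous-time ERRW *)
  (forall (d : measure_display) (T : measurableType d) (P : probability T R)
      (tau : set V -> nat -> {RV P >-> R}) (X : T -> R -> option V),
    is_ct_errw adj i0 a tau X ->
    exists W : set V -> {RV P >-> R},
      independent_gamma_weights adj a W /\
      (* for the VRJPs Y_w with weights w, w ranging over all weights *)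
      forall (d' : measure_display)
          (T' : (set V -> R) -> measurableType d')
          (P' : forall w, probability (T' w) R)
          (Y : forall w, T' w -> R -> option V),
        (forall w, positive_weights adj w -> is_vrjp adj i0 w (P' w) (Y w)) ->
        conditional_law P
          ((fun om e => W e om) : T -> weight_space R adj)
          (X : T -> path_space R V)
          (fun w B => P' w [set om | B (time_modification (Y w om))])) /\
  (* discrete-time ERRW *)
  (forall (d : measure_display) (T : measurableType d) (P : probability T R)
      (X : T -> nat -> V),
    is_errw adj a i0 P X ->
    forall (d1 : measure_display) (T1 : measurableType d1)
        (P1 : probability T1 R) (W : set V -> {RV P1 >-> R}),
      independent_gamma_weights adj a W ->
    forall (d' : measure_display)
        (T' : (set V -> R) -> measurableType d')
        (P' : forall w, probability (T' w) R)
        (Y : forall w, T' w -> R -> option V),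
      (forall w, positive_weights adj w -> is_vrjp adj i0 w (P' w) (Y w)) ->
    forall B : set (sequence_space V), measurable B ->
      measurable_fun (positive_weights adj : set (weight_space R adj))
        (fun w => P' w [set om | B (skeleton (Y w om))]) /\
      P [set om | B (fun n => Some (X om n))] =
      mixture_law P1 ((fun om e => W e om) : T1 -> weight_space R adj)
        (fun w B => P' w [set om | B (skeleton (Y w om))]) B).
Proof.
split=> d T P; first by move=> tau X XP; exact: (continuous_walk_mixture adj_sym adj_irr adj_lf adj_conn a_gt0 XP).
move=> X XP d1 T1 P1 W Wg; exact: (discrete_walk_mixture adj_sym adj_irr adj_lf adj_conn a_gt0 XP Wg).
Qed.
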